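(* Let $(X,\xi)$ be a pair where $X=(X(t))_{t\geq 0}$ is a random process with paths in $D[0,\infty)$ and $\xi$ is a positive random variable (no assumption is made on the dependence between $X$ and $\xi$), and let $(X_k,\xi_k)_{k\in\mathbb{N}}$ be independent copies of $(X,\xi)$. Put $S_0:=0$, $S_n:=\xi_1+\cdots+\xi_n$. Assume that $\mathbb{E}[|X(t)|^l]<\infty$ for all $t\geq 0$ and $l\in\mathbb{N}$, that $h(t):=\mathbb{E}[X(t)]$ is a càdlàg function, and write $\widehat{X}(t):=X(t)-h(t)$, $v(t):=\mathbb{E}[(X(t)-h(t))^2]$. Assume further: (A1) $\mathbb{P}\{\xi>t\}\sim t^{-\alpha}\ell_\xi(t)$ as $t\to\infty$ for some $\alpha\in(0,1)$ and some $\ell_\xi$ slowly varying at infinity; (A2) $h(t)\sim t^{\rho}\ell_h(t)$ as $t\to\infty$ for some $\rho>-\alpha$ and some $\ell_h$ slowly varying at infinity; (A3) $v(t)\sim t^{\beta}\ell_v(t)$ as $t\to\infty$ for some $\beta\in(-\alpha,\alpha+2\rho)$ and some $\ell_v$ slowly varying at infinity; (A4) there exists $\delta>0$ such that for every $l\in\mathbb{N}$ there are constants $C_l\in(0,\infty)$ and $\varepsilon>0$ with $\mathbb{E}[\widehat{X}(t)^{2l}]\leq C_l v^l(t)$ for all $t\geq 0$, and $\mathbb{E}\big[\sup_{y\in[0,\delta)}|\widehat{X}(t)-\widehat{X}(t-y)\mathbf{1}_{\{y\leq t\}}|^{l}\big]\leq C_l t^{l(\rho-\varepsilon)}$ for all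 $t\geq 0$. Then, as $t\to\infty$, \[\Big(\frac{\mathbb{P}\{\xi>t\}}{h(t)}\sum_{k\geq 0}X_{k+1}(ut-S_k)\mathbf{1}_{\{S_k\leq ut\}}\Big)_{u>0}\Rightarrow \big(J_{\alpha,\rho}(u)\big)_{u>0}\] weakly on $D(0,\infty)$ endowed with the $J_1$-topology.
   Context: $(W_\alpha(t))_{t\geq0}$ denotes an $\alpha$-stable subordinator with Laplace exponent $-\log\mathbb{E}e^{-sW_\alpha(1)}=\Gamma(1-\alpha)s^\alpha$, $s\geq0$, and $W_\alpha^{\leftarrow}(y):=\inf\{t\geq0: W_\alpha(t)>y\}$, $y\geq 0$, its generalized inverse. The fractionally integrated inverse $\alpha$-stable subordinator is $J_{\alpha,\rho}(u):=\int_{[0,u]}(u-y)^{\rho}\,\mathrm{d}W_\alpha^{\leftarrow}(y)$, $u\geq0$, a pathwise Lebesgue–Stieltjes integral. $D(0,\infty)$ is the Skorokhod space of càdlàg functions on $(0,\infty)$. *)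

(* Defs.v *)
From HB Require Import structures.
From mathcomp Require Import all_boot all_order all_algebra.
From mathcomp Require Import all_classical all_reals all_analysis.
Set Implicit Arguments. Unset Strict Implicit. Unset Printing Implicit Defensive.
Import Order.TTheory GRing.Theory Num.Theory numFieldTopology.Exports
  numFieldNormedType.Exports.
Local Open Scope classical_set_scope.
Local Open Scope ring_scope.

Definition cadlag0 {R : realType} (x : R -> R) : Prop :=
  (forall t : R, 0 <= t -> x @ at_right t --> x t) /\
  (forall t : R, 0 < t -> exists l : R, x @ at_left t --> l).

Definition cadlag_pos {R : realType} (x : R -> R) : Prop :=
  (forall t : R, 0 < t -> x @ at_right t --> x t) /\
  (forall t : R, 0 < t -> exists l : R, x @ at_left t --> l).

Definition asym_equiv {R : realType} (f g : R -> R) : Prop :=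
  f t / g t @[t --> +oo%R] --> (1 : R).

Definition slowly_varying {R : realType} (l : R -> R) : Prop :=
  measurable_fun [set: R] l /\
  (\forall t \near +oo%R, 0 < l t) /\
  (forall c : R, 0 < c -> l (c * t) / l t @[t --> +oo%R] --> (1 : R)).

Definition Gamma {R : realType} (x : R) : R :=
  fine (\int[@lebesgue_measure R]_(t in `]0%R, +oo[%classic)
          (t `^ (x - 1) * expR (- t))%:E)%E.

(* Pathwise Lebesgue--Stieltjes integral \int_D g dF, for F nondecreasing
   and right-continuous (the only case in which it is used below). *)
Definition cumP {R : realType} (F : R -> R) : Prop :=
  nondecreasing F /\ right_continuous F.

Definition mkcum {R : realType} (F : R -> R) (H : cumP F) : cumulative R R :=
  HB.pack_for (cumulative R R) F
    (isCumulative.Build R _ R F (proj1 H) (proj2 H)).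

Definition LSint {R : realType} (F : R -> R) (D : set R) (g : R -> R) : R :=
  match pselect (cumP F) with
  | left H => fine (\int[lebesgue_stieltjes_measure (@mkcum R F H)]_(y in D)
                      (g y)%:E)%E
  | right _ => 0
  end.

Definition J1_cvg_ab {R : realType} (a b : R) (xn : nat -> R -> R)
    (x : R -> R) : Prop :=
  exists lam : nat -> R -> R,
    (forall n, lam n a = a /\ lam n b = b /\
       {within `[a, b], continuous (lam n)} /\
       (forall s s', a <= s -> s < s' -> s' <= b -> lam n s < lam n s')) /\
    (forall e : R, 0 < e -> \forall n \near \oo,
        forall s, a <= s -> s <= b -> `|lam n s - s| < e) /\
    (forall e : R, 0 < e -> \forall n \near \oo,
        forall s, a <= s -> s <= b -> `|xn n (lam n s) - x s| < e).

Definition J1_cvg {R : realType} (xn : nat -> R -> R) (x : R -> R) : Prop :=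
  forall a b : R, 0 < a -> a < b ->
    {for a, continuous x} -> {for b, continuous x} -> J1_cvg_ab a b xn x.

(* Weak convergence, as t -> +oo, of the processes Y t (on (Om, P)) to the
   process Z (on (Om', Q)) in D(0,oo) with the J1 topology: E f(Y t) -> E f(Z)
   for every bounded J1-continuous f (J1 is metrizable, so continuity is
   sequential continuity). *)
Definition weak_cvg_D {R : realType} {d d' : measure_display}
    {Om : measurableType d} {Om' : measurableType d'}
    (P : probability Om R) (Y : R -> Om -> R -> R)
    (Q : probability Om' R) (Z : Om' -> R -> R) : Prop :=
  forall f : (R -> R) -> R,
    (exists M : R, forall x, `|f x| <= M) ->
    (forall (xn : nat -> R -> R) (x : R -> R),
        (forall n, cadlag_pos (xn n)) -> cadlag_pos x -> J1_cvg xn x ->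
        f (xn n) @[n --> \oo] --> f x) ->
    (\int[P]_w (f (Y t w))%:E)%E @[t --> +oo%R] --> (\int[Q]_w (f (Z w))%:E)%E.

Definition pair_sigma {R : realType} {d} {Om : measurableType d}
    (X : nat -> Om -> R -> R) (xi : nat -> Om -> R) (k : nat) : set (set Om) :=
  <<s [set A | (exists (t : R) (B : set R), measurable B /\
                    A = [set w | B (X k w t)]) \/
               (exists B : set R, measurable B /\ A = [set w | B (xi k w)])] >>.

Definition indep_pairs {R : realType} {d} {Om : measurableType d}
    (P : probability Om R) (X : nat -> Om -> R -> R) (xi : nat -> Om -> R)
    : Prop :=
  forall (I : seq nat) (A : nat -> set Om), uniq I ->
    (forall k, k \in I -> pair_sigma X xi k (A k)) ->
    P (\big[setI/setT]_(k <- I) A k) = (\big[*%E/1%E]_(k <- I) P (A k))%E.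

Definition same_law_pair {R : realType} {d} {Om : measurableType d}
    (P : probability Om R) (X : nat -> Om -> R -> R) (xi : nat -> Om -> R)
    (k : nat) : Prop :=
  forall (n : nat) (ts : 'I_n -> R) (Bs : 'I_n -> set R) (C : set R),
    (forall i, measurable (Bs i)) -> measurable C ->
    P [set w | C (xi k w) /\ forall i, Bs i (X k w (ts i))] =
    P [set w | C (xi 0%N w) /\ forall i, Bs i (X 0%N w (ts i))].

Definition stable_subordinator {R : realType} {d} {Om : measurableType d}
    (Q : probability Om R) (alpha : R) (W : Om -> R -> R) : Prop :=
  (forall t, measurable_fun [set: Om] (fun w => W w t)) /\
  (forall w, W w 0 = 0) /\
  (forall w, cadlag0 (W w)) /\
  (forall w s t, 0 <= s -> s <= t -> W w s <= W w t) /\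
  (forall (n : nat) (ts : 'I_n.+1 -> R) (Bs : 'I_n -> set R),
     0 <= ts ord0 -> (forall i j : 'I_n.+1, (i <= j)%N -> ts i <= ts j) ->
     (forall i, measurable (Bs i)) ->
     Q [set w | forall i : 'I_n,
                  Bs i (W w (ts (lift ord0 i)) - W w (ts (widen_ord (leqnSn n) i)))]
     = (\big[*%E/1%E]_(i < n)
          Q [set w | Bs i (W w (ts (lift ord0 i)) - W w (ts (widen_ord (leqnSn n) i)))%R])%E) /\
  (forall r t s : R, 0 <= r -> r <= t -> 0 <= s ->
     (\int[Q]_w (expR (- s * (W w t - W w r)%R))%:E)%E =
     (expR (- ((t - r) * Gamma (1 - alpha) * s `^ alpha)))%:E).

Definition gen_inverse {R : realType} (w : R -> R) (y : R) : R :=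
  inf [set t | 0 <= t /\ y < w t].

Definition J_ar {R : realType} (rho : R) (w : R -> R) (u : R) : R :=
  LSint (gen_inverse w) `[0, u] (fun y => (u - y) `^ rho).

(* Main.v *)
Require Import Defs.
From HB Require Import structures.
From mathcomp Require Import all_boot all_order all_algebra.
From mathcomp Require Import all_classical all_reals all_analysis.
From mathcomp Require Import measurable_realfun ring lra zify.
Set Implicit Arguments.
Unset Strict Implicit.
Unset Printing Implicit Defensive.
Import Order.TTheory GRing.Theory Num.Theory numFieldTopology.Exports
  numFieldNormedType.Exports.
Local Open Scope classical_set_scope.
Local Open Scope ring_scope.

(** Write [S_k] for the walk, [p t = P (xi > t)] and [Xhat_k = X_k - h].  Then
    [sum_k X_{k+1} (ut - S_k)] splits into a fluctuation part with summands
    [Xhat_{k+1} (ut - S_k)] and a mean part with summands [h (ut - S_k)].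

    Renewal windows are controlled by [P (S_{k+j} - S_k <= y) <= e phi(1/y)^j] and
    [phi(1/y) <= 1 - p y / 2]: up to a small probability every dyadic window of length
    [2^-i t] contains at most [K q^i / p (2^-i t)] points, with [q > 1] as close to [1] as
    wanted.  On this event the moments of the fluctuation part, conditionally on the walk,
    give a uniform bound on a grid of mesh [delta / 2], and the oscillation hypothesis fills
    in the cells: the fluctuation part is [o (h t / p t)] because [beta < alpha + 2 rho].
    Regular variation of [h] replaces the mean part by a sum of [(u - S_k / t)^rho], whose
    singularity at [0] is negligible by the window bound since [rho > - alpha].

    Grouping the walk into blocks of size [1 / (m p t)] leaves
    [m^-1 sum_j g (u - S_{jq} / t)] with [g] Lipschitz, and the same discretisation of the
    Stieltjes integral gives [m^-1 sum_j g (u - W (j / m))] for [J_ar].  A Lipschitz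
    functional of these finitely many block increments is uniformly approximated by a
    polynomial in their exponentials, so its expectation is a combination of products of
    Laplace transforms, and [phi (n / t)^q --> exp (- Gamma (1 - alpha) n^alpha / m)].

    Lipschitz functionals of the path suffice: a bounded J1-continuous functional is squeezed
    between its Lipschitz envelopes for the uniform norm on [[1/n, n]], whose limits agree at
    cadlag paths, so no measurability of the functional is needed. *)

(** * Weak convergence in D(0,oo) from Lipschitz functionals *)

(** Test functionals are arbitrary, so [f (Y t)] need not be measurable; its integral is a
    difference of two suprema over simple functions, monotone but not additive, and comparisons go
    through measurable approximations outside small events. No independence is available inside a
    pair, but [X_{k+1}] is independent of [S_k], so [S_k] can be frozen while integrating over
    [X_{k+1}]. At scale [2^-i t] a union bound runs over about [2^i] windows; the factor [q^i] with
    [q^n = 4] pays for it, and for [q] near [1] the strict inequalities on the exponents absorb this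
    cost. The condition [beta < alpha + 2 rho] says that the conditional variance, of order [v / p],
    is [o ((h / p)^2)]; since the grid has order [t] points, high moments are used to make each
    exceptional probability [O (t^-2)]. Parameters are fixed in the order horizon, cutoff at the
    singularity, block mesh, then [t], with the same values for the process and for the limit. The
    window estimate is stated for an abstract walk because it serves a second time, for the
    increments of [W] on a grid, where it bounds the modulus of continuity of the inverse
    subordinator. *)

Section integral_sandwich.
Context d (T : measurableType d) (R : realType).

(** No measurability is assumed: the integral is the supremum over simple functions below the
    positive part minus the same for the negative part, and both are monotone in the integrand. *)
Lemma le_integral_all (mu : {measure set T -> \bar R}) (f g : T -> \bar R) :
  (forall x, f x <= g x)%E -> (\int[mu]_x f x <= \int[mu]_x g x)%E.
Proof.
move=> fg; rewrite /integral !patch_setT.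
apply: leeB; apply: le_ereal_sup => _ [h /= hf <-]; exists h => //= x;
  apply: (le_trans (hf x)).
- by apply: (@funepos_le _ _ setT) => [y _|]; [exact: fg|rewrite inE].
- by apply: (@funeneg_le _ _ setT) => [y _|]; [exact: fg|rewrite inE].
Qed.

Variable P : probability T R.

(** For bounded [f] this is a genuine real number even when [f] is not measurable; only monotonicity
    and the sign rule survive in that case. *)
Definition Ex (f : T -> R) : R := fine (\int[P]_w (f w)%:E)%E.

Lemma bounded_integrable (f : T -> R) (M : R) : measurable_fun setT f ->
  (forall w, `|f w| <= M) -> P.-integrable setT (EFin \o f).
Proof.
move=> mf fM; apply: measurable_bounded_integrable => //.
  by have : (P setT < +oo)%E by rewrite probability_setT ltry.
exists M; split; first exact: num_real.
by move=> x Mx w _; exact: le_trans (fM w) (ltW Mx).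
Qed.

Lemma bounded_fin_num (f : T -> R) (M : R) : (forall w, `|f w| <= M) ->
  (\int[P]_w (f w)%:E)%E \is a fin_num.
Proof.
move=> fM.
have cM c : (\int[P]_w (cst c%:E) w = c%:E)%E.
  by rewrite integral_cst//= probability_setT mule1.
rewrite fin_numE -ltNye -ltey.
have H w : - M <= f w <= M by rewrite -ler_norml.
apply/andP; split.
  apply: (@lt_le_trans _ _ (\int[P]_w (cst (- M)%:E w))%E).
    by rewrite cM ltNyr.
  by apply: le_integral_all => w; rewrite lee_fin; case/andP: (H w).
apply: (@le_lt_trans _ _ (\int[P]_w (cst M%:E w))%E).
  by apply: le_integral_all => w; rewrite lee_fin; case/andP: (H w).
by rewrite cM ltry.
Qed.

Lemma ExB (f g : T -> R) : P.-integrable setT (EFin \o f) ->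
  P.-integrable setT (EFin \o g) -> Ex (fun w => f w - g w) = Ex f - Ex g.
Proof.
move=> iF ig; rewrite /Ex; under eq_integral do rewrite EFinB.
by rewrite integralB//= fineB//; apply: integrable_fin_num.
Qed.

Lemma ExD (f g : T -> R) : P.-integrable setT (EFin \o f) ->
  P.-integrable setT (EFin \o g) -> Ex (fun w => f w + g w) = Ex f + Ex g.
Proof.
move=> iF ig; rewrite /Ex; under eq_integral do rewrite EFinD.
by rewrite integralD//= fineD//; apply: integrable_fin_num.
Qed.

Lemma ExZ (c : R) (f : T -> R) : P.-integrable setT (EFin \o f) ->
  Ex (fun w => c * f w) = c * Ex f.
Proof.
move=> iF; rewrite /Ex; under eq_integral do rewrite EFinM.
by rewrite integralZl//= fineM//; apply: integrable_fin_num.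
Qed.

Lemma Ex_cst (c : R) : Ex (fun=> c) = c.
Proof. by rewrite /Ex integral_cst//= probability_setT mule1. Qed.

Lemma Ex_indic (A : set T) : measurable A -> Ex \1_A = fine (P A).
Proof. by move=> mA; rewrite /Ex integral_indic// setIT. Qed.

Lemma integrable_cstR (c : R) : P.-integrable setT (EFin \o (fun=> c)).
Proof. by apply: (@bounded_integrable (cst c) `|c|). Qed.

Lemma integrable_indicR (A : set T) : measurable A ->
  P.-integrable setT (EFin \o (\1_A : T -> R)).
Proof.
move=> mA; apply: (@bounded_integrable _ 1) => // w; rewrite indicE.
by case: (_ \in _); rewrite ?normr1 ?normr0.
Qed.

Lemma Ex_mono (f g : T -> R) (M : R) : (forall w, `|f w| <= M) ->
  (forall w, `|g w| <= M) -> (forall w, f w <= g w) -> Ex f <= Ex g.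
Proof.
move=> fM gM fg; apply: fine_le; [exact: bounded_fin_num fM|
  exact: bounded_fin_num gM|].
by apply: le_integral_all => w; rewrite lee_fin.
Qed.

(** The sign can be pulled out of a possibly nonmeasurable integrand because the bound keeps the
    integral of its negative part finite, so that the difference defining the integral may be
    reversed. *)
Lemma ExN (f : T -> R) (M : R) : (forall w, `|f w| <= M) ->
  Ex (fun w => - f w) = - Ex f.
Proof.
move=> fM; rewrite /Ex -fineN; congr fine.
rewrite -integralN; last first.
  apply: fin_num_adde_defl; rewrite fin_numN.
  apply/fin_numP; split.
    rewrite gt_eqF//; apply: (@lt_le_trans _ _ 0%E) => //.
    by apply: integral_ge0.
  rewrite lt_eqF//; apply: (@le_lt_trans _ _ (\int[P]_w (cst M%:E w))%E).
    apply: le_integral_all => w; rewrite funeneg.unlock /= ge_max !lee_fin.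
    by have := fM w; rewrite ler_norml => /andP[? ?]; apply/andP; split; lra.
  by rewrite integral_cst//= probability_setT mule1 ltry.
by apply: eq_integral => w _; rewrite EFinN.
Qed.

(** The function [g - e - 2 M 1_A] is a measurable minorant of [f]: outside [A] by hypothesis, on
    [A] because both functions are bounded by [M]. Its expectation can be computed, and monotonicity
    does the rest. *)
Lemma Ex_lower (f g : T -> R) (A : set T) (M e p : R) :
  measurable_fun setT g -> measurable A -> (P A <= p%:E)%E -> 0 <= e ->
  (forall w, `|f w| <= M) -> (forall w, `|g w| <= M) ->
  (forall w, ~ A w -> g w - e <= f w) -> Ex g - e - 2 * M * p <= Ex f.
Proof.
move=> mg mA PA e0 fM gM fg.
have M0 : 0 <= M by apply: le_trans (fM point).
pose g' := fun w => g w - e - 2 * M * \1_A w.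
have mg' : measurable_fun setT g'.
  apply: measurable_funB; first by apply: measurable_funB.
  by apply: measurable_funM.
have ind1 w : 0 <= (\1_A w : R) <= 1 by rewrite indicE; case: (_ \in _); rewrite ?ler01 ?lexx.
have g'M w : `|g' w| <= M + e + 2 * M.
  have /andP[i0 i1] := ind1 w; have := gM w.
  have M2 : 0 <= 2 * M * \1_A w <= 2 * M.
    by rewrite mulr_ge0// ?mulr_ge0//= ler_piMr// mulr_ge0.
  case/andP: M2; rewrite !ler_norml /g' => ? ? /andP[? ?]; lra.
have iA : P.-integrable setT (fun w => (2 * M * \1_A w)%:E).
  apply: (@bounded_integrable _ (2 * M)); first by apply: measurable_funM.
  move=> w; have /andP[i0 i1] := ind1 w.
  by rewrite ger0_norm ?mulr_ge0// ler_piMr// mulr_ge0.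
have ig : P.-integrable setT (fun w => (g w)%:E) by exact: bounded_integrable gM.
have ie : P.-integrable setT (fun w => e%:E).
  by apply: (@bounded_integrable (cst e) `|e|).
have Eg' : Ex g' = Ex g - e - 2 * M * fine (P A).
  have ige := integrableB measurableT ig ie.
  rewrite /g' ExB//.
  rewrite ExB// Ex_cst ExZ; last exact: integrable_indicR.
  by rewrite Ex_indic.
apply: (@le_trans _ _ (Ex g')).
  rewrite Eg' lerB// ler_wpM2l ?mulr_ge0//.
  by rewrite -lee_fin fineK ?fin_num_measure.
apply: (@Ex_mono _ _ (M + e + 2 * M)) => //.
  by move=> w; rewrite (le_trans (fM w))// -addrA lerDl addr_ge0// mulr_ge0.
move=> w; rewrite /g' indicE.
have [wA|wA] := boolP (w \in A); last first.
  rewrite mulr0 subr0; apply: fg; move: wA; by rewrite notin_setE.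
rewrite mulr1; have := fM w; have := gM w; rewrite !ler_norml => /andP[? ?] /andP[? ?]; lra.
Qed.

Lemma Ex_upper (f g : T -> R) (A : set T) (M e p : R) :
  measurable_fun setT g -> measurable A -> (P A <= p%:E)%E -> 0 <= e ->
  (forall w, `|f w| <= M) -> (forall w, `|g w| <= M) ->
  (forall w, ~ A w -> f w <= g w + e) -> Ex f <= Ex g + e + 2 * M * p.
Proof.
move=> mg mA PA e0 fM gM fg.
have := @Ex_lower (fun w => - f w) (fun w => - g w) A M e p.
rewrite (ExN fM) (ExN gM) => H.
suff : - Ex g - e - 2 * M * p <= - Ex f by lra.
apply: H => //; first exact: measurable_funN.
- by move=> w; rewrite normrN.
- by move=> w; rewrite normrN.
- by move=> w nA; have := fg w nA; lra.
Qed.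

Lemma prob_setU_le (A B : set T) (a b : R) : measurable A -> measurable B ->
  (P A <= a%:E -> P B <= b%:E -> P (A `|` B) <= (a + b)%:E)%E.
Proof.
move=> mA mB Pa Pb; rewrite EFinD; apply: le_trans (leeD Pa Pb).
exact: measureU2.
Qed.

Lemma prob_bigcup0 (N : nat -> set T) : (forall n, measurable (N n)) ->
  (forall n, P (N n) = 0%E) -> P (\bigcup_n N n) = 0%E.
Proof.
move=> mN N0; apply: (proj1 (negligibleP _ (bigcupT_measurable _ _))) => //.
by apply: negligible_bigcup => n; apply/negligibleP => //; exact: N0.
Qed.

Lemma prob_setU0 (A B : set T) : measurable A -> measurable B ->
  P A = 0%E -> P B = 0%E -> P (A `|` B) = 0%E.
Proof.
move=> mA mB PA PB; apply/eqP; rewrite eq_le measure_ge0 andbT.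
by have := @prob_setU_le A B 0 0 mA mB; rewrite PA PB add0r; apply.
Qed.

Lemma prob_bigsetU_le (n : nat) (A : nat -> set T) (f : nat -> R) :
  (forall i, measurable (A i)) -> (forall i, (i < n)%N -> (P (A i) <= (f i)%:E)%E) ->
  (P (\big[setU/set0]_(i < n) A i) <= (\sum_(i < n) f i)%:E)%E.
Proof.
move=> mA; elim: n => [|n IH] H; first by rewrite !big_ord0 measure0.
rewrite !big_ord_recr/=; apply: prob_setU_le => //; last exact: H.
  exact: bigsetU_measurable.
by apply: IH => i iN; apply: H; exact: ltnW.
Qed.

(** Closeness in probability to a measurable [g], phrased with a measurable exceptional set because
    [f] itself may fail to be measurable. *)
Definition quasi_rv (f g : T -> R) (e : R) : Prop :=
  measurable_fun setT g /\ exists A, measurable A /\ (P A <= e%:E)%E /\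
    forall w, ~ A w -> `|f w - g w| <= e.

(** Borel-Cantelli: approximations at precision [2 ^- k.+1] converge to [f] off the upper limit of
    their exceptional sets, which is null, and a pointwise limit of measurable functions is
    measurable. *)
Lemma quasi_rv_measurable (f : T -> R) :
  (forall e : R, 0 < e -> exists g, quasi_rv f g e) ->
  exists N, measurable N /\ P N = 0%E /\
    measurable_fun setT (fun w => f w * \1_(~` N) w).
Proof.
move=> H.
have H' k : {gA : (T -> R) * set T | measurable_fun setT gA.1 /\ measurable gA.2 /\
   (P gA.2 <= (2 ^- k.+1)%:E)%E /\ forall w, ~ gA.2 w -> `|f w - gA.1 w| <= 2 ^- k.+1}.
  apply: cid; have [|g [mg [A [mA [PA fg]]]]] := H (2 ^- k.+1).
    by rewrite invr_gt0 exprn_gt0.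
  by exists (g, A).
pose g k := (sval (H' k)).1; pose A k := (sval (H' k)).2.
have mg k : measurable_fun setT (g k) by rewrite /g; case: (H' k) => ? [].
have mA k : measurable (A k) by have [_ [h _]] := svalP (H' k).
have PA k : (P (A k) <= (2 ^- k.+1)%:E)%E by have [_ [_ [h _]]] := svalP (H' k).
have fg k w : ~ A k w -> `|f w - g k w| <= 2 ^- k.+1.
  by have [_ [_ [_ h]]] := svalP (H' k); exact: h.
pose N := lim_sup_set A.
have mN : measurable N.
  by apply: bigcapT_measurable => n; apply: bigcup_measurable => k _; exact: mA.
exists N; split => //; split.
  apply: lim_sup_set_cvg0 => //.
  apply: (@le_lt_trans _ _ (\sum_(0 <= n <oo) (1 / (2 ^ n.+1)%:R)%:E)%E).
    by apply: lee_nneseries => // k _; rewrite (le_trans (PA k))// lee_fin div1r natrX.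
  have := @cvg_geometric_eseries_half R 1 0; under eq_fun do rewrite addn1.
  by rewrite expr0 divr1 => /cvg_lim -> //; rewrite ltry.
apply: (@measurable_fun_cvg _ _ _ setT (fun k w => g k w * \1_(~` N) w)).
  move=> k; apply: measurable_funM => //.
  by apply: measurable_indic; exact: measurableC.
move=> w _; rewrite indicE; have [wN|wN] := boolP (w \in ~` N); last first.
  rewrite mulr0; under eq_fun do rewrite mulr0; exact: cvg_cst.
rewrite mulr1; under eq_fun do rewrite mulr1.
move: wN; rewrite in_setE => wN.
have [n Hn] : exists n, forall k, (n <= k)%N -> ~ A k w.
  apply: contrapT => /forallNP h; apply: wN => n _.
  have /existsNP[k /not_implyP[nk /contrapT Ak]] := h n.
  by exists k.
apply/cvgrPdist_le => /= e e0.
have : (2 : R) ^- k @[k --> \oo] --> (0 : R).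
  under eq_fun do rewrite -exprVn.
  by apply: cvg_expr; rewrite ger0_norm ?invr_ge0// invf_lt1// ltr1n.
move=> /cvgrPdist_le /(_ _ e0) [m _ Hm].
near=> k.
have nk : (n <= k)%N by near: k; exact: nbhs_infty_ge.
have mk : (m <= k)%N by near: k; exact: nbhs_infty_ge.
apply: le_trans (fg k w (Hn _ nk)) _.
by have := Hm k.+1 (leqW mk); rewrite sub0r normrN ger0_norm// invr_ge0 exprn_ge0.
Unshelve. all: by end_near.
Qed.

End integral_sandwich.

(** With [r = 0] the condition says that [F] depends only on the path restricted to [[a, b]]. *)
Definition lip_on {R : realType} (a b L : R) (F : (R -> R) -> R) : Prop :=
  forall x y r, 0 <= r -> (forall s, a <= s <= b -> `|x s - y s| <= r) ->
    `|F x - F y| <= L * r.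

Lemma J1_cvg_locally_uniform {R : realType} (xn : nat -> R -> R) (x : R -> R) :
  (forall a b e : R, 0 < a -> a < b -> 0 < e -> \forall n \near \oo,
     forall s, a <= s -> s <= b -> `|xn n s - x s| < e) -> J1_cvg xn x.
Proof.
move=> H a b a0 ab _ _; exists (fun=> id); split; first last.
  split => e e0; last exact: H.
  by near=> n => s _ _; rewrite subrr normr0.
move=> n; do 3 split => //.
by apply: continuous_subspaceT => y; exact: cvg_id.
Unshelve. all: by end_near.
Qed.

(** * Lipschitz envelopes of bounded functionals *)

Section lower_envelope.
Context (R : realType) (f : (R -> R) -> R) (M : R).
Hypothesis fM : forall x, `|f x| <= M.

(** The Lipschitz regularisation of [f] (infimal convolution with [c] times the uniform distance on
    [[a, b]]). The extra element [M] keeps the set nonempty when no cadlag path lies at finite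
    distance from [x], and caps the value. *)
Definition envelope (c a b : R) (x : R -> R) : R :=
  inf ([set M] `|` [set z | exists y r, [/\ cadlag_pos y, 0 <= r,
    (forall s, a <= s <= b -> `|x s - y s| <= r) & z = f y + c * r]]).

Variables (c a b : R).
Hypothesis c0 : 0 <= c.

Let envelope_lb x : lbound ([set M] `|` [set z | exists y r, [/\ cadlag_pos y, 0 <= r,
    (forall s, a <= s <= b -> `|x s - y s| <= r) & z = f y + c * r]]) (- M).
Proof.
move=> z [->|[y [r [_ r0 _ ->]]]].
  have := fM (fun=> 0); rewrite ler_norml => /andP[? ?]; lra.
have := fM y; rewrite ler_norml => /andP[? ?].
by have := mulr_ge0 c0 r0; lra.
Qed.

Lemma envelope_bound x : `|envelope c a b x| <= M.
Proof.
rewrite ler_norml; apply/andP; split.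
  by apply: lb_le_inf; [exists M; left|exact: envelope_lb].
by apply: ge_inf; [exists (- M); exact: envelope_lb|left].
Qed.

Lemma envelope_le x : cadlag_pos x -> envelope c a b x <= f x.
Proof.
move=> cx; apply: ge_inf; first by exists (- M); exact: envelope_lb.
right; exists x, 0; split => //; last by rewrite mulr0 addr0.
by move=> s _; rewrite subrr normr0.
Qed.

(** A competitor for [y] at distance [r'] is a competitor for [x] at distance [r + r'], by the
    triangle inequality. *)
Lemma envelope_lip : lip_on a b c (envelope c a b).
Proof.
suff H x y r : 0 <= r -> (forall s, a <= s <= b -> `|x s - y s| <= r) ->
    envelope c a b x - c * r <= envelope c a b y.
  move=> x y r r0 xy; have h1 := H _ _ _ r0 xy.
  have h2 : envelope c a b y - c * r <= envelope c a b x.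
    by apply: H => // s abs; rewrite distrC xy.
  rewrite ler_norml; apply/andP; split; lra.
move=> r0 xy; apply: lb_le_inf; first by exists M; left.
have cr := mulr_ge0 c0 r0.
have xM : envelope c a b x <= M.
  by have := envelope_bound x; rewrite ler_norml => /andP[].
move=> z [->|[y' [r' [cy' r'0 yy' ->]]]]; first lra.
suff : envelope c a b x <= f y' + c * (r + r') by lra.
apply: ge_inf; first by exists (- M); exact: envelope_lb.
right; exists y', (r + r'); split => //; first exact: addr_ge0.
move=> s abs; apply: le_trans (ler_distD (y s) _ _) _.
by apply: lerD; [exact: xy|exact: yy'].
Qed.

End lower_envelope.

(** Near-minimisers [y n] for the slope [n.+2] lie at distance at most [(2 M + 1) / n.+2] from [x]
    on [[1 / n.+2, n.+2]], hence converge to [x] locally uniformly and so in [J1]; continuity of [f]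
    at the cadlag path [x] concludes. *)
Lemma envelope_cvg (R : realType) (f : (R -> R) -> R) (M : R) (x : R -> R) :
  (forall x, `|f x| <= M) ->
  (forall (xn : nat -> R -> R) (x : R -> R),
        (forall n, cadlag_pos (xn n)) -> cadlag_pos x -> J1_cvg xn x ->
        f (xn n) @[n --> \oo] --> f x) ->
  cadlag_pos x ->
  envelope f M n.+2%:R n.+2%:R^-1 n.+2%:R x @[n --> \oo] --> f x.
Proof.
move=> fM fc cx.
have M0 : 0 <= M by exact: le_trans (fM x).
pose E n := envelope f M n.+2%:R n.+2%:R^-1 n.+2%:R x.
have /choice[yr Hyr] : forall n : nat, exists yr : (R -> R) * R,
    [/\ cadlag_pos yr.1, 0 <= yr.2, (forall s, n.+2%:R^-1 <= s <= n.+2%:R -> `|x s - yr.1 s| <= yr.2)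
      & f yr.1 + n.+2%:R * yr.2 <= E n + n.+2%:R^-1].
  move=> n; have n0 : 0 < n.+2%:R^-1 :> R by rewrite invr_gt0.
  have [|z Sz zE] := inf_adherent n0 (E := ([set M] `|` [set z | exists y r, [/\ cadlag_pos y, 0 <= r,
    (forall s, n.+2%:R^-1 <= s <= n.+2%:R -> `|x s - y s| <= r) & z = f y + n.+2%:R * r]])).
    split; first by exists M; left.
    exists (- M) => z [->|[y [r [_ r0 _ ->]]]]; first lra.
    have := fM y; rewrite ler_norml => /andP[? ?].
    by have := mulr_ge0 (ler0n R n.+2) r0; lra.
  case: Sz => [zM|[y [r [cy r0 xy zfy]]]].
    exists (x, 0); split => //=; first by move=> s _; rewrite subrr normr0.
    rewrite mulr0 addr0; apply: le_trans (ltW zE); rewrite zM.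
    by have := fM x; rewrite ler_norml => /andP[].
  by exists (y, r); split => //=; rewrite -zfy; exact: ltW.
pose y n := (yr n).1; pose r n := (yr n).2.
have rn n : r n <= (2 * M + 1) / n.+2%:R.
  have [_ r0 _ H] := Hyr n; rewrite ler_pdivlMr// mulrC.
  have EM : E n <= M.
    by have := @envelope_bound R f M fM n.+2%:R n.+2%:R^-1 n.+2%:R (ler0n _ _) x;
      rewrite ler_norml => /andP[].
  have := fM (yr n).1; rewrite ler_norml => /andP[h1 h2].
  have n1 : n.+2%:R^-1 <= 1 :> R by rewrite invf_le1// ler1n.
  rewrite /r; move: H n1; move: (n.+2%:R * _) (n.+2%:R^-1) => u v; lra.
have invn0 : n.+2%:R^-1 @[n --> \oo] --> (0 : R).
  by have := @cvg_harmonic R; rewrite -(cvg_shiftS (@harmonic R)).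
have r0 : r n @[n --> \oo] --> (0 : R).
  apply: (@squeeze_cvgr _ _ _ _ (fun=> 0) (fun n => (2 * M + 1) / n.+2%:R)).
  - by near=> n; rewrite rn andbT; have [] := Hyr n.
  - exact: cvg_cst.
  - by rewrite -(mulr0 (2 * M + 1)); apply: cvgM => //; exact: cvg_cst.
have fy : f (y n) @[n --> \oo] --> f x.
  apply: fc => //; first by move=> n; have [] := Hyr n.
  apply: J1_cvg_locally_uniform => a b e a0 ab e0.
  near=> n => s sa sb.
  have [_ _ H _] := Hyr n; rewrite distrC.
  apply: (@le_lt_trans _ _ (r n)).
    apply: H; apply/andP; split.
      apply: le_trans sa; apply/ltW; near: n.
      by have := invn0; move/cvgrPdist_lt => /(_ _ a0); apply: filterS => n;
        rewrite sub0r normrN ger0_norm// invr_ge0.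
    apply: le_trans sb _; apply: (@le_trans _ _ n%:R); last by rewrite ler_nat -addn2 leq_addr.
    by near: n; exact: nbhs_infty_ger.
  near: n; have := r0; move/cvgrPdist_lt => /(_ _ e0); apply: filterS => n.
  by rewrite sub0r normrN => /(le_lt_trans (ler_norm _)).
apply: (@squeeze_cvgr _ _ _ _ (fun n => f (y n) - n.+2%:R^-1) (fun=> f x)).
- near=> n; apply/andP; split; last exact: envelope_le.
  have [_ r0n _ H] := Hyr n.
  have := mulr_ge0 (ler0n R n.+2) r0n; rewrite -/(E n) /y; move: H.
  move: (n.+2%:R * _) (n.+2%:R^-1) => u v; lra.
- by rewrite -[X in _ --> X]subr0; apply: cvgB.
- exact: cvg_cst.
Unshelve. all: by end_near.
Qed.

(** * The criterion for weak convergence *)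

Section weak_criterion.
Context (R : realType) d d' (Om : measurableType d) (Om' : measurableType d').
Variables (P : probability Om R) (Y : R -> Om -> R -> R).
Variables (Q : probability Om' R) (Z : Om' -> R -> R).

(** The approximation [G'] on the limit side is fixed before [t], so that one variable serves for
    all large [t]; the bound [M + 1] leaves room for the approximation to overshoot the bound of
    [F]. *)
Definition lip_approx : Prop :=
  forall (a b L M e : R) (F : (R -> R) -> R), 0 < a -> a < b -> 0 <= L ->
  lip_on a b L F -> (forall x, `|F x| <= M) -> 0 < e ->
  exists G', [/\ quasi_rv Q (fun w => F (Z w)) G' e,
    forall w, `|G' w| <= M + 1 &
    \forall t \near +oo, exists G, [/\ quasi_rv P (fun w => F (Y t w)) G e,
       forall w, `|G w| <= M + 1 & `|Ex P G - Ex Q G'| <= e]].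

Hypothesis Ycadlag : exists N, measurable N /\ P N = 0%E /\
  forall w t, 0 < t -> ~ N w -> cadlag_pos (Y t w).
Hypothesis Zcadlag : exists N, measurable N /\ Q N = 0%E /\
  forall w, ~ N w -> cadlag_pos (Z w).
Hypothesis HF : lip_approx.

Lemma Ex_ae_eq (f g : Om' -> R) (A : set Om') (M : R) :
  measurable_fun setT g -> measurable A -> Q A = 0%E ->
  (forall w, `|f w| <= M) -> (forall w, `|g w| <= M) ->
  (forall w, ~ A w -> f w = g w) -> Ex Q f = Ex Q g.
Proof.
move=> mg mA QA fM gM fg.
have h1 := @Ex_lower _ _ _ Q f g A M 0 0 mg mA; have h2 := @Ex_upper _ _ _ Q f g A M 0 0 mg mA.
apply/eqP; rewrite eq_le; apply/andP; split.
  have : Ex Q f <= Ex Q g + 0 + 2 * M * 0.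
    by apply: h2 => //; [rewrite QA|move=> w nA; rewrite fg// addr0].
  lra.
have : Ex Q g - 0 - 2 * M * 0 <= Ex Q f.
  by apply: h1 => //; [rewrite QA|move=> w nA; rewrite fg// subr0].
lra.
Qed.

Section lower.
Variables (f : (R -> R) -> R) (M : R).
Hypothesis fM : forall x, `|f x| <= M.
Hypothesis fc : forall (xn : nat -> R -> R) (x : R -> R),
  (forall n, cadlag_pos (xn n)) -> cadlag_pos x -> J1_cvg xn x ->
  f (xn n) @[n --> \oo] --> f x.

Let env (n : nat) := envelope f M n.+2%:R n.+2%:R^-1 n.+2%:R.

Let envM n x : `|env n x| <= M.
Proof. exact: envelope_bound. Qed.

Let ninv n : 0 < n.+2%:R^-1 :> R. Proof. by rewrite invr_gt0. Qed.

Let ninvn n : n.+2%:R^-1 < n.+2%:R :> R.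
Proof.
apply: (@lt_le_trans _ _ 1); first by rewrite invf_lt1// ltr1n.
by rewrite ler1n.
Qed.

(** Each [env n (Z w)] agrees almost surely with a measurable variable, hence so does its limit
    [f (Z w)]. After removing one null set, dominated convergence applies. *)
Lemma cvg_Ex_envelope :
  Ex Q (fun w => env n (Z w)) @[n --> \oo] --> Ex Q (fun w => f (Z w)).
Proof.
have [N' [mN' [QN' cZ]]] := Zcadlag.
have /choice[N HN] : forall n : nat, exists N, measurable N /\ Q N = 0%E /\
    measurable_fun setT (fun w => env n (Z w) * \1_(~` N) w).
  move=> n; apply: quasi_rv_measurable => e e0.
  have [|G' [HG' _ _]] := @HF _ _ n.+2%:R M e (env n) (ninv n) (ninvn n) (ler0n _ _) _ (envM n) e0.
    exact: envelope_lip.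
  by exists G'.
pose A := N' `|` \bigcup_n N n.
have mN n : measurable (N n) by have [] := HN n.
have mA : measurable A by apply: measurableU => //; apply: bigcupT_measurable.
have QA : Q A = 0%E.
  apply: prob_setU0 => //; first exact: bigcupT_measurable.
  by apply: prob_bigcup0 => // n; have [_ []] := HN n.
have nAN n w : \1_(~` A) w = \1_(~` N n) w * \1_(~` A) w :> R.
  rewrite !indicE; have [wA|] := boolP (w \in ~` A); last by rewrite mulr0.
  rewrite mulr1 mem_set//= => wN; move: wA; rewrite in_setE; apply.
  by right; exists n.
pose psi n w := env n (Z w) * \1_(~` A) w.
have mpsi n : measurable_fun setT (psi n).
  rewrite (_ : psi n = fun w => env n (Z w) * \1_(~` N n) w * \1_(~` A) w); last first.
    by apply/funext => w; rewrite -mulrA -nAN.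
  apply: measurable_funM; first by have [_ []] := HN n.
  by apply: measurable_indic; exact: measurableC.
pose psi0 w := f (Z w) * \1_(~` A) w.
have psic w : psi n w @[n --> \oo] --> psi0 w.
  rewrite /psi /psi0 indicE; have [wA|_] := boolP (w \in ~` A); last first.
    rewrite mulr0; under eq_fun do rewrite mulr0; exact: cvg_cst.
  rewrite mulr1; under eq_fun do rewrite mulr1.
  apply: envelope_cvg => //; apply: cZ => wN.
  by move: wA; rewrite in_setE; apply; left.
have mpsi0 : measurable_fun setT psi0.
  by apply: (measurable_fun_cvg mpsi) => w _; exact: psic.
have ind1 (g : Om' -> R) w : `|g w| <= M -> `|g w * \1_(~` A) w| <= M.
  rewrite indicE; case: (_ \in _); rewrite ?mulr1 ?mulr0 ?normr0 //.
  by move=> _; exact: le_trans (fM (fun=> 0)).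
have psiM n w : `|psi n w| <= M by exact: (ind1 (fun w => env n (Z w))).
have psi0M w : `|psi0 w| <= M by exact: (ind1 (fun w => f (Z w))).
have E1 n : Ex Q (fun w => env n (Z w)) = Ex Q (psi n).
  apply: (@Ex_ae_eq _ _ A M) => // w nA; rewrite /psi indicE mem_set ?mulr1//.
have E2 : Ex Q (fun w => f (Z w)) = Ex Q psi0.
  apply: (@Ex_ae_eq _ _ A M) => // w nA; rewrite /psi0 indicE mem_set ?mulr1//.
rewrite E2; under eq_fun do rewrite E1.
have := @dominated_cvg _ _ _ Q setT measurableT (fun n => EFin \o psi n) (EFin \o psi0) (cst M%:E).
have -> : (\int[Q]_x (EFin \o psi0) x = (Ex Q psi0)%:E)%E.
  by rewrite /Ex fineK//; exact: bounded_fin_num psi0M.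
move=> H; apply: (proj2 (proj1 (fine_cvgP _ _) _)); apply: H.
- by move=> n; apply/measurable_EFinP.
- by move=> w _; apply: cvg_EFin; [exact: nearW|exact: psic].
- by move=> w _.
- exact: integrable_cstR.
- by move=> n w _ /=; rewrite lee_fin.
Qed.

(** One envelope, chosen on the limit side, lies below [f] along every cadlag path, and its
    expectations under [P] and [Q] are compared through measurable approximations. The reverse
    inequality comes from the same statement for [- f]. *)
Lemma Ex_liminf (e : R) : 0 < e ->
  \forall t \near +oo, Ex Q (fun w => f (Z w)) - e <= Ex P (fun w => f (Y t w)).
Proof.
move=> e0; have M0 : 0 <= M by exact: le_trans (fM (fun=> 0)).
have [n En] : exists n, Ex Q (fun w => f (Z w)) - e / 2 <= Ex Q (fun w => env n (Z w)).
  have e2 : 0 < e / 2 by lra.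
  have /cvgrPdist_le/(_ _ e2)[n _ /(_ n)] := cvg_Ex_envelope.
  by move=> /(_ (leqnn n)); rewrite ler_norml => /andP[? ?]; exists n; lra.
(* Three errors of size [e'] occur, two from the approximations and one from the expectations, and
   each of the two exceptional sets costs [2 (M + 1) e']. *)
pose e' := e / 2 / (3 + 4 * (M + 1)).
have e'0 : 0 < e' by rewrite divr_gt0//; lra.
have e'E : e' * (3 + 4 * (M + 1)) = e / 2 by rewrite mulfVK// gt_eqF//; lra.
have [|G' [[mG' [A' [mA' [QA' FG']]]] G'M Ht]] :=
  @HF _ _ n.+2%:R M e' (env n) (ninv n) (ninvn n) (ler0n _ _) _ (envM n) e'0.
  exact: envelope_lip.
have MM1 x : `|x| <= M -> `|x| <= M + 1 :> R by move=> h; lra.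
have Eup : Ex Q (fun w => env n (Z w)) <= Ex Q G' + e' + 2 * (M + 1) * e'.
  apply: (@Ex_upper _ _ _ Q _ _ A') => //; first exact: ltW.
  - by move=> w; exact/MM1/envM.
  - by move=> w /FG'; rewrite ler_norml => /andP[? ?]; lra.
have [N [mN [PN cY]]] := Ycadlag.
near=> t.
have [G [[mG [A [mA [PA FG]]]] GM EG]] : exists G, [/\ quasi_rv P (fun w => env n (Y t w)) G e',
       forall w, `|G w| <= M + 1 & `|Ex P G - Ex Q G'| <= e'] by near: t.
have t0 : 0 < t by near: t; exact: nbhs_pinfty_gt.
have Elo : Ex P G - e' - 2 * (M + 1) * e' <= Ex P (fun w => f (Y t w)).
  apply: (@Ex_lower _ _ _ P _ _ (A `|` N)) => //.
  - exact: measurableU.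
  - by rewrite -[e']addr0; apply: prob_setU_le => //; rewrite PN.
  - exact: ltW.
  - by move=> w; exact/MM1.
  - move=> w /not_orP[nA nN].
    have := FG _ nA; rewrite ler_norml => /andP[? ?].
    have := @envelope_le _ f M fM n.+2%:R n.+2%:R^-1 n.+2%:R (ler0n _ _) _ (cY w t t0 nN).
    rewrite -/(env n); lra.
move: EG; rewrite ler_norml => /andP[? ?]; lra.
Unshelve. all: by end_near.
Qed.

End lower.

Lemma weak_cvg_criterion : weak_cvg_D P Y Q Z.
Proof.
move=> f [M fM] fc.
have -> : (\int[Q]_w (f (Z w))%:E)%E = (Ex Q (fun w => f (Z w)))%:E.
  by rewrite /Ex fineK//; exact: bounded_fin_num (fun w => fM (Z w)).
apply: cvg_EFin.
  by near=> t; exact: bounded_fin_num (fun w => fM (Y t w)).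
apply/cvgrPdist_le => e e0.
have fNM x : `|- f x| <= M by rewrite normrN.
have fcN (xn : nat -> R -> R) (x : R -> R) :
  (forall n, cadlag_pos (xn n)) -> cadlag_pos x -> J1_cvg xn x ->
  (- f (xn n)) @[n --> \oo] --> - f x by move=> h1 h2 h3; apply: cvgN; exact: fc.
have := @Ex_liminf (fun x => - f x) M fNM fcN e e0.
have := @Ex_liminf f M fM fc e e0.
rewrite (ExN _ (fun w => fM (Z w))).
apply: filterS2 => t h1; rewrite (ExN _ (fun w => fM (Y t w))) => h2.
rewrite /= -/(Ex P (fun w => f (Y t w))) ler_norml; apply/andP; split; lra.
Unshelve. all: by end_near.
Qed.

End weak_criterion.

(** * Independence and adapted variables *)

Section adapted.
Context d (T : measurableType d) (R : realType).
Implicit Types (G : set (set T)) (U V : T -> R).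

(** Measurability for the sigma-algebra generated by [G], expressed by retyping the source space, so
    that the closure lemmas for measurable functions apply unchanged. *)
Definition adapted G U : Prop :=
  measurable_fun [set: g_sigma_algebraType G] (U : g_sigma_algebraType G -> R).

Lemma adapted_preimage G U (B : set R) : adapted G U -> measurable B ->
  <<s G >> (U @^-1` B).
Proof. by move=> aU mB; have := aU measurableT B mB; rewrite setTI. Qed.

Lemma adaptedP G U : (forall B, measurable B -> <<s G >> (U @^-1` B)) ->
  adapted G U.
Proof. by move=> H _ B mB; rewrite setTI; exact: H. Qed.

Lemma adapted_mono G1 G2 U : G1 `<=` <<s G2 >> -> adapted G1 U -> adapted G2 U.
Proof.
move=> G12 aU; apply: adaptedP => B mB.
by have := adapted_preimage aU mB; apply: smallest_sub.
Qed.

Lemma sigma_measurable G : (forall A, G A -> measurable A) ->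
  forall A, <<s G >> A -> measurable A.
Proof.
by move=> Gm A; apply: smallest_sub => //; exact: sigma_algebra_measurable.
Qed.

Lemma adapted_measurable G U : (forall A, G A -> measurable A) ->
  adapted G U -> measurable_fun setT U.
Proof.
move=> Gm aU _ B mB; rewrite setTI; apply: (sigma_measurable Gm).
exact: adapted_preimage.
Qed.

Variable P : probability T R.

Lemma integral_prob_cst (c : R) : (\int[P]_w c%:E = c%:E)%E.
Proof.
by rewrite integral_cst//= (_ : (_ setT = 1)%E) ?mule1//; exact: probability_setT.
Qed.

(** Independence identifies the joint law of [(U, V)] with the product of the marginal laws on
    rectangles, hence everywhere, and Tonelli splits the integral. Absolute values make the
    integrand nonnegative on the whole plane. *)
Lemma indep_integralM G1 G2 U V : (forall A, G1 A -> measurable A) ->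
  (forall A, G2 A -> measurable A) ->
  (forall A B, <<s G1 >> A -> <<s G2 >> B -> P (A `&` B) = (P A * P B)%E) ->
  adapted G1 U -> adapted G2 V -> (forall w, 0 <= U w) -> (forall w, 0 <= V w) ->
  (\int[P]_w (U w * V w)%:E = \int[P]_w (U w)%:E * \int[P]_w (V w)%:E)%E.
Proof.
move=> G1m G2m ind aU aV U0 V0.
have mU := adapted_measurable G1m aU; have mV := adapted_measurable G2m aV.
have mX : measurable_fun setT (fun w => (U w, V w)) by exact: measurable_fun_pair.
pose Um : {mfun T >-> R} := mfun_Sub (mem_set mU).
pose Vm : {mfun T >-> R} := mfun_Sub (mem_set mV).
pose Xm : {mfun T >-> (R * R)%type} := mfun_Sub (mem_set mX).
pose m1 := distribution P Um; pose m2 := distribution P Vm.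
pose m' := distribution P Xm.
pose f (z : R * R) : \bar R := (`|z.1| * `|z.2|)%:E.
have mf : measurable_fun setT f.
  apply/measurable_EFinP; apply: measurable_funM; apply: measurableT_comp => //.
have -> : (\int[P]_w (U w * V w)%:E = \int[m']_z f z)%E.
  rewrite /m' ge0_integral_distribution//; last by move=> z; rewrite lee_fin mulr_ge0.
  by apply: eq_integral => w _; rewrite /f /= !ger0_norm.
have m'E (A B : set R) : measurable A -> measurable B -> m' (A `*` B) = (m1 A * m2 B)%E.
  move=> mA mB; rewrite /m' /m1 /m2 /distribution /pushforward /= -ind; last 2 first.
  - exact: adapted_preimage.
  - exact: adapted_preimage.
  by congr (P _).
have -> : (\int[m']_z f z = \int[m1 \x m2]_z f z)%E.
  apply: eq_measure_integral => A mA _.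
  by symmetry; apply: (product_measure_unique m'E).
rewrite fubini_tonelli1//; last by move=> z; rewrite lee_fin mulr_ge0.
rewrite /fubini_F /f /=.
have mabs : measurable_fun [set: R] (fun x : R => `|x|%:E).
  by apply/measurable_EFinP; exact: normr_measurable.
have inner (x : R) : (\int[m2]_y (`|x| * `|y|)%:E = `|x|%:E * \int[m2]_y `|y|%:E)%E.
  by under eq_integral do rewrite EFinM; rewrite ge0_integralZl.
under eq_integral do rewrite inner.
rewrite ge0_integralZr//; last by apply: integral_ge0 => y _; rewrite lee_fin.
rewrite /m1 /m2 !ge0_integral_distribution//.
by congr (_ * _)%E; apply: eq_integral => w _; rewrite /= ger0_norm.
Qed.

End adapted.

(** * A sequence of independent sigma-algebras and its past *)

Section independent_sigma.
Context d (T : measurableType d) (R : realType) (P : probability T R).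
Variable S : nat -> set (set T).

Definition indep_sigma : Prop :=
  forall (I : seq nat) (A : nat -> set T), uniq I ->
    (forall k, k \in I -> S k (A k)) ->
    P (\big[setI/setT]_(k <- I) A k) = (\big[*%E/1%E]_(k <- I) P (A k))%E.

(** Only a generating family, a union of sigma-algebras; statements about the past use
    [<<s past n >>]. *)
Definition past (n : nat) : set (set T) := [set A | exists2 k, (k < n)%N & S k A].

Hypothesis Ssig : forall k, sigma_algebra setT (S k).
Hypothesis Smeas : forall k A, S k A -> measurable A.
Hypothesis Sind : indep_sigma.

Let rect n : set (set T) :=
  [set B | exists2 A : nat -> set T, (forall k, S k (A k)) &
     B = \big[setI/setT]_(k <- iota 0 n) A k].

Let ST k : S k setT.
Proof.
by have [S0 SC _] := Ssig k; rewrite -(setD0 setT); exact: SC.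
Qed.

Let SI k A B : S k A -> S k B -> S k (A `&` B).
Proof.
move=> SA SB; have [S0 SC SU] := Ssig k.
have h A' : S k A' -> S k (~` A') by rewrite -setTD; exact: SC.
rewrite -[X in S k X]setCK setCI; apply: (h).
rewrite -bigcup2E; apply: SU => -[|[|n]] /=; [exact: h|exact: h|exact: S0].
Qed.

Let rect_meas n A : rect n A -> measurable A.
Proof.
by move=> [B SB ->]; apply: bigsetI_measurable => k _; apply: Smeas (SB k).
Qed.

Let rect_setI n : setI_closed (rect n).
Proof.
move=> _ _ [A SA ->] [B SB ->]; exists (fun k => A k `&` B k) => [k|]; first exact: SI.
by rewrite big_split.
Qed.

Let past_rect n : past n `<=` rect n.
Proof.
move=> A [k kn SA]; exists (fun j => if j == k then A else setT).
  by move=> j; case: eqP => [->//|_]; exact: ST.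
rewrite (bigD1_seq k)/= ?iota_uniq ?mem_iota//= eqxx big1_seq ?setIT// => j /andP[+ _].
by move=> /negbTE ->.
Qed.

Lemma past_measurable n A : past n A -> measurable A.
Proof. by move=> [k _ /Smeas]. Qed.

(** The rectangles [rect n] form a pi-system that contains [past n]. The finite measures [P (. & B)]
    and [P B * P] agree on it, hence on the generated sigma-algebra. *)
Lemma past_indep n A B : <<s past n >> A -> S n B -> P (A `&` B) = (P A * P B)%E.
Proof.
move=> pA SB; have mB := Smeas SB.
have rA : <<s rect n >> A.
  move: A pA; apply: smallest_sub; first exact: smallest_sigma_algebra.
  by move=> A /past_rect rA; exact: sub_sigma_algebra.
have PB0 : 0 <= fine (P B) by rewrite fine_ge0.
pose m2 := mscale (NngNum PB0) P.
have := @g_sigma_algebra_measure_unique _ _ _ (rect n) _ (fun=> setT) _ _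
  (mrestr P mB) m2 _ _ _ A rA.
rewrite /= /mrestr /m2 /mscale /= fineK ?fin_num_measure// muleC; apply.
- exact: rect_meas.
- by move=> _; exists (fun=> setT); [move=> k; exact: ST|rewrite big1].
- by rewrite bigcup_const.
- exact: rect_setI.
- move=> _ [C SC ->]; rewrite muleC.
  pose C' k := if k == n then B else C k.
  have C'E : \big[setI/setT]_(k <- iota 0 n) C' k = \big[setI/setT]_(k <- iota 0 n) C k.
    apply: eq_big_seq => k; rewrite mem_iota add0n => /andP[_ kn].
    by rewrite /C' ltn_eqF.
  have SC' k : S k (C' k) by rewrite /C'; case: eqP => [->|].
  have := Sind (iota_uniq 0 n.+1) (fun k _ => SC' k).
  rewrite -addn1 iotaD add0n !big_cat !big_seq1 /= C'E {1 3}/C' eqxx => ->.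
  by rewrite -(Sind (iota_uniq 0 n) (fun k _ => SC' k)) C'E.
- by move=> _; rewrite setTI ltey_eq fin_num_measure.
Qed.

Lemma past_integralM n (U V : T -> R) : adapted (past n) U -> adapted (S n) V ->
  (forall w, 0 <= U w) -> (forall w, 0 <= V w) ->
  (\int[P]_w (U w * V w)%:E = \int[P]_w (U w)%:E * \int[P]_w (V w)%:E)%E.
Proof.
move=> aU aV; apply: (@indep_integralM _ _ _ P (past n) (S n)) => //.
- exact: past_measurable.
- exact: Smeas.
- move=> A B pA sB; apply: (@past_indep n) => //.
  by move: B sB; apply: smallest_sub.
Qed.

Lemma past_leq m n : (m <= n)%N -> past m `<=` past n.
Proof. by move=> mn A [k km SA]; exists k => //; exact: leq_trans mn. Qed.

Lemma adapted_past_leq m n (U : T -> R) : (m <= n)%N -> adapted (past m) U ->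
  adapted (past n) U.
Proof.
move=> mn; apply: adapted_mono => A /(past_leq mn); exact: sub_sigma_algebra.
Qed.

Lemma adapted_past k n (U : T -> R) : (k < n)%N -> adapted (S k) U ->
  adapted (past n) U.
Proof.
by move=> kn; apply: adapted_mono => A SA; apply: sub_sigma_algebra; exists k.
Qed.

Lemma integral_prod_indep (n : nat) (V : nat -> T -> R) :
  (forall k, adapted (S k) (V k)) -> (forall k w, 0 <= V k w) ->
  (\int[P]_w (\prod_(k < n) V k w)%:E = \prod_(k < n) \int[P]_w (V k w)%:E)%E.
Proof.
move=> aV V0; elim: n => [|n IH].
  rewrite big_ord0; under eq_integral do rewrite big_ord0.
  exact: integral_prob_cst.
rewrite big_ord_recr/= -IH -(@past_integralM n)//.
- by apply: eq_integral => w _; rewrite big_ord_recr.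
- rewrite /adapted; apply: measurable_prod => k.
  by move=> _; exact: (adapted_past (ltn_ord k) (aV k)).
- by move=> w; apply: prodr_ge0.
Qed.

End independent_sigma.

(** * Regular variation *)

Section regular_variation.
Context (R : realType).
Implicit Types (f g l k : R -> R) (r s : R).
Local Notation mu := (@lebesgue_measure R).

Lemma near_pinftyP (Q : R -> Prop) : (\forall t \near +oo, Q t) <->
  (exists M : R, 1 <= M /\ forall t, M <= t -> Q t).
Proof.
split=> [[M [_ HM]]|[M [_ HM]]]; last first.
  exists M; split; first exact: num_real.
  by move=> t /ltW; exact: HM.
exists (Num.max 1 (M + 1)); split; first by rewrite le_max lexx.
move=> t; rewrite ge_max => /andP[_ Mt]; apply: HM; lra.
Qed.

Lemma lebesgue_measure_shift (c : R) (A : set R) : measurable A ->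
  mu [set x | A (x - c)] = mu A.
Proof.
move=> mA.
have mc : measurable_fun [set: measurableTypeR R] (fun x : measurableTypeR R => (x - c) : measurableTypeR R).
  by apply: measurable_funB.
rewrite -[LHS]/(pushforward mu (fun x : measurableTypeR R => (x - c) : measurableTypeR R) A).
apply/esym/lebesgue_measure_unique => //= _ [[a b]] _ <-.
rewrite /pushforward.
rewrite (_ : _ @^-1` _ = `](a + c), (b + c)]%classic).
  rewrite !lebesgue_measure_itv/= !lte_fin ltrD2r; case: ifP => // _.
  by rewrite -!EFinB; congr _%:E; ring.
by apply/seteqP; split => x /=; rewrite !in_itv/= => /andP[? ?]; apply/andP; split; lra.
Qed.

(** The uniform convergence theorem in additive form. The bad shifts [E x] in [[0, 2 A]] have
    measure at most [A / 4] for large [x], since along any sequence their upper limit is empty by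
    pointwise convergence. If [k (x + u)] were far from [k x], then [[u, 2 A]], of length at least
    [A], would be covered by [E x] and a translate of [E (x + u)]. *)
Lemma uniform_cvg_shift k (A e : R) : measurable_fun setT k ->
  (forall u, k (x + u) - k x @[x --> +oo] --> (0 : R)) -> 0 < A -> 0 < e ->
  \forall x \near +oo, forall u, 0 <= u <= A -> `|k (x + u) - k x| <= e.
Proof.
move=> mk kc A0 e0.
pose D := `[0, 2 * A]%classic : set R.
pose E x := D `&` [set s | e / 2 < `|k (x + s) - k x|].
have mE x : measurable (E x).
  apply: measurableI; first exact: measurable_itv.
  rewrite -[X in measurable X]setTI.
  rewrite (_ : [set s | _] = (fun s => `|k (x + s) - k x|) @^-1` `]e / 2, +oo[%classic); last first.
    by apply/seteqP; split => s /=; rewrite in_itv/= andbT.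
  have mf : measurable_fun setT (fun s => `|k (x + s) - k x|).
    apply: measurableT_comp; first exact: normr_measurable.
    apply: measurable_funB => //; apply: measurableT_comp => //.
    exact: measurable_funD.
  exact: mf.
have muD : mu D = (2 * A)%:E.
  by rewrite lebesgue_measure_itv/= lte_fin mulr_gt0// oppr0 adde0.
have small : \forall x \near +oo, (mu (E x) <= (A / 4)%:E)%E.
  apply: contrapT => nsmall.
  have /choice[xn Hxn] : forall n : nat, exists x : R, n%:R <= x /\ ~ (mu (E x) <= (A / 4)%:E)%E.
    move=> n; apply: contrapT => /forallNP H; apply: nsmall; apply/near_pinftyP.
    exists (n.+1%:R); split; first by rewrite ler1n.
    move=> t nt; apply: contrapT => h; apply: (H t); split => //.
    by apply: le_trans nt; rewrite ler_nat.
  have xny : xn n @[n --> \oo] --> +oo.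
    apply: (ger_cvgy _ (@cvgr_idn R)); apply: nearW => n; by have [] := Hxn n.
  pose F n := E (xn n).
  have FD n : \bigcup_(k in [set k | (n <= k)%N]) F k `<=` D.
    by move=> s [j _ []].
  have mF n : measurable (\bigcup_(k in [set k | (n <= k)%N]) F k).
    by apply: bigcup_measurable => j _; exact: mE.
  have leD B : measurable B -> B `<=` D -> (mu B < +oo)%E.
    move=> mB BD; apply: (@le_lt_trans _ _ (mu D)); last by rewrite muD ltry.
    by apply: le_measure => //; rewrite inE//; exact: measurable_itv.
  have F0 : lim_sup_set F = set0.
    apply/seteqP; split => // s Fs.
    have Ds : D s by have [j _ []] := Fs 0%N I.
    have := proj1 (cvg_pinftyP _ _) (kc s) xn xny.
    move=> /cvgrPdist_le /(_ (e / 2)); rewrite divr_gt0// => /(_ isT)[n _ Hn].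
    have [j /= nj [_ /=]] := Fs n I; have := Hn j nj.
    by rewrite /= sub0r normrN ltNge => ->.
  have := @lim_sup_set_cvg _ _ _ mu F (fun n => mE _) (leD _ (mF 0%N) (FD 0%N)).
  rewrite F0 measure0 => /fine_cvgP[_ /cvgrPdist_lt/(_ (A / 4))].
  rewrite divr_gt0// => /(_ isT)[n _ /(_ n (leqnn n))] /=.
  rewrite sub0r normrN => h2.
  have [_ /negP] := Hxn n; rewrite -ltNge => h1.
  have h3 : (mu (E (xn n)) <= mu (\bigcup_(k in [set k | (n <= k)%N]) F k))%E.
    apply: le_measure; rewrite ?inE//; [exact: mE|exact: mF|].
    by move=> s Es; exists n => /=.
  have fin : mu (\bigcup_(k in [set k | (n <= k)%N]) F k) \is a fin_num.
    by rewrite ge0_fin_numE//; exact: leD.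
  have := lt_le_trans h1 h3; rewrite -(fineK fin) lte_fin => h4.
  by have := lt_trans h4 (le_lt_trans (ler_norm _) h2); rewrite ltxx.
have /near_pinftyP[M [_ HM]] := small.
apply/near_pinftyP; exists (Num.max 1 M); split; first by rewrite le_max lexx.
move=> x; rewrite ge_max => /andP[_ Mx] u /andP[u0 uA].
rewrite leNgt; apply/negP => ke.
have cover : `[u, 2 * A]%classic `<=` E x `|` [set s | E (x + u) (s - u)].
  move=> s /=; rewrite in_itv/= => /andP[us sA].
  have [h|h] := ltP (e / 2) `|k (x + s) - k x|.
    left; split => //=; rewrite /D/= in_itv/= sA andbT; exact: le_trans us.
  right; split; first by rewrite /D/= in_itv/=; apply/andP; split; lra.
  rewrite /= (_ : x + u + (s - u) = x + s); last by ring.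
  have := ler_distD (k (x + s)) (k (x + u)) (k x).
  by rewrite (distrC (k (x + u)) (k (x + s))) => h2; lra.
pose Es := [set s | E (x + u) (s - u)].
have mEs : measurable Es.
  rewrite -[X in measurable X]setTI.
  have mc : measurable_fun setT (fun s : R => s - u) by exact: measurable_funB.
  exact: (mc measurableT _ (mE (x + u))).
have h1 : (mu (E x `|` Es) <= (A / 4)%:E + (A / 4)%:E)%E.
  apply: le_trans (measureU2 _ _ _) _; [exact: mE|exact: mEs|].
  apply: leeD; first exact: HM.
  have Emu : mu Es = mu (E (x + u)%R) by exact: lebesgue_measure_shift.
  by have := HM (x + u) ltac:(lra); rewrite -Emu.
have h2 : (mu `[u, (2 * A)%R]%classic <= mu (E x `|` Es))%E.
  apply: le_measure; [by rewrite inE; exact: measurable_itv| |exact: cover].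
  by rewrite inE; apply: measurableU; [exact: mE|exact: mEs].
have := le_trans h2 h1; rewrite lebesgue_measure_itv/= lte_fin.
by rewrite ifT; [rewrite -EFinB -EFinD lee_fin; lra|lra].
Qed.

Lemma uniform_cvg_shift_sym k (A e : R) : measurable_fun setT k ->
  (forall u, k (x + u) - k x @[x --> +oo] --> (0 : R)) -> 0 < A -> 0 < e ->
  \forall x \near +oo, forall u, - A <= u <= A -> `|k (x + u) - k x| <= e.
Proof.
move=> mk kc A0 e0.
have /near_pinftyP[M [M1 HM]] := @uniform_cvg_shift k (2 * A) (e / 2) mk kc
  ltac:(lra) ltac:(lra).
apply/near_pinftyP; exists (M + A); split; first lra.
move=> x Mx u /andP[u1 u2].
have h1 := HM (x - A) ltac:(lra) (u + A) ltac:(apply/andP; split; lra).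
have h2 := HM (x - A) ltac:(lra) A ltac:(apply/andP; split; lra).
rewrite (_ : x - A + (u + A) = x + u) in h1; last by ring.
rewrite subrK in h2.
have := ler_distD (k (x - A)) (k (x + u)) (k x).
by rewrite (distrC (k (x - A)) (k x)) => h3; lra.
Qed.

Lemma expR_dist1 (x e : R) : 0 < e -> `|x| <= Num.min (e / 2) (1 / 2) -> `|expR x - 1| <= e.
Proof.
move=> e0; rewrite le_min => /andP[xe x1].
have := expR_ge1Dx x; have := expR_ge1Dx (- x).
have e0x := expR_gt0 x; rewrite expRN => h1 h2.
move: xe x1; rewrite !ler_norml => /andP[a1 a2] /andP[b1 b2].
apply/andP; split; first lra.
have h3 : expR x * (1 - x) <= 1.
  by have := ler_wpM2l (ltW e0x) h1; rewrite mulfV ?gt_eqF.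
have ex2 : expR x <= 2 by nra.
nra.
Qed.

(** The logarithmic change of variables [k x = ln (l (expR x))] turns slow variation into the
    additive setting; the estimate on differences of [k] is then exponentiated. *)
Lemma slowly_varying_uniform l (c d e : R) : slowly_varying l -> 0 < c -> 0 < e ->
  \forall t \near +oo, forall x, c <= x <= d -> `|l (t * x) / l t - 1| <= e.
Proof.
move=> [ml [l0 lc]] c0 e0.
have [dc|cd] := ltP d c.
  by apply: nearW => t x /andP[h1 h2]; have := lt_le_trans dc (le_trans h1 h2); rewrite ltxx.
have /near_pinftyP[M0 [M01 HM0]] := l0.
pose k x := ln (l (expR x)).
have mk : measurable_fun setT k.
  apply: measurableT_comp; first exact: measurable_ln.
  by apply: measurableT_comp => //; exact: measurable_expR.
have expM x : M0 <= x -> M0 <= expR x.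
  by move=> h; have := expR_ge1Dx x; lra.
have kc u : k (x + u) - k x @[x --> +oo] --> (0 : R).
  apply/cvgrPdist_le => h h0.
  have h1 : 0 < Num.min (1 - expR (- h)) (expR h - 1).
    rewrite lt_min !subr_gt0 expR_gt1 h0 andbT -expR0 ltr_expR; lra.
  have /cvgrPdist_le/(_ _ h1)/near_pinftyP[M [M1 HM]] := lc _ (expR_gt0 u).
  apply/near_pinftyP; exists (Num.max (Num.max M0 M) (M0 - u)).
  split; first by rewrite !le_max M01.
  move=> x; rewrite !ge_max => /andP[/andP[M0x Mx] M0u].
  have lx0 : 0 < l (expR x) by apply/HM0/expM.
  have lxu0 : 0 < l (expR (x + u)) by apply/HM0/expM; lra.
  have := HM (expR x) ltac:(have := expR_ge1Dx x; lra).
  rewrite (mulrC (expR u)) -expRD sub0r normrN /k -ln_div ?posrE//.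
  set q := _ / _; rewrite le_min => /andP[].
  have q0 : 0 < q by exact: divr_gt0.
  rewrite !ler_norml => /andP[q1 q2] /andP[q3 q4].
  rewrite -[in X in X && _](expRK (- h)) -[in X in _ && X](expRK h) !ler_ln ?posrE ?expR_gt0//.
  by apply/andP; split; lra.
pose A := Num.max (`|ln c|) (`|ln d|) + 1.
have A0 : 0 < A by rewrite ltr_wpDl// le_max normr_ge0.
have m0 : 0 < Num.min (e / 2) (1 / 2) by rewrite lt_min !divr_gt0.
have /near_pinftyP[M [M1 HM]] := uniform_cvg_shift_sym mk kc A0 m0.
apply/near_pinftyP; exists (Num.max (Num.max 1 (M0 / c)) (Num.max M0 (expR M))).
split; first by rewrite !le_max lexx.
move=> t; rewrite !ge_max => /andP[/andP[t1 tc] /andP[tM0 tM]] x /andP[cx xd].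
have x0 : 0 < x by exact: lt_le_trans cx.
have t0 : 0 < t by lra.
have Mlnt : M <= ln t by rewrite -(expRK M) ler_ln ?posrE ?expR_gt0.
have uA : - A <= ln x <= A.
  rewrite -ler_norml; apply: (@le_trans _ _ (Num.max `|ln c| `|ln d|)); last by rewrite lerDl.
  have h1 : ln c <= ln x by rewrite ler_ln ?posrE.
  have h2 : ln x <= ln d by rewrite ler_ln ?posrE//; exact: lt_le_trans xd.
  have h3 := ler_norm (ln d); have h4 := ler_norm (- ln c); rewrite normrN in h4.
  rewrite ler_norml le_max lerNl le_max.
  by apply/andP; split; apply/orP; [left|right]; lra.
have := HM _ Mlnt _ uA; rewrite /k expRD !lnK ?posrE//.
have ltx : 0 < l (t * x).
  apply: HM0; move: tc; rewrite ler_pdivrMr// => tc; apply: le_trans tc _.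
  by rewrite ler_pM2l.
have lt0 : 0 < l t by exact: HM0.
rewrite -ln_div ?posrE// => h.
have := expR_dist1 e0 h; by rewrite lnK// posrE divr_gt0.
Qed.

(** Local uniformity is built into the definition: it passes to products and inverses by elementary
    estimates, without returning to measurability. *)
Definition regularly_varying f r : Prop := (\forall t \near +oo, 0 < f t) /\
  (forall c d e : R, 0 < c -> 0 < e -> \forall t \near +oo,
     forall x, c <= x <= d -> `|f (t * x) / f t - x `^ r| <= e).

Lemma powR_bounded (c d r : R) : 0 < c -> exists2 M : R, 0 < M &
  forall x, c <= x <= d -> x `^ r <= M /\ M^-1 <= x `^ r.
Proof.
move=> c0; have [dc|cd] := ltP d c.
  by exists 1 => // x /andP[h1 h2]; have := lt_le_trans dc (le_trans h1 h2); rewrite ltxx.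
have d0 : 0 < d by exact: lt_le_trans cd.
have le (a b s : R) : 0 < a -> a <= b -> 0 <= s -> a `^ s <= b `^ s.
  move=> a0 ab s0; apply: ge0_ler_powR; rewrite ?nnegrE//; lra.
have pos a s : 0 < a -> 0 < a `^ s :> R by exact: powR_gt0.
wlog r0 : r / 0 <= r => [H|].
  have [/H//|r0] := leP 0 r.
  have [|M M0 HM] := H (- r); first by lra.
  exists M => // x cdx; have [h1 h2] := HM x cdx.
  have x0 : 0 < x by case/andP: cdx => h _; exact: lt_le_trans h.
  rewrite -(opprK r) powRN; split.
    by rewrite -(invrK M) lef_pV2 ?posrE ?invr_gt0 ?pos.
  by rewrite lef_pV2 ?posrE ?pos.
exists (d `^ r + (c `^ r)^-1); first by rewrite addr_gt0 ?invr_gt0 ?pos.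
move=> x /andP[cx xd]; have x0 : 0 < x by exact: lt_le_trans cx.
have h1 := le _ _ _ x0 xd r0; have h2 := le _ _ _ c0 cx r0.
have p1 := pos d r d0; have p2 := pos c r c0.
have p3 : 0 < (c `^ r)^-1 by rewrite invr_gt0.
split; first lra.
apply: le_trans h2; rewrite -[leRHS]invrK lef_pV2 ?posrE ?addr_gt0//; lra.
Qed.

Lemma ratio_dist1 (a b L h : R) : 0 < h -> h <= 1 / 4 -> `|a - 1| <= h ->
  `|b - 1| <= h -> `|L - 1| <= h -> `|a * L / b - 1| <= 8 * h.
Proof.
move=> h0 h4; rewrite !ler_norml => /andP[a1 a2] /andP[b1 b2] /andP[L1 L2].
have b0 : 0 < b by lra.
rewrite lerBlDr lerBrDr ler_pdivrMr// ler_pdivlMr//.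
by apply/andP; split; nra.
Qed.

Lemma asym_equiv_regularly_varying f l r : slowly_varying l ->
  asym_equiv f (fun t => t `^ r * l t) -> regularly_varying f r.
Proof.
move=> sl fl; have [ml [l0 lc]] := sl.
have /near_pinftyP[M0 [M01 HM0]] := l0.
have q14 : 0 < 1 / 4 :> R by rewrite divr_gt0.
have fd h : 0 < h -> exists M : R, 1 <= M /\ forall t, M <= t -> `|f t / (t `^ r * l t) - 1| <= h.
  by move=> h0; have /cvgrPdist_le/(_ _ h0)/near_pinftyP[M [M1 HM]] := fl;
    exists M; split => // t /HM; rewrite distrC.
split.
  have [M [M1 HM]] := fd _ q14; apply/near_pinftyP.
  exists (Num.max M M0); split; first by rewrite le_max M1.
  move=> t; rewrite ge_max => /andP[Mt M0t].
  have g0 : 0 < t `^ r * l t by rewrite mulr_gt0 ?powR_gt0 ?HM0//; lra.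
  have := HM t Mt; rewrite ler_norml => /andP[h1 _].
  have : 0 < f t / (t `^ r * l t) by lra.
  by rewrite pmulr_lgt0 ?invr_gt0.
move=> c d e c0 e0; have [K K0 HK] := powR_bounded d r c0.
pose h := Num.min (1 / 4) (e / (8 * K)).
have h0 : 0 < h by rewrite lt_min q14 divr_gt0// mulr_gt0.
have h4 : h <= 1 / 4 by rewrite ge_min lexx.
have hK : 8 * h * K <= e.
  have : h <= e / (8 * K) by rewrite ge_min lexx orbT.
  by rewrite ler_pdivlMr ?mulr_gt0// => ?; lra.
have [M [M1 HM]] := fd _ h0.
have /near_pinftyP[M2 [M21 HM2]] := slowly_varying_uniform d sl c0 h0.
apply/near_pinftyP; exists (Num.max (Num.max M M2) (Num.max (Num.max M0 (M / c)) (M0 / c))).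
split; first by rewrite !le_max M1.
move=> t; rewrite !ge_max => /andP[/andP[tM tM2] /andP[/andP[tM0 tMc] tM0c]] x cdx.
have /andP[cx xd] := cdx.
have x0 : 0 < x by exact: lt_le_trans cx.
have t0 : 0 < t by lra.
have tx a : a / c <= t -> a <= t * x.
  rewrite ler_pdivrMr// => ha; apply: le_trans ha _; by rewrite ler_pM2l.
have H1 := HM _ (tx _ tMc); have H2 := HM _ tM; have H3 := HM2 _ tM2 _ cdx.
have ltx : 0 < l (t * x) by apply/HM0/tx.
have lt0 : 0 < l t by exact: HM0.
have pt : 0 < t `^ r by exact: powR_gt0.
have px : 0 < x `^ r by exact: powR_gt0.
have ft0 : 0 < f t.
  have g0 : 0 < t `^ r * l t by rewrite mulr_gt0.
  move: H2; rewrite ler_norml => /andP[h1 _].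
  have : 0 < f t / (t `^ r * l t) by lra.
  by rewrite pmulr_lgt0 ?invr_gt0.
have := ratio_dist1 h0 h4 H1 H2 H3.
rewrite powRM; [|exact: ltW..].
set q := (X in `|X - 1|) => Hq.
have -> : f (t * x) / f t = x `^ r * q.
  by rewrite /q; field; rewrite !gt_eqF.
rewrite -{2}[x `^ r]mulr1 -mulrBr normrM (gtr0_norm px).
have [xK _] := HK x cdx; have := normr_ge0 (q - 1); nra.
Qed.

Lemma regularly_varying_inv f r : regularly_varying f r ->
  regularly_varying (fun t => (f t)^-1) (- r).
Proof.
move=> [f0 fr]; split; first by apply: filterS f0 => t; rewrite invr_gt0.
move=> c d e c0 e0; have [K K0 HK] := powR_bounded d r c0.
have K1 : 0 < K^-1 by rewrite invr_gt0.
pose h := Num.min (K^-1 / 2) (e * (K^-1 * K^-1) / 2).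
have h0 : 0 < h by rewrite lt_min !divr_gt0// !mulr_gt0.
have /near_pinftyP[M [M1 HM]] := fr c d h c0 h0.
have /near_pinftyP[M0 [M01 HM0]] := f0.
apply/near_pinftyP; exists (Num.max (Num.max M M0) (M0 / c)).
split; first by rewrite !le_max M1.
move=> t; rewrite !ge_max => /andP[/andP[tM tM0] tc] x cdx; have /andP[cx xd] := cdx.
have x0 : 0 < x by exact: lt_le_trans cx.
have px : 0 < x `^ r by exact: powR_gt0.
have ft : 0 < f t by exact: HM0.
have ftx : 0 < f (t * x).
  apply: HM0; move: tc; rewrite ler_pdivrMr// => tc; apply: le_trans tc _.
  by rewrite ler_pM2l//; lra.
have [_ xK] := HK x cdx; have := HM t tM x cdx.
set q := f (t * x) / f t.
have q0 : 0 < q by exact: divr_gt0.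
have -> : (f (t * x))^-1 / (f t)^-1 = q^-1 by rewrite invrK invf_div mulrC.
rewrite powRN => hq.
have h1 : h <= K^-1 / 2 by rewrite ge_min lexx.
have h2 : h <= e * (K^-1 * K^-1) / 2 by rewrite ge_min lexx orbT.
have qK : K^-1 / 2 <= q by move: hq; rewrite ler_norml => /andP[? ?]; lra.
have -> : q^-1 - (x `^ r)^-1 = (x `^ r - q) / (q * x `^ r).
  by field; rewrite !gt_eqF.
rewrite normrM normfV (gtr0_norm (mulr_gt0 q0 px)) ler_pdivrMr; last exact: mulr_gt0.
rewrite distrC; apply: le_trans hq _; apply: le_trans h2 _.
rewrite -mulrA ler_pM2l//; nra.
Qed.

Lemma regularly_varyingM f g r s : regularly_varying f r -> regularly_varying g s ->
  regularly_varying (fun t => f t * g t) (r + s).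
Proof.
move=> [f0 fr] [g0 gs]; split.
  by apply: filterS2 f0 g0 => t ? ?; exact: mulr_gt0.
move=> c d e c0 e0; have [K K0 HK] := powR_bounded d r c0.
have [L L0 HL] := powR_bounded d s c0.
pose h := Num.min 1 (e / (K + L + 1)).
have KL : 0 < K + L + 1 by lra.
have h0 : 0 < h by rewrite lt_min ltr01 divr_gt0.
have hKL : h * (K + L + 1) <= e.
  have : h <= e / (K + L + 1) by rewrite ge_min lexx orbT.
  by rewrite ler_pdivlMr.
have h1 : h <= 1 by rewrite ge_min lexx.
apply: filterS2 (fr c d h c0 h0) (gs c d h c0 h0) => t Hf Hg x cdx.
have x0 : 0 < x by have /andP[cx _] := cdx; exact: lt_le_trans cx.
have := Hf x cdx; have := Hg x cdx.
rewrite powRD; last by apply/implyP => _; rewrite gt_eqF.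
rewrite invfM mulrACA; set a := f _ / _; set b := g _ / _ => hb ha.
have [xK _] := HK x cdx; have [xL _] := HL x cdx.
have px : 0 < x `^ r by exact: powR_gt0.
have py : 0 < x `^ s by exact: powR_gt0.
have -> : a * b - x `^ r * x `^ s =
  (a - x `^ r) * (b - x `^ s) + (a - x `^ r) * x `^ s + x `^ r * (b - x `^ s) by ring.
apply: le_trans (ler_normD _ _) _.
apply: le_trans (lerD (ler_normD _ _) (lexx _)) _.
rewrite !normrM (gtr0_norm px) (gtr0_norm py).
have := normr_ge0 (a - x `^ r); have := normr_ge0 (b - x `^ s).
move: ha hb; move: `|a - _| `|b - _| => u v uh vh v0 u0; nra.
Qed.

Lemma regularly_varying_ratio f r (c : R) : regularly_varying f r -> 0 < c ->
  f (c * t) / f t @[t --> +oo] --> c `^ r.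
Proof.
move=> [f0 fr] c0; apply/cvgrPdist_le => e e0.
apply: filterS (fr c c e c0 e0) => t /(_ c).
by move=> /(_ ltac:(by rewrite lexx)); rewrite distrC (mulrC c).
Qed.

Lemma regularly_varying_compare f r (c d : R) : regularly_varying f r -> 0 < c ->
  exists2 K : R, 0 < K & \forall t \near +oo, forall x, c <= x <= d ->
    f (t * x) <= K * f t /\ f t <= K * f (t * x).
Proof.
move=> [f0 fr] c0; have [K K0 HK] := powR_bounded d r c0.
have K1 : 0 < K^-1 by rewrite invr_gt0.
exists (2 * K + K^-1); first by lra.
have K2 : 0 < K^-1 / 2 by rewrite divr_gt0.
have KK : K^-1 * K = 1 by rewrite mulVf// gt_eqF.
apply: filterS2 f0 (fr c d _ c0 K2) => t ft H x cdx.
have [xK Kx] := HK x cdx; have := H x cdx; rewrite ler_norml => /andP[h1 h2].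
have h3 : f (t * x) / f t <= 2 * K + K^-1 by lra.
have h4 : K^-1 / 2 <= f (t * x) / f t by lra.
split; first by move: h3; rewrite ler_pdivrMr.
move: h4; rewrite ler_pdivlMr// => h4.
have ftx : 0 < f (t * x) by nra.
have : K * (K^-1 / 2 * f t) <= K * f (t * x) by rewrite ler_pM2l.
rewrite (_ : K * (K^-1 / 2 * f t) = K^-1 * K * f t / 2); last by ring.
by rewrite KK mul1r => h5; nra.
Qed.

Lemma regularly_varying_double f r (e : R) : regularly_varying f r -> 0 < e ->
  \forall t \near +oo, f (2 * t) <= 2 `^ (r + e) * f t.
Proof.
move=> fr e0; have [f0 _] := fr.
have h0 : 0 < 2 `^ (r + e) - 2 `^ r :> R.
  rewrite subr_gt0 powRD; last by rewrite pnatr_eq0 implybT.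
  rewrite ltr_pMr ?powR_gt0// /powR pnatr_eq0/= expR_gt1 mulr_gt0// ln_gt0//.
  by rewrite ltr1n.
have /cvgrPdist_le/(_ _ h0) := regularly_varying_ratio fr (ltr0n R 2).
apply: filterS2 f0 => t ft; rewrite ler_norml => /andP[h1 h2].
by rewrite -ler_pdivrMr//; lra.
Qed.

Lemma regularly_varying_potter_ub f r (e : R) : regularly_varying f r -> 0 < e ->
  exists C s0 : R, [/\ 0 < C, 1 <= s0 & forall y, s0 <= y -> 0 < f y <= C * y `^ (r + e)].
Proof.
move=> fr e0; have [f0 _] := fr.
have /near_pinftyP[M0 [M01 HM0]] := f0.
have [K K0 /near_pinftyP[M1 [M11 HM1]]] := regularly_varying_compare 2 fr (@ltr01 R).
have /near_pinftyP[M2 [M21 HM2]] := regularly_varying_double fr e0.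
pose s0 := Num.max M0 (Num.max M1 M2).
have s01 : 1 <= s0 by rewrite le_max M01.
have [sM0 [sM1 sM2]] : M0 <= s0 /\ M1 <= s0 /\ M2 <= s0 by rewrite !le_max !lexx !orbT.
have s00 : 0 < s0 by lra.
have [L L0 HL] := powR_bounded 2 (r + e) (@ltr01 R).
pose C := K * f s0 * L.
have fs0 : 0 < f s0 by exact: HM0.
have C0 : 0 < C by rewrite !mulr_gt0.
have claim (n : nat) y : s0 <= y -> y <= 2 ^+ n.+1 * s0 -> f y <= C * (y / s0) `^ (r + e).
  elim: n y => [|n IH] y sy yn.
    have [h1 h2] : 1 <= y / s0 /\ y / s0 <= 2.
      by rewrite ler_pdivlMr// ler_pdivrMr// mul1r -[2]expr1.
    have [h3 _] := HM1 s0 sM1 (y / s0) ltac:(by rewrite h1).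
    rewrite mulrC divfK ?gt_eqF// in h3; apply: le_trans h3 _.
    have [_ h4] := HL (y / s0) ltac:(by rewrite h1).
    rewrite /C -mulrA; apply: ler_peMr; first by rewrite mulr_ge0// ltW.
    by have := ler_wpM2l (ltW L0) h4; rewrite mulfV ?gt_eqF.
  have [y2|y2] := leP y (2 ^+ n.+1 * s0); first exact: IH.
  have n2 : 1 <= 2 ^+ n :> R by rewrite exprn_ege1// ler1n.
  have sy2 : s0 <= y / 2.
    by rewrite ler_pdivlMr//; move: y2; rewrite exprS; nra.
  have yn' : y <= 2 ^+ n.+1 * s0 * 2 by move: yn; rewrite exprS; lra.
  have := IH (y / 2) sy2 ltac:(by rewrite ler_pdivrMr) => h1.
  have := HM2 (y / 2) ltac:(lra); rewrite mulrC divfK// => h2.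
  apply: le_trans h2 _.
  have p2 : 0 < 2 `^ (r + e) :> R by exact: powR_gt0.
  have := ler_wpM2l (ltW p2) h1; move=> /le_trans; apply.
  rewrite mulrCA -powRM//; last by rewrite !divr_ge0//; lra.
  by rewrite (_ : 2 * (y / 2 / s0) = y / s0)//; field; rewrite gt_eqF.
exists (C * (s0^-1) `^ (r + e)), s0; split => //.
  by rewrite mulr_gt0// powR_gt0// invr_gt0.
move=> y sy; rewrite HM0/=; last exact: le_trans sy.
have [n yn] : exists n : nat, y <= 2 ^+ n.+1 * s0.
  exists (Num.truncn y); apply: (@le_trans _ _ (2 ^+ (Num.truncn y).+1)).
    apply: (@le_trans _ _ (Num.truncn y).+1%:R); first exact/ltW/truncnS_gt.
    by rewrite -natrX ler_nat; apply: ltnW; exact: ltn_expl.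
  by rewrite ler_peMr ?exprn_ge0.
have := claim n y sy yn; rewrite powRM; [|lra|by rewrite invr_ge0 ltW].
by rewrite mulrCA mulrC.
Qed.

Lemma regularly_varying_potter_lb f r (e : R) : regularly_varying f r -> 0 < e ->
  exists C s0 : R, [/\ 0 < C, 1 <= s0 & forall y, s0 <= y -> C * y `^ (r - e) <= f y].
Proof.
move=> fr e0.
have [C [s0 [C0 s01 H]]] := regularly_varying_potter_ub (regularly_varying_inv fr) e0.
exists C^-1, s0; split => //; first by rewrite invr_gt0.
move=> y sy; have /andP[f0 fC] := H y sy.
have y0 : 0 < y by lra.
move: fC; rewrite (_ : - r + e = - (r - e)) ?powRN; last by ring.
rewrite invr_gt0 in f0.
have p0 : 0 < C^-1 * y `^ (r - e) by rewrite mulr_gt0 ?invr_gt0 ?powR_gt0.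
move=> h; rewrite -lef_pV2 ?posrE//.
by apply: le_trans h _; rewrite invfM invrK.
Qed.

End regular_variation.

(** * Polynomial approximation on the cube *)

Section polynomial_approximation.
Context (R : realType).
Implicit Types (f g : nat -> R) (x c : R) (z : nat -> R) (T : (nat -> R) -> R).

(* Expectation of [f] under the binomial law with parameters [N] and [x]. *)
Fixpoint bern (N : nat) f x : R :=
  if N is N'.+1 then x * bern N' (fun k => f k.+1) x + (1 - x) * bern N' f x
  else f 0%N.

Lemma bern_le N f g x : 0 <= x <= 1 -> (forall k, (k <= N)%N -> f k <= g k) ->
  bern N f x <= bern N g x.
Proof.
move=> /andP[x0 x1]; elim: N f g => [|N IH] f g fg /=; first exact: fg.
apply: lerD; apply: ler_wpM2l; rewrite ?subr_ge0//; apply: IH => k kN; apply: fg => //.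
exact: leqW.
Qed.

Lemma bern_lin N f g x c :
  bern N (fun k => c * f k + g k) x = c * bern N f x + bern N g x.
Proof. by elim: N f g => [|N IH] f g //=; rewrite !IH; ring. Qed.

Lemma bern_cst N c x : bern N (fun=> c) x = c.
Proof. by elim: N => [|N IH] //=; rewrite IH; ring. Qed.

Lemma eq_bern N f g x : f =1 g -> bern N f x = bern N g x.
Proof. by move=> /funext ->. Qed.

(** The variance of the binomial law. The shift [c] is what lets the induction close, since
    conditioning on one trial moves the centre. *)
Lemma bern_sqr N x c :
  bern N (fun k => (k%:R - N%:R * x + c) ^+ 2) x = N%:R * x * (1 - x) + c ^+ 2.
Proof.
elim: N c => [|N IH] c /=; first by ring.
rewrite (eq_bern _ _ (g := fun k => (k%:R - N%:R * x + (1 - x + c)) ^+ 2)); last first.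
  by move=> k; rewrite -!natr1; ring.
rewrite IH (eq_bern _ _ (g := fun k => (k%:R - N%:R * x + (c - x)) ^+ 2)); last first.
  by move=> k; rewrite -!natr1; ring.
by rewrite IH -natr1; ring.
Qed.

(** The mean deviation is reduced to the variance by [y <= y^2 / (2 c) + c / 2]. *)
Lemma bern_abs N x c : 0 <= x <= 1 -> 0 < c -> 1 <= N.+1%:R * c ^+ 2 ->
  bern N.+1 (fun k => `|k%:R / N.+1%:R - x|) x <= c.
Proof.
move=> x01 c0 Nc; have /andP[x0 x1] := x01.
have N0 : 0 < N.+1%:R :> R by [].
have := bern_sqr N.+1 x 0; move: (N.+1) Nc N0 => n Nc n0 Hs.
pose a := (2 * c)^-1 * (n%:R ^- 2).
apply: (@le_trans _ _ (bern n (fun k => a * (k%:R - n%:R * x + 0) ^+ 2 + c / 2) x)).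
  apply: bern_le => // k _.
  set y := `|_|; have y0 : 0 <= y by exact: normr_ge0.
  have -> : a * (k%:R - n%:R * x + 0) ^+ 2 = (2 * c)^-1 * y ^+ 2.
    rewrite /y real_normK ?num_real// /a addr0.
    by field; rewrite !gt_eqF.
  have h : 0 <= (y - c) ^+ 2 by exact: sqr_ge0.
  rewrite -subr_ge0 (_ : _ - _ = (2 * c)^-1 * (y - c) ^+ 2); last by field; rewrite gt_eqF.
  by rewrite mulr_ge0// invr_ge0 mulr_ge0// ltW.
rewrite bern_lin bern_cst Hs expr0n addr0 /a.
have -> : (2 * c)^-1 * n%:R ^- 2 * (n%:R * x * (1 - x)) = x * (1 - x) / (2 * (n%:R * c ^+ 2)) * c.
  by field; rewrite !gt_eqF.
have xx : x * (1 - x) <= 1 by nra.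
have h : x * (1 - x) / (2 * (n%:R * c ^+ 2)) <= 1 / 2.
  by rewrite ler_pdivrMr; [lra|lra].
nra.
Qed.

Definition monomial (B : nat) (p : R * (nat -> nat)) z : R :=
  p.1 * \prod_(i < B) z i ^+ p.2 i.

Definition polyfun (B : nat) T : Prop :=
  exists s : seq (R * (nat -> nat)), forall z, T z = \sum_(p <- s) monomial B p z.

Lemma polyfunD B T1 T2 : polyfun B T1 -> polyfun B T2 ->
  polyfun B (fun z => T1 z + T2 z).
Proof.
by move=> [s1 H1] [s2 H2]; exists (s1 ++ s2) => z; rewrite big_cat/= H1 H2.
Qed.

Lemma polyfunZ B T c : polyfun B T -> polyfun B (fun z => c * T z).
Proof.
move=> [s H]; exists [seq (c * p.1, p.2) | p <- s] => z.
rewrite H big_map mulr_sumr; apply: eq_bigr => p _.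
by rewrite /monomial /= mulrA.
Qed.

Lemma polyfunX B T (j : nat) : (j < B)%N -> polyfun B T -> polyfun B (fun z => z j * T z).
Proof.
move=> jB [s H]; exists [seq (p.1, fun i => (p.2 i + (i == j))%N) | p <- s] => z.
rewrite H big_map mulr_sumr; apply: eq_bigr => p _; rewrite /monomial /=.
under [in RHS]eq_bigr do rewrite exprD.
rewrite big_split/= mulrCA; congr (_ * _); rewrite mulrC; congr (_ * _).
rewrite (bigD1 (Ordinal jB))//= eqxx expr1 big1 ?mulr1// => i.
by rewrite -val_eqE/= => /negbTE ->.
Qed.

Lemma polyfun_bern B N (T : nat -> (nat -> R) -> R) : (forall k, polyfun B.+1 (T k)) ->
  polyfun B.+1 (fun z => bern N (fun k => T k z) (z B)).
Proof.
elim: N T => [|N IH] T HT /=; first exact: HT.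
apply: polyfunD; first by apply: polyfunX => //; exact: IH.
have -> : (fun z => (1 - z B) * bern N (T^~ z) (z B)) =
  (fun z => bern N (T^~ z) (z B) + -1 * (z B * bern N (T^~ z) (z B))).
  by apply/funext => z; ring.
apply: polyfunD; first exact: IH.
by apply: polyfunZ; apply: polyfunX => //; exact: IH.
Qed.

Lemma polyfun_widen B T : polyfun B T -> polyfun B.+1 T.
Proof.
move=> [s H]; exists [seq (p.1, fun i => if (i < B)%N then p.2 i else 0%N) | p <- s] => z.
rewrite H big_map; apply: eq_bigr => p _; rewrite /monomial/= big_ord_recr/= ltnn expr0 mulr1.
by congr (_ * _); apply: eq_bigr => i _; rewrite ltn_ord.
Qed.

Definition cube (B : nat) z : Prop := forall i, (i < B)%N -> 0 <= z i <= 1.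

(** Bernstein approximation in the last variable, with the induction hypothesis applied to the
    slices at the nodes [k / n.+1]. The Lipschitz constant turns the mean deviation of the binomial
    law into a uniform error. *)
Lemma lipschitz_polyfun_approx B (H : (nat -> R) -> R) (L e : R) : 0 <= L -> 0 < e ->
  (forall z z', cube B z -> cube B z' ->
     `|H z - H z'| <= L * \sum_(i < B) `|z i - z' i|) ->
  exists T, polyfun B T /\ forall z, cube B z -> `|T z - H z| <= e.
Proof.
move=> L0; elim: B H e => [|B IH] H e e0 HL.
  exists (fun=> H (fun=> 0)); split.
    by exists [:: (H (fun=> 0), fun=> 0%N)] => z; rewrite big_seq1 /monomial/= big_ord0 mulr1.
  by move=> z cz; apply: le_trans (HL _ _ _ _) _ => //; rewrite big_ord0 mulr0 ltW.
(* Half of [e] is spent on the Bernstein error [L * c], half on the slices. *)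
pose c := e / (2 * (L + 1)).
have c0 : 0 < c by rewrite divr_gt0// mulr_gt0//; lra.
have Lc : L * c <= e / 2.
  have : (L + 1) * c = e / 2 by rewrite /c; field; rewrite gt_eqF//; lra.
  by nra.
pose n := Num.truncn (c ^- 2).
have nc : 1 <= n.+1%:R * c ^+ 2.
  rewrite -ler_pdivrMr ?exprn_gt0// div1r; exact/ltW/truncnS_gt.
pose upd z (a : R) : nat -> R := fun i => if i == B then a else z i.
have cupd z a : cube B z -> 0 <= a <= 1 -> cube B.+1 (upd z a).
  move=> cz a01 i; rewrite /upd ltnS leq_eqVlt; case: eqP => //= _; exact: cz.
have sumupd z z' a a' : \sum_(i < B.+1) `|upd z a i - upd z' a' i| =
    \sum_(i < B) `|z i - z' i| + `|a - a'|.
  rewrite big_ord_recr/= /upd eqxx; congr (_ + _); apply: eq_bigr => i _.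
  by rewrite ltn_eqF.
have kn k : (k <= n.+1)%N -> 0 <= (k%:R / n.+1%:R : R) <= 1.
  move=> kn; rewrite divr_ge0//= ler_pdivrMr// mul1r ler_nat//.
have /choice[T HT] : forall k, exists T, (k <= n.+1)%N -> polyfun B T /\
    forall z, cube B z -> `|T z - H (upd z (k%:R / n.+1%:R))| <= e / 2.
  move=> k; case: (leqP k n.+1) => kn'; last by exists (fun=> 0).
  have [||T HT] := IH (fun z => H (upd z (k%:R / n.+1%:R))) (e / 2).
  - by lra.
  - move=> z z' cz cz'; apply: le_trans (HL _ _ _ _) _; [exact/cupd/kn|exact/cupd/kn|].
    by rewrite sumupd subrr normr0 addr0.
  - by exists T.
pose T' k := if (k <= n.+1)%N then T k else fun=> 0.
exists (fun z => bern n.+1 (fun k => T' k z) (z B)); split.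
  apply: polyfun_bern => k; rewrite /T'; case: ifP => kn'.
    by apply: polyfun_widen; have [] := HT k kn'.
  by exists [::] => z; rewrite big_nil.
move=> z cz.
have czB : cube B z by move=> i iB; apply: cz; exact: leqW.
have zB : 0 <= z B <= 1 by apply: cz.
have zupd : upd z (z B) = z by apply/funext => i; rewrite /upd; case: eqP => [->|].
have key k : (k <= n.+1)%N -> `|T' k z - H z| <= L * `|k%:R / n.+1%:R - z B| + e / 2.
  move=> kn'; rewrite /T' kn'; have [_ Tk] := HT k kn'.
  apply: le_trans (ler_distD (H (upd z (k%:R / n.+1%:R))) _ _) _.
  rewrite addrC; apply: lerD; last exact: Tk.
  rewrite -{2}zupd; apply: le_trans (HL _ _ _ _) _; [exact/cupd/kn|exact: cupd|].
  by rewrite sumupd big1 ?add0r// => i _; rewrite subrr normr0.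
have bL : bern n.+1 (fun k => L * `|k%:R / n.+1%:R - z B| + e / 2) (z B) <= e.
  by rewrite bern_lin bern_cst; have := @bern_abs n (z B) c zB c0 nc => h; nra.
rewrite ler_norml; apply/andP; split.
  have := @bern_le n.+1 (fun k => -1 * (L * `|k%:R / n.+1%:R - z B| + e / 2) + H z) (fun k => T' k z) (z B) zB.
  rewrite bern_lin bern_cst => h.
  suff : -1 * bern n.+1 (fun k => L * `|k%:R / n.+1%:R - z B| + e / 2) (z B) + H z <=
    bern n.+1 (fun k => T' k z) (z B) by lra.
  by apply: h => k /key; rewrite ler_norml => /andP[? ?]; lra.
have := @bern_le n.+1 (fun k => T' k z) (fun k => 1 * (L * `|k%:R / n.+1%:R - z B| + e / 2) + H z) (z B) zB.
rewrite (@bern_lin _ _ (fun=> H z)) bern_cst => h.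
suff : bern n.+1 (fun k => T' k z) (z B) <=
  1 * bern n.+1 (fun k => L * `|k%:R / n.+1%:R - z B| + e / 2) (z B) + H z by lra.
by apply: h => k /key; rewrite ler_norml => /andP[? ?]; lra.
Qed.

End polynomial_approximation.

(** * Laplace transform and tail *)

Section laplace_tail.
Context (R : realType).
Local Notation mu := (@lebesgue_measure R).

Lemma dyadic_shell (y : R) : 0 < y <= 1 ->
  exists k : nat, 2^-1 ^+ k.+1 < y <= 2^-1 ^+ k.
Proof.
move=> /andP[y0 y1].
have ex : exists n : nat, 2^-1 ^+ n.+1 < y.
  exists (Num.truncn y^-1); rewrite exprVn -div1r ltr_pdivrMr ?exprn_gt0// mulrC.
  rewrite -ltr_pdivrMr// div1r; apply: lt_le_trans (truncnS_gt _) _.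
  by rewrite -natrX ler_nat; apply: ltnW; exact: ltn_expl.
case: (ex_minnP ex) => n n1 nmin; exists n; rewrite n1/=.
case: n n1 nmin => [|n] n1 nmin; first by rewrite expr0.
rewrite leNgt; apply/negP => h; suff : (n < n)%N by rewrite ltnn.
exact: nmin.
Qed.

(** On the shell [(2^-(k+1), 2^-k]] the integrand is at most [(2]^ a) ^+
    k.+1[, so the shell contributes at most]q ^+ k.+1[with]q = 2 [^ (a - 1) < 1]. *)
Lemma integral_powRN_fin (a : R) : 0 <= a < 1 ->
  (\int[mu]_(y in `]0%R, 1%R]%classic) (y `^ (- a))%:E < +oo)%E.
Proof.
move=> /andP[a0 a1]; pose q : R := 2 `^ (a - 1).
have q0 : 0 < q by exact: powR_gt0.
have q1 : q < 1.
  rewrite /q /powR pnatr_eq0/= -[ltRHS]expR0 ltr_expR nmulr_rlt0 ?subr_lt0//.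
  by rewrite ln_gt0// ltr1n.
pose A k := `](2^-1 ^+ k.+1)%R, (2^-1 ^+ k)%R]%classic : set R.
have half0 k : 0 < (2^-1 : R) ^+ k by rewrite exprn_gt0.
have mA k : measurable (A k) by exact: measurable_itv.
pose f k (y : R) : \bar R := ((2 `^ a) ^+ k.+1 * \1_(A k) y)%:E.
have f0 k y : (0 <= f k y)%E.
  by rewrite lee_fin mulr_ge0// exprn_ge0// powR_ge0.
have mf k : measurable_fun (`]0%R, 1%R]%classic : set R) (f k).
  by apply/measurable_EFinP; apply: measurable_funM.
apply: (@le_lt_trans _ _ (\int[mu]_(y in `]0%R, 1%R]%classic) (\sum_(k <oo) f k y))%E).
  apply: ge0_le_integral => //.
  - by move=> y _; rewrite lee_fin powR_ge0.
  - apply/measurable_EFinP; apply: measurable_funTS; exact: measurable_powR.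
  - by apply: ge0_emeasurable_sum => [k y _ _|k _]; [exact: f0|exact: mf].
  move=> y /=; rewrite in_itv/= => y01.
  have [k /andP[ylo yhi]] := dyadic_shell y01.
  have /andP[y0 y1] := y01.
  apply: le_trans (nneseries_lim_ge k.+1 _); last by move=> *; exact: f0.
  rewrite big_nat_recr//=; apply: (@le_trans _ _ (f k y)); last first.
    by rewrite leeDr// sume_ge0.
  rewrite /f lee_fin indicE mem_set; last by rewrite /A/= in_itv/= ylo.
  rewrite mulr1 powRN -[leRHS]invrK lef_pV2 ?posrE ?powR_gt0 ?invr_gt0 ?exprn_gt0 ?powR_gt0//.
  have : (2^-1 ^+ k.+1) `^ a <= y `^ a.
    by apply: ge0_ler_powR; rewrite ?nnegrE// ltW// half0.
  apply: le_trans; rewrite -powR_mulrn ?powR_ge0// -powRrM -powRN.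
  have -> : 2^-1 ^+ k.+1 = 2 `^ (- k.+1%:R) :> R by rewrite powRN powR_mulrn// exprVn.
  by rewrite -powRrM mulNr (mulrC k.+1%:R).
rewrite integral_nneseries//.
have Ik k : (\int[mu]_(y in `]0%R, 1%R]%classic) f k y = (q ^+ k.+1)%:E)%E.
  rewrite /f; under eq_integral do rewrite EFinM.
  have mi : measurable_fun (`]0%R, 1%R]%classic : set R) (fun y : R => (\1_(A k) y : R)%:E).
    by apply/measurable_EFinP; apply: measurable_funTS; apply: measurable_indic; exact: mA.
  rewrite ge0_integralZl//.
  have -> : (\int[mu]_(x in `]0%R, 1%R]%classic) (\1_(A k) x)%:E = mu (A k))%E.
    rewrite integral_indic; [|exact: measurable_itv|exact: mA].
    rewrite setIidl// => y; rewrite /A/= !in_itv/= => /andP[h1 h2]; apply/andP; split.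
      by apply: lt_trans h1.
    by apply: le_trans h2 _; rewrite exprn_ile1// ?invr_ge0// invf_le1// ler1n.
  rewrite lebesgue_measure_itv/= lte_fin ifT; last first.
    by rewrite exprS gtr_pMl ?half0// invf_lt1// ltr1n.
  rewrite -EFinB -EFinM; congr _%:E.
  rewrite (_ : 2^-1 ^+ k - 2^-1 ^+ k.+1 = 2^-1 ^+ k.+1); last by rewrite exprS; field.
  rewrite -exprMn; congr (_ ^+ _).
  by rewrite /q powRD ?powR_inv1// pnatr_eq0 implybT.
under eq_eseriesr do rewrite Ik.
apply: (@le_lt_trans _ _ (q / (1 - q))%:E); last by rewrite ltry.
apply: lime_le; first by apply: is_cvg_nneseries => n _ _; rewrite lee_fin exprn_ge0// ltW.
apply: nearW => n; rewrite sumEFin lee_fin ler_pdivlMr ?subr_gt0//.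
rewrite (_ : _ * _ = q - q ^+ n.+1); first by rewrite lerBlDr lerDl exprn_ge0// ltW.
elim: n => [|n IH]; first by rewrite big_geq// mul0r expr1 subrr.
by rewrite big_nat_recr//= mulrDl IH [in RHS]exprS exprS; ring.
Qed.

Context d (Om : measurableType d) (P : probability Om R) (xi : Om -> R).
Hypothesis mxi : measurable_fun setT xi.
Hypothesis xi0 : P [set w | xi w <= 0] = 0%E.

Definition tail (t : R) : R := fine (P [set w | t < xi w]).

Definition laplace (s : R) : R := Ex P (fun w => expR (- (s * xi w))).

Lemma measurable_tail_set t : measurable [set w | t < xi w].
Proof.
rewrite -[X in measurable X]setTI (_ : [set w | _] = xi @^-1` `]t, +oo[%classic).
  exact: mxi.
by apply/seteqP; split => w /=; rewrite in_itv/= andbT.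
Qed.

Lemma tailE t : (tail t)%:E = P [set w | t < xi w].
Proof. by rewrite /tail fineK// fin_num_measure//; exact: measurable_tail_set. Qed.

Lemma tail_ge0 t : 0 <= tail t.
Proof. by rewrite /tail fine_ge0. Qed.

Lemma tail_le1 t : tail t <= 1.
Proof.
by rewrite -lee_fin tailE; apply: probability_le1; exact: measurable_tail_set.
Qed.

Lemma tail_nonincreasing s t : s <= t -> tail t <= tail s.
Proof.
move=> st; rewrite -lee_fin !tailE; apply: le_measure; rewrite ?inE.
- exact: measurable_tail_set.
- exact: measurable_tail_set.
- by move=> w /=; exact: le_lt_trans.
Qed.

Lemma measurable_tail : measurable_fun setT tail.
Proof.
rewrite (_ : tail = fun t => - (- tail t)); last by apply/funext => t; rewrite opprK.
apply: measurable_funN; apply: nondecreasing_measurable => //.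
by move=> s t st; rewrite lerN2 tail_nonincreasing.
Qed.

Lemma exp_integral (a : R) : 0 <= a ->
  (\int[mu]_(y in `]0%R, a[%classic) (expR (- y))%:E = (1 - expR (- a))%:E)%E.
Proof.
move=> a0; have mE (D : set R) : measurable_fun D (fun y : R => (expR (- y))%:E).
  apply/measurable_EFinP; apply: measurable_funTS; apply: measurableT_comp.
    exact: measurable_expR.
  exact: measurable_funN.
move: a0; rewrite le_eqVlt => /predU1P[<-|a0].
  by rewrite set_itvoo0 integral_set0 oppr0 expR0 subrr.
rewrite integral_itv_bndo_bndc// integral_itv_obnd_cbnd//.
have := @exponential_prob_itv0c R 1 a a0; rewrite /exponential_prob mulN1r EFinB => <-.
apply: eq_integral => y; rewrite inE/= in_itv/= => /andP[y0 _].
by rewrite exponential_pdfE// mul1r mulN1r.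
Qed.

Let expR_xp (s : R) w : 0 <= s -> 0 <= expR (- (s * Num.max (xi w) 0)) <= 1.
Proof.
move=> s0; rewrite expR_ge0/= -[leRHS]expR0 ler_expR oppr_le0 mulr_ge0//.
by rewrite le_max lexx orbT.
Qed.

Let mexp_xp (s : R) : measurable_fun setT (fun w => expR (- (s * Num.max (xi w) 0))).
Proof.
apply: measurableT_comp; first exact: measurable_expR.
apply: measurable_funN; apply: measurable_funM => //.
exact: measurable_maxr.
Qed.

Let integrable_xp (s : R) : 0 <= s ->
  P.-integrable setT (EFin \o (fun w => expR (- (s * Num.max (xi w) 0)))).
Proof.
move=> s0; apply: (@bounded_integrable _ _ _ P _ 1) => // w.
by have /andP[h1 h2] := @expR_xp s w s0; rewrite ger0_norm.
Qed.

(** Positivity of [xi] holds only almost surely; its positive part keeps the exponential in [[0, 1]]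
    everywhere. *)
Lemma integral_expE (s : R) : 0 <= s ->
  (\int[P]_w (expR (- (s * xi w)))%:E =
   \int[P]_w (expR (- (s * Num.max (xi w) 0)))%:E)%E.
Proof.
move=> s0; have mneg : measurable [set w | xi w <= 0].
  rewrite -[X in measurable X]setTI (_ : [set w | _] = xi @^-1` `]-oo, 0]%classic).
    exact: mxi.
  by apply/seteqP; split => w /=; rewrite in_itv.
apply: ae_eq_integral => //.
- apply/measurable_EFinP; apply: measurableT_comp; first exact: measurable_expR.
  by apply: measurable_funN; apply: measurable_funM.
- exact/measurable_EFinP/mexp_xp.
exists [set w | xi w <= 0]; split => // w /= /not_implyP[_ h].
rewrite leNgt; apply/negP => x0; apply: h.
by rewrite max_l// ltW.
Qed.

Lemma laplaceE (s : R) : 0 <= s ->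
  laplace s = Ex P (fun w => expR (- (s * Num.max (xi w) 0))).
Proof. by move=> s0; rewrite /laplace /Ex integral_expE. Qed.

Lemma laplace_fin (s : R) : 0 <= s ->
  (\int[P]_w (expR (- (s * xi w)))%:E = (laplace s)%:E)%E.
Proof.
move=> s0; rewrite integral_expE// laplaceE// /Ex fineK//.
exact: integrable_fin_num (integrable_xp s0).
Qed.

(** On [xi > y] the exponential is at most [1 / e], hence at most [1 / 2]; elsewhere it is at most
    [1]. *)
Lemma laplace_tail_le (y : R) : 0 < y -> laplace y^-1 <= 1 - tail y / 2.
Proof.
move=> y0; have y0' : 0 <= y^-1 by rewrite invr_ge0 ltW.
have mW : measurable [set w | y < xi w] by exact: measurable_tail_set.
rewrite laplaceE//.
have -> : 1 - tail y / 2 = Ex P (fun w => 1 - 2^-1 * \1_[set w | y < xi w] w).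
  rewrite ExB; [|exact: integrable_cstR|]; last first.
    exact: (integrableZl measurableT 2^-1 (integrable_indicR P mW)).
  rewrite Ex_cst ExZ; last exact: integrable_indicR.
  by rewrite Ex_indic// mulrC.
have i01 w : 0 <= (\1_[set w | y < xi w] w : R) <= 1.
  by rewrite indicE; case: (_ \in _); rewrite ?lexx ?ler01.
apply: (@Ex_mono _ _ _ P _ _ 1).
- by move=> w; have /andP[? ?] := @expR_xp _ w y0'; rewrite ger0_norm.
- by move=> w; have /andP[? ?] := i01 w; rewrite ger0_norm; lra.
move=> w; have /andP[e0 e1] := @expR_xp _ w y0'; rewrite indicE.
have [h|h] := boolP (w \in _); last by rewrite mulr0 subr0.
move: h; rewrite inE/= => h; rewrite mulr1 max_l; last by rewrite ltW// (lt_trans y0).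
apply: (@le_trans _ _ (expR (- 1))).
  by rewrite ler_expR lerN2 mulrC ler_pdivlMr// mul1r ltW.
rewrite expRN; have := expR_ge1Dx (1 : R) => h1.
apply: (@le_trans _ _ (2^-1)); last by lra.
by rewrite lef_pV2 ?posrE ?expR_gt0//; lra.
Qed.

(** Write [1 - expR (- x / t)] as the integral of [expR (- y)] over [(0, x / t)] and exchange the
    two integrals. *)
Lemma laplace_tailE (t : R) : 0 < t ->
  ((1 - laplace t^-1)%:E =
   \int[mu]_(y in `]0%R, +oo[%classic) (expR (- y) * tail (t * y))%:E)%E.
Proof.
move=> t0.
pose xp w := Num.max (xi w) 0.
have xp0 w : 0 <= xp w by rewrite le_max lexx orbT.
have t0' : 0 <= t^-1 by rewrite invr_ge0 ltW.
have e1 w : 0 <= xp w -> 0 <= expR (- (t^-1 * xp w)) <= 1.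
  by move=> _; exact: expR_xp.
have iexp : P.-integrable setT (EFin \o (fun w => expR (- (t^-1 * xp w)))).
  exact: integrable_xp.
rewrite laplaceE//.
pose f (z : Om * R) : \bar R := (expR (- z.2) * \1_[set z : Om * R | (0 < z.2) && (t * z.2 < xi z.1)] z)%:E.
have indE w y : 0 < y -> \1_[set z : Om * R | (0 < z.2) && (t * z.2 < xi z.1)] (w, y) =
    \1_[set w | t * y < xi w] w :> R.
  move=> y0; rewrite !indicE; congr (_ %:R); congr nat_of_bool.
  by apply/idP/idP; rewrite !inE/= y0.
have mB : measurable [set z : Om * R | (0 < z.2) && (t * z.2 < xi z.1)].
  rewrite (_ : [set z | _] = (snd @^-1` `]0%R, +oo[%classic) `&`
    ((fun z : Om * R => xi z.1 - t * z.2) @^-1` `]0%R, +oo[%classic)); last first.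
    apply/seteqP; split => z /=; rewrite !in_itv/= !andbT subr_gt0.
      by move=> /andP.
    by move=> [-> ->].
  have m1 : measurable_fun setT (fun z : Om * R => xi z.1 - t * z.2).
    apply: measurable_funB; first by apply: measurableT_comp.
    by apply: measurable_funM.
  apply: measurableI; rewrite -[X in measurable X]setTI.
    exact: (@measurable_snd _ _ Om R measurableT _ (measurable_itv _)).
  exact: (m1 measurableT _ (measurable_itv _)).
have mf : measurable_fun setT f.
  apply/measurable_EFinP; apply: measurable_funM; last exact: measurable_indic.
  apply: measurableT_comp; first exact: measurable_expR.
  by apply: measurable_funN.
have f0 z : (0 <= f z)%E by rewrite lee_fin mulr_ge0// expR_ge0.
have := @fubini_tonelli _ _ Om _ R P mu f mf f0.
have -> : (\int[P]_x \int[mu]_y f (x, y) = (1 - Ex P (fun w => expR (- (t^-1 * xp w))))%:E)%E.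
  rewrite -[X in X - Ex _ _](Ex_cst P) -ExB//; last exact: integrable_cstR.
  rewrite /Ex fineK; last first.
    apply: (@bounded_fin_num _ _ _ P _ 1) => w.
    have /andP[h1 h2] := e1 w (xp0 w); rewrite ger0_norm; lra.
  apply: eq_integral => w _.
  rewrite -exp_integral; last by rewrite mulr_ge0// invr_ge0 ltW.
  rewrite [in RHS]integral_mkcond; apply: eq_integral => y _.
  rewrite patchE /f /= indicE; have [h|h] := boolP (y \in _).
    rewrite mem_set ?mulr1//=; move: h; rewrite inE/= in_itv/= => /andP[y0 h]; rewrite y0/=.
    move: h; rewrite mulrC ltr_pdivlMr// mulrC /xp lt_max => /orP[//|].
    by rewrite ltNge mulr_ge0// ltW.
  rewrite memNset ?mulr0// => /= /andP[y0 ty]; move/negP: h; apply.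
  rewrite inE/= in_itv/= y0/=.
  rewrite mulrC ltr_pdivlMr// mulrC; apply: lt_le_trans ty _.
  by rewrite le_max lexx.
move=> ->; rewrite [in RHS]integral_mkcond; apply: eq_integral => y _.
rewrite patchE; have [h|h] := boolP (y \in _).
  have y0 : 0 < y by move: h; rewrite inE/= in_itv/= andbT.
  rewrite /f /=; under eq_integral do rewrite EFinM indE//.
  rewrite ge0_integralZl//; last first.
    by apply/measurable_EFinP; apply: measurable_indic; exact: measurable_tail_set.
  rewrite EFinM tailE; congr (_ * _)%E.
  by rewrite integral_indic ?setIT//; exact: measurable_tail_set.
rewrite integral0_eq// => w _; rewrite /f /= indicE memNset ?mulr0// => /= /andP[y0 _].
by move/negP: h; apply; rewrite inE/= in_itv/= y0.
Qed.

Section regular_tail.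
Variable alpha : R.
Hypotheses (alpha0 : 0 < alpha) (alpha1 : alpha < 1).
Hypothesis rvt : regularly_varying tail (- alpha).

Lemma tail_gt0 t : 0 < tail t.
Proof.
have [/near_pinftyP[M [M1 HM]] _] := rvt.
apply: (@lt_le_trans _ _ (tail (Num.max M t))); first by apply: HM; rewrite le_max lexx.
by apply: tail_nonincreasing; rewrite le_max lexx orbT.
Qed.

Lemma tail_potter (a : R) : alpha < a -> exists C t0 : R, [/\ 0 < C, 1 <= t0 &
  forall t y, t0 <= t -> 0 < y <= 1 -> tail (t * y) <= C * y `^ (- a) * tail t].
Proof.
move=> aa.
have := regularly_varying_double (regularly_varying_inv rvt) (e := a - alpha).
rewrite opprK subr_gt0 => /(_ aa)/near_pinftyP[x0 [x01 Hx0]].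
rewrite (_ : alpha + (a - alpha) = a) in Hx0; last by ring.
have a0 : 0 < a by exact: lt_trans aa.
have p2 : 0 < 2 `^ a :> R by exact: powR_gt0.
have H2 s : x0 <= s -> tail s <= 2 `^ a * tail (2 * s).
  have t1 := tail_gt0 s; have t2 := tail_gt0 (2 * s).
  by move=> /Hx0; rewrite ler_pdivlMr// mulrC ler_pdivrMr.
have Hn n s : x0 <= s -> tail s <= (2 `^ a) ^+ n * tail (2 ^+ n * s).
  elim: n s => [|n IH] s xs; first by rewrite !expr0 !mul1r.
  apply: le_trans (H2 _ xs) _; rewrite exprS -mulrA ler_pM2l//.
  have := IH (2 * s) ltac:(have := lt_le_trans ltr01 x01; lra).
  by rewrite mulrA -exprSr.
have A t y : x0 <= t * y -> 0 < t -> 0 < y <= 1 -> tail (t * y) <= 2 `^ a * y `^ (- a) * tail t.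
  move=> xty t0 y01; have [k /andP[ylo yhi]] := dyadic_shell y01.
  have /andP[y0 y1] := y01.
  apply: le_trans (Hn k.+1 _ xty) _.
  have e2 j : 0 < 2 ^+ j :> R by rewrite exprn_gt0.
  have h1 : tail (2 ^+ k.+1 * (t * y)) <= tail t.
    apply: tail_nonincreasing; rewrite mulrCA ler_peMr ?ltW//.
    by move: ylo; rewrite exprVn -div1r ltr_pdivrMr// mulrC.
  have h2 : (2 `^ a) ^+ k.+1 <= 2 `^ a * y `^ (- a).
    rewrite exprS ler_pM2l// powRN -[leLHS]invrK lef_pV2 ?posrE ?invr_gt0 ?exprn_gt0 ?powR_gt0//.
    have -> : ((2 `^ a) ^+ k)^-1 = (2^-1 ^+ k) `^ a.
      rewrite -powR_mulrn ?powR_ge0// -powRrM -powRN exprVn -powR_mulrn// -powRN -powRrM.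
      by rewrite mulNr (mulrC a).
    by apply: ge0_ler_powR; rewrite ?nnegrE ?exprn_ge0 ?invr_ge0// ltW.
  apply: le_trans (ler_wpM2l _ h1) _; first by rewrite exprn_ge0// ltW.
  by rewrite ler_wpM2r// tail_ge0.
have tx0 := tail_gt0 x0.
exists (2 `^ a / tail x0), x0; split => //; first by rewrite divr_gt0.
move=> t y xt y01; have /andP[y0 y1] := y01.
have t0 : 0 < t by have := lt_le_trans ltr01 x01 => ?; exact: lt_le_trans xt.
have py : 0 < y `^ (- a) by exact: powR_gt0.
have [h|h] := leP x0 (t * y).
  apply: le_trans (A _ _ h t0 y01) _.
  rewrite -!mulrA ler_pM2l//; apply: ler_peMl; first by rewrite mulr_ge0 ?tail_ge0// ltW.
  by rewrite invf_ge1 ?tail_le1.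
apply: le_trans (tail_le1 _) _; rewrite -[leLHS](divff (lt0r_neq0 tx0)).
rewrite [leRHS](_ : _ = 2 `^ a * y `^ (- a) * tail t / tail x0) ?ler_pM2r ?invr_gt0//; last by ring.
have x00 : 0 < x0 by exact: lt_le_trans ltr01 x01.
have tE : t * (x0 / t) = x0 by rewrite mulrC divfK// gt_eqF.
have := A t (x0 / t); rewrite tE lexx divr_gt0// ler_pdivrMr// mul1r xt => /(_ isT t0 isT) h1.
apply: le_trans h1 _; rewrite ler_wpM2r ?tail_ge0// ler_pM2l//.
rewrite !powRN lef_pV2 ?posrE ?powR_gt0 ?divr_gt0//.
apply: ge0_ler_powR; rewrite ?nnegrE ?divr_ge0 ?ltW//.
by rewrite ltr_pdivlMr// mulrC.
Qed.

Lemma tail_cvg0 : tail t @[t --> +oo] --> (0 : R).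
Proof.
have e0 : 0 < alpha / 2 by rewrite divr_gt0.
have [C [s0 [C0 s01 H]]] := regularly_varying_potter_ub rvt e0.
apply/cvgrPdist_le => e e0'; apply/near_pinftyP.
pose M := Num.max s0 ((C / e) `^ (2 / alpha)).
exists M; split; first by rewrite le_max s01.
move=> t; rewrite ge_max => /andP[st te].
have t0 : 0 < t by have := lt_le_trans ltr01 s01 => ?; exact: lt_le_trans st.
have /andP[_ h] := H t st.
rewrite sub0r normrN ger0_norm ?tail_ge0//; apply: le_trans h _.
have -> : - alpha + alpha / 2 = - (alpha / 2) by field.
rewrite powRN ler_pdivrMr ?powR_gt0// mulrC -ler_pdivrMr//.
have Ce : 0 <= C / e by rewrite divr_ge0// ltW.
have : ((C / e) `^ (2 / alpha)) `^ (alpha / 2) <= t `^ (alpha / 2).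
  by apply: ge0_ler_powR => //; rewrite ?nnegrE ?powR_ge0// ltW.
rewrite -powRrM (_ : 2 / alpha * (alpha / 2) = 1) ?powRr1//.
by field; rewrite gt_eqF.
Qed.

Let D := `]0%R, +oo[%classic : set R.

Let mD : measurable D. Proof. exact: measurable_itv. Qed.

Let mexp (A : set R) : measurable_fun A (fun y : R => expR (- y)).
Proof.
apply: measurable_funTS; apply: measurableT_comp; first exact: measurable_expR.
exact: measurable_funN.
Qed.

Let dom (a C : R) (y : R) : \bar R := (C%:E * (y `^ (- a) * \1_(`]0%R, 1%R]%classic) y)%:E + (expR (- y))%:E)%E.

Let integrable_dom (a C : R) : 0 <= a < 1 -> mu.-integrable D (dom a C).
Proof.
move=> a01; apply: integrableD => //.
  apply: integrableZl => //; apply/integrableP; split.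
    apply/measurable_EFinP; apply: measurable_funTS; apply: measurable_funM.
      exact: measurable_powR.
    by apply: measurable_indic; exact: measurable_itv.
  apply: le_lt_trans (integral_powRN_fin a01).
  rewrite [leRHS]integral_mkcond [leLHS]integral_mkcond.
  apply: le_integral_all => y; rewrite !patchE.
  have [|hD] := boolP (y \in D); last first.
    by case: ifP => // _; rewrite lee_fin powR_ge0.
  rewrite inE /D/= in_itv/= andbT => y0; rewrite indicE.
  have [h|h] := boolP (y \in (`]0%R, 1%R]%classic)).
    by rewrite mulr1 lee_fin ger0_norm// powR_ge0.
  by rewrite mulr0 normr0.
have := @integrable_exponential_pdf R 1 ltr01 => H.
have H2 : mu.-integrable D (EFin \o exponential_pdf 1).
  by apply: integrableS H => //; exact: measurable_itv.
have mE : measurable_fun D (fun y : R => (expR (- y))%:E).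
  by apply/measurable_EFinP; exact: mexp.
refine (@le_integrable _ _ _ mu D (measurable_itv _) _ _ mE _ H2).
move=> y; rewrite /D/= in_itv/= andbT => y0.
by rewrite exponential_pdfE; [rewrite mul1r mulN1r|exact: ltW].
Qed.

Let Gamma_dom (y : R) : D y -> (`|(expR (- y) * y `^ (- alpha))%:E| <= `|dom alpha 1 y|)%E.
Proof.
rewrite /D/= in_itv/= andbT => y0; rewrite mul1r lee_fin.
have e1 : expR (- y) <= 1 by rewrite -[leRHS]expR0 ler_expR oppr_le0 ltW.
have e0 := expR_gt0 (- y); have p0 : 0 < y `^ (- alpha) by exact: powR_gt0.
rewrite [X in X <= _]ger0_norm; last by rewrite mulr_ge0// ltW.
rewrite ger0_norm; last by rewrite addr_ge0// ?mulr_ge0// ltW.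
rewrite indicE.
have [h|h] := boolP (y \in (`]0%R, 1%R]%classic)); first by rewrite mulr1; nra.
rewrite mulr0 add0r; apply: ler_piMr; first exact: ltW.
have y1 : 1 <= y.
  by rewrite leNgt; apply/negP => y1; move/negP: h; apply; rewrite inE/= in_itv/= y0 ltW.
rewrite powRN invf_le1 ?powR_gt0//; suff : 1 `^ alpha <= y `^ alpha by rewrite powR1.
by apply: ge0_ler_powR => //; rewrite ?nnegrE// ltW.
Qed.

Let Gamma_integrable : mu.-integrable D (fun y => (expR (- y) * y `^ (- alpha))%:E).
Proof.
apply: (@le_integrable _ _ _ mu D _ _ (dom alpha 1)); first exact: measurable_itv.
- apply/measurable_EFinP; apply: measurable_funM; first exact: mexp.
  by apply: measurable_funTS; exact: measurable_powR.
- exact: Gamma_dom.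
- by apply: integrable_dom; rewrite alpha1 ltW.
Qed.

Lemma GammaE : (\int[mu]_(y in D) (expR (- y) * y `^ (- alpha))%:E)%E = (Gamma (1 - alpha))%:E.
Proof.
rewrite /Gamma fineK; last first.
  rewrite (_ : 1 - alpha - 1 = - alpha); last by ring.
  have := @integrable_fin_num _ _ _ mu D (measurable_itv _) _ Gamma_integrable.
  by under eq_integral do rewrite mulrC.
apply: eq_integral => y _; rewrite mulrC; congr (_ `^ _ * _)%:E; ring.
Qed.

Lemma Gamma_gt0 : 0 < Gamma (1 - alpha).
Proof.
rewrite -lte_fin -GammaE.
have c0 : 0 < expR (- 2) * 2 `^ (- alpha) :> R by rewrite mulr_gt0 ?expR_gt0 ?powR_gt0.
apply: (@lt_le_trans _ _ (\int[mu]_(y in `[1%R, 2%R]%classic) (expR (- 2) * 2 `^ (- alpha))%:E)%E).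
  rewrite integral_cst//= lebesgue_measure_itv/= lte_fin ltr1n/= -EFinB -EFinM lte_fin.
  by rewrite mulr_gt0//; lra.
have sub : `[1%R, 2%R]%classic `<=` D.
  by move=> y; rewrite /D/= !in_itv/= andbT => /andP[h _]; exact: lt_le_trans h.
have mg : measurable_fun D (fun y : R => (expR (- y) * y `^ (- alpha))%:E).
  by case/integrableP: Gamma_integrable.
apply: (@le_trans _ _ (\int[mu]_(y in `[1%R, 2%R]%classic) (expR (- y) * y `^ (- alpha))%:E)%E); last first.
  apply: ge0_subset_integral => //.
  by move=> y _; rewrite lee_fin mulr_ge0 ?expR_ge0 ?powR_ge0.
- apply: ge0_le_integral => //.
  + apply/measurable_EFinP; apply: measurable_funM; first exact: mexp.
    by apply: measurable_funTS; exact: measurable_powR.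
  + move=> y /=; rewrite in_itv/= => /andP[y1 y2].
  have y0 : 0 < y by exact: lt_le_trans y1.
  rewrite lee_fin; apply: ler_pM; rewrite ?expR_ge0 ?powR_ge0//.
    by rewrite ler_expR lerN2.
  rewrite !powRN lef_pV2 ?posrE ?powR_gt0//.
  by apply: ge0_ler_powR => //; rewrite ?nnegrE// ltW.
Qed.

Lemma laplace_asymptotics :
  (1 - laplace t^-1) / tail t @[t --> +oo] --> Gamma (1 - alpha).
Proof.
(* An exponent strictly between [alpha] and [1]: large enough for the Potter bound, small enough for
   integrability at [0]. *)
pose a := (alpha + 1) / 2.
have [aa [a0 a1]] : alpha < a /\ 0 <= a /\ a < 1 by rewrite /a; have := alpha0; have := alpha1; lra.
have [C [t0 [C0 t01 HC]]] := tail_potter aa.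
apply/cvg_pinftyP => u uoo.
(* The majorant is valid only from [t0] on, while dominated convergence asks for it at every
   index. *)
pose v n := Num.max (u n) t0.
have voo : v n @[n --> \oo] --> +oo.
  by apply: ger_cvgy uoo; apply: nearW => n; rewrite /v le_max lexx.
have vt n : t0 <= v n by rewrite /v le_max lexx orbT.
have v0 n : 0 < v n by apply: lt_le_trans (vt n); exact: lt_le_trans t01.
suff : (1 - laplace (v n)^-1) / tail (v n) @[n --> \oo] --> Gamma (1 - alpha).
  apply: cvg_trans; apply: near_eq_cvg.
  have /cvgryPge/(_ t0) := uoo; apply: filterS => n h.
  by rewrite /v max_l.
pose f n (y : R) : \bar R := (expR (- y) * (tail (v n * y) / tail (v n)))%:E.
have fE n : ((1 - laplace (v n)^-1) / tail (v n))%:E = (\int[mu]_(y in D) f n y)%E.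
  rewrite EFinM laplace_tailE// -ge0_integralZr//.
  - by apply: eq_integral => y _; rewrite /f -EFinM mulrA.
  - apply/measurable_EFinP; apply: measurable_funM; first exact: mexp.
    apply: measurable_funTS; apply: (measurableT_comp measurable_tail).
    exact: measurable_funM.
  - by move=> y _; rewrite lee_fin mulr_ge0 ?expR_ge0 ?tail_ge0.
  - by rewrite lee_fin invr_ge0 tail_ge0.
have : (\int[mu]_(y in D) f n y)%E @[n \oo] --> (\int[mu]_(y in D) (expR (- y) * y `^ (- alpha))%:E)%E.
  apply: (@dominated_cvg _ _ _ mu D mD f _ (dom a C)).
  - move=> n; apply/measurable_EFinP; apply: measurable_funM; first exact: mexp.
    apply: measurable_funM => //.
    apply: measurable_funTS; apply: (measurableT_comp measurable_tail).
    exact: measurable_funM.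
  - move=> y; rewrite /D/= in_itv/= andbT => y0.
    apply: cvg_EFin; first exact: nearW.
    apply: cvgM; first exact: cvg_cst.
    have := proj1 (cvg_pinftyP _ _) (regularly_varying_ratio rvt y0) v voo.
    by under eq_fun do rewrite (mulrC y).
  - by move=> y _.
  - by apply: integrable_dom; rewrite a0.
  - move=> n y; rewrite /D/= in_itv/= andbT => y0.
    have e1 : expR (- y) <= 1 by rewrite -[leRHS]expR0 ler_expR oppr_le0 ltW.
    have e0 := expR_gt0 (- y); have tv := tail_gt0 (v n).
    rewrite /f /dom -EFinM -EFinD lee_fin ger0_norm; last first.
      by rewrite mulr_ge0 ?divr_ge0 ?tail_ge0 ?ltW.
    rewrite indicE; have [h|h] := boolP (y \in (`]0%R, 1%R]%classic)).
      move: h; rewrite inE/= in_itv/= => h.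
      have := HC _ _ (vt n) h; rewrite -ler_pdivrMr// mulr1 => h2.
      have := divr_ge0 (tail_ge0 (v n * y)) (tail_ge0 (v n)).
      by move: (tail (v n * y) / tail (v n)) h2 => q h2 q0; nra.
    rewrite !mulr0 add0r; apply: ler_piMr; first exact: ltW.
    rewrite ler_pdivrMr// mul1r.
    apply: tail_nonincreasing; apply: ler_peMr; first exact: ltW.
    rewrite leNgt; apply/negP => y1; move/negP: h; apply.
    by rewrite inE/= in_itv/= y0 ltW.
rewrite GammaE => H; have /fine_cvgP[_] := H.
by under eq_fun do rewrite /= -fE.
Qed.

End regular_tail.

End laplace_tail.

(** * Renewal counts *)

Lemma sum_window (n j k : nat) : (\sum_(i < n) ((j <= i) && (i < j + k) : nat))%N = minn (n - j) k.
Proof.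
elim: n => [|n IH]; first by rewrite big_ord0; lia.
by rewrite big_ord_recr/= IH; case: leqP; case: leqP => /=; lia.
Qed.

Section renewal.
Context d (T : measurableType d) (R : realType) (P : probability T R).
Variable S : nat -> set (set T).
Hypothesis Ssig : forall k, sigma_algebra setT (S k).
Hypothesis Smeas : forall k A, S k A -> measurable A.
Hypothesis Sind : indep_sigma P S.
Variable xi : nat -> T -> R.
Hypothesis xiS : forall k, adapted (S k) (xi k).

Definition walk (k : nat) (w : T) : R := \sum_(i < k) xi i w.

Lemma walk0 w : walk 0 w = 0. Proof. by rewrite /walk big_ord0. Qed.

Lemma walkS k w : walk k.+1 w = walk k w + xi k w.
Proof. by rewrite /walk big_ord_recr. Qed.

Lemma walk_mono w : (forall k, 0 <= xi k w) -> forall i j, (i <= j)%N -> walk i w <= walk j w.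
Proof.
move=> x0 i j /subnK <-; elim: (j - i)%N => [|m IH]; first by rewrite add0n.
by rewrite addSn walkS ler_wpDr.
Qed.

Lemma adapted_walk k n : (k <= n)%N -> adapted (past S n) (walk k).
Proof.
move=> kn; rewrite /adapted /walk; apply: measurable_sum => i.
 exact (adapted_past (leq_trans (ltn_ord i) kn) (@xiS i)).
Qed.

Lemma measurable_xi k : measurable_fun setT (xi k).
Proof. exact (adapted_measurable (@Smeas k) (@xiS k)). Qed.

Lemma measurable_walk k : measurable_fun setT (walk k).
Proof.
exact (adapted_measurable (@past_measurable _ _ S Smeas k) (adapted_walk (leqnn k))).
Qed.

(** First-passage events: disjoint in [j] and decided by the first [j] steps, hence independent of
    the later ones. *)
Definition passage (x : R) (j : nat) : set T :=
  [set w | x < walk j w /\ forall i, (i < j)%N -> walk i w <= x].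

Lemma passage_past x j : <<s past S j >> (passage x j).
Proof.
have -> : passage x j = walk j @^-1` `]x, +oo[%classic `&`
    \bigcap_i (if (i < j)%N then walk i @^-1` `]-oo, x]%classic else setT).
  apply/seteqP; split => w /=.
    move=> [h1 h2]; split => [|i _]; first by rewrite in_itv/= h1.
    by case: ifP => // ij; rewrite /= in_itv/=; exact: h2.
  move=> [+ h2]; rewrite in_itv/= andbT => h1; split => // i ij.
  by have := h2 i I; rewrite ij/= in_itv.
have m1 : <<s past S j >> (walk j @^-1` `]x, +oo[%classic).
  exact (adapted_preimage (adapted_walk (leqnn j)) (measurable_itv _)).
have m2 : <<s past S j >> (\bigcap_i (if (i < j)%N then walk i @^-1` `]-oo, x]%classic else setT)).
  apply: (@bigcapT_measurable _ (g_sigma_algebraType (past S j))) => i.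
  case: ifP => ij; last exact: (@measurableT _ (g_sigma_algebraType (past S j))).
  exact (adapted_preimage (adapted_walk (ltnW ij)) (measurable_itv _)).
exact: (@measurableI _ (g_sigma_algebraType (past S j)) _ _ m1 m2).
Qed.

Lemma measurable_passage x j : measurable (passage x j).
Proof. exact (sigma_measurable (@past_measurable _ _ S Smeas j) (@passage_past x j)). Qed.

Lemma passage_triv x : trivIset setT (passage x).
Proof.
apply/trivIsetP => i j _ _ ij; rewrite -subset0 => w [[h1 h2] [h3 h4]].
case: (ltngtP i j) ij => // lt _.
  by have := h4 i lt; rewrite leNgt h1.
by have := h2 j lt; rewrite leNgt h3.
Qed.

Lemma increments_after x j k (y c : R) : 0 < y -> 0 <= c ->
  (forall i, (\int[P]_w (expR (- (y^-1 * xi i w)))%:E <= c%:E)%E) ->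
  (\int[P]_w (\1_(passage x j) w * \prod_(i < k) expR (- (y^-1 * xi (j + i)%N w)))%:E
     <= P (passage x j) * (c ^+ k)%:E)%E.
Proof.
move=> y0 c0 Hc; elim: k => [|k IH].
  under eq_integral do rewrite big_ord0 mulr1.
  by rewrite expr0 mule1 integral_indic ?setIT//; exact: measurable_passage.
under eq_integral do rewrite big_ord_recr/= mulrA.
rewrite (@past_integralM _ _ _ P S Ssig Smeas Sind (j + k)).
- rewrite exprSr EFinM muleA; apply: lee_pmul => //; apply: integral_ge0 => w _.
  + by rewrite lee_fin mulr_ge0// prodr_ge0// => i _; rewrite expR_ge0.
  + by rewrite lee_fin expR_ge0.
- apply: measurable_funM.
    apply: measurable_indic.
    have sub : <<s past S j >> `<=` <<s past S (j + k) >>.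
      by apply: sub_sigma_algebra2; exact: past_leq (leq_addr k j).
    exact (sub _ (@passage_past x j)).
  apply: measurable_prod => i _; apply: measurableT_comp; first exact: measurable_expR.
  apply: measurable_funN; apply: measurable_funM => //.
  have ijk : (j + i < j + k)%N by rewrite ltn_add2l.
  exact (adapted_past ijk (@xiS _)).
- apply: measurableT_comp; first exact: measurable_expR.
  by apply: measurable_funN; apply: measurable_funM => //; exact (@xiS _).
- by move=> w; rewrite mulr_ge0// prodr_ge0// => i _; rewrite expR_ge0.
- by move=> w; rewrite expR_ge0.
Qed.

Definition crossing (x y : R) (k j : nat) : set T :=
  passage x j `&` [set w | walk (j + k) w - walk j w <= y].

Lemma measurable_crossing x y k j : measurable (crossing x y k j).
Proof.
apply: measurableI; first exact: measurable_passage.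
rewrite -[X in measurable X]setTI (_ : [set w | _] = (fun w => walk (j + k) w - walk j w) @^-1` `]-oo, y]%classic).
  have mf : measurable_fun setT (fun w => walk (j + k) w - walk j w).
    by apply: measurable_funB; exact: measurable_walk.
  exact: (mf measurableT _ (measurable_itv _)).
by apply/seteqP; split => w /=; rewrite in_itv.
Qed.

(** A Chernoff bound at parameter [y^-1] after the first passage: where [k] further steps add at
    most [y], [expR 1] times the product of the [expR (- xi / y)] is at least [1]. *)
Lemma crossing_le x y k j (c : R) : 0 < y -> 0 <= c ->
  (forall i, (\int[P]_w (expR (- (y^-1 * xi i w)))%:E <= c%:E)%E) ->
  (P (crossing x y k j) <= P (passage x j) * (expR 1 * c ^+ k)%:E)%E.
Proof.
move=> y0 c0 Hc.
rewrite mulrC EFinM muleA.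
apply: le_trans (lee_wpmul2r _ (increments_after x j k y0 c0 Hc)); last first.
  by rewrite lee_fin expR_ge0.
have e0 : (0 <= (expR 1)%:E :> \bar R)%E by rewrite lee_fin expR_ge0.
rewrite -ge0_integralZr//; last 2 first.
- apply/measurable_EFinP; apply: measurable_funM.
    by apply: measurable_indic; exact: measurable_passage.
  apply: measurable_prod => i _; apply: measurableT_comp; first exact: measurable_expR.
  by apply: measurable_funN; apply: measurable_funM => //; exact: measurable_xi.
- by move=> w _; rewrite lee_fin mulr_ge0// prodr_ge0// => i _; rewrite expR_ge0.
have -> : P (crossing x y k j) = (\int[P]_w (\1_(crossing x y k j) w)%:E)%E.
  by rewrite integral_indic ?setIT//; exact: measurable_crossing.
apply: le_integral_all => w; rewrite -EFinM lee_fin indicE.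
have [h|_] := boolP (w \in _); last first.
  by rewrite !mulr_ge0 ?expR_ge0// prodr_ge0// => i _; rewrite expR_ge0.
move: h; rewrite inE => -[pw /= hw].
rewrite indicE mem_set// mul1r -expR_sum -expRD -[leLHS]expR0 ler_expR.
rewrite sumrN -mulr_sumr.
have -> : \sum_(i < k) xi (j + i)%N w = walk (j + k) w - walk j w.
  rewrite /walk big_split_ord/= [X in X + _ - _](_ : _ = \sum_(i < j) xi i w)//.
  by rewrite addrC addKr.
rewrite addrC subr_ge0 mulrC ler_pdivrMr// mul1r//.
Qed.

Definition cell_count (n : nat) (x y : R) (w : T) : nat :=
  (\sum_(k < n) ((x < walk k w)%R && (walk k w <= x + y)%R : nat))%N.

Lemma cell_count_measurable n x y k : measurable [set w | (k < cell_count n x y w)%N].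
Proof.
have mf : measurable_fun setT (fun w => \sum_(i < n) \1_(walk i @^-1` `]x, (x + y)]%classic) w : R).
  apply: measurable_sum => i; apply: measurable_indic.
  rewrite -[X in measurable X]setTI.
  exact: (measurable_walk i measurableT (measurable_itv _)).
rewrite -[X in measurable X]setTI (_ : [set w | _] =
  (fun w => \sum_(i < n) \1_(walk i @^-1` `]x, (x + y)]%classic) w : R) @^-1` `]k%:R, +oo[%classic).
  exact: (mf measurableT _ (measurable_itv _)).
have memE i w : (w \in walk i @^-1` `]x, (x + y)]%classic) = (x < walk i w <= x + y).
  by apply/idP/idP; rewrite inE/= in_itv.
by apply/seteqP; split => w /=; rewrite in_itv/= andbT -(ltr_nat R) /cell_count natr_sum;
  move=> /lt_le_trans; apply; apply: ler_sum => i _; rewrite indicE memE.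
Qed.

(** If [j] is the first index beyond [x] and the cell holds more than [k] points, then the [k] steps
    after [j] add at most [y]. Summing over the disjoint values of [j] costs nothing, so the bound
    is free of [n]. *)
Lemma cell_bound (n k : nat) (x y c : R) : 0 < y -> 0 <= c ->
  (forall i w, 0 <= xi i w) ->
  (forall i, (\int[P]_w (expR (- (y^-1 * xi i w)))%:E <= c%:E)%E) ->
  (P [set w | (k < cell_count n x y w)%N] <= (expR 1 * c ^+ k)%:E)%E.
Proof.
move=> y0 c0 x0 Hc.
have sub : [set w | (k < cell_count n x y w)%N] `<=` \big[setU/set0]_(j < n) crossing x y k j.
  move=> w /= kn.
  have ex : exists j, (j < n)%N && (x < walk j w).
    apply: contrapT => /forallNP H; move: kn; rewrite /cell_count big1// => i _.
    by have /negP := H i; rewrite ltn_ord/= -leNgt => /le_gtF ->.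
  case: (ex_minnP ex) => j /andP[jn xj] jmin.
  have pj : passage x j w.
    split => // i ij; rewrite leNgt; apply/negP => xi'; have := jmin i.
    by rewrite (ltn_trans ij jn) xi' => /(_ isT); rewrite leqNgt ij.
  rewrite -bigcup_mkord; exists j => //=; split => //=.
  rewrite leNgt; apply/negP => hy; move: kn; rewrite ltnNge => /negP; apply.
  apply: leq_trans (_ : minn (n - j) k <= k)%N; last exact: geq_minr.
  rewrite -sum_window; apply: leq_sum => i _.
  have [ij|ij] := ltnP i j.
    by have /le_gtF -> := (pj.2 i ij).
  have [ik|ik] := ltnP i (j + k); first by rewrite leq_b1.
  have := walk_mono (fun i => x0 i w) ik => h.
  rewrite (_ : walk i w <= x + y = false) ?andbF//.
  by apply/negbTE; rewrite -ltNge; lra.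
apply: le_trans (_ : P (\big[setU/set0]_(j < n) crossing x y k j) <= _)%E.
  apply: le_measure => //; rewrite inE; first exact: cell_count_measurable.
  by apply: bigsetU_measurable => j _; exact: measurable_crossing.
have Pfin j : P (passage x j) = (fine (P (passage x j)))%:E.
  by rewrite fineK// fin_num_measure//; exact: measurable_passage.
apply: (@le_trans _ _ (\sum_(j < n) fine (P (passage x j)) * (expR 1 * c ^+ k))%:E).
  apply: (@prob_bigsetU_le _ _ _ P n (crossing x y k)
    (fun j => fine (P (passage x j)) * (expR 1 * c ^+ k))) => [j|j _].
    exact: measurable_crossing.
  by rewrite EFinM -Pfin; exact: crossing_le.
have ec : 0 <= expR 1 * c ^+ k by rewrite mulr_ge0 ?expR_ge0 ?exprn_ge0.
rewrite -mulr_suml EFinM -[leRHS]mul1e; apply: lee_wpmul2r; first by rewrite lee_fin.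
rewrite -sumEFin; under eq_bigr do rewrite -Pfin.
rewrite -(@measure_bigsetU _ _ _ P); last 2 first.
- by move=> i; exact: measurable_passage.
- exact (@passage_triv x).
apply: probability_le1; apply: bigsetU_measurable => j _; exact: measurable_passage.
Qed.

(** From [expR (- z) <= (z / n) ^- n] and [q ^+ n = 4], the exponential decays like [4 ^- i], which
    beats the [2 ^+ i.+1] windows of level [i]. *)
Lemma exp_sum_small (n : nat) (q e : R) : (0 < n)%N -> 0 < q -> q ^+ n = 4 -> 0 < e ->
  exists K : R, 1 <= K /\ forall I, \sum_(i < I) 2 ^+ i.+1 * (expR 1 * expR (- (K * q ^+ i / 2))) <= e.
Proof.
move=> n0 q0 qn e0; have n0' : 0 < n%:R :> R by rewrite ltr0n.
have n1' : 1 <= n%:R :> R by rewrite ler1n.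
have E0 := expR_gt0 (1 : R).
(* The first summand gives [r <= 1], the second gives [4 * expR 1 * r <= e], for [r = 2 n / K]. *)
pose K := 2 * n%:R + 8 * expR 1 * n%:R / e.
have Kn : 0 < 8 * expR 1 * n%:R / e by rewrite divr_gt0// !mulr_gt0.
have K0 : 0 < K by rewrite /K; lra.
exists K; split; first by rewrite /K; lra.
pose r := 2 * n%:R / K.
have r0 : 0 < r by rewrite divr_gt0// mulr_gt0.
have r1 : r <= 1 by rewrite ler_pdivrMr// mul1r /K; lra.
have rn : r ^+ n <= r by rewrite -[leRHS]expr1; apply: ler_wiXn2l => //; exact: ltW.
have re : 4 * expR 1 * r <= e.
  rewrite /r mulrA ler_pdivrMr// /K mulrDr (_ : e * (8 * expR 1 * n%:R / e) = 8 * expR 1 * n%:R).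
    have : 0 <= e * (2 * n%:R) by rewrite mulr_ge0 ?mulr_ge0// ltW.
    by move=> h; lra.
  by rewrite mulrC divfK// gt_eqF.
have term i : 2 ^+ i.+1 * (expR 1 * expR (- (K * q ^+ i / 2))) <= 2 * expR 1 * r * 2^-1 ^+ i.
  have qi : 0 < q ^+ i by rewrite exprn_gt0.
  have z0 : 0 < K * q ^+ i / 2 by rewrite divr_gt0// mulr_gt0.
  have h : expR (- (K * q ^+ i / 2)) <= r ^+ n * 4^-1 ^+ i.
    have -> : r ^+ n * 4^-1 ^+ i = ((K * q ^+ i / 2 / n%:R) ^+ n)^-1.
      rewrite -exprVn (_ : (K * q ^+ i / 2 / n%:R)^-1 = r * (q ^+ i)^-1); last first.
        by rewrite /r; field; rewrite !gt_eqF.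
      rewrite [RHS]exprMn; congr (_ * _).
      by rewrite -qn -!exprVn -!exprM mulnC.
    rewrite expRN lef_pV2 ?posrE ?expR_gt0 ?exprn_gt0 ?divr_gt0 ?mulr_gt0//.
    apply: (@le_trans _ _ ((1 + K * q ^+ i / 2 / n%:R) ^+ n)).
      by apply: lerXn2r; rewrite ?nnegrE; have := divr_gt0 z0 n0'; lra.
    apply: (@le_trans _ _ (expR (K * q ^+ i / 2 / n%:R) ^+ n)).
      by apply: lerXn2r; rewrite ?nnegrE ?expR_ge0 ?expR_ge1Dx//; have := divr_gt0 z0 n0'; lra.
    by rewrite -expRM_natl mulrC divfK// gt_eqF.
  have e2 : 0 < 2 ^+ i.+1 :> R by rewrite exprn_gt0.
  have e4 : 0 < 4^-1 ^+ i :> R by rewrite exprn_gt0.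
  apply: (@le_trans _ _ (2 ^+ i.+1 * (expR 1 * (r * 4^-1 ^+ i)))).
    rewrite ler_pM2l// ler_pM2l//; apply: le_trans h _.
    by rewrite ler_pM2r.
  have -> : 4^-1 ^+ i = 2^-1 ^+ i * 2^-1 ^+ i :> R.
    by rewrite -exprMn; congr (_ ^+ _); field.
  rewrite exprS (_ : 2 * 2 ^+ i * (expR 1 * (r * (2^-1 ^+ i * 2^-1 ^+ i))) =
    2 * expR 1 * r * 2^-1 ^+ i * (2 ^+ i * 2^-1 ^+ i)); last by ring.
  by rewrite -exprMn mulfV// expr1n mulr1.
move=> I; apply: (@le_trans _ _ (\sum_(i < I) 2 * expR 1 * r * 2^-1 ^+ i)).
  by apply: ler_sum => i _; exact: term.
rewrite -mulr_sumr; apply: le_trans re.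
have hs : \sum_(i < I) 2^-1 ^+ i <= 2 :> R.
  suff : \sum_(i < I) 2^-1 ^+ i = 2 - 2 * 2^-1 ^+ I :> R.
    by move=> ->; rewrite gerBl mulr_ge0// exprn_ge0// invr_ge0.
  elim: I => [|I IH]; first by rewrite big_ord0 expr0; lra.
  by rewrite big_ord_recr/= IH exprS; field.
have c0 : 0 < 2 * expR 1 * r by apply: mulr_gt0 => //; apply: mulr_gt0.
by have := ler_wpM2l (ltW c0) hs; lra.
Qed.

(** The starting point [walk 0 = 0] is left out because half-open grid cells never contain [0]; its
    contribution is always treated separately. *)
Definition window_count (n : nat) (x y : R) (w : T) : nat :=
  (\sum_(k < n) ((0 < walk k w)%R && (x - y <= walk k w <= x)%R : nat))%N.

(** With [j] the integer part of [x / y], the window meets the cells starting at [j y] and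
    [(j - 1) y]; the one starting at [(j - 2) y] is there only for the endpoint [x - y] falling on
    the grid. *)
Lemma window_count_le (n m : nat) (x y : R) (w : T) : 0 < y -> 0 <= x ->
  (forall j, (j%:R * y <= x)%R -> (cell_count n (j%:R * y) y w <= m)%N) ->
  (window_count n x y w <= 3 * m)%N.
Proof.
move=> y0 x0 H; pose j := Num.truncn (x / y).
have xy0 : 0 <= x / y by rewrite divr_ge0// ltW.
have jx : j%:R * y <= x by rewrite -ler_pdivlMr// truncn_le.
have xj : x < j.+1%:R * y by rewrite -ltr_pdivrMr// truncnS_gt.
have jr r : (j - r)%:R * y <= x.
  by apply: le_trans jx; rewrite ler_pM2r// ler_nat leq_subr.
apply: (@leq_trans (\sum_(r < 3) cell_count n ((j - r)%:R * y) y w)%N); last first.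
  apply: (@leq_trans (\sum_(r < 3) m)%N); last by rewrite sum_nat_const card_ord.
  by apply: leq_sum => r _; exact: H.
rewrite /cell_count exchange_big/=; apply: leq_sum => k _.
case: (boolP (_ && _)) => //= /and3P[s0 sl sx].
set s := walk k w in s0 sl sx *.
have key (r : 'I_3) : ((j - r)%:R * y < s) && (s <= (j - r)%:R * y + y) ->
    (1 <= \sum_(i < 3) (((j - i)%:R * y < s)%R && (s <= (j - i)%:R * y + y)%R : nat))%N.
  by move=> h; rewrite (bigD1 r)//= h.
move: xj; rewrite -natr1 mulrDl mul1r => xj.
have [h1|h1] := ltP (j%:R * y) s.
  by apply: (key (inord 0)); rewrite inordK// subn0 h1/= ltW// (le_lt_trans sx).
have j0 : (0 < j)%N.
  by rewrite lt0n; apply/eqP => j0; move: h1; rewrite j0 mul0r => /(lt_le_trans s0); rewrite ltxx.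
have j1 : (j - 1)%:R * y + y = j%:R * y.
  by rewrite natrB// mulrBl mul1r subrK.
have [h2|h2] := ltP ((j - 1)%:R * y) s.
  by apply: (key (inord 1)); rewrite inordK// h2 j1 h1.
have j2 : (1 < j)%N.
  rewrite ltn_neqAle j0 andbT eq_sym; apply/eqP => j1'.
  by move: h2; rewrite j1' subnn mul0r => /(lt_le_trans s0); rewrite ltxx.
have j3 : (j - 2)%:R * y + y = (j - 1)%:R * y.
  by rewrite !natrB//; ring.
by apply: (key (inord 2)); rewrite inordK//; apply/andP; split; lra.
Qed.

(** A union bound over the levels [i < I] and the at most [2 ^+ i.+1] cells of level [i], each
    allowed about [K q^i / tl] points. The function [tl] is abstract so that the estimate also
    covers the grid increments of a subordinator. *)
Lemma renewal_good_event (tl : R -> R) (q e K : R) :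
  (forall y, 0 < y -> 0 < tl y <= 1) -> (forall i w, 0 <= xi i w) ->
  (forall y i, 0 < y -> (\int[P]_w (expR (- (y^-1 * xi i w)))%:E <= (expR (- (tl y / 2)))%:E)%E) ->
  1 <= q -> 1 <= K ->
  (forall I, \sum_(i < I) 2 ^+ i.+1 * (expR 1 * expR (- (K * q ^+ i / 2))) <= e) ->
  forall (t : R) (N I : nat), 0 < t ->
    exists A, measurable A /\ (P A <= e%:E)%E /\
    forall w, ~ A w -> forall i x, (i < I)%N -> 0 <= x <= t ->
      (window_count N x (t / 2 ^+ i) w)%:R <= 6 * K * q ^+ i / tl (t / 2 ^+ i).
Proof.
move=> tl01 x0 Hl q1 K1 HK t N I t0.
pose y i : R := t / 2 ^+ i.
have y0 i : 0 < y i by rewrite divr_gt0// exprn_gt0.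
(* Rounding up at most doubles the count, as the quotient is at least [1]; three cells per window
   then give the factor [6]. *)
pose k i := (Num.truncn (K * q ^+ i / tl (y i))).+1.
have Kq i : 1 <= K * q ^+ i by rewrite mulr_ege1// exprn_ege1.
have z0 i : 0 <= K * q ^+ i / tl (y i).
  by have /andP[? _] := tl01 _ (y0 i); rewrite divr_ge0 ?ltW// (lt_le_trans ltr01).
have klo i : K * q ^+ i / tl (y i) <= (k i)%:R by exact/ltW/truncnS_gt.
have khi i : (k i)%:R <= 2 * K * q ^+ i / tl (y i).
  have /andP[l0 l1] := tl01 _ (y0 i).
  have : (Num.truncn (K * q ^+ i / tl (y i)))%:R <= K * q ^+ i / tl (y i) by rewrite truncn_le.
  have : 1 <= K * q ^+ i / tl (y i).
    by rewrite ler_pdivlMr// mul1r (le_trans l1).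
  rewrite /k -natr1 -!mulrA mulrA; move: (K * (q ^+ i / tl (y i))) => z; lra.
pose B i j := [set w | (k i < cell_count N (j%:R * y i) (y i) w)%N].
have mB i j : measurable (B i j) by exact: cell_count_measurable.
pose A := \big[setU/set0]_(i < I) \big[setU/set0]_(j < (2 ^ i).+1) B i j.
exists A; split; first by apply: bigsetU_measurable => i _; exact: bigsetU_measurable.
split.
  apply: le_trans (_ : (\sum_(i < I) 2 ^+ i.+1 * (expR 1 * expR (- (K * q ^+ i / 2))))%:E <= _)%E; last first.
    by rewrite lee_fin.
  apply: (@prob_bigsetU_le _ _ _ P I (fun i => \big[setU/set0]_(j < (2 ^ i).+1) B i j)
    (fun i => 2 ^+ i.+1 * (expR 1 * expR (- (K * q ^+ i / 2))))).
    by move=> i; exact: bigsetU_measurable.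
  move=> i _.
  apply: (@le_trans _ _ (\sum_(j < (2 ^ i).+1) expR 1 * expR (- (K * q ^+ i / 2)))%:E).
    apply: (@prob_bigsetU_le _ _ _ P (2 ^ i).+1 (B i)
      (fun=> expR 1 * expR (- (K * q ^+ i / 2)))) => // j _.
    apply: le_trans (@cell_bound N (k i) (j%:R * y i) (y i) (expR (- (tl (y i) / 2))) (y0 i) _ x0 _) _.
    - exact: expR_ge0.
    - by move=> i'; exact: Hl.
    rewrite lee_fin ler_pM2l ?expR_gt0// -expRM_natl ler_expR mulrN lerN2.
    have /andP[l0 l1] := tl01 _ (y0 i).
    by have := klo i; rewrite ler_pdivrMr// mulrA => h; rewrite ler_pM2r ?invr_gt0.
  rewrite sumr_const card_ord -(mulr_natl (expR 1 * _)) lee_fin ler_wpM2r ?mulr_ge0 ?expR_ge0//.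
  by rewrite -natrX ler_nat expnS mul2n -addnn -addn1 leq_add2l expn_gt0.
move=> w nA i x iI /andP[x0' xt].
rewrite -/(y i).
have : (window_count N x (y i) w <= 3 * k i)%N.
  apply: window_count_le => // j jx; rewrite leqNgt; apply/negP => h; apply: nA.
  rewrite /A -(bigcup_mkord I (fun i => \big[setU/set0]_(j < (2 ^ i).+1) B i j)).
  exists i => //=; rewrite -(bigcup_mkord (2 ^ i).+1 (B i)); exists j => //=.
  rewrite ltnS -(ler_nat R) natrX.
  have := le_trans jx xt; rewrite /y mulrA ler_pdivrMr ?exprn_gt0//.
  by rewrite mulrC ler_pM2l.
rewrite -(ler_nat R) natrM => h; apply: le_trans h _.
have := khi i; rewrite -!mulrA; lra.
Qed.

End renewal.

(** * Freezing and moments of shot noise *)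

(** Replace [s] by the next multiple of [1 / m.+1]: the composition becomes a countable patchwork of
    measurable pieces, and right-continuity of [V] recovers the limit. The approximation stays
    strictly to the right of [s]. *)
Lemma frozen_measurable d1 d2 (A : measurableType d1) (B : measurableType d2)
    (R : realType) (V : B -> R -> R) (s : A -> R) :
  (forall x, 0 <= x -> measurable_fun setT (V^~ x)) ->
  (forall b x, 0 <= x -> V b y @[y --> x^'+] --> V b x) ->
  measurable_fun setT s -> (forall a, 0 <= s a) ->
  measurable_fun setT (fun z : A * B => V z.2 (s z.1)).
Proof.
move=> mV cV ms s0.
pose g m j : R := j.+1%:R / m.+1%:R.
pose k m a := Num.truncn (m.+1%:R * s a).
have m0 m : 0 < m.+1%:R :> R by [].
have ms0 m a : 0 <= m.+1%:R * s a by rewrite mulr_ge0.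
have gk m a : s a < g m (k m a) <= s a + m.+1%:R^-1.
  rewrite /g ltr_pdivlMr// mulrC truncnS_gt/= ler_pdivrMr// mulrDl mulVf ?gt_eqF//.
  by rewrite -natr1 lerD2r mulrC truncn_le.
apply: (@measurable_fun_cvg _ _ _ (setT : set (A * B))
    (fun m (z : A * B) => V z.2 (g m (k m z.1)))) => //.
  move=> m _ C mC; rewrite setTI.
  have -> : (fun z : A * B => V z.2 (g m (k m z.1))) @^-1` C =
      \bigcup_j ((k m @^-1` [set j]) `*` ((V^~ (g m j)) @^-1` C)).
    apply/seteqP; split => [[a b] /= h|[a b] [j _ [/= -> //]]].
    by exists (k m a).
  apply: bigcupT_measurable => j; apply: measurableX.
    rewrite (_ : k m @^-1` [set j] = s @^-1` `[j%:R / m.+1%:R, j.+1%:R / m.+1%:R[%classic).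
      by rewrite -[X in measurable X]setTI; apply: ms => //; exact: measurable_itv.
    apply/seteqP; split => a /=; rewrite in_itv/= ler_pdivrMr// ltr_pdivlMr//.
      move=> <-; rewrite (mulrC (s a)) truncnS_gt andbT.
      by rewrite truncn_le.
    by rewrite (mulrC (s a)) => h; exact: truncn_def.
  rewrite -[X in measurable X]setTI; apply: mV => //.
  by rewrite /g divr_ge0.
move=> [a b] _ /=; apply/cvgrPdist_le => e e0.
have /cvgrPdist_le/(_ e e0) := cV b (s a) (s0 a).
rewrite near_withinE => -[r /= r0 hr].
near=> m.
have /andP[h1 h2] := gk m a.
have hm : m.+1%:R^-1 < r by near: m; exact: near_infty_natSinv_lt (PosNum r0).
apply: hr => //=; rewrite distrC ger0_norm.
  by rewrite ltrBlDl (le_lt_trans h2)// ltrD2l.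
by rewrite subr_ge0; exact: ltW.
Unshelve. all: by end_near. Qed.

Section freezing.
Context d (T : measurableType d) (R : realType) (P : probability T R).
Variables G1 G2 : set (set T).
Hypothesis G1m : forall A, G1 A -> measurable A.
Hypothesis G2m : forall A, G2 A -> measurable A.
Hypothesis ind : forall A B, <<s G1 >> A -> <<s G2 >> B -> P (A `&` B) = (P A * P B)%E.
Let T1 := g_sigma_algebraType G1.
Let T2 := g_sigma_algebraType G2.

(** Independence says that the diagonal map into [T1 * T2] has the product of the restricted
    measures as its law; the formula is Tonelli for that product. *)
Lemma indep_fubini (f : T1 * T2 -> \bar R) : measurable_fun setT f ->
  (forall z, 0 <= f z)%E ->
  (\int[P]_w f (w, w) = \int[P]_w \int[P]_w' f (w, w'))%E.
Proof.
move=> mf f0.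
have mU : measurable_fun setT (fun w : T => w : T1).
  by move=> _ B mB; rewrite setTI; exact: (sigma_measurable G1m).
have mV : measurable_fun setT (fun w : T => w : T2).
  by move=> _ B mB; rewrite setTI; exact: (sigma_measurable G2m).
have mX : measurable_fun [set: T] (fun w : T => (w : T1, w : T2)) by exact: measurable_fun_pair.
pose Um : {mfun T >-> T1} := mfun_Sub (mem_set mU).
pose Vm : {mfun T >-> T2} := mfun_Sub (mem_set mV).
pose Xm : {mfun T >-> (T1 * T2)%type} := mfun_Sub (mem_set mX).
pose m1 := distribution P Um; pose m2 := distribution P Vm.
pose m' := distribution P Xm.
have -> : (\int[P]_w f (w, w) = \int[m']_z f z)%E by rewrite /m' ge0_integral_distribution.
have m'E (A : set T1) (B : set T2) : measurable A -> measurable B ->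
    m' (A `*` B) = (m1 A * m2 B)%E.
  by move=> mA mB; rewrite /m' /m1 /m2 /distribution /pushforward /= -ind.
have -> : (\int[m']_z f z = \int[m1 \x m2]_z f z)%E.
  apply: eq_measure_integral => A mA _.
  by symmetry; apply: (product_measure_unique m'E).
rewrite fubini_tonelli1// /fubini_F /=.
rewrite /m1 ge0_integral_distribution//; last 2 first.
- exact: measurable_fun_fubini_tonelli_F.
- by move=> x; exact: integral_ge0.
apply: eq_integral => w _; rewrite /= ge0_integral_distribution//.
by apply: measurableT_comp => //; exact: measurable_fun_pair.
Qed.

(** Integration conditionally on [G1]: inside the inner integral the random time [s w] is a
    constant. This is how a path is evaluated at an independent random time. *)
Lemma freezing (U : T -> R) (V : T -> R -> R) (s : T -> R) :
  adapted G1 U -> (forall w, 0 <= U w) ->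
  adapted G1 s -> (forall w, 0 <= s w) ->
  (forall x, 0 <= x -> adapted G2 (V^~ x)) ->
  (forall w x, 0 <= x -> V w y @[y --> x^'+] --> V w x) ->
  (forall w x, 0 <= x -> 0 <= V w x) ->
  (\int[P]_w (U w * V w (s w))%:E =
   \int[P]_w ((U w)%:E * \int[P]_w' (V w' (s w))%:E))%E.
Proof.
move=> aU U0 as_ s0 aV cV V0.
pose f (z : T1 * T2) := (U z.1 * V z.2 (s z.1))%:E.
rewrite (_ : (\int[P]_w (U w * V w (s w))%:E = \int[P]_w f (w, w))%E)// indep_fubini.
- apply: eq_integral => w _ /=; rewrite /f/=.
  under eq_integral do rewrite EFinM.
  rewrite ge0_integralZl//.
  + apply/measurable_EFinP; exact: (adapted_measurable G2m (aV _ (s0 w))).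
  + by move=> w' _; rewrite lee_fin V0.
  + by rewrite lee_fin.
- apply/measurable_EFinP; apply: measurable_funM.
    by apply: (@measurableT_comp _ _ _ _ _ _ (U : T1 -> R)).
  exact: (@frozen_measurable _ _ T1 T2 R V s).
- by move=> z; rewrite lee_fin mulr_ge0 ?V0.
Qed.

Lemma adapted_frozen (G3 : set (set T)) (V : T -> R -> R) (s : T -> R) :
  G1 `<=` <<s G3 >> -> G2 `<=` <<s G3 >> ->
  adapted G1 s -> (forall w, 0 <= s w) ->
  (forall x, 0 <= x -> adapted G2 (V^~ x)) ->
  (forall w x, 0 <= x -> V w y @[y --> x^'+] --> V w x) ->
  adapted G3 (fun w => V w (s w)).
Proof.
move=> G13 G23 as_ s0 aV cV; pose T3 := g_sigma_algebraType G3.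
have mX : measurable_fun [set: T3] (fun w : T3 => (w : T1, w : T2)).
  apply: measurable_fun_pair => _ B mB; rewrite setTI.
    by move: B mB; apply: smallest_sub => //; exact: smallest_sigma_algebra.
  by move: B mB; apply: smallest_sub => //; exact: smallest_sigma_algebra.
have := measurableT_comp (@frozen_measurable _ _ T1 T2 R V s aV cV as_ s0) mX.
by [].
Qed.

End freezing.

(** The term [2 l x^(2l-1) y] of the binomial expansion is split by signs and its negative part
    moved to the left. All terms become nonnegative, so the inequality can be integrated before any
    integrability is known. *)
Lemma power_expand_le (R : realType) (l : nat) (x y : R) : (0 < l)%N ->
  (x + y) ^+ (2 * l) + (2 * l)%:R * (Num.max x 0 ^+ (2 * l).-1 * Num.max (- y) 0 +
                          Num.max (- x) 0 ^+ (2 * l).-1 * Num.max y 0)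
  <= x ^+ (2 * l) + (2 * l)%:R * (Num.max x 0 ^+ (2 * l).-1 * Num.max y 0 +
                          Num.max (- x) 0 ^+ (2 * l).-1 * Num.max (- y) 0)
     + \sum_(2 <= j < (2 * l).+1) 'C(2 * l, j)%:R * (`|x| ^+ (2 * l - j) * `|y| ^+ j).
Proof.
move=> l0; set N := (2 * l)%N; have N2 : (1 < N)%N by rewrite /N; lia.
have oddN : odd N.-1 by rewrite -subn1 oddB 1?ltnW// /N oddM.
have key : x ^+ N.-1 * y = (Num.max x 0 ^+ N.-1 * Num.max y 0 + Num.max (- x) 0 ^+ N.-1 * Num.max (- y) 0)
   - (Num.max x 0 ^+ N.-1 * Num.max (- y) 0 + Num.max (- x) 0 ^+ N.-1 * Num.max y 0).
  have z : (0 : R) ^+ N.-1 = 0 by rewrite expr0n; move: N2; case: (N) => [|[|]].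
  have s : (- x) ^+ N.-1 = - x ^+ N.-1 by rewrite exprNn -signr_odd oddN expr1 mulN1r.
  have [hx|hx] := leP 0 x; have [hy|hy] := leP 0 y.
  - by rewrite (max_r (_ : - x <= 0)) ?oppr_le0// (max_r (_ : - y <= 0)) ?oppr_le0// z; ring.
  - by rewrite (max_r (_ : - x <= 0)) ?oppr_le0// (max_l (_ : 0 <= - y)) ?oppr_ge0 ?(ltW hy)// z; ring.
  - by rewrite (max_l (_ : 0 <= - x)) ?oppr_ge0 ?(ltW hx)// (max_r (_ : - y <= 0)) ?oppr_le0// s z; ring.
  - by rewrite (max_l (_ : 0 <= - x)) ?oppr_ge0 ?(ltW hx)// (max_l (_ : 0 <= - y)) ?oppr_ge0 ?(ltW hy)// s z; ring.
have expand : (x + y) ^+ N = x ^+ N + N%:R * (x ^+ N.-1 * y) +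
    \sum_(2 <= j < N.+1) 'C(N, j)%:R * (x ^+ (N - j) * y ^+ j).
  rewrite exprDn -(big_mkord xpredT (fun i => x ^+ (N - i) * y ^+ i *+ 'C(N, i))).
  rewrite big_nat_recl// [X in _ + X]big_ltn; last by rewrite ltnW.
  rewrite [in RHS]big_add1/=.
  rewrite subn0 bin0 expr0 mulr1 mulr1n bin1 expr1 subn1 addrA mulr_natl; congr (_ + _ + _).
  by apply: eq_bigr => i _; rewrite mulr_natl.
rewrite expand key.
have : \sum_(2 <= j < N.+1) 'C(N, j)%:R * (x ^+ (N - j) * y ^+ j) <=
    \sum_(2 <= j < N.+1) 'C(N, j)%:R * (`|x| ^+ (N - j) * `|y| ^+ j).
  apply: ler_sum => j _; rewrite ler_wpM2l// (le_trans (ler_norm _))//.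
  by rewrite normrM !normrX.
by lra.
Qed.

(** * Moments of sums with conditionally small increments *)

Section moment.
Context d (T : measurableType d) (R : realType) (P : probability T R).
Variable S : nat -> set (set T).
Hypothesis Smeas : forall k A, S k A -> measurable A.
Variables (D W : nat -> T -> R) (b C : R) (l : nat).
Hypothesis l0 : (0 < l)%N.
Hypothesis b0 : 0 < b.
Hypothesis C0 : 0 <= C.
Hypothesis aD : forall n, adapted (past S n.+1) (D n).
Hypothesis aW : forall n, adapted (past S n) (W n).
Hypothesis W0 : forall n w, 0 <= W n w.
Hypothesis HDp : forall n U, adapted (past S n) U -> (forall w, 0 <= U w) ->
  (\int[P]_w (U w * Num.max (D n w) 0)%:E <=
   \int[P]_w (U w * Num.max (- D n w) 0)%:E + \int[P]_w (U w * (C * b * W n w))%:E)%E.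
Hypothesis HDn : forall n U, adapted (past S n) U -> (forall w, 0 <= U w) ->
  (\int[P]_w (U w * Num.max (- D n w) 0)%:E <=
   \int[P]_w (U w * Num.max (D n w) 0)%:E + \int[P]_w (U w * (C * b * W n w))%:E)%E.
Hypothesis HDj : forall n U j, (2 <= j <= 2 * l)%N ->
  adapted (past S n) U -> (forall w, 0 <= U w) ->
  (\int[P]_w (U w * `|D n w| ^+ j)%:E <= \int[P]_w (U w * (C * b ^+ j * W n w))%:E)%E.

Let N := (2 * l)%N.
Let M n w := \sum_(k < n) D k w.
(** Adding [b ^+ N] makes every mixed term [b ^+ j * |M| ^+ (N - j)] at most [Psi], whichever of
    [|M|] and [b] is larger. *)
Let Psi n w := M n w ^+ N + b ^+ N.
(** [2 ^+ N] bounds the sum of the binomial coefficients of order at least [2]; [2 N] comes from the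
    two signed halves of the first-order term. *)
Let C' := (2 ^+ N + 2 * N%:R) * C.

Let meas n (U : T -> R) : adapted (past S n) U -> measurable_fun setT U.
Proof. exact: (adapted_measurable (@past_measurable _ _ S Smeas n)). Qed.

Let aM n : adapted (past S n) (M n).
Proof.
rewrite /adapted /M; apply: measurable_sum => i.
exact: (adapted_past_leq (ltn_ord i) (@aD i)).
Qed.

Let M_ge0 n w : 0 <= M n w ^+ N.
Proof. by rewrite /N exprM exprn_ge0// sqr_ge0. Qed.

Let Psi0 n w : 0 <= Psi n w.
Proof. by rewrite addr_ge0// exprn_ge0// ltW. Qed.

Let absPsi n w j : (j <= N)%N -> b ^+ j * `|M n w| ^+ (N - j) <= Psi n w.
Proof.
move=> jN; have bb := ltW b0.
have MN : M n w ^+ N = `|M n w| ^+ N by rewrite -normrX ger0_norm.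
rewrite /Psi MN; set x := `|_|; have x0 : 0 <= x by exact: normr_ge0.
have [xb|bx] := leP x b.
  apply: (@le_trans _ _ (b ^+ j * b ^+ (N - j))).
    by rewrite ler_wpM2l ?exprn_ge0// lerXn2r.
  by rewrite -exprD subnKC// lerDr exprn_ge0.
apply: (@le_trans _ _ (x ^+ j * x ^+ (N - j))).
  by rewrite ler_wpM2r ?exprn_ge0// lerXn2r// ltW.
by rewrite -exprD subnKC// lerDl exprn_ge0.
Qed.

Let C'0 : 0 <= C'.
Proof. by rewrite mulr_ge0// addr_ge0 ?exprn_ge0 ?mulr_ge0. Qed.

Let I (f : T -> R) : \bar R := (\int[P]_w (f w)%:E)%E.

Let ID (f g : T -> R) : measurable_fun setT f -> measurable_fun setT g -> (forall w, 0 <= f w) ->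
  (forall w, 0 <= g w) -> I (fun w => f w + g w) = (I f + I g)%E.
Proof.
move=> mf mg f0 g0; rewrite /I; under eq_integral do rewrite EFinD.
by rewrite ge0_integralD// => [w _||w _|]; rewrite ?lee_fin//; exact/measurable_EFinP.
Qed.

Let IZ c (f : T -> R) : measurable_fun setT f -> (forall w, 0 <= f w) -> 0 <= c ->
  I (fun w => c * f w) = (c%:E * I f)%E.
Proof.
move=> mf f0 c0; rewrite /I; under eq_integral do rewrite EFinM.
by rewrite ge0_integralZl// => [|w _]; rewrite ?lee_fin//; exact/measurable_EFinP.
Qed.

Let I0 (f : T -> R) : (forall w, 0 <= f w) -> (0 <= I f)%E.
Proof. by move=> f0; apply: integral_ge0 => w _; rewrite lee_fin. Qed.

Let ILe (f g : T -> R) : (forall w, f w <= g w) -> (I f <= I g)%E.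
Proof. by move=> fg; apply: le_integral_all => w; rewrite lee_fin. Qed.

(** Conditionally on the past, one increment multiplies [Psi] by at most [1 + C' W]. Conditional
    expectations are encoded by integrals against nonnegative weights [U] adapted to the past. *)
Let step n U : adapted (past S n) U -> (forall w, 0 <= U w) ->
  (\int[P]_w (U w * Psi n.+1 w)%:E <= \int[P]_w (U w * (Psi n w * (1 + C' * W n w)))%:E)%E.
Proof.
move=> aU U0; rewrite -!/(I _).
(* An infinite right-hand side is trivial; otherwise all the signed first-order integrals are finite
   and can be cancelled. *)
have [->|finE] := eqVneq (I (fun w => U w * (Psi n w * (1 + C' * W n w)))) +oo%E.
  by rewrite leey.
have bb := ltW b0.
have mU := meas aU; have mM := meas (@aM n); have mM1 := meas (@aM n.+1).
have mD := meas (@aD n); have mW := meas (@aW n).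
have mPsi : measurable_fun setT (Psi n).
  by apply: measurable_funD => //; exact: measurable_funX.
have mPsi1 : measurable_fun setT (Psi n.+1).
  by apply: measurable_funD => //; exact: measurable_funX.
have mpos (f : T -> R) : measurable_fun setT f -> measurable_fun setT (fun w => Num.max (f w) 0).
  by move=> mf; apply: measurable_maxr.
have apos : adapted (past S n) (fun w => Num.max (M n w) 0).
  by apply: measurable_maxr => //; exact: (@aM n).
have aneg : adapted (past S n) (fun w => Num.max (- M n w) 0).
  by apply: measurable_maxr => //; apply: measurable_funN; exact: (@aM n).
have aabs : adapted (past S n) (fun w => `|M n w|).
  by apply: measurableT_comp => //; exact: (@aM n).
pose Up w := U w * Num.max (M n w) 0 ^+ N.-1.
pose Un w := U w * Num.max (- M n w) 0 ^+ N.-1.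
pose Uj j w := U w * `|M n w| ^+ (N - j).
have aUp : adapted (past S n) Up.
  by apply: measurable_funM => //; apply: measurable_funX.
have aUn : adapted (past S n) Un.
  by apply: measurable_funM => //; apply: measurable_funX.
have aUj j : adapted (past S n) (Uj j).
  by apply: measurable_funM => //; apply: measurable_funX.
have pos0 (x : R) : 0 <= Num.max x 0 by rewrite le_max lexx orbT.
have Up0 w : 0 <= Up w by rewrite mulr_ge0// exprn_ge0.
have Un0 w : 0 <= Un w by rewrite mulr_ge0// exprn_ge0.
have Uj0 j w : 0 <= Uj j w by rewrite mulr_ge0// exprn_ge0.
have mUp := meas aUp; have mUn := meas aUn; have mUj j := meas (aUj j).
have N2 : (1 < N)%N by rewrite /N; have := l0; lia.
pose q := I (fun w => C * (U w * (Psi n w * W n w))).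
pose Y := I (fun w => U w * Psi n w).
have mUPW : measurable_fun setT (fun w => U w * (Psi n w * W n w)).
  by apply: measurable_funM => //; apply: measurable_funM.
have mUP : measurable_fun setT (fun w => U w * Psi n w) by exact: measurable_funM.
have UP0 w : 0 <= U w * Psi n w by rewrite mulr_ge0.
have UPW0 w : 0 <= U w * (Psi n w * W n w) by rewrite !mulr_ge0.
have EE : I (fun w => U w * (Psi n w * (1 + C' * W n w))) = (Y + (2 ^+ N + 2 * N%:R)%:E * q)%E.
  rewrite /q /Y -IZ//; first last.
  - by move=> w; rewrite mulr_ge0.
  - exact: measurable_funM.
  rewrite -ID//; first last.
  - by move=> w; rewrite !mulr_ge0// addr_ge0 ?exprn_ge0 ?mulr_ge0.
  - by apply: measurable_funM => //; apply: measurable_funM.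
  by apply: eq_integral => w _; congr EFin; rewrite /C'; ring.
have q0 : (0 <= q)%E by apply: I0 => w; rewrite mulr_ge0.
have Y0 : (0 <= Y)%E by exact: I0.
have c1 : 1 <= 2 ^+ N + 2 * N%:R :> R.
  by rewrite ler_wpDr ?mulr_ge0// exprn_ege1// ler1n.
have Yfin : Y \is a fin_num.
  rewrite ge0_fin_numE// ltey; apply: contra finE => /eqP Yoo.
  by rewrite EE Yoo addye// gt_eqF// (lt_le_trans (@ltNy0 R))// mule_ge0// lee_fin (le_trans _ c1).
have qfin : q \is a fin_num.
  rewrite ge0_fin_numE// ltey; apply: contra finE => /eqP qoo.
  rewrite EE qoo gt0_muley ?lte_fin ?(lt_le_trans _ c1)// addey//.
  by rewrite gt_eqF// (lt_le_trans (@ltNy0 R)).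
have abs_max (x : R) : Num.max x 0 <= `|x| by rewrite ge_max ler_norm normr_ge0.
have UpPsi w : Up w * b <= U w * Psi n w.
  rewrite /Up -mulrA ler_wpM2l//; apply: le_trans (absPsi n w (ltnW N2)).
  by rewrite expr1 mulrC subn1 ler_wpM2l// lerXn2r ?nnegrE.
have UnPsi w : Un w * b <= U w * Psi n w.
  rewrite /Un -mulrA ler_wpM2l//; apply: le_trans (absPsi n w (ltnW N2)).
  rewrite expr1 mulrC subn1 ler_wpM2l// lerXn2r ?nnegrE//.
  by rewrite -[leRHS]normrN.
have cross (V : T -> R) : (forall w, 0 <= V w) -> (forall w, V w * b <= U w * Psi n w) ->
    (I (fun w => V w * (C * b * W n w))%R <= q)%E.
  move=> V0 VP; apply: ILe => w.
  rewrite (_ : V w * _ = C * W n w * (V w * b)); last by ring.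
  rewrite (_ : C * (U w * _) = C * W n w * (U w * Psi n w)); last by ring.
  by rewrite ler_wpM2l// mulr_ge0.
(* Finiteness comes from [|D| <= b + D^2 / b] together with the second conditional moment. *)
have afin (V Dp : T -> R) : adapted (past S n) V -> (forall w, 0 <= V w) ->
    (forall w, V w * b <= U w * Psi n w) -> (forall w, 0 <= Dp w <= `|D n w|) ->
    I (fun w => V w * Dp w) \is a fin_num.
  move=> aV V0 VP DpD; have mV := meas aV.
  rewrite ge0_fin_numE; last by apply: I0 => w; rewrite mulr_ge0//; case/andP: (DpD w).
  apply: (@le_lt_trans _ _ (I (fun w => V w * b + V w * b^-1 * `|D n w| ^+ 2))).
    apply: ILe => w; rewrite -mulrA -mulrDr ler_wpM2l//.
    have /andP[_ h] := DpD w; apply: le_trans h _; set y := `|_|.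
    have y0 : 0 <= y by exact: normr_ge0.
    have [yb|yb] := leP y b; first by rewrite ler_wpDr// mulr_ge0 ?invr_ge0 ?sqr_ge0.
    rewrite ler_wpDl// mulrC ler_pdivlMr// expr2.
    by rewrite ler_wpM2l// ltW.
  rewrite ID; first last.
  - by move=> w; rewrite !mulr_ge0 ?invr_ge0 ?exprn_ge0.
  - by move=> w; rewrite mulr_ge0.
  - by apply: measurable_funM; [exact: measurable_funM|apply: measurable_funX; exact: measurableT_comp].
  - exact: measurable_funM.
  apply: lte_add_pinfty.
    apply: le_lt_trans (ILe VP) _.
    by rewrite -/Y -ge0_fin_numE.
  have j2 : (2 <= 2 <= 2 * l)%N by rewrite -/N N2.
  have aVb : adapted (past S n) (fun w => V w * b^-1) by apply: measurable_funM.
  apply: le_lt_trans (HDj j2 aVb _) _; first by move=> w; rewrite mulr_ge0// invr_ge0.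
  apply: (@le_lt_trans _ _ q); last by rewrite -ge0_fin_numE.
  apply: le_trans (cross _ V0 VP); apply: ILe => w.
  rewrite (_ : _ / b * _ = V w * (C * b * W n w))//; field.
  by rewrite gt_eqF.
have DpD w : 0 <= Num.max (D n w) 0 <= `|D n w| by rewrite pos0 abs_max.
have DnD w : 0 <= Num.max (- D n w) 0 <= `|D n w| by rewrite pos0 -[leRHS]normrN abs_max.
pose a1 := I (fun w => Up w * Num.max (- D n w) 0).
pose a2 := I (fun w => Un w * Num.max (D n w) 0).
pose b1 := I (fun w => Up w * Num.max (D n w) 0).
pose b2 := I (fun w => Un w * Num.max (- D n w) 0).
have a1f : a1 \is a fin_num by exact: afin.
have a2f : a2 \is a fin_num by exact: afin.
have b1f : b1 \is a fin_num by exact: afin.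
have b2f : b2 \is a fin_num by exact: afin.
have h1 : (b1 <= a1 + q)%E.
  by apply: le_trans (HDp aUp Up0) _; rewrite leeD2l//; exact: cross.
have h2 : (b2 <= a2 + q)%E.
  by apply: le_trans (HDn aUn Un0) _; rewrite leeD2l//; exact: cross.
pose Zs w := \sum_(2 <= j < N.+1) 'C(N, j)%:R * (Uj j w * `|D n w| ^+ j).
have mUD j : measurable_fun setT (fun w => Uj j w * `|D n w| ^+ j).
  by apply: measurable_funM => //; apply: measurable_funX; exact: measurableT_comp.
have UD0 j w : 0 <= Uj j w * `|D n w| ^+ j by rewrite mulr_ge0 ?exprn_ge0.
have h3 : (I Zs <= (2 ^+ N)%:E * q)%E.
  rewrite /I /Zs; under eq_integral do rewrite -sumEFin.
  rewrite ge0_integral_sum//; last 2 first.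
  - by move=> j; apply/measurable_EFinP; exact: measurable_funM.
  - by move=> j w _; rewrite lee_fin mulr_ge0.
  have bin2 : (\sum_(2 <= j < N.+1) 'C(N, j)%:R : R) <= 2 ^+ N.
    rewrite -natr_sum -natrX ler_nat -[X in (_ <= X)%N](_ : (\sum_(0 <= j < N.+1) 'C(N, j) = 2 ^ N)%N).
      by rewrite [leqRHS](@big_cat_nat _ _ _ 2 0 N.+1)//= ?leq_addl// ltnW.
    rewrite (expnDn 1 1) big_mkord; apply: eq_bigr => i _.
    by rewrite !exp1n !muln1.
  apply: (@le_trans _ _ (\sum_(2 <= j < N.+1) 'C(N, j)%:R%:E * q)%E).
    rewrite big_nat_cond [leRHS]big_nat_cond; apply: lee_sum => j /andP[/andP[j2 jN] _].
    rewrite -/(I (fun w => 'C(N, j)%:R * (Uj j w * `|D n w| ^+ j))) IZ//.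
    rewrite lee_wpmul2l ?lee_fin//.
    have jj : (2 <= j <= 2 * l)%N by rewrite j2.
    apply: le_trans (HDj jj (aUj j) (Uj0 j)) _; apply: ILe => w.
    rewrite /Uj (_ : _ * _ * _ = C * W n w * (U w * (b ^+ j * `|M n w| ^+ (N - j)))); last by ring.
    rewrite (_ : C * (U w * _) = C * W n w * (U w * Psi n w)); last by ring.
    by rewrite ler_wpM2l ?mulr_ge0// ler_wpM2l// absPsi.
  rewrite -ge0_sume_distrl; last by move=> j _; rewrite lee_fin.
  by rewrite lee_wpmul2r// sumEFin lee_fin.
have MS w : M n.+1 w = M n w + D n w by rewrite /M big_ord_recr.
pose L w := U w * Psi n.+1 w + N%:R * (Up w * Num.max (- D n w) 0 + Un w * Num.max (D n w) 0).
pose K w := U w * Psi n w + N%:R * (Up w * Num.max (D n w) 0 + Un w * Num.max (- D n w) 0) + Zs w.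
have LK w : L w <= K w.
  have := ler_wpM2l (U0 w) (power_expand_le (M n w) (D n w) l0).
  rewrite -MS -/N !mulrDr mulr_sumr => h.
  have ZE : Zs w = \sum_(2 <= i < N.+1) U w * ('C(N, i)%:R * (`|M n w| ^+ (N - i) * `|D n w| ^+ i)).
    by apply: eq_bigr => i _; rewrite /Uj; ring.
  by rewrite /L /K ZE /Up /Un /Psi; lra.
have mDp := mpos _ mD; have mDn := mpos _ (measurable_funN mD).
have m1 := measurable_funM mUp mDp; have m2 := measurable_funM mUp mDn.
have m3 := measurable_funM mUn mDp; have m4 := measurable_funM mUn mDn.
have p1 w : 0 <= Up w * Num.max (D n w) 0 by rewrite mulr_ge0.
have p2 w : 0 <= Up w * Num.max (- D n w) 0 by rewrite mulr_ge0.
have p3 w : 0 <= Un w * Num.max (D n w) 0 by rewrite mulr_ge0.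
have p4 w : 0 <= Un w * Num.max (- D n w) 0 by rewrite mulr_ge0.
have part (f1 f2 : T -> R) : measurable_fun setT f1 -> measurable_fun setT f2 ->
    (forall w, 0 <= f1 w) -> (forall w, 0 <= f2 w) ->
    [/\ measurable_fun setT (fun w => N%:R * (f1 w + f2 w)),
      (forall w, 0 <= N%:R * (f1 w + f2 w)) &
      I (fun w => N%:R * (f1 w + f2 w)) = (N%:R%:E * (I f1 + I f2))%E].
  move=> mf1 mf2 f10 f20; have mf := measurable_funD mf1 mf2; split.
  - by apply: measurable_funM.
  - by move=> w; rewrite mulr_ge0// addr_ge0.
  - by rewrite IZ// ?ID// => w; rewrite addr_ge0.
have IL : I L = (I (fun w => U w * Psi n.+1 w)%R + N%:R%:E * (a1 + a2))%E.
  have [mm pp <-] := part _ _ m2 m3 p2 p3.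
  by rewrite -ID//; [exact: measurable_funM|move=> w; rewrite mulr_ge0].
have mZs : measurable_fun setT Zs.
  by apply: measurable_sum => j; exact: measurable_funM.
have Zs0 w : 0 <= Zs w by apply: sumr_ge0 => j _; rewrite mulr_ge0.
have IK : I K = (Y + N%:R%:E * (b1 + b2) + I Zs)%E.
  have [mm pp <-] := part _ _ m1 m4 p1 p4.
  by rewrite -ID// -ID//; [exact: measurable_funD|move=> w; rewrite addr_ge0].
have Zsf : I Zs \is a fin_num.
  rewrite ge0_fin_numE; last exact: I0.
  by apply: le_lt_trans h3 _; rewrite -(fineK qfin) -EFinM ltry.
have h4 := ILe LK; rewrite IL IK in h4; rewrite EE.
have fa1 : 0 <= fine a1 by rewrite fine_ge0//; exact: I0.
have fa2 : 0 <= fine a2 by rewrite fine_ge0//; exact: I0.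
move: h1 h2 h3 h4.
rewrite -(fineK Yfin) -(fineK qfin) -(fineK a1f) -(fineK a2f) -(fineK b1f) -(fineK b2f) -(fineK Zsf).
move: (fine Y) (fine q) (fine a1) (fine a2) (fine b1) (fine b2) (fine (I Zs)) fa1 fa2
  => y q' a1' a2' b1' b2' z'.
move=> fa1 fa2 h1 h2 h3 h4.
rewrite -EFinD lee_fin in h1; rewrite -EFinD lee_fin in h2; rewrite -EFinM lee_fin in h3.
rewrite -?EFinD -?EFinM -?EFinD in h4; rewrite -EFinM -EFinD.
have Xf : I (fun w => U w * Psi n.+1 w) \is a fin_num.
  rewrite ge0_fin_numE; last by apply: I0 => w; rewrite mulr_ge0.
  apply: le_lt_trans (le_lt_trans _ (ltry _)); last exact: h4.
  by rewrite leeDl// lee_fin mulr_ge0// addr_ge0.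
move: h4; rewrite -(fineK Xf) -EFinD !lee_fin => h4.
have NR : 0 <= N%:R :> R by [].
have := ler_wpM2l NR h1; have := ler_wpM2l NR h2; lra.
Qed.

(** Discounting by [Rn], the product of the [expR (- C' W k)], turns [Psi] into a nonnegative
    supermartingale started at [b ^+ N]. Where the sum of the [W k] is at most [1] the discount is
    at least [expR (- C')], and Markov's inequality applies. *)
Lemma moment_bound (n : nat) (th : R) : 0 < th ->
  exists A, [/\ measurable A,
    (P A <= (expR ((2 ^+ (2 * l) + 2 * (2 * l)%:R) * C) * (b / th) ^+ (2 * l))%:E)%E &
    forall w, ~ A w -> \sum_(k < n) W k w <= 1 -> `|\sum_(k < n) D k w| < th].
Proof.
move=> th0; rewrite -/N -/C'.
pose Rn n w := \prod_(k < n) expR (- (C' * W k w)).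
have aR m : adapted (past S m) (Rn m.+1).
  rewrite /adapted /Rn; apply: measurable_prod => k _.
  have aWk : adapted (past S m) (W k).
    exact: (@adapted_past_leq _ _ _ S k m _ (leq_ord k) (@aW k)).
  apply: measurableT_comp; first exact: measurable_expR.
  by apply: measurable_funN; apply: measurable_funM.
have R0 m w : 0 <= Rn m w by rewrite prodr_ge0// => k _; rewrite expR_ge0.
have main m : (\int[P]_w (Rn m w * Psi m w)%:E <= (b ^+ N)%:E)%E.
  elim: m => [|m IH].
    rewrite -(integral_prob_cst P); apply: le_integral_all => w.
    rewrite /Rn /Psi /M !big_ord0 mul1r expr0n (_ : N == 0%N = false) ?add0r//.
    by rewrite /N; have := l0; case: (l).
  apply: le_trans IH; apply: (le_trans (step (@aR m) (R0 m.+1))) => //.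
  apply: le_integral_all => w; rewrite lee_fin /Rn big_ord_recr/= -/(Rn m w).
  rewrite (_ : _ * _ * _ = Rn m w * Psi m w * (expR (- (C' * W m w)) * (1 + C' * W m w))); last by ring.
  rewrite -[leRHS]mulr1 ler_wpM2l ?mulr_ge0//.
  by rewrite expRN mulrC ler_pdivrMr ?expR_gt0// mul1r expR_ge1Dx.
pose A := [set w | th <= `|M n w| /\ \sum_(k < n) W k w <= 1].
have mM := meas (@aM n).
have mSW : measurable_fun setT (fun w => \sum_(k < n) W k w).
  by apply: measurable_sum => k; exact: meas (@aW k).
have mA : measurable A.
  rewrite (_ : A = (fun w => `|M n w|) @^-1` `[th, +oo[%classic `&`
    (fun w => \sum_(k < n) W k w) @^-1` `]-oo, 1]%classic).
    apply: measurableI; rewrite -[X in measurable X]setTI.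
      have mn : measurable_fun setT (fun w => `|M n w|) by exact: measurableT_comp.
      by apply: mn => //; exact: measurable_itv.
    by apply: mSW => //; exact: measurable_itv.
  by apply/seteqP; split => w /=; rewrite !in_itv/= andbT.
have key w : expR (- C') * th ^+ N * \1_A w <= Rn n w * Psi n w.
  rewrite indicE; have [|_] := boolP (w \in A); last by rewrite mulr0 mulr_ge0.
  rewrite inE => -[/= h1 h2]; rewrite mulr1; apply: ler_pM.
  - exact: expR_ge0.
  - by rewrite exprn_ge0// ltW.
  - apply: (@le_trans _ _ (expR (- (C' * \sum_(k < n) W k w)))).
      by rewrite ler_expR lerN2 -[leRHS]mulr1 ler_wpM2l.
    by rewrite mulr_sumr -sumrN expR_sum.
  - rewrite /Psi ler_wpDr ?exprn_ge0 ?(ltW b0)//.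
    have -> : M n w ^+ N = `|M n w| ^+ N by rewrite -normrX ger0_norm.
    by rewrite lerXn2r ?nnegrE// ltW.
have c0 : 0 < expR (- C') * th ^+ N by rewrite mulr_gt0 ?expR_gt0// exprn_gt0.
exists A; split => //; last first.
  by move=> w nA W1; rewrite ltNge; apply/negP => h; apply: nA.
have := le_trans (ILe key) (main n).
rewrite IZ//; last exact: ltW.
have -> : I \1_A = P A by rewrite /I integral_indic// setIT.
have -> : P A = (fine (P A))%:E by rewrite fineK// fin_num_measure.
rewrite -EFinM !lee_fin => h.
rewrite -(ler_pM2l c0) (le_trans h)// expr_div_n expRN.
have eC := expR_gt0 C'; have tN : 0 < th ^+ N by rewrite exprn_gt0.
rewrite le_eqVlt; apply/orP; left; apply/eqP; move: (expR C') (th ^+ N) eC tN => x y x0 y0.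
by field; rewrite !gt_eqF.
Qed.
End moment.

(** * Path space, laws and oscillations *)

Section path_space.
Context {R : realType}.

Definition cylinder : set (set (R -> R)) :=
  [set A | exists (n : nat) (ts : 'I_n -> R) (Bs : 'I_n -> set R),
     (forall i, measurable (Bs i)) /\ A = [set f | forall i, Bs i (f (ts i))]].

(** All functions with the cylinder sigma-algebra, on which equality of finite-dimensional laws is
    equality of laws. *)
Definition path_space := g_sigma_algebraType cylinder.

Lemma cylinder_setI : setI_closed cylinder.
Proof.
move=> _ _ [n [ts [Bs [mB ->]]]] [m [us [Cs [mC ->]]]].
exists (n + m)%N, (fun i => match fintype.split i with inl j => ts j | inr j => us j end),
  (fun i => match fintype.split i with inl j => Bs j | inr j => Cs j end).
split; first by move=> i; case: (fintype.split i).
apply/seteqP; split => f /=.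
  by move=> [h1 h2] i; case: (fintype.split i).
move=> h; split => i.
  by have := h (fintype.unsplit (inl i)); rewrite fintype.unsplitK.
by have := h (fintype.unsplit (inr i)); rewrite fintype.unsplitK.
Qed.

Lemma measurable_eval (t : R) : measurable_fun [set: path_space] (fun f : path_space => f t).
Proof.
move=> _ B mB; rewrite setTI; apply: sub_sigma_algebra.
exists 1%N, (fun=> t), (fun=> B); split => //.
by apply/seteqP; split => f //= /(_ ord0).
Qed.

Lemma measurable_path d (T : measurableType d) (X : T -> path_space) :
  (forall t, measurable_fun setT (fun w => X w t)) -> measurable_fun setT X.
Proof.
move=> mX; apply: (@measurability _ _ T path_space setT X cylinder erefl).
move=> _ [_ [n [ts [Bs [mB ->]]]] <-].
rewrite (_ : _ `&` _ = \bigcap_(i in [set: 'I_n]) ((fun w => X w (ts i)) @^-1` Bs i)).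
  apply: fin_bigcap_measurable => [|i _]; first exact: finite_finset.
  by rewrite -[X in measurable X]setTI; exact: mX.
rewrite setTI; apply/seteqP; split => w /= h i; first by move=> _; exact: h.
exact: h.
Qed.

(** Cylinders are stable under intersection and generate, so the two image laws coincide, and [F]
    has the same integral under both. *)
Lemma law_transfer d (T : measurableType d) (P : probability T R) (X1 X2 : T -> R -> R)
    (F : path_space -> \bar R) :
  (forall t, measurable_fun setT (X1^~ t)) -> (forall t, measurable_fun setT (X2^~ t)) ->
  (forall (n : nat) (ts : 'I_n -> R) (Bs : 'I_n -> set R), (forall i, measurable (Bs i)) ->
     P [set w | forall i, Bs i (X1 w (ts i))] = P [set w | forall i, Bs i (X2 w (ts i))]) ->
  measurable_fun setT F -> (forall x, 0 <= F x)%E ->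
  (\int[P]_w F (X1 w) = \int[P]_w F (X2 w))%E.
Proof.
move=> m1 m2 H mF F0.
have mX1 := @measurable_path _ T (X1 : T -> path_space) m1.
have mX2 := @measurable_path _ T (X2 : T -> path_space) m2.
pose Y1 : {mfun T >-> path_space} := mfun_Sub (mem_set mX1).
pose Y2 : {mfun T >-> path_space} := mfun_Sub (mem_set mX2).
have e1 := @ge0_integral_distribution _ _ _ _ _ P Y1 F mF F0.
have e2 := @ge0_integral_distribution _ _ _ _ _ P Y2 F mF F0.
rewrite -[LHS]e1 -[RHS]e2.
apply: eq_measure_integral => A mA _.
have := @g_sigma_algebra_measure_unique _ R path_space cylinder _ (fun=> setT) _ _
  (distribution P Y1) (distribution P Y2) _ _ _ A mA.
apply.
- by move=> B cB; exact: sub_sigma_algebra.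
- move=> _; exists 0%N, (fun=> 0), (fun=> setT); split=> //.
  by apply/seteqP; split.
- by rewrite bigcup_const.
- exact: cylinder_setI.
- by move=> _ [n [ts [Bs [mB ->]]]]; exact: H.
- by move=> _; rewrite ltey_eq fin_num_measure.
Qed.

End path_space.

(** * Oscillations over finitely many shifts *)

Section oscillation.
Context {R : realType}.

(** Used in two roles: the shifted path in the oscillation hypothesis, and the summand of the shot
    noise with [y] a point of the walk. *)
Definition shift0 (f : R -> R) (y s : R) : R := if y <= s then f (s - y) else 0.

(** A maximum over finitely many shifts in place of the supremum over an interval: it is measurable
    and right-continuous in [s], so it can be treated as a shot-noise response itself. *)
Fixpoint osc (ys : nat -> R) (n : nat) (f : R -> R) (s : R) : R :=
  if n is m.+1 then Num.max (osc ys m f s) `|f s - shift0 f (ys m) s| else 0.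

Lemma osc_ge0 ys n f s : 0 <= osc ys n f s.
Proof. by elim: n => [|n IH] //=; rewrite le_max IH. Qed.

Lemma osc_mono ys n m f s : (n <= m)%N -> osc ys n f s <= osc ys m f s.
Proof.
move=> /subnK <-; elim: (m - n)%N => [|k IH]; first by rewrite add0n.
by rewrite addSn /= le_max IH.
Qed.

Lemma osc_ub ys n i f s : (i < n)%N -> `|f s - shift0 f (ys i) s| <= osc ys n f s.
Proof.
move=> hi; apply: le_trans (osc_mono ys f s hi).
by rewrite /= le_max lexx orbT.
Qed.

Lemma shift0_right_continuous (f : R -> R) (y s : R) : 0 <= y ->
  (forall x, 0 <= x -> f z @[z --> x^'+] --> f x) -> 0 <= s ->
  shift0 f y z @[z --> s^'+] --> shift0 f y s.
Proof.
move=> y0 cf s0; rewrite /shift0; have [ys|sy] := leP y s; last first.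
  apply: cvg_near_cst; near=> z; rewrite (_ : y <= z = false)//; apply/negbTE.
  by rewrite -ltNge; near: z; exact: nbhs_right_lt.
have h : f (z - y) @[z --> s^'+] --> f (s - y).
  apply/cvgrPdist_le => e e0; have sy0 : 0 <= s - y by rewrite subr_ge0.
  have /cvgrPdist_le/(_ e e0) := cf _ sy0.
  rewrite !near_withinE => -[r /= r0 hr]; exists r => //= z /= zr sz; apply: hr => /=.
    by rewrite opprB addrA subrK.
  by rewrite ltrD2r.
apply: cvg_trans h; apply: near_eq_cvg; near=> z; rewrite (_ : y <= z = true)//.
by apply: le_trans ys _; apply: ltW; near: z; exact: nbhs_right_gt.
Unshelve. all: by end_near. Qed.

Lemma osc_right_continuous ys n (f : R -> R) s : (forall i, 0 <= ys i) ->
  (forall x, 0 <= x -> f z @[z --> x^'+] --> f x) -> 0 <= s ->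
  osc ys n f z @[z --> s^'+] --> osc ys n f s.
Proof.
move=> y0 cf s0; elim: n => [|n IH] /=; first exact: cvg_cst.
have h : `|f z - shift0 f (ys n) z| @[z --> s^'+] --> `|f s - shift0 f (ys n) s|.
  by apply: cvg_norm; apply: cvgB; [exact: cf|exact: shift0_right_continuous].
under eq_fun do rewrite maxr_absE; rewrite maxr_absE.
apply: cvgMl; apply: cvgD; first exact: cvgD.
by apply: cvg_norm; apply: cvgB.
Qed.

Lemma measurable_shift0 d (T : measurableType d) (V : T -> R -> R) y s :
  (forall x, measurable_fun setT (V^~ x)) -> measurable_fun setT (fun w => shift0 (V w) y s).
Proof.
by move=> mV; rewrite /shift0; case: (y <= s); [exact: mV|exact: measurable_cst].
Qed.

Lemma measurable_osc d (T : measurableType d) ys n (V : T -> R -> R) s :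
  (forall x, measurable_fun setT (V^~ x)) -> measurable_fun setT (fun w => osc ys n (V w) s).
Proof.
move=> mV; elim: n => [|n IH] /=; first exact: measurable_cst.
apply: measurable_maxr => //; apply: measurableT_comp => //; apply: measurable_funB => //.
exact: measurable_shift0.
Qed.

Definition osc_set (j : nat) (delta : R) (f : R -> R) (t : R) : set (\bar R) :=
  [set ((`|f t - (if y <= t then f (t - y) else 0)| ^+ j)%R%:E) | y in `[0%R, delta[%classic].

Lemma osc_sup ys n (f : R -> R) s (j : nat) delta : (0 < j)%N ->
  (forall i, 0 <= ys i < delta) ->
  ((osc ys n f s ^+ j)%:E <= ereal_sup (osc_set j delta f s))%E.
Proof.
move=> j0 Hy; have mem i : osc_set j delta f s ((`|f s - shift0 f (ys i) s| ^+ j)%:E).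
  by exists (ys i) => //=; rewrite in_itv/=; exact: Hy.
elim: n => [|n IH] /=.
  rewrite expr0n gtn_eqF//=; apply: le_trans (ereal_sup_ubound (mem 0%N)).
  by rewrite lee_fin exprn_ge0.
by rewrite /Num.max; case: ifP => _ //; exact: ereal_sup_ubound.
Qed.

(** Powers of [1 + s] neither vanish nor blow up at [0]; they replace powers of [s] so that one
    moment bound holds for all [s >= 0]. *)
Lemma powr_shift_bounded (c a : R) : 0 < c -> exists2 D : R, 0 < D &
  (forall s, c <= s -> s `^ a <= D * (1 + s) `^ a) /\
  (forall s, 0 <= s <= c -> 1 <= D * (1 + s) `^ a).
Proof.
move=> c0.
have c1 : 0 < 1 + c by rewrite addr_gt0.
have [D1 D10 H1] := @powR_bounded R (c / (1 + c)) 1 a (divr_gt0 c0 c1).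
have [D2 D20 H2] := @powR_bounded R 1 (1 + c) a ltr01.
exists (D1 + D2); first exact: addr_gt0; split => s.
  move=> cs; have s0 : 0 < s by exact: lt_le_trans cs.
  have s1 : 0 < 1 + s by rewrite addr_gt0.
  have -> : s = s / (1 + s) * (1 + s) by rewrite divfK// gt_eqF.
  rewrite powRM ?divr_ge0 ?(ltW s0) ?(ltW s1)// divfK ?gt_eqF//.
  rewrite ler_wpM2r ?powR_ge0//.
  have [|h _] := H1 (s / (1 + s)).
    rewrite !ler_pdivrMr// mul1r mulrAC ler_pdivlMr//.
    by apply/andP; split; [nra|lra].
  by apply: le_trans h _; rewrite lerDl ltW.
move=> /andP[s0 sc]; have [|_ h] := H2 (1 + s); first by apply/andP; split; lra.
have p0 : 0 < (1 + s) `^ a by apply: powR_gt0; lra.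
have : 1 <= D2 * (1 + s) `^ a by rewrite -ler_pdivrMl// mulr1.
have : 0 <= D1 * (1 + s) `^ a by rewrite mulr_ge0 ?ltW.
by rewrite mulrDl; lra.
Qed.

Variables (d : measure_display) (T : measurableType d) (P : probability T R).
Variables (V : T -> R -> R) (delta C a : R) (j : nat).
Hypotheses (j0 : (0 < j)%N) (delta0 : 0 < delta) (C0 : 0 < C).
Hypothesis mV : forall x, measurable_fun setT (V^~ x).
Hypothesis HV : forall t, 0 < t ->
  (\int[P]_w ereal_sup (osc_set j delta (V w) t) <= (C * t `^ a)%:E)%E.

Lemma shift_moment (y t : R) : 0 <= y < delta -> 0 < t ->
  (\int[P]_w (`|V w t - shift0 (V w) y t| ^+ j)%:E <= (C * t `^ a)%:E)%E.
Proof.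
move=> yd t0; apply: le_trans (HV t0); apply: le_integral_all => w.
by apply: ereal_sup_ubound; exists y => //=; rewrite in_itv.
Qed.

Lemma norm_addX (x y : R) : `|x + y| ^+ j <= 2 ^+ j * (`|x| ^+ j + `|y| ^+ j).
Proof.
have h z : `|x + y| <= 2 * `|z| -> `|x + y| ^+ j <= 2 ^+ j * `|z| ^+ j.
  by move=> h; rewrite -exprMn lerXn2r ?nnegrE ?mulr_ge0.
have t0 := ler_normD x y.
have [xy|yx] := leP `|x| `|y|.
  have /h : `|x + y| <= 2 * `|y| by lra.
  have : 0 <= 2 ^+ j * `|x| ^+ j by rewrite mulr_ge0 ?exprn_ge0.
  by rewrite mulrDr; lra.
have /h : `|x + y| <= 2 * `|x| by lra.
have : 0 <= 2 ^+ j * `|y| ^+ j by rewrite mulr_ge0 ?exprn_ge0.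
by rewrite mulrDr; lra.
Qed.

Lemma integral_norm_addX (f g : T -> R) (A B : R) :
  measurable_fun setT f -> measurable_fun setT g ->
  (\int[P]_w (`|f w| ^+ j)%:E <= A%:E)%E -> (\int[P]_w (`|g w| ^+ j)%:E <= B%:E)%E ->
  (\int[P]_w (`|f w + g w| ^+ j)%:E <= (2 ^+ j * (A + B))%:E)%E.
Proof.
move=> mf mg hf hg.
have mX (f' : T -> R) : measurable_fun setT f' -> measurable_fun setT (fun w => (`|f' w| ^+ j)%:E).
  by move=> mf'; apply/measurable_EFinP; apply: measurable_funX; exact: measurableT_comp.
apply: (@le_trans _ _ (\int[P]_w ((2 ^+ j)%:E * ((`|f w| ^+ j)%:E + (`|g w| ^+ j)%:E)))%E).
  by apply: le_integral_all => w; rewrite -EFinD -EFinM lee_fin norm_addX.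
rewrite ge0_integralZl//; last 2 first.
- by apply: emeasurable_funD; exact: mX.
- by move=> w _; rewrite -EFinD lee_fin addr_ge0// exprn_ge0.
have -> : (\int[P]_x ((`|f x| ^+ j)%:E + (`|g x| ^+ j)%:E) =
    \int[P]_x (`|f x| ^+ j)%:E + \int[P]_x (`|g x| ^+ j)%:E)%E.
  by rewrite ge0_integralD//; first [exact: mX | move=> w _; rewrite lee_fin exprn_ge0].
by rewrite EFinM EFinD lee_wpmul2l ?lee_fin ?exprn_ge0// leeD.
Qed.

(** The oscillation bound may blow up as [t] tends to [0], so it is used at the single time
    [delta / 2]: a shift beyond that time yields [|V (delta / 2)|], and the shift [delta / 2 - s]
    yields [V (delta / 2) - V s]. *)
Lemma local_moment_first : exists B : R, forall s, 0 <= s <= delta / 2 ->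
  (\int[P]_w (`|V w s| ^+ j)%:E <= B%:E)%E.
Proof.
have d2 : 0 < delta / 2 by rewrite divr_gt0.
pose c := C * (delta / 2) `^ a.
exists (2 ^+ j * (c + c)) => s /andP[s0 sd].
have mS y : measurable_fun setT (fun w => V w (delta / 2) - shift0 (V w) y (delta / 2)).
  by apply: measurable_funB => //; exact: measurable_shift0.
have h1 := @shift_moment (3 / 4 * delta) _ _ d2.
have h2 := @shift_moment (delta / 2 - s) _ _ d2.
have y1 : 0 <= 3 / 4 * delta < delta by have := delta0; lra.
have y2 : 0 <= delta / 2 - s < delta by have := delta0; lra.
have mN : measurable_fun setT (fun w => - (V w (delta / 2) - shift0 (V w) (delta / 2 - s) (delta / 2))).
  exact: measurable_funN.
have := integral_norm_addX (mS (3 / 4 * delta)) mN (h1 y1).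
rewrite (_ : (\int[P]_w (`|- (V w (delta / 2) - shift0 (V w) (delta / 2 - s) (delta / 2))| ^+ j)%:E)%E =
  (\int[P]_w (`|(V w (delta / 2) - shift0 (V w) (delta / 2 - s) (delta / 2))| ^+ j)%:E)%E); last first.
  by apply: eq_integral => w _; rewrite normrN.
move=> /(_ _ (h2 y2)); apply: le_trans; apply: le_integral_all => w.
rewrite lee_fin /shift0 (_ : 3 / 4 * delta <= delta / 2 = false); last first.
  by apply/negbTE; rewrite -ltNge; have := delta0; lra.
rewrite (_ : delta / 2 - s <= delta / 2 = true); last by lra.
by rewrite subr0 opprB addrA addrC addrA addNr add0r subKr.
Qed.

Lemma local_moment (M : R) : exists B : R, forall s, 0 <= s <= M ->
  (\int[P]_w (`|V w s| ^+ j)%:E <= B%:E)%E.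
Proof.
have d2 : 0 < delta / 2 by rewrite divr_gt0.
suff H n : exists B : R, forall s, 0 <= s <= n.+1%:R * (delta / 2) ->
    (\int[P]_w (`|V w s| ^+ j)%:E <= B%:E)%E.
  have [B HB] := H (Num.truncn (M / (delta / 2))).
  exists B => s /andP[s0 sM]; apply: HB; rewrite s0 (le_trans sM)//.
  by rewrite -ler_pdivrMr// ltW// truncnS_gt.
elim: n => [|n [B IH]].
  have [B HB] := local_moment_first; exists B => s; rewrite mul1r; exact: HB.
have [K K0 HK] := @powR_bounded R (delta / 2) (n.+2%:R * (delta / 2)) a d2.
exists (Num.max B (2 ^+ j * (B + C * K))) => s /andP[s0 sn].
have [sn'|sn'] := leP s (n.+1%:R * (delta / 2)).
  by apply: (@le_trans _ _ B%:E); [apply: IH; rewrite s0|rewrite lee_fin le_max lexx].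
have sd : delta / 2 < s.
  by apply: le_lt_trans sn'; rewrite ler_peMl ?ler1n// ltW.
apply: (@le_trans _ _ (2 ^+ j * (B + C * K))%:E); last by rewrite lee_fin le_max lexx orbT.
have y2 : 0 <= delta / 2 < delta by have := delta0; lra.
have s0' : 0 < s by exact: lt_trans sd.
have h := shift_moment y2 s0'.
have h' : (\int[P]_w (`|V w s - shift0 (V w) (delta / 2) s| ^+ j)%:E <= (C * K)%:E)%E.
  apply: le_trans h _; rewrite lee_fin ler_wpM2l ?(ltW C0)//.
  by have [] := HK s; first by rewrite (ltW sd).
have hh := integral_norm_addX (mV (s - delta / 2)) _ (IH (s - delta / 2) _) h'.
apply: le_trans (hh _ _).
- apply: le_integral_all => w.
  by rewrite lee_fin {1}/shift0 (ltW sd) [X in _ <= `|X| ^+ _]addrC subrK.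
- by apply: measurable_funB => //; exact: measurable_shift0.
rewrite subr_ge0 ltW//= lerBlDr; apply: le_trans sn _.
by rewrite -[X in X%:R](addn1 n.+1) natrD mulrDl mul1r.
Qed.

(** Away from [0] the hypothesis applies directly. For [s < delta / 2] all values entering the
    oscillation at [s] are reached by admissible shifts from [delta / 2], at the price of a factor
    [4]. *)
Lemma osc_moment : exists2 A : R, 0 < A & forall ys n s, (forall i, 0 <= ys i < delta) -> 0 <= s ->
  (\int[P]_w (osc ys n (V w) s ^+ j)%:E <= (A * (1 + s) `^ a)%:E)%E.
Proof.
have d2 : 0 < delta / 2 by rewrite divr_gt0.
have [D D0 [H1 H2]] := powr_shift_bounded a d2.
pose B' := 4 ^+ j * (C * (delta / 2) `^ a).
have B'0 : 0 <= B' by rewrite mulr_ge0 ?exprn_ge0 ?mulr_ge0 ?powR_ge0// ltW.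
exists (D * (C + B' + 1)) => [|ys n s Hy s0].
  by rewrite mulr_gt0//; have := C0; lra.
have [sd|sd] := leP (delta / 2) s.
  have s0' : 0 < s by exact: lt_le_trans sd.
  apply: (@le_trans _ _ (C * s `^ a)%:E).
    apply: le_trans (HV s0'); apply: le_integral_all => w; exact: osc_sup.
  rewrite lee_fin; apply: (@le_trans _ _ (C * (D * (1 + s) `^ a))).
    by rewrite ler_wpM2l ?(ltW C0)// H1.
  rewrite mulrA ler_wpM2r ?powR_ge0// mulrC ler_wpM2l ?(ltW D0)//.
  by lra.
(* Index [0] is a shift past the origin and gives [|V (delta / 2)|]; index [1] reaches [s]; index
   [k.+2] reaches [s - ys k], or again [s] when that time is negative. *)
pose zs i := if i is i'.+1 then
  (if i' is k.+1 then delta / 2 - s + (if ys k <= s then ys k else 0) else delta / 2 - s)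
  else 3 / 4 * delta.
have Hz i : 0 <= zs i < delta.
  have d0 := delta0; case: i => [|[|k]] /=; [lra|lra|].
  by have := Hy k; case: (leP (ys k) s) => h; lra.
have key w : osc ys n (V w) s <= 4 * osc zs n.+2 (V w) (delta / 2).
  have V0 : `|V w (delta / 2)| <= osc zs n.+2 (V w) (delta / 2).
    have := @osc_ub zs n.+2 0 (V w) (delta / 2) isT; rewrite /shift0 {1}/zs.
    by rewrite (_ : 3 / 4 * delta <= delta / 2 = false) ?subr0//; apply/negbTE; rewrite -ltNge; have := delta0; lra.
  have Vr i r : (i < n.+2)%N -> r <= delta / 2 -> 0 <= r -> zs i = delta / 2 - r ->
      `|V w r| <= 2 * osc zs n.+2 (V w) (delta / 2).
    move=> hi rd r0 hz; have := @osc_ub zs n.+2 i (V w) (delta / 2) hi; rewrite /shift0 hz.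
    rewrite (_ : delta / 2 - r <= delta / 2 = true); last by lra.
    rewrite subKr => h; have := ler_normB (V w (delta / 2)) (V w (delta / 2) - V w r).
    by rewrite subKr; lra.
  have O0 := osc_ge0 zs n.+2 (V w) (delta / 2).
  have Vs : `|V w s| <= 2 * osc zs n.+2 (V w) (delta / 2).
    by apply: (Vr 1%N) => //; exact: ltW.
  suff h k : (k <= n)%N -> osc ys k (V w) s <= 4 * osc zs n.+2 (V w) (delta / 2) by exact: h.
  elim: k => [_|k IH kn]; first by rewrite [leLHS]/= mulr_ge0.
  move: (osc zs n.+2 (V w) (delta / 2)) V0 Vr O0 Vs IH => O V0 Vr O0 Vs IH.
  rewrite /= ge_max; apply/andP; split; first by apply: IH; exact: ltnW.
  apply: le_trans (ler_normB _ _) _; rewrite /shift0.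
  have [ks|ks] := leP (ys k) s; last by rewrite normr0; lra.
  have : `|V w (s - ys k)| <= 2 * O.
    have /andP[yk0 ykd] := Hy k.
    by apply: (Vr k.+2) => //; [lra|lra|rewrite /= ks; lra].
  by lra.
apply: (@le_trans _ _ (\int[P]_w ((4 ^+ j)%:E * (osc zs n.+2 (V w) (delta / 2) ^+ j)%:E))%E).
  apply: le_integral_all => w; rewrite -EFinM lee_fin -exprMn lerXn2r ?nnegrE ?osc_ge0//.
  by rewrite mulr_ge0 ?osc_ge0.
rewrite ge0_integralZl//; last 2 first.
- by apply/measurable_EFinP; apply: measurable_funX; exact: measurable_osc.
- by move=> w _; rewrite lee_fin exprn_ge0// osc_ge0.
apply: (@le_trans _ _ ((4 ^+ j)%:E * (C * (delta / 2) `^ a)%:E)%E).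
  rewrite lee_wpmul2l ?lee_fin ?exprn_ge0//.
  by apply: le_trans (HV d2); apply: le_integral_all => w; exact: osc_sup.
rewrite -EFinM lee_fin -/B'.
have h2 : 1 <= D * (1 + s) `^ a by apply: H2; rewrite s0 ltW.
rewrite mulrAC; apply: (@le_trans _ _ (1 * (C + B' + 1))); last first.
  by rewrite ler_wpM2r//; have := C0; lra.
by have := C0; lra.
Qed.

End oscillation.

Lemma cvg_maxr {R : realType} {T : Type} (F : set_system T) {FF : Filter F} (f g : T -> R) (a b : R) :
  f @ F --> a -> g @ F --> b -> (fun z => Num.max (f z) (g z)) @ F --> Num.max a b.
Proof.
move=> fa gb; under eq_fun do rewrite maxr_absE; rewrite maxr_absE.
apply: cvgMl; apply: cvgD; first exact: cvgD.
by apply: cvg_norm; apply: cvgB.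
Qed.

Lemma cvg_exprn {R : realType} {T : Type} (F : set_system T) {FF : Filter F} (f : T -> R) (a : R) n :
  f @ F --> a -> (fun z => f z ^+ n) @ F --> a ^+ n.
Proof.
by move=> fa; apply: (@continuous_cvg _ _ _ _ _ _ (fun x : R => x ^+ n)) => //; exact: exprn_continuous.
Qed.

(** * Moment bounds for shot noise at a fixed time *)

Section shot_noise.
Context d (T : measurableType d) (R : realType) (P : probability T R).
Variable S : nat -> set (set T).
Hypothesis Ssig : forall k, sigma_algebra setT (S k).
Hypothesis Smeas : forall k A, S k A -> measurable A.
Hypothesis Sind : indep_sigma P S.
Variable xi : nat -> T -> R.
Hypothesis xiS : forall k, adapted (S k) (xi k).
Variable V : nat -> T -> R -> R.
Hypothesis aV : forall k s, 0 <= s -> adapted (S k) (V k ^~ s).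
Hypothesis cV : forall k w s, 0 <= s -> V k w y @[y --> s^'+] --> V k w s.
Variables (m : nat -> R -> R) (l : nat) (b x : R).
Hypothesis l0 : (0 < l)%N.
Hypothesis b0 : 0 < b.
Hypothesis mm : forall j, measurable_fun setT (m j).
Hypothesis m0 : forall j s, 0 <= s -> 0 <= m j s.
Hypothesis cm : forall j s, 0 <= s -> m j y @[y --> s^'+] --> m j s.
Hypothesis Hp : forall k s, 0 <= s -> (\int[P]_w (Num.max (V k w s) 0)%:E <=
  \int[P]_w (Num.max (- V k w s) 0)%:E + (m 1 s)%:E)%E.
Hypothesis Hn : forall k s, 0 <= s -> (\int[P]_w (Num.max (- V k w s) 0)%:E <=
  \int[P]_w (Num.max (V k w s) 0)%:E + (m 1 s)%:E)%E.
Hypothesis Hj : forall k s j, (2 <= j <= 2 * l)%N -> 0 <= s ->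
  (\int[P]_w (`|V k w s| ^+ j)%:E <= (m j s)%:E)%E.

Let ind k w : R := (walk xi k w <= x)%R%:R.
Let s k w : R := Num.max (x - walk xi k w) 0.
(** [V k] is evaluated at a time given by the past and is independent of it, so freezing turns the
    hypotheses on [V] at fixed times into conditional bounds for [D]. *)
Let D k w : R := if walk xi k w <= x then V k w (x - walk xi k w) else 0.
(** All normalised moments are summed, so that the single quantity [b ^+ j * W k] dominates the
    conditional moment of every order [j]. *)
Let W k w : R := if walk xi k w <= x then
  \sum_(1 <= j < (2 * l).+1) m j (x - walk xi k w) / b ^+ j else 0.

Let s0 k w : 0 <= s k w. Proof. by rewrite le_max lexx orbT. Qed.

Let as_ k : adapted (past S k) (s k).
Proof.
apply: measurable_maxr => //; apply: measurable_funB => //.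
exact: (adapted_walk xiS (leqnn k)).
Qed.

Let aind k : adapted (past S k) (ind k).
Proof.
have -> : ind k = \1_(walk xi k @^-1` `]-oo, x]%classic).
  apply/funext => w; rewrite /ind indicE; congr (_%:R); congr nat_of_bool.
  by apply/idP/idP; rewrite inE/= in_itv.
apply: measurable_indic.
exact: (adapted_preimage (adapted_walk xiS (leqnn k)) (measurable_itv _)).
Qed.

Let DE k w : D k w = ind k w * V k w (s k w).
Proof.
rewrite /D /ind /s; case: leP => h; last by rewrite mul0r.
by rewrite mul1r max_l// subr_ge0.
Qed.

Let WE k w : W k w = ind k w * \sum_(1 <= j < (2 * l).+1) m j (s k w) / b ^+ j.
Proof.
rewrite /W /ind /s; case: leP => h; last by rewrite mul0r.
by rewrite mul1r max_l// subr_ge0.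
Qed.

Let W0 k w : 0 <= W k w.
Proof.
rewrite WE mulr_ge0// sumr_ge0// => j _; rewrite divr_ge0 ?m0// exprn_ge0//.
exact: ltW.
Qed.

Let aW k : adapted (past S k) (W k).
Proof.
rewrite (_ : W k = fun w => ind k w * \sum_(1 <= j < (2 * l).+1) m j (s k w) / b ^+ j); last first.
  by apply/funext => w; rewrite WE.
apply: measurable_funM; first exact: (@aind k).
apply: measurable_sum => j; apply: measurable_funM => //.
apply: measurableT_comp; [exact: mm|exact: (@as_ k)].
Qed.

Let sub1 k : past S k `<=` <<s past S k.+1 >>.
Proof. by move=> A pA; apply: sub_sigma_algebra; exact: past_leq (leqnSn k) _ pA. Qed.

Let sub2 k : S k `<=` <<s past S k.+1 >>.
Proof. by move=> A pA; apply: sub_sigma_algebra; exists k. Qed.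

Let aD k : adapted (past S k.+1) (D k).
Proof.
rewrite (_ : D k = fun w => ind k w * V k w (s k w)); last first.
  by apply/funext => w; rewrite DE.
apply: measurable_funM; first exact: (adapted_past_leq (leqnSn k) (@aind k)).
exact: (adapted_frozen (@sub1 k) (@sub2 k) (@as_ k) (s0 k) (@aV k) (@cV k)).
Qed.

Let frz k (U : T -> R) (V' : T -> R -> R) : adapted (past S k) U -> (forall w, 0 <= U w) ->
  (forall x, 0 <= x -> adapted (S k) (V'^~ x)) ->
  (forall w x, 0 <= x -> V' w y @[y --> x^'+] --> V' w x) ->
  (forall w x, 0 <= x -> 0 <= V' w x) ->
  (\int[P]_w (U w * V' w (s k w))%:E = \int[P]_w ((U w)%:E * \int[P]_w' (V' w' (s k w))%:E))%E.
Proof.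
move=> aU U0 aV' cV' V'0.
have ind' A B : <<s past S k >> A -> <<s S k >> B -> P (A `&` B) = (P A * P B)%E.
  move=> pA sB; apply: (@past_indep _ _ _ P S Ssig Smeas Sind k) => //.
  by move: B sB; apply: smallest_sub.
exact (@freezing _ _ _ P (past S k) (S k) (@past_measurable _ _ S Smeas k) (@Smeas k) ind'
  U V' (s k) aU U0 (@as_ k) (s0 k) aV' cV' V'0).
Qed.

Let aUi k (U : T -> R) : adapted (past S k) U -> adapted (past S k) (fun w => U w * ind k w).
Proof. by move=> aU; apply: measurable_funM => //; exact: (@aind k). Qed.

Let m_le_W k w j : (1 <= j <= 2 * l)%N -> ind k w * m j (s k w) <= b ^+ j * W k w.
Proof.
move=> /andP[j1 jl]; rewrite WE mulrCA ler_wpM2l//.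
have bj : 0 < b ^+ j by rewrite exprn_gt0.
rewrite mulrC -ler_pdivrMr//.
rewrite (@big_cat_nat _ _ _ j)//= ?(leq_trans jl)// (@big_ltn _ _ _ j)//= addrCA lerDl.
by rewrite addr_ge0//; apply: sumr_ge0 => i _; rewrite divr_ge0 ?m0// exprn_ge0// ltW.
Qed.

Let HDj k U j : (2 <= j <= 2 * l)%N -> adapted (past S k) U -> (forall w, 0 <= U w) ->
  (\int[P]_w (U w * `|D k w| ^+ j)%:E <= \int[P]_w (U w * (1 * b ^+ j * W k w))%:E)%E.
Proof.
move=> hj aU U0; have j0 : (0 < j)%N by case/andP: hj => /ltnW.
have -> : (\int[P]_w (U w * `|D k w| ^+ j)%:E =
    \int[P]_w (U w * ind k w * `|V k w (s k w)| ^+ j)%:E)%E.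
  apply: eq_integral => w _; rewrite DE normrM exprMn ger0_norm//; congr EFin.
  by rewrite /ind; case: leP => _; rewrite ?expr1n ?expr0n ?gtn_eqF//= ?mulr1 ?mul1r// mulr0 !mul0r mulr0.
rewrite (@frz k (fun w => U w * ind k w) (fun w y => `|V k w y| ^+ j)).
- apply: le_integral_all => w; rewrite mul1r.
  apply: (@le_trans _ _ ((U w * ind k w)%:E * (m j (s k w))%:E)%E).
    by rewrite lee_wpmul2l ?lee_fin ?mulr_ge0//; apply: Hj.
  rewrite -EFinM lee_fin -mulrA ler_wpM2l// m_le_W//.
  by case/andP: hj => /ltnW -> ->.
- exact: aUi.
- by move=> w; rewrite mulr_ge0.
- move=> y y0; apply: measurable_funX; apply: measurableT_comp => //.
  exact: (@aV k y y0).
- by move=> w y y0; apply: cvg_exprn; apply: cvg_norm; exact: cV.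
- by move=> w y y0; rewrite exprn_ge0.
Qed.

(** Stated for abstract [f] and [g] so that both signs of the conditional mean are covered, with [f]
    and [g] the positive and negative parts in either order. *)
Let half k U (f g : R -> R) : continuous f -> continuous g ->
  measurable_fun setT f -> measurable_fun setT g ->
  (forall y, 0 <= f y) -> (forall y, 0 <= g y) -> f 0 = 0 -> g 0 = 0 ->
  (forall y, 0 <= y -> (\int[P]_w (f (V k w y))%:E <= \int[P]_w (g (V k w y))%:E + (m 1 y)%:E)%E) ->
  adapted (past S k) U -> (forall w, 0 <= U w) ->
  (\int[P]_w (U w * f (D k w))%:E <=
   \int[P]_w (U w * g (D k w))%:E + \int[P]_w (U w * (1 * b * W k w))%:E)%E.
Proof.
move=> cf cg mf mg f0 g0 f00 g00 H aU U0.
have mU := adapted_measurable (@past_measurable _ _ S Smeas k) aU.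
have mi := adapted_measurable (@past_measurable _ _ S Smeas k) (@aind k).
have ms := adapted_measurable (@past_measurable _ _ S Smeas k) (@as_ k).
have mD := adapted_measurable (@past_measurable _ _ S Smeas k.+1) (@aD k).
have fE (h : R -> R) w : h 0 = 0 -> U w * h (D k w) = U w * ind k w * h (V k w (s k w)).
  move=> h00; rewrite DE /ind; case: leP => _; first by rewrite mul1r mulr1.
  by rewrite mul0r h00 !mulr0 mul0r.
have mV y : 0 <= y -> measurable_fun setT (V k ^~ y).
  by move=> y0; exact: (adapted_measurable (@Smeas k) (@aV k y y0)).
under eq_integral do rewrite fE//.
rewrite (@frz k (fun w => U w * ind k w) (fun w y => f (V k w y))).
- apply: (@le_trans _ _ (\int[P]_w ((U w * ind k w)%:E *
      \int[P]_w' (g (V k w' (s k w)) + m 1 (s k w))%:E))%E).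
    apply: le_integral_all => w; rewrite lee_wpmul2l ?lee_fin ?mulr_ge0//.
    apply: le_trans (H _ (s0 k w)) _.
    under [leRHS]eq_integral do rewrite EFinD.
    rewrite ge0_integralD//.
    + by rewrite integral_prob_cst.
    + by move=> w' _; rewrite lee_fin.
    + by apply/measurable_EFinP; apply: measurableT_comp => //; exact: mV.
    + by move=> w' _; rewrite lee_fin m0.
  rewrite -(@frz k (fun w => U w * ind k w) (fun w y => g (V k w y) + m 1 y)).
  + under eq_integral do rewrite mulrDr -fE// EFinD.
    rewrite ge0_integralD//.
    * rewrite leeD2l//; apply: le_integral_all => w; rewrite lee_fin mul1r -mulrA ler_wpM2l//.
      by have := @m_le_W k w 1; rewrite expr1; apply; rewrite /= ltnW// mulnC; case: (l) l0.
    * by move=> w _; rewrite lee_fin mulr_ge0.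
    * apply/measurable_EFinP; apply: measurable_funM => //.
      exact: measurableT_comp.
    * by move=> w _; rewrite lee_fin !mulr_ge0// m0.
    * apply/measurable_EFinP; apply: measurable_funM; first exact: measurable_funM.
      by apply: measurableT_comp.
  + exact: aUi.
  + by move=> w; rewrite mulr_ge0.
  + move=> y y0; apply: measurable_funD => //; apply: (@measurableT_comp _ _ _ _ _ _ g) => //.
    exact: (@aV k y y0).
  + move=> w y y0; apply: cvgD; last exact: cm.
    by apply: continuous_cvg; [exact: cg|exact: cV].
  + by move=> w y y0; rewrite addr_ge0// m0.
- exact: aUi.
- by move=> w; rewrite mulr_ge0.
- move=> y y0; apply: (@measurableT_comp _ _ _ _ _ _ f) => //.
  exact: (@aV k y y0).
- by move=> w y y0; apply: continuous_cvg; [exact: cf|exact: cV].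
- by move=> w y y0.
Qed.

(** The exceptional event does not depend on the condition that the sum of the [W k] is at most [1];
    that condition is later supplied by the renewal estimates. *)
Lemma shot_noise_bound (n : nat) (th : R) : 0 < th ->
  exists A, [/\ measurable A,
    (P A <= (expR ((2 ^+ (2 * l) + 2 * (2 * l)%:R) * 1) * (b / th) ^+ (2 * l))%:E)%E &
    forall w, ~ A w ->
      \sum_(k < n) (if walk xi k w <= x then
        \sum_(1 <= j < (2 * l).+1) m j (x - walk xi k w) / b ^+ j else 0) <= 1 ->
      `|\sum_(k < n) (if walk xi k w <= x then V k w (x - walk xi k w) else 0)| < th].
Proof.
move=> th0.
have c1 : continuous (fun y : R => Num.max y 0).
  by move=> y; apply: cvg_maxr; [exact: cvg_id|exact: cvg_cst].
have c2 : continuous (fun y : R => Num.max (- y) 0).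
  by move=> y; apply: cvg_maxr; [apply: cvgN; exact: cvg_id|exact: cvg_cst].
have m1 : measurable_fun setT (fun y : R => Num.max y 0) by apply: measurable_maxr.
have m2 : measurable_fun setT (fun y : R => Num.max (- y) 0).
  by apply: measurable_maxr => //; exact: measurable_funN.
have p0 (y : R) : 0 <= Num.max y 0 by rewrite le_max lexx orbT.
have z1 : Num.max (0 : R) 0 = 0 by rewrite maxxx.
have z2 : Num.max (- 0 : R) 0 = 0 by rewrite oppr0 maxxx.
apply: (@moment_bound _ _ _ P S Smeas D W b 1 l l0 b0 ler01 aD aW W0) => //.
- move=> k U aU U0.
  exact (@half k U _ _ c1 c2 m1 m2 p0 (fun y => p0 (- y)) z1 z2 (@Hp k) aU U0).
- move=> k U aU U0.
  exact (@half k U _ _ c2 c1 m2 m1 (fun y => p0 (- y)) p0 z2 z1 (@Hn k) aU U0).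
Qed.

End shot_noise.

(** * Sums over the random walk *)

Lemma ler_powRl {R : realType} (u v r : R) : 0 < u -> u <= v -> 0 <= r -> u `^ r <= v `^ r.
Proof.
move=> u0 uv r0; apply: ge0_ler_powR => //; rewrite nnegrE; apply: ltW => //.
exact: lt_le_trans uv.
Qed.

Lemma ler_powRl_neg {R : realType} (u v r : R) : 0 < u -> u <= v -> r <= 0 -> v `^ r <= u `^ r.
Proof.
move=> u0 uv r0; have v0 : 0 < v by exact: lt_le_trans uv.
have r0' : 0 <= - r by rewrite oppr_ge0.
have := ler_powRl u0 uv r0'; rewrite !powRN lef_pV2 ?posrE ?powR_gt0//.
Qed.

Lemma powR_ge1 {R : realType} (u r : R) : 1 <= u -> 0 <= r -> 1 <= u `^ r.
Proof. by move=> u1 r0; rewrite -[leLHS](powRr0 u); exact: ler_powR. Qed.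

Section shells.
Context d (T : measurableType d) (R : realType) (xi : nat -> T -> R).

(** Each walk point below [x] is charged to the dyadic shell containing its distance to [x]; the
    last level [I] collects all points within [t / 2 ^+ I], where shells would no longer be
    controlled. *)
Lemma shell_sum (N I i0 : nat) (t x : R) (w : T) (phi : R -> R) (Phi : nat -> R) : 0 < t ->
  (i0 <= I)%N -> (forall i, 0 <= Phi i) ->
  (forall i s, (i0 <= i < I)%N -> t / 2 ^+ i.+1 < s <= t / 2 ^+ i -> phi s <= Phi i) ->
  (forall s, 0 <= s <= t / 2 ^+ I -> phi s <= Phi I) ->
  \sum_(k < N) (if (0 < walk xi k w) && (x - t / 2 ^+ i0 <= walk xi k w <= x)
                then phi (x - walk xi k w) else 0) <=
  \sum_(i0 <= i < I.+1) Phi i * (window_count xi N x (t / 2 ^+ i) w)%:R.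
Proof.
move=> t0 i0I Phi0 H1 H2; rewrite /window_count.
under [leRHS]eq_bigr do rewrite natr_sum mulr_sumr.
rewrite exchange_big/=; apply: ler_sum => k _.
have nn i : 0 <= Phi i * ((0 < walk xi k w) && (x - t / 2 ^+ i <= walk xi k w <= x) : nat)%:R.
  by rewrite mulr_ge0.
case: ifP => [/and3P[s0 sl sx]|_]; last by rewrite sumr_ge0.
set s := walk xi k w in s0 sl sx nn *.
have pick i : (i0 <= i <= I)%N -> x - s <= t / 2 ^+ i -> phi (x - s) <= Phi i ->
    phi (x - s) <= \sum_(i0 <= j < I.+1) Phi j * ((0 < s) && (x - t / 2 ^+ j <= s <= x) : nat)%:R.
  move=> /andP[ii iI] hs hp; rewrite (@big_cat_nat _ _ _ i)//= ?(leq_trans iI)//.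
  rewrite (@big_ltn _ _ _ i)//= s0 sx (_ : x - t / 2 ^+ i <= s = true) ?mulr1; last by lra.
  have n2 j : 0 <= Phi j * [&& true, x - t / 2 ^+ j <= s & true]%:R by rewrite mulr_ge0.
  by rewrite addrCA ler_wpDr// addr_ge0// sumr_ge0.
have [hI|hI] := leP (x - s) (t / 2 ^+ I).
  apply: (pick I); [by rewrite i0I leqnn|by []|].
  by apply: H2; rewrite subr_ge0 sx.
have ex : exists i, (i0 <= i)%N && (t / 2 ^+ i.+1 < x - s).
  by exists I; rewrite i0I/=; apply: lt_trans hI; rewrite ltr_pM2l// ltf_pV2 ?posrE ?exprn_gt0// ltr_eXn2l// ltr1n.
case: (ex_minnP ex) => i /andP[ii hi] imin.
have hi' : x - s <= t / 2 ^+ i.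
  move: ii; rewrite leq_eqVlt => /orP[/eqP <-|ii]; first by lra.
  rewrite leNgt; apply/negP => h; case: i ii h imin {hi} => // i ii h /(_ i).
  by rewrite -ltnS ii h => /(_ isT); rewrite ltnn.
have iI : (i < I)%N.
  rewrite ltnNge; apply/negP => Ii; have := lt_le_trans hI hi'; rewrite ltNge => /negP; apply.
  by rewrite ler_pM2l// lef_pV2 ?posrE ?exprn_gt0// ler_eXn2l// ltr1n.
by apply: (pick i) => //; [rewrite ii ltnW|apply: H1; rewrite ?ii ?hi].
Qed.

Lemma powR_le_double (u v r : R) : 0 < u -> u <= v -> v <= 2 * u -> u `^ r <= 2 `^ `|r| * v `^ r.
Proof.
move=> u0 uv vu; have v0 : 0 < v by exact: lt_le_trans uv.
have [r0|r0] := leP 0 r.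
  apply: le_trans (ler_powRl u0 uv r0) _; rewrite ler_peMl ?powR_ge0//.
  by apply: powR_ge1; rewrite ?ler1n.
have -> : v `^ r = (v / 2) `^ r * 2 `^ r.
  by rewrite -powRM ?divfK// ltW// divr_gt0.
rewrite mulrCA -powRD ?pnatr_eq0 ?implybT// ler0_norm ?(ltW r0)// addNr powRr0 mulr1.
by apply: ler_powRl_neg; [rewrite divr_gt0|lra|exact: ltW].
Qed.

Lemma powR_le_max (v V c : R) : 1 <= v -> v <= V -> v `^ c <= Num.max 1 (V `^ c).
Proof.
move=> v1 vV; rewrite le_max; have v0 : 0 < v by exact: lt_le_trans v1.
have [c0|c0] := leP 0 c; first by rewrite ler_powRl ?orbT.
by rewrite -[X in _ <= X](powRr0 v) ler_powR// ltW.
Qed.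

Lemma window_power_sum (N I : nat) (t x Q a r : R) (w : T) : 0 < t -> t <= 2 ^+ I ->
  0 <= x <= t -> 0 <= Q ->
  (forall i, (i < I.+1)%N -> (window_count xi N x (t / 2 ^+ i) w)%:R <= Q * (1 + t / 2 ^+ i) `^ a) ->
  \sum_(k < N) (if (0 < walk xi k w) && (walk xi k w <= x) then (1 + (x - walk xi k w)) `^ r else 0) <=
  I.+1%:R * (2 `^ `|r| * Q * Num.max 1 ((1 + t) `^ (r + a))).
Proof.
move=> t0 tI /andP[x0 xt] Q0 H.
have ti i : 0 < t / 2 ^+ i by rewrite divr_gt0 ?exprn_gt0.
have tI1 : t / 2 ^+ I <= 1 by rewrite ler_pdivrMr ?exprn_gt0// mul1r.
pose Phi i : R := 2 `^ `|r| * (1 + t / 2 ^+ i) `^ r.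
have := @shell_sum N I 0 t x w (fun s => (1 + s) `^ r) Phi t0 (leq0n I) _ _ _.
rewrite expr0 divr1 => h; apply: le_trans (le_trans (h _ _ _) _).
- apply: ler_sum => k _; case: ifP => [/andP[s0 sx]|_]; last by case: ifP => _ //; exact: powR_ge0.
  by rewrite s0 sx (_ : x - t <= walk xi k w = true)//; lra.
- by move=> i; rewrite mulr_ge0 ?powR_ge0.
- move=> i s /andP[_ iI] /andP[s1 s2]; apply: powR_le_double.
  + by apply: addr_gt0 => //; exact: lt_trans (ti _) s1.
  + by rewrite lerD2l.
  + move: s1; rewrite exprS invfM mulrCA -ltr_pdivlMl ?invr_gt0// invrK.
    by lra.
- move=> s /andP[s0 s1]; apply: powR_le_double; [lra|by rewrite lerD2l|lra].
apply: (@le_trans _ _ (\sum_(0 <= i < I.+1) 2 `^ `|r| * Q * Num.max 1 ((1 + t) `^ (r + a)))).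
  rewrite big_nat [leRHS]big_nat; apply: ler_sum => i /= iI.
  apply: le_trans (ler_wpM2l _ (H i iI)) _; first by rewrite mulr_ge0 ?powR_ge0.
  rewrite (_ : Phi i * _ = 2 `^ `|r| * Q * ((1 + t / 2 ^+ i) `^ r * (1 + t / 2 ^+ i) `^ a)); last by rewrite /Phi; ring.
  rewrite -powRD; last by apply/implyP => _; rewrite gt_eqF// addr_gt0.
  rewrite ler_wpM2l ?mulr_ge0 ?powR_ge0// powR_le_max//.
    by rewrite lerDl ltW.
  rewrite lerD2l ler_pdivrMr ?exprn_gt0//; apply: ler_peMr; first exact: ltW.
  by rewrite exprn_ege1// ler1n.
by rewrite sumr_const_nat subn0 -[leLHS]mulr_natl.
Qed.

End shells.

Lemma pow2_cover {R : realType} (t : R) : 1 <= t -> exists I : nat, t <= 2 ^+ I /\ 2 ^+ I <= 2 * t.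
Proof.
move=> t1; have ex : exists I : nat, t <= 2 ^+ I.
  exists (Num.truncn t).+1; apply: ltW; apply: lt_le_trans (truncnS_gt t) _.
  by rewrite -natrX ler_nat; exact: ltnW (ltn_expl _ _).
case: (ex_minnP ex) => -[|I] tI Imin; [exists 0%N|exists I.+1]; split => //; first by rewrite expr0; lra.
rewrite exprS ler_pM2l//; apply: ltW; rewrite ltNge; apply/negP => h.
by have := Imin _ h; rewrite ltnn.
Qed.

(** The second identity reads the cost [q ^+ I] as the power [2 / n] of the ratio of scales, which
    is as small an exponent as wanted. *)
Lemma root_of_4 {R : realType} (n : nat) : (0 < n)%N ->
  exists2 q : R, 1 < q & q ^+ n = 4 /\ forall I, q ^+ I = (2 ^+ I) `^ (2 / n%:R).
Proof.
move=> n0; have n0' : 0 < n%:R :> R by rewrite ltr0n.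
exists (4 `^ n%:R^-1).
  rewrite /powR pnatr_eq0/= expR_gt1 mulr_gt0 ?invr_gt0// ln_gt0//.
  by rewrite ltr1n.
split; first by rewrite -powR_mulrn ?powR_ge0// -powRrM mulVf ?gt_eqF// powRr1.
move=> I; rewrite -powR_mulrn ?powR_ge0// -powRrM.
have -> : (4 : R) = 2 `^ 2%:R by rewrite powR_mulrn// expr2; ring.
have -> : (2 ^+ I : R) = 2 `^ I%:R by rewrite powR_mulrn.
rewrite -!powRrM; congr (_ `^ _).
by field; rewrite gt_eqF.
Qed.

Section renewal_sums.
Context d (T : measurableType d) (R : realType) (P : probability T R).
Variable S : nat -> set (set T).
Hypothesis Ssig : forall k, sigma_algebra setT (S k).
Hypothesis Smeas : forall k A, S k A -> measurable A.
Hypothesis Sind : indep_sigma P S.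
Variable xi : nat -> T -> R.
Hypothesis xiS : forall k, adapted (S k) (xi k).
Hypothesis xi0 : forall k w, 0 <= xi k w.
Variable N0 : set T.
Hypothesis mN0 : measurable N0.
Hypothesis PN0 : P N0 = 0%E.
Hypothesis xiN0 : forall w, ~ N0 w -> forall k, 0 < xi k w.
Variables (p : R -> R) (alpha : R).
Hypothesis alpha0 : 0 < alpha.
Hypothesis p01 : forall y, 0 < p y <= 1.
Hypothesis pdec : forall y z, y <= z -> p z <= p y.
Hypothesis rvp : regularly_varying p (- alpha).
Hypothesis Hl : forall y i, 0 < y ->
  (\int[P]_w (expR (- (y^-1 * xi i w)))%:E <= (expR (- (p y / 2)))%:E)%E.

Lemma walk_gt0 w k : ~ N0 w -> (0 < k)%N -> 0 < walk xi k w.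
Proof.
move=> nw; case: k => // k _; rewrite walkS ltr_wpDl ?xiN0//.
by rewrite -(walk0 xi w); apply: walk_mono => //.
Qed.

Lemma walk_ge0 w k : 0 <= walk xi k w.
Proof. by rewrite -(walk0 xi w); apply: walk_mono => //. Qed.

Lemma inv_tail_bound (g : R) : 0 < g -> exists2 C : R, 0 < C &
  forall y, 0 <= y -> (p y)^-1 <= C * (1 + y) `^ (alpha + g).
Proof.
move=> g0; have [C [s0 [C0 s01 H]]] := regularly_varying_potter_lb rvp g0.
have a0 := alpha0; have ps0 : 0 < p s0 by case/andP: (p01 s0).
exists (C^-1 + (p s0)^-1) => [|y y0]; first by rewrite addr_gt0 ?invr_gt0.
have y1 : 1 <= 1 + y by rewrite lerDl.
have py : 0 < p y by case/andP: (p01 y).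
rewrite mulrDl; have [sy|sy] := leP s0 y.
  have y0' : 0 < y by apply: lt_le_trans sy; lra.
  rewrite ler_wpDr ?mulr_ge0 ?invr_ge0 ?(ltW ps0) ?powR_ge0//.
  have := H y sy; rewrite -opprD powRN => h.
  have yp : 0 < y `^ (alpha + g) by exact: powR_gt0.
  apply: (@le_trans _ _ (C^-1 * y `^ (alpha + g))).
    rewrite -[leRHS]invrK lef_pV2 ?posrE ?invr_gt0 ?mulr_gt0 ?invr_gt0//.
    by rewrite invfM invrK.
  rewrite ler_wpM2l ?invr_ge0 ?(ltW C0)//; apply: ler_powRl => //; lra.
rewrite ler_wpDl ?mulr_ge0 ?invr_ge0 ?(ltW C0) ?powR_ge0//.
apply: (@le_trans _ _ ((p s0)^-1)); first by rewrite lef_pV2 ?posrE// pdec// ltW.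
by rewrite ler_peMr ?invr_ge0 ?(ltW ps0)//; apply: powR_ge1 => //; lra.
Qed.

(** A shell at distance [y] holds about [y]^ alpha[points of weight]y [^ r], so the largest or the
    smallest shell dominates according to the sign of [r + alpha]; [g] absorbs the number of shells
    and the factors [q ^+ i]. The event is chosen before [x] and [r]. *)
Lemma renewal_power_sum (g e c : R) : 0 < g -> 0 < e -> 0 < c ->
  exists C : R -> R, (forall r, 0 <= C r) /\ \forall t \near +oo, forall N : nat,
    exists A, measurable A /\ (P A <= e%:E)%E /\ forall w, ~ A w -> forall x r, 0 <= x <= c * t ->
      \sum_(k < N) (if walk xi k w <= x then (1 + (x - walk xi k w)) `^ r else 0) <=
      C r * t `^ (g + Num.max 0 (r + alpha + g)).
Proof.
move=> g0 e0 c0.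
(* Two factors [q ^+ I] occur, one for the window counts and one dominating the number [I.+1] of
   shells; together they are the power [4 / n <= g] of [2 ^+ I]. *)
pose n := (Num.truncn (4 / g)).+1.
have n0' : 0 < n%:R :> R by [].
have ng : 4 / n%:R <= g.
  by rewrite ler_pdivrMr// mulrC -ler_pdivrMr// ltW// truncnS_gt.
have [q q1 [qn qI]] := @root_of_4 R n isT.
have q0 : 0 < q by exact: lt_trans q1.
have [K [K1 HK]] := @exp_sum_small R n q e isT q0 qn e0.
have [B B0 HB] := inv_tail_bound g0.
pose E := 1 + (q - 1)^-1.
have E0 : 0 < E by rewrite addr_gt0// invr_gt0 subr_gt0.
have EI I : I.+1%:R <= E * q ^+ I.
  have bern : 1 + I%:R * (q - 1) <= q ^+ I.
    elim: I => [|I IH]; first by rewrite mul0r addr0 expr0.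
    rewrite exprSr; apply: (@le_trans _ _ ((1 + I%:R * (q - 1)) * q)).
      rewrite -natr1; have q1' := ltW q1.
      have : 0 <= I%:R * (q - 1) * (q - 1) by rewrite !mulr_ge0 ?subr_ge0.
      by move: (I%:R) => z; lra.
    by rewrite ler_pM2r.
  have qq : 0 < q - 1 by rewrite subr_gt0.
  have qI1 : 1 <= q ^+ I by rewrite exprn_ege1// ltW.
  have : I%:R <= (q - 1)^-1 * q ^+ I.
    rewrite mulrC ler_pdivlMr//; lra.
  rewrite -natr1 /E mulrDl mul1r; lra.
pose D := 2 * c + 1.
have D0 : 0 < D by rewrite /D; lra.
exists (fun r => (E * (2 * c) `^ g * (2 `^ `|r| * (6 * K * B)) + 1) * Num.max 1 (D `^ (r + alpha + g)) + 1).
have mx1 (z : R) : 1 <= Num.max 1 z by rewrite le_max lexx.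
have mx0 (z : R) : 0 <= Num.max 1 z by rewrite le_max ler01.
have cst0 r : 0 <= E * (2 * c) `^ g * (2 `^ `|r| * (6 * K * B)).
  by rewrite !mulr_ge0 ?powR_ge0// ?(ltW E0) ?(ltW B0)//; lra.
split.
  by move=> r; apply: addr_ge0 => //; apply: mulr_ge0; [apply: addr_ge0|exact: le_trans (mx1 _)].
apply/near_pinftyP; exists (Num.max 1 (c^-1)); split; first by rewrite le_max lexx.
move=> t; rewrite ge_max => /andP[t1 tc] N.
have ct1 : 1 <= c * t by rewrite mulrC -ler_pdivrMr// div1r.
have t0 : 0 < t by exact: lt_le_trans t1.
have ct0 : 0 < c * t by exact: lt_le_trans ct1.
have [I [tI It]] := pow2_cover ct1.
have [A [mA [PA HA]]] := @renewal_good_event _ _ _ P S Ssig Smeas Sind xi xiS p q e K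
  (fun y _ => p01 y) xi0 Hl (ltW q1) K1 HK (c * t) N I.+1 ct0.
exists (A `|` N0); split; first exact: measurableU.
split.
  rewrite -[e]addr0; apply: prob_setU_le => //.
  by rewrite PN0.
move=> w /not_orP[nA nN] x r /andP[x0 xt].
have Kge0 : 0 <= K by exact: le_trans ler01 K1.
have Q0 : 0 <= 6 * K * B * q ^+ I by rewrite !mulr_ge0 ?(ltW B0) ?exprn_ge0 ?(ltW q0).
have := @window_power_sum _ T R xi N I (c * t) x (6 * K * B * q ^+ I) (alpha + g) r w ct0 tI.
rewrite x0 xt => /(_ isT Q0) h.
have hw i : (i < I.+1)%N -> (window_count xi N x (c * t / 2 ^+ i) w)%:R <=
    6 * K * B * q ^+ I * (1 + c * t / 2 ^+ i) `^ (alpha + g).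
  move=> iI; have := HA w nA i x iI; rewrite x0 xt => /(_ isT) h'; apply: le_trans h' _.
  have yi : 0 <= c * t / 2 ^+ i by rewrite divr_ge0 ?exprn_ge0// ltW.
  have := HB _ yi => h'.
  rewrite (_ : 6 * K * B * q ^+ I * _ = 6 * K * q ^+ I * (B * (1 + c * t / 2 ^+ i) `^ (alpha + g))); last by ring.
  apply: ler_pM => //.
  - by rewrite !mulr_ge0 ?exprn_ge0 ?(ltW q0).
  - by rewrite invr_ge0 ltW//; case/andP: (p01 (c * t / 2 ^+ i)).
  - rewrite ler_wpM2l//; first by rewrite mulr_ge0.
    by rewrite ler_weXn2l// ltW.
have hs := h hw.
have qII : q ^+ I * q ^+ I <= (2 * c) `^ g * t `^ g.
  rewrite -powRM ?mulr_ge0 ?(ltW c0) ?(ltW t0)//.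
  apply: (@le_trans _ _ ((2 * (c * t)) `^ g)); last by rewrite mulrA.
  have p1 : 1 <= 2 ^+ I :> R by rewrite exprn_ege1// ler1n.
  have p0 : 2 ^+ I != 0 :> R by rewrite gt_eqF// exprn_gt0.
  rewrite qI -powRD; last by rewrite p0 implybT.
  apply: (@le_trans _ _ ((2 ^+ I) `^ g)).
    apply: ler_powR => //; move: ng; rewrite -mulrDl; lra.
  by apply: ler_powRl; rewrite ?exprn_gt0// ltW.
have tg : 1 <= t `^ g by apply: powR_ge1 => //; exact: ltW.
pose m := Num.max 0 (r + alpha + g).
have m0 : 0 <= m by rewrite le_max lexx.
have tm : 1 <= t `^ m by exact: powR_ge1.
pose Z := Num.max 1 (D `^ (r + alpha + g)).
have Z1 : 1 <= Z by exact: mx1.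
have mxZ : Num.max 1 ((1 + c * t) `^ (r + (alpha + g))) <= Z * t `^ m.
  rewrite addrA ge_max; apply/andP; split; first by rewrite mulr_ege1.
  have [h0|h0] := leP 0 (r + alpha + g).
    rewrite /m max_r// /Z; apply: (@le_trans _ _ (D `^ (r + alpha + g) * t `^ (r + alpha + g))).
      rewrite -powRM ?(ltW D0) ?(ltW t0)//; apply: ler_powRl => //; first by rewrite addr_gt0.
      by rewrite /D mulrDl mul1r addrC lerD// -mulrA ler_peMl ?ler1n// ltW.
    by rewrite ler_wpM2r ?powR_ge0// le_max lexx orbT.
  apply: (@le_trans _ _ 1); last by rewrite mulr_ege1.
  by rewrite -[leRHS](powRr0 (1 + c * t)); apply: ler_powR; rewrite ?lerDl; exact: ltW.
have tn0 : t != 0 by rewrite gt_eqF.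
rewrite powRD; last by rewrite tn0 implybT.
rewrite -/m -/Z.
have bulk : \sum_(k < N) (if (0 < walk xi k w) && (walk xi k w <= x)
    then (1 + (x - walk xi k w)) `^ r else 0) <=
    E * (2 * c) `^ g * (2 `^ `|r| * (6 * K * B)) * Z * (t `^ g * t `^ m).
  apply: le_trans hs _.
  have q2 : 0 <= 2 `^ `|r| * (6 * K * B * q ^+ I) * Num.max 1 ((1 + c * t) `^ (r + (alpha + g))).
    by rewrite mulr_ge0// mulr_ge0 ?powR_ge0.
  apply: le_trans (ler_wpM2r q2 (EI I)) _.
  rewrite [leLHS](_ : _ = E * (q ^+ I * q ^+ I) * (2 `^ `|r| * (6 * K * B)) *
     Num.max 1 ((1 + c * t) `^ (r + (alpha + g)))); last by ring.
  rewrite [leRHS](_ : _ = E * ((2 * c) `^ g * t `^ g) * (2 `^ `|r| * (6 * K * B)) * (Z * t `^ m)); last by ring.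
  have k0 : 0 <= 2 `^ `|r| * (6 * K * B) by rewrite !mulr_ge0 ?powR_ge0 ?(ltW B0).
  apply: ler_pM => //.
  - by rewrite !mulr_ge0 ?(ltW E0) ?exprn_ge0 ?(ltW q0) ?powR_ge0 ?(ltW B0).
  - by rewrite ler_wpM2r// ler_pM2l.
have first_ : (1 + x) `^ r <= Z * (t `^ g * t `^ m).
  apply: (@le_trans _ _ (Num.max 1 ((1 + c * t) `^ (r + (alpha + g))))).
    apply: (@le_trans _ _ ((1 + x) `^ (r + (alpha + g)))).
      by apply: ler_powR; rewrite lerDl// addr_ge0// ltW// alpha0.
    by apply: powR_le_max; rewrite ?lerDl ?lerD2l.
  apply: le_trans mxZ _; rewrite mulrCA ler_peMl//.
  by rewrite mulr_ge0 ?powR_ge0//; exact: le_trans Z1.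
(* The starting point of the walk, not seen by the window counts, is split off. *)
apply: (@le_trans _ _ ((1 + x) `^ r + \sum_(k < N) (if (0 < walk xi k w) && (walk xi k w <= x)
    then (1 + (x - walk xi k w)) `^ r else 0))).
  case: N {A mA PA HA hw hs h bulk nA} => [|N]; first by rewrite !big_ord0 addr0 powR_ge0.
  rewrite !big_ord_recl /= walk0 ltxx/= x0 subr0 add0r lerD2l.
  by apply: ler_sum => k _; rewrite walk_gt0.
apply: le_trans (lerD first_ bulk) _.
have tt : 0 <= t `^ g * t `^ m by rewrite mulr_ge0 ?powR_ge0.
rewrite -mulrDl ler_wpM2r// mulrDl mul1r; lra.
Qed.

End renewal_sums.

(** * The fluctuation term *)

Lemma rat_enum {R : realType} (delta : R) : 0 < delta -> exists ys : nat -> R,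
  (forall i, 0 <= ys i < delta) /\
  (forall u v, 0 <= u -> u < v -> v <= delta -> exists j, u < ys j < v).
Proof.
move=> d0; exists (fun i => if unpickle i is Some q then
  (if 0 <= (ratr q : R) < delta then ratr q else 0) else 0); split.
  by move=> i; case: (unpickle i) => [q|]; rewrite ?lexx//; case: ifP => //; rewrite lexx.
move=> u v u0 uv vd; have [q] := rat_in_itvoo uv; rewrite in_itv/= => /andP[uq qv].
exists (pickle q); rewrite pickleK ifT ?uq//.
by rewrite (le_trans u0 (ltW uq)) (lt_le_trans qv vd).
Qed.

Lemma cvg_sum_ord {R : realType} {T : Type} (F : set_system T) {FF : Filter F} (n : nat)
    (f : nat -> T -> R) (a : nat -> R) :
  (forall k, f k @ F --> a k) -> (fun z => \sum_(k < n) f k z) @ F --> \sum_(k < n) a k.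
Proof.
move=> H; elim: n => [|n IH].
  by rewrite big_ord0; under eq_fun do rewrite big_ord0; exact: cvg_cst.
rewrite big_ord_recr/=; under eq_fun do rewrite big_ord_recr/=.
exact: cvgD.
Qed.

(** For [x] just left of the grid point [z], choose a shift [ys j] slightly below [z - x].
    Right-continuity makes the sum at [z - ys j] close to that at [x], and its distance to the sum
    at [z] is an oscillation over finitely many shifts. *)
Lemma grid_control {R : realType} (delta th : R) (ys : nat -> R) (N G : nat)
    (f : nat -> R -> R) (a : nat -> R) : 0 < delta ->
  (forall i, 0 <= ys i < delta) ->
  (forall u v, 0 <= u -> u < v -> v <= delta -> exists j, u < ys j < v) ->
  (forall k, 0 <= a k) -> (forall k x, 0 <= x -> f k z @[z --> x^'+] --> f k x) ->
  (forall i, (i <= G)%N -> `|\sum_(k < N) shift0 (f k) (a k) (i%:R * delta)| <= th) ->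
  (forall i n, (i <= G)%N -> \sum_(k < N) (if a k <= i%:R * delta then
      osc ys n (f k) (i%:R * delta - a k) else 0) <= th) ->
  forall x, 0 <= x < G%:R * delta -> `|\sum_(k < N) shift0 (f k) (a k) x| <= 2 * th.
Proof.
move=> d0 Hy yd a0 cf H1 H2 x /andP[x0 xG].
pose i := (Num.truncn (x / delta)).+1.
have xi : x < i%:R * delta by rewrite -ltr_pdivrMr// truncnS_gt.
have xi' : i%:R * delta <= x + delta.
  rewrite /i -natr1 mulrDl mul1r lerD2r -ler_pdivlMr//.
  by rewrite truncn_le// divr_ge0// ltW.
have iG : (i <= G)%N.
  move: xG; rewrite -ltr_pdivrMr// => xG.
  by rewrite -(ltr_nat R); apply: le_lt_trans xG; rewrite truncn_le// divr_ge0// ltW.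
set z := i%:R * delta in xi xi'.
apply/ler_addgt0Pr => e e0.
have cM : (fun y => \sum_(k < N) shift0 (f k) (a k) y) y @[y --> x^'+] --> \sum_(k < N) shift0 (f k) (a k) x.
  apply: (@cvg_sum_ord R R (x^'+) _ N (fun k y => shift0 (f k) (a k) y)
    (fun k => shift0 (f k) (a k) x)) => k.
  exact: (shift0_right_continuous (a0 k) (@cf k) x0).
have /cvgrPdist_le/(_ e e0) := cM; rewrite near_withinE => -[r /= r0 hr].
have [j /andP[j1 j2]] : exists j, Num.max 0 (z - x - r) < ys j < z - x.
  apply: yd; [by rewrite le_max lexx|by rewrite gt_max; apply/andP; split; lra|by lra].
move: j1; rewrite gt_max => /andP[j0 j1].
have xz : x < z - ys j by lra.
have h3 : `|\sum_(k < N) shift0 (f k) (a k) x - \sum_(k < N) shift0 (f k) (a k) (z - ys j)| <= e.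
  by apply: hr => //=; rewrite ltr_distlC; apply/andP; split; lra.
have h4 : `|\sum_(k < N) shift0 (f k) (a k) z - \sum_(k < N) shift0 (f k) (a k) (z - ys j)| <= th.
  rewrite -sumrB; apply: le_trans (ler_norm_sum _ _ _) _.
  apply: le_trans (H2 i j.+1 iG); apply: ler_sum => k _.
  rewrite -/z {1}/shift0; have [az|az] := leP (a k) z; last first.
    by rewrite /shift0 (_ : a k <= z - ys j = false) ?subrr ?normr0//; apply/negbTE; rewrite -ltNge; lra.
  apply: le_trans (osc_ub ys (f k) (z - a k) (ltnSn j)).
  rewrite /shift0 (_ : (ys j <= z - a k) = (a k <= z - ys j)); last by rewrite lerBrDr lerBrDl.
  by case: ifP => // _; rewrite (_ : z - ys j - a k = z - a k - ys j)//; ring.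
have h5 := H1 i iG; rewrite -/z in h5.
move: h3 h4 h5; rewrite !ler_norml.
by move=> /andP[? ?] /andP[? ?] /andP[? ?]; apply/andP; split; lra.
Qed.

Lemma prob_bigcup_nondecreasing d (T : measurableType d) (R : realType) (P : probability T R)
    (A : nat -> set T) (e : R) : (forall n, measurable (A n)) ->
  {homo A : m n / (m <= n)%N >-> m `<=` n} -> (forall n, (P (A n) <= e%:E)%E) ->
  (P (\bigcup_n A n) <= e%:E)%E.
Proof.
move=> mA hA He.
have ndA : nondecreasing_seq A by move=> m n mn; apply/subsetPset; exact: hA.
have mU : measurable (\bigcup_n A n) by exact: bigcupT_measurable.
have := @nondecreasing_cvg_mu _ _ _ P A mA mU ndA => /cvg_lim <-//.
apply: lime_le => //; last by apply: nearW => n /=; exact: He.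
apply: ereal_nondecreasing_is_cvgn => m n mn /=.
by apply: le_measure; rewrite ?inE//; exact: hA.
Qed.

(** Fatou for events: if each fails with probability at most [e], then off a set of probability at
    most [e] infinitely many hold. For statements monotone in [n] this replaces an infinite union
    bound. *)
Lemma prob_liminf_le d (T : measurableType d) (R : realType) (P : probability T R)
    (A : nat -> set T) (e : R) : (forall n, measurable (A n)) -> (forall n, (P (A n) <= e%:E)%E) ->
  exists B, [/\ measurable B, (P B <= e%:E)%E &
    forall w, ~ B w -> forall n, exists2 m, (n <= m)%N & ~ A m w].
Proof.
move=> mA PA; pose B n := \bigcap_(m in [set m | (n <= m)%N]) A m.
have mB n : measurable (B n) by apply: bigcap_measurable => //; exists n => /=.
exists (\bigcup_n B n); split; first exact: bigcupT_measurable.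
  apply: prob_bigcup_nondecreasing => //.
    by move=> m n mn w Bw k /= nk; apply: Bw => /=; exact: leq_trans nk.
  move=> n; apply: le_trans (PA n); apply: le_measure; rewrite ?inE//.
  by move=> w; apply => /=.
move=> w nB n; apply: contrapT => h; apply: nB; exists n => // m /= nm.
by apply: contrapT => nA; apply: h; exists m.
Qed.

Lemma powR_cvg0 {R : realType} (a e : R) : a < 0 -> 0 < e -> \forall t \near +oo, t `^ a <= e.
Proof.
move=> a0 e0; apply/near_pinftyP; exists (Num.max 1 (e `^ a^-1)).
split; first by rewrite le_max lexx.
move=> t; rewrite ge_max => /andP[t1 te].
have t0 : 0 < t by exact: lt_le_trans t1.
apply: (@le_trans _ _ ((e `^ a^-1) `^ a)).
  by apply: ler_powRl_neg => //; [exact: powR_gt0|exact: ltW].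
by rewrite -powRrM mulVf ?powRr1// ?lt_eqF// ltW.
Qed.

Lemma sum_powR_cvg0 {R : realType} (n : nat) (A a : nat -> R) (e : R) :
  (forall j, (j < n)%N -> A j = 0 \/ a j < 0) -> 0 < e ->
  \forall t \near +oo, \sum_(j < n) A j * t `^ (a j) <= e.
Proof.
elim: n e => [|n IH] e H e0; first by apply: nearW => t; rewrite big_ord0 ltW.
have e2 : 0 < e / 2 by rewrite divr_gt0.
have h1 := IH (e / 2) (fun j jn => H j (ltnW jn)) e2.
have h2 : \forall t \near +oo, A n * t `^ (a n) <= e / 2.
  have [-> |an] := H n (ltnSn n); first by apply: nearW => t; rewrite mul0r ltW.
  have c0 : 0 < e / 2 / (`|A n| + 1) by rewrite divr_gt0// ltr_wpDl.
  apply: filterS (powR_cvg0 an c0) => t; rewrite ler_pdivlMr ?ltr_wpDl// => h.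
  apply: le_trans (ler_norm _) _; rewrite normrM (ger0_norm (powR_ge0 _ _)).
  by have := powR_ge0 t (a n); move: h; move: (t `^ a n) => z; lra.
apply: filterS2 h1 h2 => t; rewrite big_ord_recr/=; lra.
Qed.

Lemma powR_continuous_at {R : realType} (x r : R) : 0 < x -> (y `^ r) @[y --> x] --> x `^ r.
Proof.
move=> x0; have h : expR (r * ln y) @[y --> x] --> expR (r * ln x).
  apply: continuous_cvg; first exact: continuous_expR.
  by apply: cvgMr; exact: continuous_ln.
rewrite {2}/powR gt_eqF//; apply: cvg_trans h; apply: near_eq_cvg; near=> y.
rewrite /powR gt_eqF//; near: y; exact: lt_nbhsr.
Unshelve. all: by end_near. Qed.

Lemma powR_shift_right_continuous {R : realType} (s r : R) : 0 <= s ->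
  ((1 + y) `^ r) @[y --> s^'+] --> (1 + s) `^ r.
Proof.
move=> s0; have s1 : 0 < 1 + s by rewrite ltr_pwDl.
have h : (fun y : R => 1 + y) y @[y --> s^'+] --> 1 + s.
  apply: cvgD; first exact: cvg_cst.
  exact: cvg_within.
by apply: (@continuous_cvg _ _ _ _ _ _ (fun z : R => z `^ r)) => //; exact: powR_continuous_at.
Qed.

Section fluctuation.
Context d (T : measurableType d) (R : realType) (P : probability T R).
Variable S : nat -> set (set T).
Hypothesis Ssig : forall k, sigma_algebra setT (S k).
Hypothesis Smeas : forall k A, S k A -> measurable A.
Hypothesis Sind : indep_sigma P S.
Variable xi : nat -> T -> R.
Hypothesis xiS : forall k, adapted (S k) (xi k).

Lemma shot_prob (V : nat -> T -> R -> R) (A0 r : nat -> R) (l : nat) (b x th : R) (n : nat) :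
  (forall k s, 0 <= s -> adapted (S k) (V k ^~ s)) ->
  (forall k w s, 0 <= s -> V k w y @[y --> s^'+] --> V k w s) ->
  (0 < l)%N -> 0 < b -> 0 < th -> (forall j, 0 <= A0 j) ->
  (forall k s, 0 <= s -> (\int[P]_w (Num.max (V k w s) 0)%:E <=
    \int[P]_w (Num.max (- V k w s) 0)%:E + (A0 1%N * (1 + s) `^ (r 1%N))%:E)%E) ->
  (forall k s, 0 <= s -> (\int[P]_w (Num.max (- V k w s) 0)%:E <=
    \int[P]_w (Num.max (V k w s) 0)%:E + (A0 1%N * (1 + s) `^ (r 1%N))%:E)%E) ->
  (forall k s j, (2 <= j <= 2 * l)%N -> 0 <= s ->
    (\int[P]_w (`|V k w s| ^+ j)%:E <= (A0 j * (1 + s) `^ (r j))%:E)%E) ->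
  exists A, [/\ measurable A,
    (P A <= (expR (2 ^+ (2 * l) + 2 * (2 * l)%:R) * (b / th) ^+ (2 * l))%:E)%E &
    forall w, ~ A w ->
      \sum_(1 <= j < (2 * l).+1) A0 j / b ^+ j *
        \sum_(k < n) (if walk xi k w <= x then (1 + (x - walk xi k w)) `^ (r j) else 0) <= 1 ->
      `|\sum_(k < n) (if walk xi k w <= x then V k w (x - walk xi k w) else 0)| < th].
Proof.
move=> aV cV l0 b0 th0 A00 Hp Hn Hj.
have mm j : measurable_fun setT (fun s : R => A0 j * (1 + s) `^ (r j)).
  apply: measurable_funM => //; apply: (measurableT_comp (measurable_powR (r j))).
  exact: measurable_funD.
have m0 j s : 0 <= s -> 0 <= A0 j * (1 + s) `^ (r j) by move=> s0; rewrite mulr_ge0 ?powR_ge0.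
have cm j s : 0 <= s -> A0 j * (1 + y) `^ (r j) @[y --> s^'+] --> A0 j * (1 + s) `^ (r j).
  by move=> s0; apply: cvgMr; exact: powR_shift_right_continuous.
have [A [mA PA HA]] := @shot_noise_bound _ _ _ P S Ssig Smeas Sind xi xiS V aV cV
  (fun j s => A0 j * (1 + s) `^ (r j)) l b x l0 b0 mm m0 cm Hp Hn Hj n th th0.
exists A; split => //; first by move: PA; rewrite mulr1.
move=> w nA H; apply: HA => //; apply: le_trans H.
rewrite le_eqVlt; apply/orP; left; apply/eqP.
under [RHS]eq_bigr do rewrite mulr_sumr.
rewrite exchange_big/=; apply: eq_bigr => k _; case: ifP => _.
  by apply: eq_bigr => j _; rewrite mulrAC.
by rewrite big1// => j _; rewrite mulr0.
Qed.

Hypothesis xi0 : forall k w, 0 <= xi k w.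
Variable N0 : set T.
Hypothesis mN0 : measurable N0.
Hypothesis PN0 : P N0 = 0%E.
Hypothesis xiN0 : forall w, ~ N0 w -> forall k, 0 < xi k w.
Variables (p : R -> R) (alpha : R).
Hypothesis alpha0 : 0 < alpha.
Hypothesis p01 : forall y, 0 < p y <= 1.
Hypothesis pdec : forall y z, y <= z -> p z <= p y.
Hypothesis rvp : regularly_varying p (- alpha).
Hypothesis Hl : forall y i, 0 < y ->
  (\int[P]_w (expR (- (y^-1 * xi i w)))%:E <= (expR (- (p y / 2)))%:E)%E.

Variables (V : nat -> T -> R -> R) (rho beta eps delta : R) (H : R -> R).
Hypothesis aV : forall k s, adapted (S k) (V k ^~ s).
Hypothesis cV : forall k w s, 0 <= s -> V k w y @[y --> s^'+] --> V k w s.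
Hypothesis rho_alpha : - alpha < rho.
Hypothesis beta_lt : beta < alpha + 2 * rho.
Hypothesis eps0 : 0 < eps.
Hypothesis delta0 : 0 < delta.
Hypothesis rvH : regularly_varying H (rho + alpha).
Hypothesis V_centered : forall k s, 0 <= s ->
  (\int[P]_w (Num.max (V k w s) 0)%:E = \int[P]_w (Num.max (- V k w s) 0)%:E)%E.
Hypothesis V_moment : forall l : nat, (0 < l)%N -> exists2 A : R, 0 <= A & forall k s j,
  (2 <= j <= 2 * l)%N -> 0 <= s ->
  (\int[P]_w (`|V k w s| ^+ j)%:E <= (A * (1 + s) `^ (j%:R * (beta / 2)))%:E)%E.
Hypothesis osc_mean : exists2 A : R, 0 <= A & forall ys n k s,
  (forall i, 0 <= ys i < delta) -> 0 <= s ->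
  (\int[P]_w (osc ys n (V k w) s)%:E <= (A * (1 + s) `^ (rho - eps))%:E)%E.
Hypothesis osc_moments : forall l : nat, (0 < l)%N -> exists2 A : R, 0 <= A & forall ys n k s j,
  (forall i, 0 <= ys i < delta) -> (2 <= j <= 2 * l)%N -> 0 <= s ->
  (\int[P]_w (osc ys n (V k w) s ^+ j)%:E <= (A * (1 + s) `^ (j%:R * rho))%:E)%E.

(** With [b] slightly below [H t], the expected normalised moments sum to a negative power of [t],
    both for the responses [V] and for their oscillations. Each grid point then fails with
    probability [O (t^-2)], and there are order [t] of them. *)
Lemma fluctuation_small (c eta e : R) : 0 < c -> 0 < eta -> 0 < e ->
  \forall t \near +oo, forall N : nat, exists A, [/\ measurable A, (P A <= e%:E)%E &
    forall w, ~ A w -> forall x, 0 <= x <= c * t ->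
      `|\sum_(k < N) shift0 (V k w) (walk xi k w) x| <= eta * H t].
Proof.
move=> c0 eta0 e0.
have a0 := alpha0; have ra := rho_alpha; have bl := beta_lt; have ep := eps0; have dl := delta0.
pose mu := (alpha + 2 * rho - beta) / 2.
(* A margin well inside all four strict inequalities, shared by the Potter bounds, the renewal sums
   and the choice of [b]. *)
pose g := Num.min (Num.min alpha (rho + alpha)) (Num.min mu eps) / 16.
have mu0 : 0 < mu by rewrite /mu; lra.
have [g0 [ga [gr [gm ge]]]] : 0 < g /\ 16 * g <= alpha /\ 16 * g <= rho + alpha /\ 16 * g <= mu /\ 16 * g <= eps.
  have mE : 16 * g = Num.min (Num.min alpha (rho + alpha)) (Num.min mu eps).
    by rewrite /g mulrC divfK.
  have h1 : 16 * g <= alpha by rewrite mE !ge_min lexx.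
  have h2 : 16 * g <= rho + alpha by rewrite mE !ge_min lexx ?orbT.
  have h3 : 16 * g <= mu by rewrite mE !ge_min lexx ?orbT.
  have h4 : 16 * g <= eps by rewrite mE !ge_min lexx ?orbT.
  have : 0 < 16 * g by rewrite mE !lt_min; repeat (apply/andP; split); lra.
  by move=> h; do !split => //; lra.
pose bd := rho + alpha - g.
have bd0 : 0 < bd by rewrite /bd; lra.
pose l := (Num.truncn (4 / g)).+1.
have lg : 4 < l%:R * g by rewrite -ltr_pdivrMr// truncnS_gt.
have l0 : (0 < l)%N by [].
have l2 : - (g / 2) * (2 * l)%:R <= -2 by rewrite natrM; lra.
have m2 : -1 + -1 = -2 :> R by ring.
have d2d : delta / 2 <= delta by lra.
have [AV AV0 HV] := V_moment l0.
have [AO1 AO10 HO1] := osc_mean.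
have [AO AO0 HO] := osc_moments l0.
(* The horizon is [c + 1] because the grid point closing the last cell lies beyond [c * t]. *)
have [Cr [Cr0 near_sum]] := @renewal_power_sum _ _ _ P S Ssig Smeas Sind xi xiS xi0 N0 mN0 PN0
  xiN0 p alpha alpha0 p01 pdec rvp Hl g (e / 2) (c + 1) g0 (divr_gt0 e0 (ltr0n R 2)) (addr_gt0 c0 ltr01).
have [Ch [s0 [Ch0 s01 HH]]] := regularly_varying_potter_lb rvH (e := g / 2) (divr_gt0 g0 (ltr0n R 2)).
(* The first-order coefficient vanishes because the responses are centred; the oscillations below
   are not, and use the gain [eps] in their mean instead. *)
pose A1 j := if j == 1%N then 0 else AV.
pose r1 j : R := j%:R * (beta / 2).
pose A2 j := if j == 1%N then AO1 else AO.
pose r2 j : R := if j == 1%N then rho - eps else j%:R * rho.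
(* The exponent of [t] in the [j]-th normalised moment sum; it must be negative whenever the
   coefficient is not zero. *)
pose ex (r : nat -> R) j : R := g + Num.max 0 (r j + alpha + g) - j%:R * bd.
have jb (j : nat) : (1 <= j)%N -> bd <= j%:R * bd.
  by move=> j1; rewrite ler_peMl ?ler1n// ltW.
have ex1 j : (1 <= j)%N -> A1 j = 0 \/ ex r1 j < 0.
  move=> j1; rewrite /A1; have [->|jn1] := eqVneq j 1%N; [by left|right].
  (* From order [2] on, the margin [rho + alpha - g - beta / 2] is multiplied by [j], and at [j = 2]
     it already exceeds [alpha]: this is where [beta < alpha + 2 rho] enters. *)
  have j2 : 2 <= j%:R :> R by rewrite (ler_nat _ 2) ltn_neqAle eq_sym jn1.
  have := jb _ j1; rewrite /ex /r1.
  have [h|h] := leP 0 (j%:R * (beta / 2) + alpha + g); last by rewrite /bd; move: (j%:R * _) => z; lra.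
  have hb' : (rho + alpha - g - beta / 2) * 2 <= (rho + alpha - g - beta / 2) * j%:R.
    by rewrite ler_wpM2l//; move: gm; rewrite /mu; lra.
  by move: gm; rewrite /bd /mu; move: hb'; move: (j%:R) j2 => J j2 hb'; lra.
have ex2 j : (1 <= j)%N -> A2 j = 0 \/ ex r2 j < 0.
  move=> j1; right; rewrite /ex /r2; have [->|jn1] := eqVneq j 1%N.
    by rewrite mul1r /bd; have [h|h] := leP 0 (rho - eps + alpha + g); lra.
  have j2 : 2 <= j%:R :> R by rewrite (ler_nat _ 2) ltn_neqAle eq_sym jn1.
  have := jb _ j1.
  have [h|h] := leP 0 (j%:R * rho + alpha + g); last by rewrite /bd; move: (j%:R * _) => z; lra.
  have hb' : (alpha - g) * 2 <= (alpha - g) * j%:R by rewrite ler_wpM2l//; lra.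
  by rewrite /bd; move: hb'; move: (j%:R) j2 => J j2 hb'; lra.
have A10 j : 0 <= A1 j by rewrite /A1; case: ifP.
have A20 j : 0 <= A2 j by rewrite /A2; case: ifP.
have near1 := @sum_powR_cvg0 R (2 * l) (fun j => A1 j.+1 * Cr (r1 j.+1)) (fun j => ex r1 j.+1) 1
  (fun j _ => match ex1 j.+1 isT with or_introl z => or_introl (etrans (congr1 (fun z => z * _) z) (mul0r _)) | or_intror z => or_intror z end) ltr01.
have near2 := @sum_powR_cvg0 R (2 * l) (fun j => A2 j.+1 * Cr (r2 j.+1)) (fun j => ex r2 j.+1) 1
  (fun j _ => match ex2 j.+1 isT with or_introl z => or_introl (etrans (congr1 (fun z => z * _) z) (mul0r _)) | or_intror z => or_intror z end) ltr01.
pose Kl := expR (2 ^+ (2 * l) + 2 * (2 * l)%:R) * (2 / (eta * Ch)) ^+ (2 * l) : R.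
have Kl0 : 0 < Kl by rewrite mulr_gt0 ?expR_gt0// exprn_gt0// divr_gt0// mulr_gt0.
pose Gc := 2 * c / delta + 2.
have Gc0 : 0 < Gc by rewrite /Gc ltr_wpDl// divr_ge0 ?mulr_ge0 ?ltW.
have near3 : \forall t \near +oo, t `^ (-1) <= e / 2 / (Gc * (2 * Kl)) :> R.
  apply: powR_cvg0; first exact: ltrN10.
  by apply: divr_gt0; [exact: divr_gt0|apply: mulr_gt0 => //; exact: mulr_gt0].
have [ys [Hy yd]] := rat_enum (divr_gt0 delta0 (ltr0n R 2)).
have Hyd i : 0 <= ys i < delta by have /andP[h1 h2] := Hy i; rewrite h1 (lt_le_trans h2 d2d).
near=> t => N.
have t1 : 1 <= t by near: t; exact: nbhs_pinfty_ge.
have tge : delta <= t by near: t; exact: nbhs_pinfty_ge (num_real _).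
have ts0 : s0 <= t by near: t; exact: nbhs_pinfty_ge (num_real _).
have tn0 : t != 0 by rewrite gt_eqF// (lt_le_trans _ t1).
have t0 : 0 < t by exact: lt_le_trans t1.
have Hsum : forall N : nat, exists A, measurable A /\ (P A <= (e / 2)%:E)%E /\ forall w, ~ A w ->
    forall x r, 0 <= x <= (c + 1) * t ->
      \sum_(k < N) (if walk xi k w <= x then (1 + (x - walk xi k w)) `^ r else 0) <=
      Cr r * t `^ (g + Num.max 0 (r + alpha + g)) by near: t; exact: near_sum.
have Hn1 : \sum_(j < 2 * l) A1 j.+1 * Cr (r1 j.+1) * t `^ ex r1 j.+1 <= 1 by near: t; exact: near1.
have Hn2 : \sum_(j < 2 * l) A2 j.+1 * Cr (r2 j.+1) * t `^ ex r2 j.+1 <= 1 by near: t; exact: near2.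
have Hn3 : t `^ (-1) <= e / 2 / (Gc * (2 * Kl)) by near: t; exact: near3.
have [Ag [mAg [PAg HAg]]] := Hsum N.
pose b := t `^ bd.
have b0 : 0 < b by exact: powR_gt0.
have Ht0 : 0 < H t by apply: lt_le_trans (HH t ts0); rewrite mulr_gt0// powR_gt0.
pose th := eta * H t / 2.
have th0 : 0 < th by rewrite divr_gt0// mulr_gt0.
have bpow (q : R) (j : nat) : t `^ q / b ^+ j = t `^ (q - j%:R * bd).
  by rewrite -powR_mulrn ?powR_ge0// /b -powRrM (mulrC bd) -powRN -powRD// tn0 implybT.
have Wsmall (A0 r : nat -> R) w x : (forall j, 0 <= A0 j) ->
    \sum_(j < 2 * l) A0 j.+1 * Cr (r j.+1) * t `^ ex r j.+1 <= 1 ->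
    ~ Ag w -> 0 <= x <= (c + 1) * t ->
    \sum_(1 <= j < (2 * l).+1) A0 j / b ^+ j *
      \sum_(k < N) (if walk xi k w <= x then (1 + (x - walk xi k w)) `^ (r j) else 0) <= 1.
  move=> A00 Hs nA xc; apply: le_trans Hs.
  rewrite big_add1/= big_mkord; apply: ler_sum => j _.
  rewrite /ex -bpow; apply: le_trans (ler_wpM2l _ (HAg w nA x (r j.+1) xc)) _.
    by rewrite divr_ge0// exprn_ge0// ltW.
  by rewrite le_eqVlt; apply/orP; left; apply/eqP; ring.
have bth : expR (2 ^+ (2 * l) + 2 * (2 * l)%:R) * (b / th) ^+ (2 * l) <= Kl * t `^ (- 2).
  rewrite /Kl -mulrA ler_pM2l ?expR_gt0//.
  apply: (@le_trans _ _ ((2 / (eta * Ch) * t `^ (- (g / 2))) ^+ (2 * l))).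
    have n1 : 0 <= b / th by apply: divr_ge0; exact: ltW.
    have n2 : 0 <= 2 / (eta * Ch) * t `^ (- (g / 2)).
      by apply: mulr_ge0; [apply: divr_ge0 => //; apply: mulr_ge0; exact: ltW|exact: powR_ge0].
    apply: lerXn2r; rewrite ?nnegrE//.
    rewrite ler_pdivrMr//.
    have := HH t ts0 => h.
    rewrite /th (_ : _ * (eta * H t / 2) = t `^ (- (g / 2)) * (H t / Ch)); last first.
      by field; rewrite !gt_eqF.
    apply: (@le_trans _ _ (t `^ (- (g / 2)) * t `^ (rho + alpha - g / 2))).
      rewrite -powRD ?tn0 ?implybT// /b; apply: ler_powR => //.
      by rewrite /bd le_eqVlt; apply/orP; left; apply/eqP; field.
    by rewrite ler_wpM2l ?powR_ge0// ler_pdivlMr// mulrC.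
  have n3 : 0 <= 2 / (eta * Ch) by apply: divr_ge0 => //; apply: mulr_ge0; exact: ltW.
  rewrite exprMn ler_wpM2l ?exprn_ge0//.
  rewrite -powR_mulrn ?powR_ge0// -powRrM; apply: ler_powR => //.
have aVs k s : 0 <= s -> adapted (S k) (V k ^~ s) by move=> _; exact: (@aV k s).
have ev1 (i : nat) : exists A, [/\ measurable A, (P A <= (Kl * t `^ (- 2))%:E)%E &
    forall w, ~ A w -> ~ Ag w -> i%:R * (delta / 2) <= (c + 1) * t ->
     `|\sum_(k < N) (if walk xi k w <= i%:R * (delta / 2) then V k w (i%:R * (delta / 2) - walk xi k w) else 0)| < th].
  have [|||A [mA PA HA]] := @shot_prob V A1 r1 l b (i%:R * (delta / 2)) th N aVs cV l0 b0 th0 A10.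
  - by move=> k s s_ge0; rewrite V_centered// /A1 eqxx mul0r adde0.
  - by move=> k s s_ge0; rewrite V_centered// /A1 eqxx mul0r adde0.
  - move=> k s j jl s_ge0; rewrite /A1 /r1 ifF; last by case/andP: jl => j2 _; rewrite gtn_eqF.
    exact: HV.
  exists A; split => //; first by apply: le_trans PA _; rewrite lee_fin.
  move=> w nA ng ic; apply: HA => //; apply: Wsmall => //.
  by rewrite ic andbT mulr_ge0// divr_ge0// ltW.
have ev2 (i : nat) (n : nat) : exists A, [/\ measurable A, (P A <= (Kl * t `^ (- 2))%:E)%E &
    forall w, ~ A w -> ~ Ag w -> i%:R * (delta / 2) <= (c + 1) * t ->
     \sum_(k < N) (if walk xi k w <= i%:R * (delta / 2) then osc ys n (V k w) (i%:R * (delta / 2) - walk xi k w) else 0) < th].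
  have o0 k w s : 0 <= osc ys n (V k w) s by exact: osc_ge0.
  have aO k s : 0 <= s -> adapted (S k) (fun w => osc ys n (V k w) s).
    by move=> _; apply: (@measurable_osc _ _ (g_sigma_algebraType (S k))) => y; exact: (@aV k y).
  have cO k w s : 0 <= s -> osc ys n (V k w) y @[y --> s^'+] --> osc ys n (V k w) s.
    by move=> s_ge0; apply: osc_right_continuous => //; [move=> j; case/andP: (Hy j)|exact: cV].
  have [|||A [mA PA HA]] := @shot_prob (fun k w => osc ys n (V k w)) A2 r2 l b (i%:R * (delta / 2)) th N aO cO l0 b0 th0 A20.
  - move=> k s s_ge0; apply: (@le_trans _ _ (\int[P]_w (osc ys n (V k w) s)%:E)%E).
      by apply: le_integral_all => w; rewrite max_l.
    apply: le_trans (HO1 ys n k s Hyd s_ge0) _; rewrite /A2 /r2 eqxx leeDr//.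
    by apply: integral_ge0 => w _; rewrite lee_fin le_max lexx orbT.
  - move=> k s s_ge0; apply: (@le_trans _ _ 0%:E).
      rewrite -(integral_prob_cst P 0); apply: le_integral_all => w.
      by rewrite max_r// oppr_le0.
    apply: adde_ge0; last by rewrite lee_fin mulr_ge0 ?powR_ge0.
    by apply: integral_ge0 => w _; rewrite lee_fin le_max lexx orbT.
  - move=> k s j jl s_ge0; have jn1 : (j == 1%N) = false by case/andP: jl => j2 _; rewrite gtn_eqF.
    rewrite /A2 /r2 jn1.
    apply: le_trans (HO ys n k s j Hyd jl s_ge0).
    by apply: le_integral_all => w; rewrite ger0_norm.
  exists A; split => //; first by apply: le_trans PA _; rewrite lee_fin.
  move=> w nA ng ic; apply: le_lt_trans (ler_norm _) _; apply: HA => //; apply: Wsmall => //.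
  by rewrite ic andbT mulr_ge0// divr_ge0// ltW.
have Kt0 : 0 <= Kl * t `^ (- 2) by rewrite mulr_ge0 ?powR_ge0// ltW.
have ev3 (i : nat) : exists A, [/\ measurable A, (P A <= (Kl * t `^ (- 2) + Kl * t `^ (- 2))%:E)%E &
    forall w, ~ A w -> ~ Ag w -> i%:R * (delta / 2) <= (c + 1) * t ->
     `|\sum_(k < N) shift0 (V k w) (walk xi k w) (i%:R * (delta / 2))| <= th /\
     forall n, \sum_(k < N) (if walk xi k w <= i%:R * (delta / 2)
        then osc ys n (V k w) (i%:R * (delta / 2) - walk xi k w) else 0) <= th].
  have [B1 [mB1 PB1 HB1]] := ev1 i.
  have /choice[B2 HB2] := ev2 i.
  (* The oscillation bound is needed for all numbers of shifts at once, with exceptional sets that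
     vary; since [osc] grows with [n], infinitely many good [n] suffice. *)
  have [B3 [mB3 PB3 HB3]] := @prob_liminf_le _ _ _ P B2 (Kl * t `^ (- 2))
    (fun n => let: And3 h _ _ := HB2 n in h) (fun n => let: And3 _ h _ := HB2 n in h).
  exists (B1 `|` B3); split; [exact: measurableU|exact: prob_setU_le|].
  move=> w /not_orP[n1 n3] ng ic; split; first exact: ltW (HB1 w n1 ng ic).
  move=> n; have [m nm n2] := HB3 w n3 n; have [_ _ h] := HB2 m.
  apply: le_trans (ltW (h w n2 ng ic)); apply: ler_sum => k _.
  by case: ifP => // _; exact: osc_mono.
have /choice[B HB] := ev3.
pose G := (Num.truncn (c * t / (delta / 2))).+1.
have d20 : 0 < delta / 2 by rewrite divr_gt0.
have ctd : 0 <= c * t / (delta / 2) by rewrite divr_ge0 ?mulr_ge0 ?ltW.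
have cG : c * t < G%:R * (delta / 2) by rewrite -ltr_pdivrMr// truncnS_gt.
have Gc' : G%:R * (delta / 2) <= (c + 1) * t.
  have : G%:R * (delta / 2) <= c * t + delta / 2.
    rewrite /G -natr1 mulrDl mul1r lerD2r -ler_pdivlMr//.
    by rewrite truncn_le.
  by move=> h; apply: le_trans h _; rewrite mulrDl mul1r lerD2l (le_trans d2d).
have GG : G.+1%:R <= Gc * t.
  have h1 : (Num.truncn (c * t / (delta / 2)))%:R <= c * t / (delta / 2) by rewrite truncn_le.
  have h2 : c * t / (delta / 2) = 2 * c / delta * t by field; rewrite gt_eqF.
  rewrite /Gc mulrDl -h2 /G -natr1 -natr1 -addrA; apply: lerD => //.
  by rewrite -[X in X <= _](mulr1 2) ler_pM2l.
exists (Ag `|` \big[setU/set0]_(i < G.+1) B i); split.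
- apply: measurableU => //; apply: bigsetU_measurable => i _; by have [] := HB i.
- rewrite [e]splitr.
  apply: prob_setU_le => //; first by apply: bigsetU_measurable => i _; by have [] := HB i.
  apply: (@le_trans _ _ (\sum_(i < G.+1) (Kl * t `^ (- 2) + Kl * t `^ (- 2)))%:E).
    by apply: (@prob_bigsetU_le _ _ _ P G.+1 B (fun=> Kl * t `^ (- 2) + Kl * t `^ (- 2))) => i *; have [] := HB i.
  rewrite lee_fin sumr_const card_ord -[leLHS]mulr_natl.
  apply: (@le_trans _ _ (Gc * t * (Kl * t `^ (- 2) + Kl * t `^ (- 2)))).
    by rewrite ler_wpM2r// addr_ge0.
  have -> : t `^ (- 2) = t `^ (- 1) * t `^ (- 1) by rewrite -powRD ?tn0 ?implybT// m2.
  have tt : t * t `^ (- 1) = 1 by rewrite powR_inv1 ?(ltW t0)// divff.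
  rewrite [leLHS](_ : _ = Gc * (2 * Kl) * t `^ (-1) * (t * t `^ (-1))); last by ring.
  have GK : 0 < Gc * (2 * Kl) by apply: mulr_gt0 => //; exact: mulr_gt0.
  rewrite tt mulr1; move: Hn3; rewrite ler_pdivlMr//.
  by rewrite (mulrC (t `^ (-1))).
- move=> w /not_orP[ng nB] x /andP[x0 xc].
  have -> : eta * H t = 2 * th by rewrite /th mulrCA divff// mulr1.
  have key i : (i <= G)%N -> ~ B i w.
    by move=> iG Bi; apply: nB; rewrite -(bigcup_mkord G.+1 B); exists i.
  have ic i : (i <= G)%N -> i%:R * (delta / 2) <= (c + 1) * t.
    by move=> iG; apply: le_trans Gc'; rewrite ler_pM2r// ler_nat.
  apply: (@grid_control R (delta / 2) th ys N G (fun k => V k w) (fun k => walk xi k w) d20 Hy yd).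
  + by move=> k; exact: walk_ge0.
  + by move=> k; exact: cV.
  + by move=> i iG; have [_ _ h] := HB i; have [] := h w (key i iG) ng (ic i iG).
  + by move=> i n iG; have [_ _ h] := HB i; have [_] := h w (key i iG) ng (ic i iG); apply.
  + by rewrite x0 (le_lt_trans xc).
Unshelve. all: by end_near. Qed.

End fluctuation.

(** * The mean term *)

(** Here the comparison goes downward from [T] to any [s >= s0], uniformly in both, by iterating the
    doubling inequality from [s] up to the octave of [T]. *)
Lemma regularly_varying_potter {R : realType} (f : R -> R) (r e : R) :
  regularly_varying f r -> 0 < e -> exists C s0 : R, [/\ 0 < C, 1 <= s0 &
    forall s T, s0 <= s -> s <= T -> 0 < f s /\ f s <= C * (s / T) `^ (r - e) * f T].
Proof.
move=> fr e0; have [f0 _] := fr.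
have /near_pinftyP[M0 [M01 HM0]] := f0.
have /near_pinftyP[M1 [M11 HM1]] := regularly_varying_double (regularly_varying_inv fr) e0.
have [K K0 /near_pinftyP[M2 [M21 HM2]]] := regularly_varying_compare 2 fr (@ltr01 R).
pose s0 := Num.max M0 (Num.max M1 M2).
have s00 : M0 <= s0 by rewrite le_max lexx.
have s01 : M1 <= s0 by rewrite !le_max lexx orbT.
have s02 : M2 <= s0 by rewrite !le_max lexx !orbT.
have s0g : 1 <= s0 by exact: le_trans s00.
have step s : s0 <= s -> f s <= 2 `^ (- (r - e)) * f (2 * s).
  move=> ss; have := HM1 s (le_trans s01 ss).
  have fs : 0 < f s by apply: HM0; exact: le_trans ss.
  have f2 : 0 < f (2 * s) by apply: HM0; apply: le_trans s00 (le_trans ss _); lra.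
  rewrite (_ : - (r - e) = - r + e); last by ring.
  rewrite -[X in X <= _]div1r ler_pdivrMr// mulrAC -[X in _ <= X]/(_ * _ / f s) ler_pdivlMr//.
  by rewrite mul1r.
have iter k s : s0 <= s -> f s <= (2 `^ (- (r - e))) ^+ k * f (2 ^+ k * s).
  elim: k s => [|k IH] s ss; first by rewrite !expr0 !mul1r.
  have s2 : s0 <= 2 * s by lra.
  apply: le_trans (step s ss) _; rewrite exprS -mulrA ler_wpM2l ?powR_ge0//.
  by apply: le_trans (IH _ s2) _; rewrite mulrA -exprSr.
have [K' K'0 HK'] := @powR_bounded R 1 2 (r - e) ltr01.
exists (K * K'), s0; split => //; first exact: mulr_gt0.
move=> s T ss sT; split; first by apply: HM0; exact: le_trans ss.
have s0' : 0 < s by apply: lt_le_trans ss; lra.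
have T0 : 0 < T by exact: lt_le_trans sT.
have sT1 : 1 <= T / s by rewrite ler_pdivlMr// mul1r.
have [k [k1 k2]] : exists k : nat, 2 ^+ k <= T / s /\ T / s <= 2 * 2 ^+ k.
  have [I [h1 h2]] := pow2_cover sT1; case: I h1 h2 => [|I] h1 h2.
    by exists 0%N; rewrite expr0 in h1 h2 *; split; lra.
  by exists I; move: h1 h2; rewrite exprS; split; lra.
have p0 : 0 < 2 ^+ k :> R by rewrite exprn_gt0.
apply: le_trans (iter k s ss) _.
set y := T / s / 2 ^+ k.
have y1 : 1 <= y <= 2.
  rewrite /y ler_pdivlMr// ler_pdivrMr// mul1r k1/=.
  by move: k2; lra.
have Ty : 2 ^+ k * s * y = T by rewrite /y; field; rewrite !gt_eqF.
have ks : M2 <= 2 ^+ k * s.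
  apply: le_trans s02 (le_trans ss _); rewrite ler_peMl ?(ltW s0')//.
  by rewrite exprn_ege1// ler1n.
have [_ h] := HM2 _ ks y y1; rewrite Ty in h.
have [_ h'] := HK' y y1.
have -> : (s / T) `^ (r - e) = (2 `^ (- (r - e))) ^+ k * y `^ (- (r - e)).
  have -> : s / T = (2 ^+ k)^-1 * y^-1 by rewrite /y; field; rewrite !gt_eqF.
  rewrite powRM ?invr_ge0 ?(ltW p0)//; last by case/andP: y1; lra.
  have yp : 0 < y by case/andP: y1; lra.
  rewrite -!powR_inv1 ?(ltW p0) ?(ltW yp)// -!powRrM mulN1r; congr (_ * _).
  have -> : 2 ^+ k = 2 `^ k%:R :> R by rewrite powR_mulrn.
  by rewrite -powRrM mulrC powRrM powR_mulrn// powR_ge0.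
have yr : 1 <= K' * y `^ (- (r - e)).
  have yp : 0 < y by case/andP: y1; lra.
  have [h2 _] := HK' y y1.
  by rewrite powRN ler_pdivlMr ?powR_gt0// mul1r.
have fT : 0 < f T by apply: HM0; apply: le_trans s00 (le_trans ss sT).
rewrite [leRHS](_ : _ = (2 `^ (- (r - e))) ^+ k * ((K' * y `^ (- (r - e))) * (K * f T))); last by ring.
rewrite ler_wpM2l ?exprn_ge0 ?powR_ge0//; apply: le_trans h _.
by rewrite ler_peMl//; apply: mulr_ge0; exact: ltW.
Qed.

(** Let [s] be the supremum of the points up to which [h] is bounded: the left limit at [s] gives
    boundedness up to [s], and right-continuity pushes past [s]. *)
Lemma cadlag_bounded {R : realType} (h : R -> R) (M : R) : cadlag0 h ->
  exists B : R, forall s, 0 <= s <= M -> `|h s| <= B.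
Proof.
move=> [hr hl]; have [M0|M0] := ltP M 0.
  by exists 0 => s /andP[h1 h2]; have := le_lt_trans (le_trans h1 h2) M0; rewrite ltxx.
pose bd x := exists B : R, forall s, 0 <= s <= x -> `|h s| <= B.
pose A := [set x | 0 <= x <= M /\ bd x].
have A0 : A 0.
  split; first by rewrite lexx.
  by exists `|h 0| => s h0; rewrite (_ : s = 0)//; apply/eqP; rewrite eq_sym eq_le.
have hsA : has_sup A by split; [exists 0|exists M => x [/andP[]]].
pose s := sup A.
have s0 : 0 <= s by apply: ub_le_sup => //; exact: hsA.2.
have sM : s <= M by apply: ge_sup; [exists 0|move=> x [/andP[]]].
have right x : 0 <= x -> exists2 r, 0 < r & forall y, x <= y < x + r -> `|h y| <= `|h x| + 1.
  move=> x0; have /cvgrPdist_le/(_ _ ltr01) := hr x x0.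
  rewrite near_withinE => -[r /= r0 H]; exists r => // y /andP[]; rewrite le_eqVlt => /orP[/eqP <- _|xy yr].
    by rewrite lerDl.
  have := H y; rewrite /= ltr_distlC => /(_ ltac:(apply/andP; split; lra) xy).
  by rewrite -lerBlDl; apply: le_trans; rewrite distrC; exact: lerB_dist.
have bds : bd s.
  move: s0; rewrite le_eqVlt => /orP[/eqP <-|s0]; first exact: A0.2.
  have [l] := hl s s0; move/cvgrPdist_le/(_ _ ltr01).
  rewrite near_withinE => -[r /= r0 H].
  have [x Ax xs] := sup_adherent r0 hsA.
  have [x0M [B HB]] := Ax.
  exists (Num.max B (Num.max (`|l| + 1) `|h s|)) => y /andP[y0 ys].
  rewrite !le_max; have [yx|xy] := leP y x; first by rewrite HB ?y0.
  move: ys; rewrite le_eqVlt => /orP[/eqP ->|ys]; first by rewrite lexx !orbT.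
  have xs' : s - r < x by [].
  have := H y; rewrite /= ltr_distlC => /(_ ltac:(apply/andP; split; lra) ys) hh.
  rewrite (_ : `|h y| <= `|l| + 1) ?orbT//.
  by rewrite -lerBlDl; apply: le_trans hh; rewrite distrC; exact: lerB_dist.
have [r r0 Hr] := right s s0; have [B HB] := bds.
have ext x : x < s + r -> bd x.
  move=> xr; exists (Num.max B (`|h s| + 1)) => y /andP[y0 yx]; rewrite le_max.
  have [ys|sy] := leP y s; first by rewrite HB ?y0.
  by rewrite Hr ?orbT//; apply/andP; split; [exact: ltW|exact: le_lt_trans xr].
have [Ms|sM'] := leP M s; first by apply: ext; lra.
exfalso; pose x := Num.min M (s + r / 2).
have : A x.
  split; last by apply: ext; rewrite /x gt_min; apply/orP; right; lra.
  by rewrite /x le_min ge_min lexx M0 /= andbT; lra.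
move=> Ax; have := ub_le_sup hsA.2 Ax; rewrite -/s /x ge_min => /orP[|]; lra.
Qed.

Section kernel.
Context {R : realType}.
Variables (kap b rho : R).
Hypothesis kap0 : 0 < kap.
Hypothesis kapb : kap <= b.

Definition kernel (x : R) : R :=
  Num.min (Num.max x kap) b `^ rho - kap `^ rho + kap `^ rho / kap * Num.min (Num.max x 0) kap.

Lemma kernel_le0 x : x <= 0 -> kernel x = 0.
Proof.
move=> x0; have k0 := kap0; have kb := kapb.
rewrite /kernel (max_r (_ : x <= kap)); last by lra.
by rewrite (min_l kb) (max_r x0) (min_l (ltW k0)) subrr mulr0 addr0.
Qed.

Lemma kernel_near x : 0 <= x <= kap -> kernel x = kap `^ rho / kap * x.
Proof.
move=> /andP[x0 xk]; rewrite /kernel (max_r xk) (min_l kapb) (max_l x0) (min_l xk).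
by rewrite subrr add0r.
Qed.

Lemma kernel_far x : kap <= x <= b -> kernel x = x `^ rho.
Proof.
move=> /andP[kx xb]; have k0 := kap0; rewrite /kernel (max_l kx) (min_l xb).
by rewrite (max_l (_ : 0 <= x)) ?(min_r kx) ?divfK ?gt_eqF ?subrK//; lra.
Qed.

Lemma clamp_lip (lo hi x y : R) :
  `|Num.min (Num.max x lo) hi - Num.min (Num.max y lo) hi| <= `|x - y|.
Proof.
wlog xy : x y / x <= y.
  by move=> H; case: (leP x y) => [/H//|/ltW/H]; rewrite distrC (distrC y).
have mono (z z' : R) : z <= z' -> Num.min (Num.max z lo) hi <= Num.min (Num.max z' lo) hi.
  by move=> zz; rewrite le_min !ge_min lexx orbT andbT ge_max !le_max zz lexx orbT.
rewrite distrC (distrC x) !ger0_norm ?subr_ge0 ?mono//.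
have h1 : Num.max y lo - Num.max x lo <= y - x.
  by have [h1|h1] := leP x lo; have [h2|h2] := leP y lo; lra.
have h2 (z z' : R) : z <= z' -> Num.min z' hi - Num.min z hi <= z' - z.
  by move=> zz; have [h2|h2] := leP z hi; have [h3|h3] := leP z' hi; lra.
apply: le_trans h1; apply: h2.
by rewrite ge_max !le_max xy lexx orbT.
Qed.

Lemma powR_lip : exists2 L : R, 0 <= L & forall x y, kap <= x <= b -> kap <= y <= b ->
  `|x `^ rho - y `^ rho| <= L * `|x - y|.
Proof.
have k0 := kap0; have [M M0 HM] := powR_bounded b rho kap0.
exists (M * (`|rho| / kap)); first by rewrite mulr_ge0 ?divr_ge0 ?(ltW M0) ?(ltW k0).
have exp_lip (u v : R) : expR u - expR v <= expR u * `|u - v|.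
  have := expR_ge1Dx (v - u); rewrite expRD expRN => h.
  have eu := expR_gt0 u; have : expR u * (1 + (v - u)) <= expR v.
    by rewrite -ler_pdivlMl// mulrC.
  have : expR u * (u - v) <= expR u * `|u - v| by rewrite ler_pM2l// ler_norm.
  lra.
have ln_lip (x y : R) : kap <= x -> kap <= y -> ln x - ln y <= `|x - y| / kap.
  move=> kx ky; have x0 : 0 < x by exact: lt_le_trans kx.
  have y0 : 0 < y by exact: lt_le_trans ky.
  rewrite -lnV ?posrE// -lnM ?posrE ?invr_gt0//.
  apply: (@le_trans _ _ (x / y - 1)).
    have := @le_ln1Dx R (x / y - 1); rewrite (_ : 1 + (x / y - 1) = x / y); last by ring.
    by apply; rewrite ltrBrDr addNr divr_gt0.
  have -> : x / y - 1 = (x - y) / y by field; rewrite gt_eqF.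
  apply: (@le_trans _ _ (`|x - y| / y)); first by rewrite ler_pM2r ?invr_gt0// ler_norm.
  by rewrite ler_wpM2l// lef_pV2 ?posrE.
have ln_lip2 (x y : R) : kap <= x -> kap <= y -> `|ln x - ln y| <= `|x - y| / kap.
  move=> kx ky; rewrite ler_norml ln_lip// andbT lerNl opprB distrC; exact: ln_lip.
have half x y : kap <= x <= b -> kap <= y <= b -> x `^ rho - y `^ rho <= M * (`|rho| / kap) * `|x - y|.
  move=> xb yb; have /andP[kx _] := xb; have /andP[ky _] := yb.
  have x0 : 0 < x by exact: lt_le_trans kx.
  have y0 : 0 < y by exact: lt_le_trans ky.
  have [hM _] := HM x xb.
  rewrite {1}/powR {1}[y `^ _]/powR !gt_eqF//.
  apply: le_trans (exp_lip _ _) _; rewrite -mulrA; apply: ler_pM => //.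
    by move: hM; rewrite /powR gt_eqF.
  rewrite -mulrBr normrM -mulrA ler_wpM2l//.
  by rewrite mulrC; exact: ln_lip2.
move=> x y xb yb; rewrite ler_norml half// andbT lerNl opprB distrC.
exact: half.
Qed.

Lemma kernel_lip : exists2 L : R, 0 <= L & forall x y, `|kernel x - kernel y| <= L * `|x - y|.
Proof.
have [L L0 HL] := powR_lip; have k0 := kap0; have kb := kapb.
have c0 : 0 <= kap `^ rho / kap by rewrite divr_ge0 ?powR_ge0// ltW.
exists (L + kap `^ rho / kap); first exact: addr_ge0.
move=> x y; rewrite /kernel.
have mem z : kap <= Num.min (Num.max z kap) b <= b.
  by rewrite le_min le_max lexx orbT kb ge_min lexx orbT.
have h1 := le_trans (HL _ _ (mem x) (mem y)) (ler_wpM2l L0 (clamp_lip kap b x y)).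
have h2 := ler_wpM2l c0 (clamp_lip 0 kap x y).
set A := Num.min (Num.max x kap) b `^ rho in h1 *; set A' := Num.min (Num.max y kap) b `^ rho in h1 *.
set B := Num.min (Num.max x 0) kap in h2 *; set B' := Num.min (Num.max y 0) kap in h2 *.
set c := kap `^ rho / kap in c0 h2 *.
rewrite (_ : A - _ + _ - _ = (A - A') + c * (B - B')); last by ring.
apply: le_trans (ler_normD _ _) _; rewrite normrM (ger0_norm c0) mulrDl.
exact: lerD.
Qed.

Lemma kernel_bounded : exists2 G : R, 0 <= G & forall x, 0 <= kernel x <= G.
Proof.
have k0 := kap0; have kb := kapb; have [M M0 HM] := powR_bounded b rho kap0.
have [L L0 HL] := kernel_lip.
have c0 : 0 <= kap `^ rho / kap by rewrite divr_ge0 ?powR_ge0// ltW.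
exists (M + kap `^ rho); first by rewrite addr_ge0 ?powR_ge0// ltW.
move=> x; have [x0|x0] := leP x 0.
  by rewrite kernel_le0// lexx addr_ge0 ?powR_ge0// ltW.
have [xk|xk] := leP x kap.
  rewrite kernel_near ?(ltW x0)// mulr_ge0 ?(ltW x0)//=.
  apply: (@le_trans _ _ (kap `^ rho)); last by rewrite lerDr ltW.
  by rewrite -[leRHS](@divfK _ kap) ?gt_eqF// ler_wpM2l.
rewrite /kernel (max_l (ltW xk)) (max_l (ltW x0)) (min_r (ltW xk)) divfK ?gt_eqF// subrK powR_ge0/=.
have [h _] := HM (Num.min x b) ltac:(by rewrite le_min (ltW xk) kb ge_min lexx orbT).
by apply: le_trans h _; rewrite lerDl powR_ge0.
Qed.

End kernel.

(** The error in one block is at most [q * L] times the advance of the walk over the block, and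
    these advances telescope. *)
Lemma block_discretization {R : realType} (g : R -> R) (L b u : R) (a : nat -> R) (q B : nat) :
  0 <= L -> (forall x y, `|g x - g y| <= L * `|x - y|) -> (forall x, x <= 0 -> g x = 0) ->
  0 <= b -> u <= b -> (forall k, 0 <= a k) -> (forall i j, (i <= j)%N -> a i <= a j) ->
  `|\sum_(k < B * q) g (u - a k.+1) - q%:R * \sum_(j < B) g (u - a (j.+1 * q)%N)| <= q%:R * L * b.
Proof.
move=> L0 gL g0 b0 ub a0 amono.
(* Points beyond [b >= u] do not contribute since [g] vanishes on the left; clamping there bounds
   the telescoped sum by [b]. *)
pose m k := Num.min (a k) b.
have gm k : g (u - a k) = g (u - m k).
  rewrite /m; case: (leP (a k) b) => // h; rewrite !g0//; lra.
have mmono i j : (i <= j)%N -> m i <= m j.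
  by move=> ij; rewrite /m le_min !ge_min amono//= lexx orbT.
suff H : `|\sum_(k < B * q) g (u - a k.+1) - q%:R * \sum_(j < B) g (u - a (j.+1 * q)%N)| <=
    q%:R * L * (m (B * q)%N - m 0%N).
  apply: le_trans H _; apply: ler_wpM2l; first by rewrite mulr_ge0.
  have h1 : m (B * q)%N <= b by rewrite /m ge_min lexx orbT.
  have h2 : 0 <= m 0%N by rewrite /m le_min a0.
  lra.
elim: B => [|B IH]; first by rewrite mul0n !big_ord0 mulr0 subrr normr0 subrr mulr0.
rewrite [X in `|_ - _ * X|]big_ord_recr/=.
have -> : \sum_(k < B.+1 * q) g (u - a k.+1) = \sum_(k < B * q) g (u - a k.+1) +
    \sum_(i < q) g (u - a (B * q + i).+1).
  by rewrite mulSnr big_split_ord.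
have blk : `|\sum_(i < q) g (u - a (B * q + i).+1) - q%:R * g (u - a (B.+1 * q)%N)| <=
    q%:R * L * (m (B.+1 * q)%N - m (B * q)%N).
  have -> : q%:R * g (u - a (B.+1 * q)%N) = \sum_(i < q) g (u - a (B.+1 * q)%N).
    by rewrite sumr_const card_ord mulr_natl.
  rewrite -sumrB; apply: le_trans (ler_norm_sum _ _ _) _.
  apply: (@le_trans _ _ (\sum_(i < q) L * (m (B.+1 * q)%N - m (B * q)%N))).
    apply: ler_sum => i _; rewrite 2!gm; apply: le_trans (gL _ _) _; apply: ler_wpM2l => //.
    have h1 : m (B * q + i).+1 <= m (B.+1 * q)%N by apply: mmono; rewrite mulSnr ltn_add2l.
    have h2 : m (B * q)%N <= m (B * q + i).+1 by apply: mmono; rewrite -addnS leq_addr.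
    by rewrite ler_norml; apply/andP; split; lra.
  by rewrite sumr_const card_ord -[leLHS]mulr_natl mulrA.
have h := lerD IH blk.
rewrite (_ : q%:R * L * (m (B.+1 * q)%N - m 0%N) =
  q%:R * L * (m (B * q)%N - m 0%N) + q%:R * L * (m (B.+1 * q)%N - m (B * q)%N)); last by ring.
apply: le_trans h; apply: le_trans (ler_normD _ _).
by rewrite mulrDr opprD addrACA.
Qed.

Lemma pow_inv2_powR {R : realType} (i : nat) (r : R) : (2^-1 ^+ i) `^ r = (2 `^ (- r)) ^+ i.
Proof.
rewrite -powR_mulrn ?powR_ge0// -powRrM.
have -> : 2^-1 ^+ i = 2 `^ (- i%:R) :> R by rewrite powRN powR_mulrn// exprVn.
by rewrite -powRrM; congr (_ `^ _); ring.
Qed.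

Lemma geometric_tail {R : realType} (z : R) (i0 I : nat) : 0 <= z < 1 ->
  \sum_(i0 <= i < I) z ^+ i <= z ^+ i0 / (1 - z).
Proof.
move=> /andP[z0 z1]; have z1' : 0 < 1 - z by rewrite subr_gt0.
have [iI|Ii] := leqP i0 I; last first.
  by rewrite big_geq ?(ltnW Ii)// divr_ge0 ?exprn_ge0// ltW.
rewrite ler_pdivlMr//.
have -> : (\sum_(i0 <= i < I) z ^+ i) * (1 - z) = z ^+ i0 - z ^+ I.
  have := telescope_sumr (fun i => - z ^+ i) iI.
  rewrite opprK (addrC (- z ^+ I)) => <-; rewrite mulr_suml; apply: eq_bigr => i _.
  by rewrite exprSr; ring.
by rewrite gerBl exprn_ge0.
Qed.

Lemma exprn_small {R : realType} (z C e : R) : 0 <= z < 1 -> 0 < e ->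
  exists i1 : nat, forall i, (i1 <= i)%N -> C * z ^+ i <= e.
Proof.
move=> /andP[z0 z1] e0; have c0 : 0 < `|C| + 1 by rewrite ltr_wpDl.
have ec : 0 < e / (`|C| + 1) by rewrite divr_gt0.
have /cvgrPdist_le/(_ _ ec)[i1 _ H] : (fun n => z ^+ n) @ \oo --> (0 : R).
  by apply: cvg_expr; rewrite ger0_norm.
exists i1 => i ii; have := H i ii; rewrite /= sub0r normrN ger0_norm ?exprn_ge0//.
rewrite ler_pdivlMr// => h; have zi : 0 <= z ^+ i by rewrite exprn_ge0.
have : C * z ^+ i <= `|C| * z ^+ i by rewrite ler_wpM2r// ler_norm.
by lra.
Qed.

(** Far from [u * t] regular variation compares [h] with the power uniformly; within [kap * t] both
    terms are only bounded in absolute value. The point [y = 0] always counts as far, because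
    [kap <= u]. *)
Lemma kernel_compare {R : realType} (h : R -> R) (pt t kap b rho u y ep : R) :
  0 < t -> 0 < pt -> 0 < h t -> 0 < kap -> kap <= b -> kap <= u -> u <= b -> 0 <= y -> 0 <= ep ->
  (forall x, kap <= x <= b -> `|h (t * x) / h t - x `^ rho| <= ep) ->
  `|pt / h t * shift0 h y (u * t) - pt * kernel kap b rho (u - y / t)| <=
    pt / h t * (if (0 < y) && (u * t - kap * t <= y <= u * t) then `|h (u * t - y)| else 0) +
    pt * kap `^ rho * ((0 < y)%R && (u * t - kap * t <= y <= u * t)%R)%:R +
    pt * ep * (y <= u * t)%R%:R.
Proof.
move=> t0 pt0 ht0 k0 kb ku ub y0 ep0 hh.
have tn0 : t != 0 by rewrite gt_eqF.
have uw : u - y / t = (u * t - y) / t by field.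
have pk := powR_ge0 kap rho.
have ph : 0 <= pt / h t by rewrite divr_ge0// ltW.
set x := u * t in uw *.
rewrite /shift0; have [wx|wx] := leP y x; last first.
  rewrite !andbF !mulr0 !addr0 sub0r normrN uw kernel_le0 ?mulr0 ?normr0//.
  by rewrite ler_pdivrMr// mul0r subr_le0 ltW.
rewrite andbT; case: (boolP (_ && _)) => nk.
  have /andP[_ h1] := nk.
  rewrite !mulr1; apply: le_trans (ler_normB _ _) _.
  rewrite [`|pt / h t * _|]normrM (ger0_norm ph) [`|pt * _|]normrM (gtr0_norm pt0).
  rewrite -addrA lerD2l; apply: (@le_trans _ _ (pt * kap `^ rho)).
    have xk : 0 <= (x - y) / t <= kap.
      by rewrite ler_pdivlMr// mul0r subr_ge0 wx ler_pdivrMr//=; lra.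
    rewrite ler_pM2l// uw kernel_near//; have /andP[xk0 xk1] := xk.
    have c0 : 0 <= kap `^ rho / kap by rewrite divr_ge0 ?powR_ge0// ltW.
    rewrite ger0_norm; last exact: mulr_ge0.
    by apply: le_trans (ler_wpM2l c0 xk1) _; rewrite divfK// gt_eqF.
  by rewrite lerDl mulr_ge0// ltW.
rewrite !mulr0 !add0r mulr1.
have far : kap <= (x - y) / t <= b.
  rewrite ler_pdivlMr// ler_pdivrMr//; apply/andP; split.
    move: nk; have [ws _|ws] := leP y 0.
      have -> : y = 0 by apply/eqP; rewrite eq_le ws y0.
      by rewrite subr0 ler_pM2r.
    by rewrite /= -ltNge; lra.
  by rewrite lerBlDr; apply: ler_wpDr => //; rewrite ler_pM2r.
rewrite uw kernel_far//.
rewrite (_ : _ - _ = pt * (h (t * ((x - y) / t)) / h t - ((x - y) / t) `^ rho)); last first.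
  by rewrite (mulrC t) divfK//; field; rewrite gt_eqF.
by rewrite normrM (gtr0_norm pt0) ler_pM2l// hh.
Qed.

Section mean_term.
Context d (T : measurableType d) (R : realType) (P : probability T R).
Variable S : nat -> set (set T).
Hypothesis Ssig : forall k, sigma_algebra setT (S k).
Hypothesis Smeas : forall k A, S k A -> measurable A.
Hypothesis Sind : indep_sigma P S.
Variable xi : nat -> T -> R.
Hypothesis xiS : forall k, adapted (S k) (xi k).
Hypothesis xi0 : forall k w, 0 <= xi k w.
Variable N0 : set T.
Hypothesis mN0 : measurable N0.
Hypothesis PN0 : P N0 = 0%E.
Hypothesis xiN0 : forall w, ~ N0 w -> forall k, 0 < xi k w.
Variables (p : R -> R) (alpha : R).
Hypothesis p01 : forall y, 0 < p y <= 1.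
Hypothesis pdec : forall y z, y <= z -> p z <= p y.
Hypothesis rvp : regularly_varying p (- alpha).
Hypothesis Hl : forall y i, 0 < y ->
  (\int[P]_w (expR (- (y^-1 * xi i w)))%:E <= (expR (- (p y / 2)))%:E)%E.
Variables (h : R -> R) (rho : R).
Hypothesis rho_alpha : - alpha < rho.
Hypothesis rvh : regularly_varying h rho.
Hypothesis ch : cadlag0 h.

Let p0 y : 0 < p y. Proof. by case/andP: (p01 y). Qed.

(** In the shell of distance [s] the counts are of order [1 / p s], so [h] contributes about [H s]
    with [H = h / p], regularly varying of positive index [rho + alpha]. The shells near the
    singularity thus form a geometric series, and a small cutoff makes their total small. *)
Lemma mean_term (a b e : R) : 0 < a -> a < b -> 0 < e -> exists i1 : nat, forall i0, (i1 <= i0)%N ->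
  \forall t \near +oo, forall N : nat, exists A, [/\ measurable A, (P A <= e%:E)%E &
    forall w, ~ A w -> forall u, a <= u <= b ->
    `|p t / h t * \sum_(k < N) shift0 h (walk xi k w) (u * t) -
      p t * \sum_(k < N) kernel (b / 2 ^+ i0) b rho (u - walk xi k w / t)| <= e].
Proof.
move=> a0 ab e0; have b0 : 0 < b by exact: lt_trans ab.
have ra := rho_alpha.
have [H HE] : exists H : R -> R, forall t, H t = h t / p t by exists (fun t => h t / p t).
have rvH : regularly_varying H (rho + alpha).
  have -> : H = (fun t => h t * (p t)^-1) by apply/funext => t; rewrite HE.
  by have := regularly_varyingM rvh (regularly_varying_inv rvp); rewrite opprK.
have hhalf : 1 / 2 <= (1 / 2 : R) <= 1 by lra.
have hsub (y y' : R) : - (y' / 2) <= y - y' -> y' / 2 <= y by lra.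
pose g := (rho + alpha) / 4.
have g0 : 0 < g by rewrite /g divr_gt0//; lra.
have g4 : rho + alpha = 4 * g by rewrite /g mulrC divfK.
have g3 : rho + alpha - g = 3 * g by lra.
pose n := (Num.truncn (2 / g)).+1.
have n0' : 0 < n%:R :> R by [].
have ng : 2 / n%:R <= g by rewrite ler_pdivrMr// mulrC -ler_pdivrMr// ltW// truncnS_gt.
have ng0 : 0 < 2 / n%:R :> R by rewrite divr_gt0.
have [q q1 [qn qI]] := @root_of_4 R n isT.
have q0 : 0 < q by exact: lt_trans q1.
have [K [K1 HK]] := @exp_sum_small R n q e isT q0 qn e0.
have K0 : 0 < K by exact: lt_le_trans K1.
have [C1 [s0 [C10 s01 HC1]]] := regularly_varying_potter rvH g0.
have s0p : 0 < s0 by exact: lt_le_trans s01.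
have [C2 C20 /near_pinftyP[s2 [s21 HC2]]] := regularly_varying_compare 1 rvp (c := 1 / 2) ltac:(lra).
pose s1 := Num.max s0 s2.
have s10 : s0 <= s1 by rewrite le_max lexx.
have s12 : s2 <= s1 by rewrite le_max lexx orbT.
have s1g : 1 <= s1 by exact: le_trans s10.
have s1p : 0 < s1 by exact: lt_le_trans s1g.
have [Bh HBh] := cadlag_bounded (2 * s1) ch.
have Bh0 : 0 <= Bh by apply: le_trans (HBh 0 _); rewrite ?lexx ?mulr_ge0//; exact: ltW.
have [C4 C40 nearC4] := regularly_varying_compare b rvH b0.
have [C6 C60 nearC6] := regularly_varying_compare b rvp b0.
have [Ch [s3 [Ch0 s31 HCh]]] := regularly_varying_potter_lb rvH g0.
(* The decay exponent per octave left of [rho + alpha = 4 g] after the Potter loss [g] and the loss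
   [2 / n] from [q ^+ i]. *)
pose th := 3 * g - 2 / n%:R.
have th0 : 0 < th by rewrite /th; lra.
pose z : R := 2 `^ (- th).
have z01 : 0 <= z < 1.
  rewrite powR_ge0/= /z /powR pnatr_eq0/= -[ltRHS]expR0 ltr_expR mulNr oppr_lt0 mulr_gt0//.
  by rewrite ln_gt0// ltr1n.
have z1' : 0 < 1 - z by rewrite subr_gt0; case/andP: z01.
have z0 : 0 <= z by case/andP: z01.
pose C3 := 6 * K * C1 * C2.
have C30 : 0 < C3 by rewrite /C3 !mulr_gt0.
have e4 : 0 < e / 4 by rewrite divr_gt0.
have [i1 Hi1] := exprn_small (C3 * C4 / (1 - z)) z01 e4.
have [i2 Hi2] := exprn_small (12 * K * b `^ (4 * g)) z01 e4.
have [i3 Hi3] : exists i3 : nat, forall i, (i3 <= i)%N -> b / 2 ^+ i <= a.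
  have h2 : 0 <= (2^-1 : R) < 1 by lra.
  have [i3 H3] := exprn_small b h2 a0.
  by exists i3 => i ii; have := H3 i ii; rewrite exprVn.
(* The three bounds serve the geometric tail of the shells, the linear part of the kernel, and
   [kap <= a]. *)
exists (maxn i1 (maxn i2 i3)) => i0; rewrite !geq_max => /and3P[ii1 ii2 ii3].
have hi1 := Hi1 i0 ii1; have hi2 := Hi2 i0 ii2; have hi3 := Hi3 i0 ii3.
set kap := b / 2 ^+ i0 in hi3 *.
have p2 i : 0 < 2 ^+ i :> R by rewrite exprn_gt0.
have kap0 : 0 < kap by rewrite divr_gt0.
have kn0 : kap != 0 by rewrite gt_eqF.
have kapb : kap <= b by apply: le_trans hi3 (ltW ab).
pose C7 := 1 + 6 * K * C6.
have C70 : 0 < C7 by rewrite /C7; have := mulr_gt0 K0 C60; lra.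
have ec : 0 < e / 4 / C7 by rewrite !divr_gt0.
have nearh := rvh.2 kap b (e / 4 / C7) kap0 ec.
have kp : 0 < kap `^ (- alpha) / 2 by rewrite divr_gt0// powR_gt0.
have nearp := rvp.2 kap kap (kap `^ (- alpha) / 2) kap0 kp.
have near0 := rvh.1.
(* The constant for the bottom shell, where [h] is merely bounded: its count [q ^+ I] is [O (t]^
   g)[while]H t[is at least of order]t [^ (3 * g)]. *)
pose C8 := 6 * K * Bh / p (2 * s1) * (b `^ g / Ch).
have nearz : \forall t \near +oo, `|C8| * t `^ (- (2 * g)) <= e / 4.
  have := @sum_powR_cvg0 R 1 (fun=> `|C8|) (fun=> - (2 * g)) (e / 4) (fun _ _ => or_intror _) e4.
  move=> H0; have {}H0 := H0 ltac:(rewrite oppr_lt0 mulr_gt0//).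
  by apply: filterS H0 => t; rewrite big_ord1.
near=> t => N.
have t1 : 1 <= t by near: t; exact: nbhs_pinfty_ge.
have t0 : 0 < t by exact: lt_le_trans t1.
have tn0 : t != 0 by rewrite gt_eqF.
have tb : 2 * s1 / b <= t by near: t; exact: nbhs_pinfty_ge (num_real _).
have tk : 2 * s1 / kap + 1 <= t by near: t; exact: nbhs_pinfty_ge (num_real _).
have ts3 : s3 <= t by near: t; exact: nbhs_pinfty_ge (num_real _).
have ht0 : 0 < h t by near: t; exact: near0.
have [hC4 _] : H (t * b) <= C4 * H t /\ H t <= C4 * H (t * b).
  by (suff : forall x, b <= x <= b -> H (t * x) <= C4 * H t /\ H t <= C4 * H (t * x) by apply; rewrite lexx); near: t; exact: nearC4.
have [_ hC6] : p (t * b) <= C6 * p t /\ p t <= C6 * p (t * b).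
  by (suff : forall x, b <= x <= b -> p (t * x) <= C6 * p t /\ p t <= C6 * p (t * x) by apply; rewrite lexx); near: t; exact: nearC6.
have hh : forall x, kap <= x <= b -> `|h (t * x) / h t - x `^ rho| <= e / 4 / C7 by near: t; exact: nearh.
have hp : forall x, kap <= x <= kap -> `|p (t * x) / p t - x `^ (- alpha)| <= kap `^ (- alpha) / 2 by near: t; exact: nearp.
have hz : `|C8| * t `^ (- (2 * g)) <= e / 4 by near: t; exact: nearz.
pose TT := b * t.
have TT0 : 0 < TT by rewrite mulr_gt0.
have TTs : 1 <= TT / (2 * s1).
  by rewrite ler_pdivlMr ?mulr_gt0// mul1r /TT (mulrC b) -ler_pdivrMr.
(* The last level is chosen so that [TT / 2 ^+ I] lies in [[s1, 2 * s1]]: Potter bounds hold above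
   it, and boundedness of [h] is used below. *)
have [I [tI It]] := pow2_cover TTs.
have TI1 : s1 <= TT / 2 ^+ I.
  rewrite ler_pdivlMr//; move: It; rewrite mulrC => It.
  have -> : TT = s1 * (TT / (2 * s1) * 2) by field; rewrite gt_eqF.
  by rewrite ler_pM2l.
have TI2 : TT / 2 ^+ I <= 2 * s1.
  by rewrite ler_pdivrMr//; move: tI; rewrite ler_pdivrMr ?mulr_gt0// mulrC.
have i0I : (i0 <= I)%N.
  rewrite leqNgt; apply/negP => Ii; have : TT / 2 ^+ i0 <= TT / 2 ^+ I.
    by rewrite ler_pM2l// lef_pV2 ?posrE// ler_eXn2l ?ltr1n// ltnW.
  rewrite (_ : TT / 2 ^+ i0 = kap * t); last by rewrite /kap /TT mulrAC.
  move=> h1; have := le_trans h1 TI2; rewrite mulrC -ler_pdivlMr// leNgt => /negP; apply.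
  by apply: lt_le_trans tk; rewrite ltrDl.
have [A [mA [PA HA]]] := @renewal_good_event _ _ _ P S Ssig Smeas Sind xi xiS p q e K
  (fun y _ => p01 y) xi0 Hl (ltW q1) K1 HK TT N I.+1 TT0.
exists (A `|` N0); split; first exact: measurableU.
  by rewrite -[e]addr0; apply: prob_setU_le => //; rewrite PN0.
move=> w /not_orP[nA nN] u /andP[au ub].
have u0 : 0 < u by exact: lt_le_trans au.
set x := u * t.
have x0 : 0 < x by rewrite mulr_gt0.
have xTT : x <= TT by rewrite ler_pM2r.
have win i : (i < I.+1)%N -> (window_count xi N x (TT / 2 ^+ i) w)%:R <= 6 * K * q ^+ i / p (TT / 2 ^+ i).
  by move=> iI; apply: HA => //; rewrite (ltW x0).
have Ht0 : 0 < H t by rewrite HE divr_gt0.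
have pH : p t / h t = (H t)^-1 by rewrite HE invf_div.
have kapT : TT / 2 ^+ i0 = kap * t by rewrite /kap /TT mulrAC.
pose nr k := (0 < walk xi k w) && (x - TT / 2 ^+ i0 <= walk xi k w <= x).
have term (k : 'I_N) : `|p t / h t * shift0 h (walk xi k w) x - p t * kernel kap b rho (u - walk xi k w / t)| <=
    (H t)^-1 * (if nr k then `|h (x - walk xi k w)| else 0) + p t * kap `^ rho * (nr k)%:R +
    p t * (e / 4 / C7) * (walk xi k w <= x)%R%:R.
  have := @kernel_compare R h (p t) t kap b rho u (walk xi k w) (e / 4 / C7) t0 (p0 t) ht0 kap0 kapb
    (le_trans hi3 au) ub (walk_ge0 xi0 w k) (ltW ec) hh.
  by rewrite /nr kapT -/x -pH.
rewrite !mulr_sumr -sumrB; apply: le_trans (ler_norm_sum _ _ _) _.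
apply: le_trans (ler_sum _ (fun k _ => term k)) _.
rewrite !big_split/= -!mulr_sumr.
have qE i : q ^+ i = (2 `^ (2 / n%:R)) ^+ i.
  by rewrite qI -[in LHS]powR_mulrn// -powRrM mulrC powRrM powR_mulrn// powR_ge0.
have zE i : (2^-1 ^+ i) `^ (3 * g) * q ^+ i = z ^+ i.
  rewrite pow_inv2_powR qE -exprMn -powRD ?pnatr_eq0 ?implybT//.
  by congr (_ `^ _ ^+ _); rewrite /th; ring.
have HTT : H TT <= C4 * H t by rewrite /TT mulrC.
have HTT0 : 0 < H TT.
  have [] := HC1 TT TT _ (lexx _) => //; apply: le_trans s10 (le_trans TI1 _).
  by rewrite ler_pdivrMr// ler_peMr ?(ltW TT0)// exprn_ege1// ler1n.
have near_h : (H t)^-1 * (\sum_(k < N) (if nr k then `|h (x - walk xi k w)| else 0)) <= e / 4 + e / 4.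
  pose Phi i := if (i < I)%N then C1 * C2 * (2^-1 ^+ i) `^ (3 * g) * H TT * p (TT / 2 ^+ i) else Bh.
  have Phi0 i : 0 <= Phi i.
    rewrite /Phi; case: ifP => // _.
    by rewrite !mulr_ge0 ?powR_ge0 ?(ltW C10) ?(ltW C20) ?(ltW HTT0) ?(ltW (p0 _)).
  have P1 i s : (i0 <= i < I)%N -> TT / 2 ^+ i.+1 < s <= TT / 2 ^+ i -> `|h s| <= Phi i.
    move=> /andP[_ iI] /andP[sl sr]; rewrite /Phi iI.
    have si1 : s1 <= TT / 2 ^+ i.+1.
      apply: le_trans TI1 _; rewrite ler_pM2l// lef_pV2 ?posrE// ler_eXn2l ?ltr1n//.
    have ss : s0 <= s by apply: le_trans s10 (le_trans si1 (ltW sl)).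
    have sp : 0 < s by apply: lt_le_trans ss.
    have sT : s / TT <= 2^-1 ^+ i by rewrite ler_pdivrMr// mulrC exprVn.
    have sTT : s <= TT.
      by apply: le_trans sr _; rewrite ler_pdivrMr// ler_peMr ?(ltW TT0)// exprn_ege1// ler1n.
    have [Hs0 Hs] := HC1 s TT ss sTT.
    have -> : h s = H s * p s by rewrite HE divfK// gt_eqF.
    rewrite normrM !gtr0_norm//.
    have si : s2 <= TT / 2 ^+ i.
      apply: le_trans s12 (le_trans TI1 _); rewrite ler_pM2l// lef_pV2 ?posrE// ler_eXn2l ?ltr1n//.
      exact: ltnW.
    have [hp2 _] := HC2 _ si (1 / 2) hhalf.
    have ps : p s <= C2 * p (TT / 2 ^+ i).
      apply: le_trans hp2; apply: pdec; apply: ltW; apply: le_lt_trans sl.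
      by rewrite exprS div1r -mulrA -invfM (mulrC (2 ^+ i)).
    have sg : (s / TT) `^ (rho + alpha - g) <= (2^-1 ^+ i) `^ (3 * g).
      rewrite g3.
      by apply: ler_powRl => //; [rewrite divr_gt0|rewrite mulr_ge0// ltW].
    rewrite [leRHS](_ : _ = (C1 * (2^-1 ^+ i) `^ (3 * g) * H TT) * (C2 * p (TT / 2 ^+ i))); last by ring.
    apply: ler_pM => //; [exact: ltW|exact: ltW|apply: le_trans Hs _].
    by rewrite ler_pM2r// ler_pM2l.
  have P2 s : 0 <= s <= TT / 2 ^+ I -> `|h s| <= Phi I.
    move=> /andP[s_0 s_1]; rewrite /Phi ltnn; apply: HBh; rewrite s_0.
    exact: le_trans TI2.
  have := @shell_sum _ T R xi N I i0 TT x w (fun s => `|h s|) Phi TT0 i0I Phi0 P1 P2.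
  rewrite -/(nr _) => hs.
  have {}hs : \sum_(k < N) (if nr k then `|h (x - walk xi k w)| else 0) <=
    \sum_(i0 <= i < I.+1) Phi i * (window_count xi N x (TT / 2 ^+ i) w)%:R by exact: hs.
  rewrite ler_pdivrMl//; apply: le_trans hs _.
  rewrite big_nat_recr//= mulrDr; apply: lerD.
    apply: (@le_trans _ _ (\sum_(i0 <= i < I) C3 * H TT * z ^+ i)).
      rewrite big_nat [leRHS]big_nat; apply: ler_sum => i /andP[ii iI].
      apply: le_trans (ler_wpM2l (Phi0 i) (win i (ltnW iI))) _.
      rewrite /Phi iI -zE le_eqVlt; apply/orP; left; apply/eqP; rewrite /C3.
      by field; rewrite gt_eqF.
    rewrite -mulr_sumr; apply: le_trans (ler_wpM2l _ (geometric_tail i0 I z01)) _.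
      by rewrite mulr_ge0 ?(ltW C30) ?(ltW HTT0).
    have zi : 0 <= z ^+ i0 / (1 - z) by rewrite divr_ge0 ?exprn_ge0// ltW.
    apply: (@le_trans _ _ (C3 * (C4 * H t) * (z ^+ i0 / (1 - z)))).
      by rewrite ler_wpM2r// ler_pM2l.
    rewrite [leLHS](_ : _ = H t * (C3 * C4 / (1 - z) * z ^+ i0)); last by ring.
    by rewrite ler_pM2l.
  apply: le_trans (ler_wpM2l (Phi0 I) (win I (ltnSn I))) _; rewrite /Phi ltnn.
  have bg := powR_ge0 b g.
  have qb : q ^+ I <= b `^ g * t `^ g.
    rewrite -powRM ?(ltW b0) ?(ltW t0)// -/TT qI.
    have I1 : 1 <= 2 ^+ I :> R by rewrite exprn_ege1// ler1n.
    apply: (@le_trans _ _ ((2 ^+ I) `^ g)); first exact: ler_powR.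
    apply: ler_powRl; [by []| |exact: ltW].
    by move: TI1; rewrite ler_pdivlMr// => h1; apply: le_trans h1; rewrite ler_peMl// ltW.
  have pI : (p (TT / 2 ^+ I))^-1 <= (p (2 * s1))^-1 by rewrite lef_pV2 ?posrE ?p0//; exact: pdec.
  have Ht3 := HCh t ts3.
  rewrite g3 in Ht3.
  apply: (@le_trans _ _ (Bh * (6 * K * (b `^ g * t `^ g) * (p (2 * s1))^-1))).
    rewrite ler_wpM2l//; apply: ler_pM => //.
    - by rewrite !mulr_ge0 ?exprn_ge0 ?(ltW q0) ?(ltW K0).
    - by rewrite invr_ge0 ltW// p0.
    - by rewrite ler_pM2l// mulr_gt0.
  have tg3 : t `^ g = t `^ (- (2 * g)) * t `^ (3 * g).
    by rewrite -powRD ?tn0 ?implybT//; congr (_ `^ _); ring.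
  have C80 : 0 <= C8.
    by rewrite /C8 !mulr_ge0 ?invr_ge0 ?(ltW K0) ?(ltW (p0 _)) ?powR_ge0 ?(ltW Ch0).
  apply: (@le_trans _ _ (`|C8| * t `^ (- (2 * g)) * (Ch * t `^ (3 * g)))).
    rewrite (ger0_norm C80) tg3 le_eqVlt; apply/orP; left; apply/eqP; rewrite /C8.
    by field; rewrite !gt_eqF.
  rewrite mulrC; apply: ler_pM => //; first by rewrite mulr_ge0 ?powR_ge0 ?(ltW Ch0).
  by rewrite mulr_ge0 ?powR_ge0.
have near_g : p t * kap `^ rho * (\sum_(k < N) (nr k)%:R) <= e / 4.
  have -> : \sum_(k < N) (nr k)%:R = (window_count xi N x (TT / 2 ^+ i0) w)%:R :> R.
    by rewrite /window_count natr_sum.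
  have c0 : 0 <= p t * kap `^ rho by rewrite mulr_ge0 ?powR_ge0 ?(ltW (p0 _)).
  apply: le_trans (ler_wpM2l c0 (win i0 _)) _; first by rewrite ltnS.
  have pk : p t <= 2 * kap `^ alpha * p (TT / 2 ^+ i0).
    have := hp kap ltac:(by rewrite lexx); rewrite ler_norml => /andP[h1 _].
    have ka : 0 < kap `^ alpha by exact: powR_gt0.
    rewrite kapT (mulrC kap).
    have h2 : (kap `^ alpha)^-1 / 2 <= p (t * kap) / p t.
      by rewrite -powRN; exact: hsub.
    move: h2; rewrite ler_pdivlMr// ?p0// -ler_pdivlMl ?divr_gt0 ?invr_gt0//.
    by rewrite invf_div invrK.
  have rr : kap `^ rho * kap `^ alpha = b `^ (4 * g) * (2^-1 ^+ i0) `^ (4 * g).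
    rewrite -powRM ?exprn_ge0 ?invr_ge0 ?(ltW b0)// exprVn -/kap -powRD ?kn0 ?implybT//.
    by rewrite g4.
  apply: (@le_trans _ _ (2 * kap `^ alpha * p (TT / 2 ^+ i0) * kap `^ rho * (6 * K * q ^+ i0 / p (TT / 2 ^+ i0)))).
    rewrite ler_wpM2r//; last by rewrite ler_wpM2r ?powR_ge0.
    by rewrite divr_ge0 ?mulr_ge0 ?exprn_ge0 ?(ltW q0) ?(ltW K0) ?(ltW (p0 _)).
  rewrite [leLHS](_ : _ = 12 * K * (kap `^ rho * kap `^ alpha) * q ^+ i0); last by field; rewrite gt_eqF ?p0.
  rewrite rr; apply: le_trans hi2.
  rewrite [leLHS](_ : _ = 12 * K * b `^ (4 * g) * ((2^-1 ^+ i0) `^ (4 * g) * q ^+ i0)); last by ring.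
  rewrite ler_wpM2l ?mulr_ge0 ?powR_ge0 ?(ltW K0)// -zE.
  rewrite ler_pM2r ?exprn_gt0//.
  have hf : 0 < 2^-1 ^+ i0 :> R by rewrite exprn_gt0.
  have hf' : 2^-1 ^+ i0 != 0 :> R by rewrite gt_eqF.
  have -> : 4 * g = g + 3 * g by ring.
  rewrite powRD ?hf' ?implybT// -[leRHS]mul1r ler_wpM2r ?powR_ge0//.
  apply: (@le_trans _ _ (1 `^ g)); last by rewrite powR1.
  apply: ler_powRl; [exact: hf| |exact: ltW].
  by rewrite exprn_ile1// ?invr_ge0// invf_le1// ler1n.
have far_ : p t * (e / 4 / C7) * (\sum_(k < N) (walk xi k w <= x)%R%:R) <= e / 4.
  have cnt : \sum_(k < N) (walk xi k w <= x)%R%:R <= 1 + (window_count xi N x (TT / 2 ^+ 0) w)%:R :> R.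
    rewrite /window_count natr_sum expr0 divr1.
    have tm (k : nat) : (0 < k)%N -> ((walk xi k w <= x)%R%:R : R) <=
        ((0 < walk xi k w)%R && (x - TT <= walk xi k w <= x)%R)%:R.
      move=> k0; have wk := walk_gt0 xi0 xiN0 nN k0; rewrite wk (_ : x - TT <= walk xi k w)//.
      by apply: le_trans (ltW wk); rewrite subr_le0.
    case: (N) => [|N']; first by rewrite !big_ord0 addr0.
    rewrite !big_ord_recl/= walk0 ltxx (ltW x0)/= add0r lerD2l; apply: ler_sum => k _.
    exact: tm.
  have := win 0%N (ltn0Sn _); rewrite expr0 mulr1 divr1 => wT.
  have pT : p t / p TT <= C6 by rewrite ler_pdivrMr ?p0// /TT (mulrC b).
  have hc : p t * \sum_(k < N) (walk xi k w <= x)%R%:R <= C7.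
    apply: (@le_trans _ _ (p t * (1 + 6 * K / p TT))).
      rewrite ler_pM2l ?p0//; apply: le_trans cnt _; rewrite lerD2l expr0 divr1; exact: wT.
    rewrite mulrDr mulr1 /C7; apply: lerD; first by case/andP: (p01 t).
    rewrite [leLHS](_ : _ = 6 * K * (p t / p TT)); last by ring.
    by rewrite ler_pM2l// mulr_gt0.
  rewrite mulrAC; apply: le_trans (ler_wpM2r (ltW ec) hc) _.
  by rewrite mulrC divfK// gt_eqF.
apply: le_trans (lerD (lerD near_h near_g) far_) _.
by rewrite (_ : e / 4 + e / 4 + e / 4 + e / 4 = e)//; field.
Unshelve. all: by end_near. Qed.

End mean_term.

(** * Approximation by blocks of the walk *)

(** The common discrete form of both sides: [s] is the rescaled walk sampled at block ends, or the
    subordinator sampled on a grid. *)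
Definition block_path {R : realType} (g : R -> R) (m B : nat) (s : nat -> R) (u : R) : R :=
  m%:R^-1 * \sum_(j < B) g (u - s j.+1).

Lemma four_step_bound {R : realType} (e z1 z2 z3 z4 z5 z6 : R) : `|z1| <= e / 5 ->
  `|z2 - (z4 + z3)| <= e / 5 -> `|z3 - z6| <= e / 5 -> `|z6 - z5| + z4 <= e / 5 -> 0 <= z4 ->
  `|z1 + z2 - z5| <= e.
Proof.
rewrite !ler_norml => /andP[? ?] /andP[? ?] /andP[? ?].
have := ler_norm (z6 - z5); have := ler_norm (z5 - z6); rewrite (distrC z5).
by move=> ? ? ? ?; apply/andP; split; lra.
Qed.

Section process_approx.
Context d (T : measurableType d) (R : realType) (P : probability T R).
Variable S : nat -> set (set T).
Hypothesis Ssig : forall k, sigma_algebra setT (S k).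
Hypothesis Smeas : forall k A, S k A -> measurable A.
Hypothesis Sind : indep_sigma P S.
Variable xi : nat -> T -> R.
Hypothesis xiS : forall k, adapted (S k) (xi k).
Hypothesis xi0 : forall k w, 0 <= xi k w.

(** The exponential Markov inequality at parameter [y^-1], with the Laplace transform factorised by
    independence. *)
Lemma walk_lower_tail (n : nat) (y c : R) : 0 < y -> 0 <= c ->
  (forall i, (\int[P]_w (expR (- (y^-1 * xi i w)))%:E <= c%:E)%E) ->
  measurable [set w | walk xi n w <= y] /\
  (P [set w | (walk xi n w <= y)%R] <= (expR 1 * c ^+ n)%:E)%E.
Proof.
move=> y0 c0 Hc.
have mA : measurable [set w | walk xi n w <= y].
  rewrite -[X in measurable X]setTI (_ : [set w | _] = walk xi n @^-1` `]-oo, y]%classic).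
    have mw := @measurable_walk _ _ _ _ Smeas _ xiS n.
    exact: (mw measurableT _ (measurable_itv _)).
  by apply/seteqP; split => w /=; rewrite in_itv.
split => //.
have e0 : 0 <= expR 1 :> R by exact: expR_ge0.
have prod : (\int[P]_w (\prod_(i < n) expR (- (y^-1 * xi i w)))%:E <= (c ^+ n)%:E)%E.
  rewrite (@integral_prod_indep _ _ _ P S Ssig Smeas Sind n (fun i w => expR (- (y^-1 * xi i w)))).
  - elim: n {mA} => [|n IH]; first by rewrite big_ord0 expr0.
    rewrite big_ord_recr/= exprSr EFinM; apply: lee_pmul => //.
    + by apply: prode_ge0 => i _; apply: integral_ge0 => w _; rewrite lee_fin expR_ge0.
    + by apply: integral_ge0 => w _; rewrite lee_fin expR_ge0.
  - move=> k; apply: measurableT_comp; first exact: measurable_expR.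
    by apply: measurable_funN; apply: measurable_funM => //; exact: (@xiS k).
  - by move=> k w; exact: expR_ge0.
have -> : P [set w | walk xi n w <= y] = (\int[P]_w (\1_[set w | (walk xi n w <= y)%R] w)%:E)%E.
  by rewrite integral_indic// setIT.
rewrite EFinM; apply: le_trans (lee_wpmul2l _ prod); last by rewrite lee_fin.
rewrite -ge0_integralZl//; last 2 first.
- apply/measurable_EFinP; apply: measurable_prod => i _.
  apply: measurableT_comp; first exact: measurable_expR.
  by apply: measurable_funN; apply: measurable_funM => //; exact: (measurable_xi Smeas xiS).
- by move=> w _; rewrite lee_fin prodr_ge0// => i _; exact: expR_ge0.
apply: le_integral_all => w; rewrite -EFinM lee_fin indicE.
have [|_] := boolP (w \in _); last by rewrite mulr_ge0// prodr_ge0// => i _; exact: expR_ge0.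
rewrite inE /= => h; rewrite -expR_sum -expRD -[leLHS]expR0 ler_expR sumrN -mulr_sumr -/(walk xi n w).
by rewrite subr_ge0 mulrC ler_pdivrMr// mul1r.
Qed.

Lemma limn_shift0 (X : nat -> R -> R) (w : T) (x : R) (N : nat) : x < walk xi N w ->
  limn (fun n => \sum_(k < n) shift0 (X k) (walk xi k w) x) =
  \sum_(k < N.+1) shift0 (X k) (walk xi k w) x.
Proof.
move=> xN; apply: (@lim_near_cst R^o) => //; near=> n.
have Nn : (N.+1 <= n)%N by near: n; exact: nbhs_infty_ge.
rewrite -(subnKC Nn) big_split_ord/= [X in _ + X]big1 ?addr0// => i _.
rewrite /shift0 (_ : walk xi _ w <= x = false)//; apply/negbTE; rewrite -ltNge.
apply: lt_le_trans xN _; apply: walk_mono => //.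
by rewrite addSn ltnW// ltnS leq_addr.
Unshelve. all: by end_near. Qed.

Variables (p : R -> R) (alpha : R).
Hypothesis p01 : forall y, 0 < p y <= 1.
Hypothesis rvp : regularly_varying p (- alpha).
Hypothesis p_cvg0 : p t @[t --> +oo] --> (0 : R).
Hypothesis Hl : forall y i, 0 < y ->
  (\int[P]_w (expR (- (y^-1 * xi i w)))%:E <= (expR (- (p y / 2)))%:E)%E.
Variables (h : R -> R) (rho : R) (V : nat -> T -> R -> R).
Hypothesis rvh : regularly_varying h rho.
Hypothesis fluct : forall c eta e : R, 0 < c -> 0 < eta -> 0 < e ->
  \forall t \near +oo, forall N : nat, exists A, [/\ measurable A, (P A <= e%:E)%E &
    forall w, ~ A w -> forall x, 0 <= x <= c * t ->
      `|\sum_(k < N) shift0 (V k w) (walk xi k w) x| <= eta * (h t / p t)].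
Hypothesis mean : forall a b e : R, 0 < a -> a < b -> 0 < e -> exists i1 : nat, forall i0, (i1 <= i0)%N ->
  \forall t \near +oo, forall N : nat, exists A, [/\ measurable A, (P A <= e%:E)%E &
    forall w, ~ A w -> forall u, a <= u <= b ->
    `|p t / h t * \sum_(k < N) shift0 h (walk xi k w) (u * t) -
      p t * \sum_(k < N) kernel (b / 2 ^+ i0) b rho (u - walk xi k w / t)| <= e].

(** The integer part of [1 / (m p t)], so that a block carries mass close to [1 / m] under the
    normalisation [p t]. *)
Definition block_size (m : nat) (t : R) : nat := Num.truncn (m%:R * p t)^-1.

Let p0 y : 0 < p y. Proof. by case/andP: (p01 y). Qed.

Lemma block_size_bounds (m : nat) (t : R) : (0 < m)%N ->
  (block_size m t)%:R * p t <= m%:R^-1 /\ m%:R^-1 - p t <= (block_size m t)%:R * p t.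
Proof.
move=> m0; have mR : 0 < m%:R :> R by rewrite ltr0n.
have mp : 0 < m%:R * p t by rewrite mulr_gt0.
have v0 : 0 <= (m%:R * p t)^-1 by rewrite invr_ge0 ltW.
have pE : (m%:R * p t)^-1 * p t = m%:R^-1 by field; rewrite !gt_eqF.
split.
  by rewrite -pE ler_pM2r// truncn_le.
rewrite -pE lerBlDr -[X in _ + X]mul1r -mulrDl ler_pM2r// natr1.
by rewrite ltW// truncnS_gt.
Qed.

(** The horizon [C], the cutoff [i0] and the mesh [m] may each be enlarged at will before the next
    is chosen, so that common values can be taken for the process and for the limit. *)
Lemma process_approx (a b e : R) : 0 < a -> a < b -> 0 < e -> exists C0 : nat, forall C, (C0 <= C)%N ->
  exists i1, forall i0, (i1 <= i0)%N -> exists m0, forall m, (m0 <= m)%N -> (0 < m)%N ->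
  \forall t \near +oo, exists A, [/\ measurable A, (P A <= e%:E)%E &
    forall w, ~ A w -> forall u, a <= u <= b ->
    `|p t / h t * limn (fun n => \sum_(k < n) shift0 (fun s => V k w s + h s) (walk xi k w) (u * t)) -
      block_path (kernel (b / 2 ^+ i0) b rho) m (C * m)%N
        (fun j => walk xi (j * block_size m t)%N w / t) u| <= e].
Proof.
move=> a0 ab e0; have b0 : 0 < b by exact: lt_trans ab.
have e5 : 0 < e / 5 by rewrite divr_gt0.
have e35 : e / 5 + e / 5 + e / 5 <= e by lra.
have [D D0 nearD] := regularly_varying_compare b rvp b0.
(* [C * m] blocks carry walk steps of total mass about [C] relative to [1 / p t]; comparing [p t]
   with [p (t * b)] through [D], the walk stays below [b * t] with probability at most
   [expR 1 * expR (- C c1)]. *)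
pose c1 : R := (8 * D)^-1.
have c10 : 0 < c1 by rewrite invr_gt0 mulr_gt0.
pose C0 := (Num.truncn (c1^-1 * (expR 1 / (e / 5)))).+1.
exists C0 => C CC.
have CE : expR 1 * expR (- (C%:R * c1)) <= e / 5.
  have h1 : expR 1 / (e / 5) <= C%:R * c1.
    rewrite -ler_pdivrMr// mulrC; apply: (@le_trans _ _ C0%:R); last by rewrite ler_nat.
    exact/ltW/truncnS_gt.
  have h2 : C%:R * c1 <= expR (C%:R * c1).
    by apply: le_trans (expR_ge1Dx _); rewrite lerDr.
  rewrite expRN ler_pdivrMr ?expR_gt0// mulrC -ler_pdivrMr//.
  exact: le_trans h1 h2.
have [i1 Hi1] := mean a0 ab e5.
exists i1 => i0 ii; have near_mean := Hi1 i0 ii.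
set kap := b / 2 ^+ i0 in near_mean *.
have kap0 : 0 < kap by rewrite divr_gt0 ?exprn_gt0.
have kapb : kap <= b.
  by rewrite ler_pdivrMr ?exprn_gt0// ler_peMr ?(ltW b0)// exprn_ege1// ler1n.
have [L L0 HL] := kernel_lip rho kap0 kapb.
have [G G0 HG] := kernel_bounded rho kap0 kapb.
set g := kernel kap b rho in near_mean HL HG *.
have g_le0 x : x <= 0 -> g x = 0 by exact: kernel_le0.
pose m0 := (Num.truncn (L * b / (e / 5))).+1.
exists m0 => m mm m_gt0.
have mR : 0 < m%:R :> R by rewrite ltr0n.
have Lm : m%:R^-1 * L * b <= e / 5.
  rewrite -mulrA ler_pdivrMl// -ler_pdivrMr//; apply: (@le_trans _ _ m0%:R); last by rewrite ler_nat.
  exact/ltW/truncnS_gt.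
(* This bounds the rounding of [block_size] and the term of the starting point, both proportional to
   [p t]. *)
pose BG := (C * m)%:R * G + G + 1.
have BG0 : 0 < BG by rewrite /BG ltr_wpDl// addr_ge0// mulr_ge0.
have near_fl := fluct b0 e5 e5.
have near_p : \forall t \near +oo, p t <= Num.min ((2 * m%:R)^-1) (e / 5 / BG).
  have c0 : 0 < Num.min ((2 * m%:R)^-1) (e / 5 / BG) by rewrite lt_min invr_gt0 mulr_gt0//= divr_gt0.
  move/cvgrPdist_le : p_cvg0 => /(_ _ c0); apply: filterS => t.
  by rewrite sub0r normrN ger0_norm// ltW.
near=> t.
have t0 : 0 < t by near: t; exact: nbhs_pinfty_gt.
have ht0 : 0 < h t by near: t; exact: rvh.1.
have [_ hD] : p (t * b) <= D * p t /\ p t <= D * p (t * b).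
  by (suff : forall x, b <= x <= b -> p (t * x) <= D * p t /\ p t <= D * p (t * x) by apply; rewrite lexx); near: t; exact: nearD.
have : p t <= Num.min ((2 * m%:R)^-1) (e / 5 / BG) by near: t; exact: near_p.
rewrite le_min => /andP[pm pB].
set q := block_size m t; set B := (C * m)%N; pose N := (B * q)%N.
have [qlo qhi] := block_size_bounds t m_gt0; rewrite -/q in qlo qhi.
have [A1 [mA1 PA1 HA1]] : exists A, [/\ measurable A, (P A <= (e / 5)%:E)%E &
    forall w, ~ A w -> forall x, 0 <= x <= b * t ->
      `|\sum_(k < N.+1) shift0 (V k w) (walk xi k w) x| <= e / 5 * (h t / p t)].
  by move: (N.+1); near: t; exact: near_fl.
have [A2 [mA2 PA2 HA2]] : exists A, [/\ measurable A, (P A <= (e / 5)%:E)%E &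
    forall w, ~ A w -> forall u, a <= u <= b ->
    `|p t / h t * \sum_(k < N.+1) shift0 h (walk xi k w) (u * t) -
      p t * \sum_(k < N.+1) g (u - walk xi k w / t)| <= e / 5].
  by move: (N.+1); near: t; exact: near_mean.
have tb0 : 0 < t * b by rewrite mulr_gt0.
have [mA3 PA3] := @walk_lower_tail N (t * b) (expR (- (p (t * b) / 2))) tb0 (expR_ge0 _)
  (fun i => Hl i tb0).
pose A3 := [set w | walk xi N w <= t * b].
have PA3' : (P A3 <= (e / 5)%:E)%E.
  apply: le_trans PA3 _; rewrite lee_fin; apply: le_trans CE.
  rewrite ler_pM2l ?expR_gt0// -expRM_natl ler_expR mulrN lerN2.
  have h1 : (2 * m%:R)^-1 <= q%:R * p t.
    apply: le_trans qhi; rewrite lerBrDr.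
    apply: (@le_trans _ _ ((2 * m%:R)^-1 + (2 * m%:R)^-1)); first by rewrite lerD2l.
    by rewrite le_eqVlt; apply/orP; left; apply/eqP; field; rewrite gt_eqF.
  have h2 : q%:R * p t <= q%:R * (D * p (t * b)) by rewrite ler_wpM2l.
  have h3 := le_trans h1 h2.
  have h4 : B%:R * (2 * m%:R)^-1 = C%:R / 2 :> R.
    by rewrite /B natrM; field; rewrite gt_eqF.
  have := ler_wpM2l (ler0n R B) h3; rewrite h4 => h5.
  have -> : N%:R * (p (t * b) / 2) = (B%:R * (q%:R * (D * p (t * b)))) / (2 * D).
    by rewrite /N natrM; field; rewrite gt_eqF.
  apply: (@le_trans _ _ (C%:R / 2 / (2 * D))).
    have -> : C%:R / 2 / (2 * D) = C%:R * c1 * 2 by rewrite /c1; field; rewrite gt_eqF.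
    by rewrite ler_peMr// ?ler1n// mulr_ge0// ltW.
  by rewrite ler_pM2r// invr_gt0 mulr_gt0.
exists (A1 `|` A2 `|` A3); split.
- by apply: measurableU => //; exact: measurableU.
- apply: (@le_trans _ _ (e / 5 + e / 5 + e / 5)%:E); last by rewrite lee_fin.
  by apply: prob_setU_le => //; [exact: measurableU|exact: prob_setU_le].
move=> w /not_orP[/not_orP[n1 n2] n3] u /andP[au ub].
have u0 : 0 < u by exact: lt_le_trans au.
have wN : u * t < walk xi N w.
  apply: (@le_lt_trans _ _ (t * b)); first by rewrite mulrC ler_pM2l.
  by rewrite ltNge; apply/negP.
rewrite (limn_shift0 (fun k s => V k w s + h s) wN).
have -> : \sum_(k < N.+1) shift0 (fun s => V k w s + h s) (walk xi k w) (u * t) =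
    \sum_(k < N.+1) shift0 (V k w) (walk xi k w) (u * t) +
    \sum_(k < N.+1) shift0 h (walk xi k w) (u * t).
  by rewrite -big_split/=; apply: eq_bigr => k _; rewrite /shift0; case: ifP; rewrite ?addr0.
have f1 : `|p t / h t * \sum_(k < N.+1) shift0 (V k w) (walk xi k w) (u * t)| <= e / 5.
  have := HA1 w n1 (u * t); rewrite ler_pM2r// ub mulr_ge0 ?(ltW u0) ?(ltW t0)// => /(_ isT) h1.
  have ph : 0 < p t / h t by rewrite divr_gt0.
  rewrite normrM (gtr0_norm ph); apply: le_trans (ler_wpM2l (ltW ph) h1) _.
  by rewrite le_eqVlt; apply/orP; left; apply/eqP; field; rewrite !gt_eqF.
have f2 := HA2 w n2 u ltac:(by rewrite au).
pose sa k := walk xi k w / t.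
have sa0 k : 0 <= sa k by rewrite divr_ge0 ?(ltW t0)//; exact: walk_ge0.
have samono i j : (i <= j)%N -> sa i <= sa j.
  by move=> ij; rewrite ler_pM2r ?invr_gt0//; exact: walk_mono.
have f3 := @block_discretization R g L b u sa q B L0 HL g_le0 (ltW b0) ub sa0 samono.
have f3' : `|p t * \sum_(k < N) g (u - sa k.+1) - p t * q%:R * \sum_(j < B) g (u - sa (j.+1 * q)%N)| <= e / 5.
  rewrite -mulrA -mulrBr normrM (gtr0_norm (p0 t)).
  apply: le_trans (ler_wpM2l (ltW (p0 t)) f3) _; apply: le_trans Lm.
  rewrite !mulrA ler_wpM2r ?(ltW b0)// ler_wpM2r// mulrC.
  exact: qlo.
set Sg := \sum_(j < B) g (u - sa (j.+1 * q)%N) in f3'.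
have Sg0 : 0 <= Sg <= B%:R * G.
  rewrite /Sg sumr_ge0 => [|j _]; last by case/andP: (HG (u - sa (j.+1 * q)%N)).
  apply: (@le_trans _ _ (\sum_(j < B) G)); last by rewrite sumr_const card_ord mulr_natl.
  by apply: ler_sum => j _; case/andP: (HG (u - sa (j.+1 * q)%N)).
have f4 : `|p t * q%:R * Sg - m%:R^-1 * Sg| + p t * g (u - sa 0%N) <= e / 5.
  have /andP[s1 s2] := Sg0; have /andP[g1 g2] := HG (u - sa 0%N).
  rewrite -mulrBl normrM (ger0_norm s1).
  have hq : `|p t * q%:R - m%:R^-1| <= p t.
    have pq := p0 t.
    rewrite ler_norml; move: qlo qhi; rewrite (mulrC q%:R) => qlo qhi.
    by rewrite lerBrDr lerBlDr (addrC (- _)) qhi/= (le_trans qlo)// lerDr ltW.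
  have h1 : `|p t * q%:R - m%:R^-1| * Sg <= p t * (B%:R * G) by apply: ler_pM.
  have h2 : p t * g (u - sa 0%N) <= p t * G by rewrite ler_pM2l.
  apply: le_trans (lerD h1 h2) _; rewrite -mulrDr.
  move: pB; rewrite ler_pdivlMr// => pB; apply: le_trans pB.
  by rewrite ler_pM2l// /BG ler_wpDr.
have f5 : \sum_(k < N.+1) g (u - walk xi k w / t) = g (u - sa 0%N) + \sum_(k < N) g (u - sa k.+1).
  by rewrite big_ord_recl.
rewrite f5 mulrDr in f2; rewrite /block_path -/B -/Sg [p t / h t * (_ + _)]mulrDr.
have g00 : 0 <= p t * g (u - sa 0%N).
  by rewrite mulr_ge0 ?(ltW (p0 t))//; case/andP: (HG (u - sa 0%N)).
exact: (four_step_bound f1 f2 f3' f4 g00).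
Unshelve. all: by end_near. Qed.

End process_approx.

(** * Stieltjes integrals and the inverse subordinator *)

Section stieltjes.
Context {R : realType}.
Variable f : cumulative R R.
Let mu := lebesgue_stieltjes_measure f.

Lemma stieltjes_itvoc (x y : R) : x <= y -> mu `]x, y]%classic = (f y - f x)%:E.
Proof.
move=> xy; rewrite /mu /lebesgue_stieltjes_measure /measure_extension/=.
rewrite measurable_mu_extE/=; last by exists (x, y).
by rewrite wlength_itv_bnd.
Qed.

Lemma le_integral_dom (D : set R) (g h : R -> \bar R) : (forall y, D y -> (g y <= h y)%E) ->
  (\int[mu]_(y in D) g y <= \int[mu]_(y in D) h y)%E.
Proof.
move=> gh; rewrite integral_mkcond [leRHS]integral_mkcond; apply: le_integral_all => y.
rewrite /patch; case: ifP => // yD; apply: gh; exact: set_mem.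
Qed.

Lemma stieltjes_cst (x y c : R) : x <= y ->
  (\int[mu]_(z in `]x, y]%classic) c%:E = (c * (f y - f x))%:E)%E.
Proof.
move=> xy; rewrite (@integral_cst _ _ _ mu _ (measurable_itv _) c%:E).
by rewrite [X in (_ * X)%E](stieltjes_itvoc xy).
Qed.

Lemma stieltjes_split (x y z : R) (g : R -> R) : x <= y -> y <= z ->
  measurable_fun setT g -> (forall t, 0 <= g t) ->
  (\int[mu]_(t in `]x, z]%classic) (g t)%:E =
   \int[mu]_(t in `]x, y]%classic) (g t)%:E + \int[mu]_(t in `]y, z]%classic) (g t)%:E)%E.
Proof.
move=> xy yz mg g0; rewrite -(ge0_integral_setU mu (measurable_itv _) (measurable_itv _)).
- congr (integral _ _ _); apply/seteqP; split => t /=; rewrite !in_itv/=.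
    by move=> /andP[h1 h2]; have [h|h] := leP t y; [left|right]; rewrite ?h1 ?h2 ?h.
  by move=> [/andP[h1 h2]|/andP[h1 h2]]; apply/andP; split; lra.
- by apply/measurable_EFinP; exact: measurable_funTS.
- by move=> t _; rewrite lee_fin.
- apply/eqP; rewrite -subset0 => t [/=]; rewrite !in_itv/= => /andP[_ h1] /andP[h2 _].
  by have := lt_le_trans h2 h1; rewrite ltxx.
Qed.

Lemma stieltjes_null1 (x : R) : (forall e, 0 < e -> exists2 r, r < x & f x - f r <= e) ->
  mu [set x] = 0%E.
Proof.
move=> H; apply/eqP; rewrite eq_le measure_ge0 andbT; apply/lee_addgt0Pr => e e0; rewrite add0e.
have [r rx hr] := H e e0.
apply: (@le_trans _ _ (mu `]r, x]%classic)); last by rewrite (stieltjes_itvoc (ltW rx)) lee_fin.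
apply: le_measure; rewrite ?inE; [exact: measurable_set1|exact: measurable_itv|].
by move=> _ /= ->; rewrite in_itv/= rx lexx.
Qed.

Lemma stieltjes_remove_left (u : R) (g : R -> R) : 0 <= u -> mu [set 0] = 0%E ->
  measurable_fun setT g -> (forall t, 0 <= g t) ->
  (\int[mu]_(t in `[0%R, u]%classic) (g t)%:E = \int[mu]_(t in `]0%R, u]%classic) (g t)%:E)%E.
Proof.
move=> u0 m0 mg g0.
have -> : `[0, u]%classic = [set 0] `|` `]0, u]%classic :> set R.
  apply/seteqP; split => t /=; rewrite !in_itv/=.
    by rewrite le_eqVlt => /andP[/orP[/eqP <-|h1] h2]; [left|right; rewrite h1].
  by move=> [->|/andP[h1 h2]]; rewrite ?lexx ?u0// (ltW h1).
rewrite (ge0_integral_setU mu (measurable_set1 _) (measurable_itv _)).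
- rewrite null_set_integral ?add0e//.
  by apply/measurable_EFinP; exact: measurable_funTS.
- by apply/measurable_EFinP; exact: measurable_funTS.
- by move=> t _; rewrite lee_fin.
- by apply/eqP; rewrite -subset0 => t [/= ->]; rewrite in_itv/= ltxx.
Qed.

Lemma lipschitz_shift_measurable (g : R -> R) (u L : R) : 0 <= L ->
  (forall x y, `|g x - g y| <= L * `|x - y|) -> measurable_fun setT (fun y : R => g (u - y)).
Proof.
move=> L0 gL; apply: continuous_measurable_fun => x; apply/cvgrPdist_le => e e0.
have L1 : 0 < L + 1 by lra.
near=> y; apply: le_trans (gL _ _) _.
have -> : u - x - (u - y) = y - x by ring.
have : `|x - y| <= e / (L + 1).
  by near: y; apply: cvgr_dist_le; [exact: cvg_id|rewrite divr_gt0].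
rewrite distrC ler_pdivlMr// => h; have := normr_ge0 (y - x); lra.
Unshelve. all: by end_near. Qed.

(** Since [f (a j) = j / m], each interval [(a j, a j.+1]] has mass [1 / m]; replacing [g] by its
    value at the right end costs [L] times the clamped length, and the lengths telescope. *)
Lemma stieltjes_block (g : R -> R) (L b u : R) (m B : nat) (a : nat -> R) :
  0 <= L -> (forall x y, `|g x - g y| <= L * `|x - y|) -> (forall x, x <= 0 -> g x = 0) ->
  (forall x, 0 <= g x) -> 0 <= u -> u <= b -> (0 < m)%N ->
  a 0%N = 0 -> (forall i j, (i <= j)%N -> a i <= a j) -> (forall j, f (a j) = j%:R / m%:R) ->
  b < a B -> mu [set 0] = 0%E ->
  exists2 I : R, (\int[mu]_(y in `[0%R, u]%classic) (g (u - y))%:E = I%:E)%E &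
    `|I - block_path g m B a u| <= m%:R^-1 * L * b.
Proof.
move=> L0 gL gz g0 u0 ub m0 a0 amono fa bB mu0.
have b0 : 0 <= b by exact: le_trans ub.
have mR : 0 < m%:R :> R by rewrite ltr0n.
have mg := lipschitz_shift_measurable u L0 gL.
have g0' y : 0 <= g (u - y) by [].
rewrite stieltjes_remove_left//.
pose F j := (\int[mu]_(y in `]0%R, a j]%classic) (g (u - y))%:E)%E.
have uB : u <= a B by apply: le_trans ub (ltW bB).
have -> : (\int[mu]_(y in `]0%R, u]%classic) (g (u - y))%:E)%E = F B.
  rewrite /F (stieltjes_split u0 uB mg g0') [X in (_ + X)%E]integral0_eq ?adde0// => y /=.
  by rewrite in_itv/= => /andP[uy _]; rewrite gz// subr_le0 ltW.
pose mn j := Num.min (a j) b.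
have aj0 j : 0 <= a j by rewrite -a0; exact: amono.
have mn0 j : 0 <= mn j by rewrite le_min aj0.
have mnb j : mn j <= b by rewrite ge_min lexx orbT.
have gm y : g (u - y) = g (u - Num.min y b).
  by have [//|h] := leP y b; rewrite !gz//; lra.
pose X j := m%:R^-1 * \sum_(i < j) g (u - a i.+1).
pose er j := m%:R^-1 * L * mn j.
have step j : let c := (\int[mu]_(y in `]a j, a j.+1]%classic) (g (u - y))%:E)%E in
   (c <= (m%:R^-1 * g (u - a j.+1) + (er j.+1 - er j))%:E)%E /\
   ((m%:R^-1 * g (u - a j.+1))%:E <= c + (er j.+1 - er j)%:E)%E.
  move=> c; have jj := amono j j.+1 (leqnSn j).
  have fj : f (a j.+1) - f (a j) = m%:R^-1.
    by rewrite !fa -mulrBl -natr1 addrAC subrr add0r mul1r.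
  pose e := L * (mn j.+1 - mn j).
  have mnm : mn j <= mn j.+1 by rewrite /mn le_min !ge_min jj lexx orbT.
  have e0 : 0 <= e by rewrite mulr_ge0// subr_ge0.
  have key y : a j < y -> y <= a j.+1 -> `|g (u - y) - g (u - a j.+1)| <= e.
    move=> y1 y2; rewrite (gm y) (gm (a j.+1)); apply: le_trans (gL _ _) _; apply: ler_wpM2l => //.
    have h1 : mn j <= Num.min y b by rewrite /mn le_min !ge_min (ltW y1) lexx orbT.
    have h2 : Num.min y b <= mn j.+1 by rewrite /mn le_min !ge_min y2 lexx orbT.
    by move: h1 h2; rewrite /mn ler_norml => h1 h2; apply/andP; split; lra.
  have erE : er j.+1 - er j = m%:R^-1 * e by rewrite /er /e; ring.
  rewrite erE; split.
    rewrite -mulrDr mulrC -fj -stieltjes_cst//; apply: le_integral_dom => y /=.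
    rewrite in_itv/= => /andP[y1 y2]; rewrite lee_fin.
    by have := key y y1 y2; rewrite ler_norml => /andP[_]; lra.
  have cD : (c + \int[mu]_(y in `]a j, a j.+1]%classic) e%:E =
      \int[mu]_(y in `]a j, a j.+1]%classic) ((g (u - y))%:E + e%:E))%E.
    by rewrite ge0_integralD//; first [exact: measurable_itv | by move=> y _; rewrite lee_fin
      | by apply/measurable_EFinP; exact: measurable_funTS].
  rewrite (mulrC _ e) (mulrC _ (g _)) -fj -!stieltjes_cst// cD.
  apply: le_integral_dom => y /=; rewrite in_itv/= => /andP[y1 y2]; rewrite -EFinD lee_fin.
  by have := key y y1 y2; rewrite ler_norml => /andP[+ _]; lra.
have FX j : (F j <= (X j + (er j - er 0%N))%:E)%E /\ ((X j)%:E <= F j + (er j - er 0%N)%:E)%E.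
  elim: j => [|j [IH1 IH2]].
    have F0 : F 0%N = 0%:E by rewrite /F a0 set_itvoc0 integral_set0.
    have X0 : X 0%N = 0 by rewrite /X big_ord0 mulr0.
    by rewrite F0 X0 -EFinD subrr addr0 lexx.
  have FE : F j.+1 = (F j + \int[mu]_(y in `]a j, a j.+1]%classic) (g (u - y))%:E)%E.
    by rewrite /F; apply: stieltjes_split => //; exact: amono.
  have [h1 h2] := step j.
  have XE : X j.+1 = X j + m%:R^-1 * g (u - a j.+1) by rewrite /X big_ord_recr/= mulrDr.
  split.
    rewrite FE XE; apply: le_trans (leeD IH1 h1) _; rewrite -EFinD lee_fin; lra.
  rewrite FE XE EFinD; apply: le_trans (leeD IH2 h2) _.
  by rewrite addeACA -EFinD; apply: leeD => //; rewrite lee_fin; lra.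
have [h1 h2] := FX B.
have er0 : er 0%N = 0 by rewrite /er /mn a0 min_l// mulr0.
have erB : er B <= m%:R^-1 * L * b by rewrite ler_wpM2l ?mulr_ge0 ?invr_ge0.
have Ff : F B \is a fin_num.
  rewrite ge0_fin_numE; first by apply: le_lt_trans h1 (ltry _).
  by apply: integral_ge0 => y _; rewrite lee_fin.
exists (fine (F B)); first by rewrite fineK.
move: h1 h2; rewrite -(fineK Ff) -EFinD !lee_fin er0 subr0 /block_path -/(X B) => h1 h2.
by rewrite ler_norml; apply/andP; split; lra.
Qed.

Lemma powR_shift_measurable (u r : R) : measurable_fun setT (fun y : R => (u - y) `^ r).
Proof. by apply: (measurableT_comp (measurable_powR r)); exact: measurable_funB. Qed.

(** On each dyadic shell below [u] the power is comparable with its value at the outer edge and the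
    mass is at most [D i]. Monotone convergence exhausts the interval up to [u], which carries no
    mass. *)
Lemma stieltjes_near (b u rho Bd : R) (i0 : nat) (D : nat -> R) : 0 < b ->
  (forall i, (i0 <= i)%N -> f u - f (u - b / 2 ^+ i) <= D i) ->
  (forall n, \sum_(i0 <= i < n) 2 `^ `|rho| * (b / 2 ^+ i) `^ rho * D i <= Bd) ->
  mu [set u] = 0%E ->
  (\int[mu]_(y in `](u - b / 2 ^+ i0)%R, u]%classic) ((u - y) `^ rho)%:E <= Bd%:E)%E.
Proof.
move=> b0 HD HB muu.
have bi i : 0 < b / 2 ^+ i by rewrite divr_gt0// exprn_gt0.
have bmono i j : (i <= j)%N -> b / 2 ^+ j <= b / 2 ^+ i.
  by move=> ij; rewrite ler_pM2l// lef_pV2 ?posrE ?exprn_gt0// ler_eXn2l// ltr1n.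
have mp := powR_shift_measurable u rho.
have p0 y : 0 <= (u - y) `^ rho by exact: powR_ge0.
pose A n := `]u - b / 2 ^+ i0, u - b / 2 ^+ (i0 + n)]%classic : set R.
have partial n : (\int[mu]_(y in A n) ((u - y) `^ rho)%:E <=
    (\sum_(i0 <= i < i0 + n) 2 `^ `|rho| * (b / 2 ^+ i) `^ rho * D i)%:E)%E.
  elim: n => [|n IH].
    by rewrite /A addn0 set_itvoc0 integral_set0 big_geq.
  rewrite addnS big_nat_recr ?leq_addr//= EFinD.
  have h1 : u - b / 2 ^+ i0 <= u - b / 2 ^+ (i0 + n) by rewrite lerD2l lerN2 bmono// leq_addr.
  have h2 : u - b / 2 ^+ (i0 + n) <= u - b / 2 ^+ (i0 + n).+1 by rewrite lerD2l lerN2 bmono.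
  rewrite /A addnS (stieltjes_split h1 h2 mp p0); apply: leeD; first exact: IH.
  set i := (i0 + n)%N.
  apply: (@le_trans _ _ (\int[mu]_(y in `](u - b / 2 ^+ i)%R, (u - b / 2 ^+ i.+1)%R]%classic)
      (2 `^ `|rho| * (b / 2 ^+ i) `^ rho)%:E)%E).
    apply: le_integral_dom => y /=; rewrite in_itv/= => /andP[y1 y2]; rewrite lee_fin.
    have bs : b / 2 ^+ i.+1 = b / 2 ^+ i / 2 by rewrite exprS invfM; ring.
    move: y1 y2; rewrite bs; have := bi i; move: (b / 2 ^+ i) => z z0 y1 y2.
    by apply: powR_le_double; lra.
  rewrite stieltjes_cst// lee_fin ler_wpM2l ?mulr_ge0 ?powR_ge0//.
  apply: le_trans (HD i (leq_addr _ _)); rewrite lerD2r.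
  by apply: cumulative_is_nondecreasing; rewrite gerBl ltW.
have AU : \bigcup_n A n = `]u - b / 2 ^+ i0, u[%classic :> set R.
  apply/seteqP; split => y /=.
    move=> [n _]; rewrite /A /= !in_itv/= => /andP[-> h]; have := bi (i0 + n)%N; lra.
  rewrite in_itv/= => /andP[y1 y2].
  have h2 : 0 <= (2^-1 : R) < 1 by lra.
  have uy : 0 < u - y by rewrite subr_gt0.
  have [n Hn] := exprn_small b h2 uy.
  exists n => //; rewrite /A /= in_itv/= y1/= lerBrDl -lerBrDr.
  by have := Hn (i0 + n)%N (leq_addl _ _); rewrite exprVn.
have -> : `]u - b / 2 ^+ i0, u]%classic = `]u - b / 2 ^+ i0, u[%classic `|` [set u] :> set R.
  apply/seteqP; split => y /=; rewrite !in_itv/=.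
    by move=> /andP[-> ]; rewrite le_eqVlt => /orP[/eqP ->|->]; [right|left].
  move=> [/andP[-> /ltW]//|->]; rewrite lexx andbT; have := bi i0; lra.
rewrite (ge0_integral_setU mu (measurable_itv _) (measurable_set1 _)).
- rewrite [X in (_ + X <= _)%E]null_set_integral ?adde0//; last first.
    by apply/measurable_EFinP; exact: measurable_funTS.
  rewrite -AU.
  have nd : nondecreasing_seq A.
    move=> m n mn; apply/subsetPset => y; rewrite /A /= !in_itv/= => /andP[-> h]/=.
    by apply: le_trans h _; rewrite lerD2l lerN2 bmono// leq_add2l.
  have := @ge0_nondecreasing_set_cvg_integral _ (g_sigma_algebraType (R.-ocitv.-measurable)) R A (fun y => ((u - y) `^ rho)%:E) mu nd.
  have mA n : measurable (A n) by exact: measurable_itv.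
  move=> /(_ mA) H; have {}H := H _ _.
  have mf n : measurable_fun (A n) (fun y => ((u - y) `^ rho)%:E).
    by apply/measurable_EFinP; exact: measurable_funTS.
  have {}H := H mf (fun i y _ => p0 y).
  rewrite -(cvg_lim _ H)//; apply: lime_le; first by apply/cvg_ex; eexists; exact: H.
  apply: nearW => n; apply: le_trans (partial n) _; rewrite lee_fin; exact: HB.
- by apply/measurable_EFinP; exact: measurable_funTS.
- by move=> y _; rewrite lee_fin.
- by apply/eqP; rewrite -subset0 => y [/= h1 h2]; move: h1; rewrite h2 in_itv/= ltxx andbF.
Qed.

End stieltjes.

(** * The generalized inverse of a nondecreasing path *)

Section generalized_inverse.
Context {R : realType}.
Variable x : R -> R.
Hypothesis x0 : x 0 = 0.
Hypothesis xmono : forall s t, 0 <= s -> s <= t -> x s <= x t.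
Hypothesis xunb : forall y, exists2 t, 0 <= t & y < x t.

Let E := gen_inverse x.
Let G y := [set t | 0 <= t /\ y < x t].

Let G_has_inf y : has_inf (G y).
Proof. by split; [have [t t0 yt] := xunb y; exists t|exists 0 => t [] ]. Qed.

Lemma gen_inverse_ge0 y : 0 <= E y.
Proof. by apply: lb_le_inf; [exact: (G_has_inf y).1|move=> t []]. Qed.

Lemma gen_inverse_le y t : 0 <= t -> y < x t -> E y <= t.
Proof. by move=> t0 yt; apply: ge_inf; [exact: (G_has_inf y).2|]. Qed.

Lemma lt_gen_inverse y t : 0 <= t -> t < E y -> x t <= y.
Proof.
move=> t0 tE; rewrite leNgt; apply/negP => yt.
by have := lt_le_trans tE (gen_inverse_le t0 yt); rewrite ltxx.
Qed.

Lemma gen_inverse_lt y t : E y < t -> y < x t.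
Proof.
move=> Et; have Et0 : 0 < t - E y by rewrite subr_gt0.
have [s [s0 ys] st] := inf_adherent Et0 (G_has_inf y).
rewrite -/(E y) addrC subrK in st.
by apply: lt_le_trans ys _; apply: xmono => //; exact: ltW.
Qed.

Lemma gen_inverse_mono y z : y <= z -> E y <= E z.
Proof.
move=> yz; apply: lb_le_inf; first exact: (G_has_inf z).1.
by move=> t [t0 zt]; apply: gen_inverse_le => //; exact: le_lt_trans zt.
Qed.

Lemma gen_inverse_neg y : y < 0 -> E y = 0.
Proof.
move=> y0; apply/eqP; rewrite eq_le gen_inverse_ge0 andbT.
by apply: gen_inverse_le => //; rewrite x0.
Qed.

Lemma gen_inverse_cumP : cumP E.
Proof.
split => [y z|y]; first exact: gen_inverse_mono.
apply/cvgrPdist_le => e e0.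
have [s [s0 ys] st] := inf_adherent e0 (G_has_inf y).
have ysx : 0 < x s - y by rewrite subr_gt0.
near=> z.
have yz : y < z by near: z; exact: nbhs_right_gt.
have zs : z < x s by near: z; apply: nbhs_right_lt; lra.
have h1 := gen_inverse_mono (ltW yz); have h2 := gen_inverse_le s0 zs.
rewrite distrC ger0_norm ?subr_ge0//.
have st' : s < E y + e by exact: st.
lra.
Unshelve. all: by end_near. Qed.

Lemma gen_inverse_at t : 0 <= t -> (forall t', t < t' -> x t < x t') -> E (x t) = t.
Proof.
move=> t0 H; apply/eqP; rewrite eq_le; apply/andP; split.
  apply/ler_addgt0Pr => e e0; apply: gen_inverse_le; first by rewrite addr_ge0// ltW.
  by apply: H; rewrite ltrDl.
rewrite leNgt; apply/negP => h; have := gen_inverse_lt h; rewrite ltxx//.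
Qed.

(** The inverse spends between levels [v] and [u] a time that is read off from the grid times
    [k / m] at which the path lies in [(v, u]]; the summand [2] accounts for the partial cells at
    both ends. *)
Lemma gen_inverse_increment (m N : nat) (u v : R) : (0 < m)%N -> 0 <= v -> v <= u ->
  u < x (N%:R / m%:R) ->
  E u - E v <= ((\sum_(k < N) ((v < x (k%:R / m%:R))%R && (x (k%:R / m%:R) <= u)%R : nat))%:R + 2) / m%:R.
Proof.
move=> m0 v0 vu uN; have mR : 0 < m%:R :> R by rewrite ltr0n.
set c := (\sum_(k < N) _)%N; rewrite ler_pdivlMr// mulrBl.
have Ev := gen_inverse_ge0 v.
pose k0 := (Num.truncn (E v * m%:R)).+1.
have k01 : E v * m%:R < k0%:R by exact: truncnS_gt.
have k02 : k0%:R <= E v * m%:R + 1.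
  by rewrite /k0 -natr1 lerD2r truncn_le// mulr_ge0.
have [h|h] := leP (E u * m%:R - E v * m%:R) 2.
  by apply: le_trans h _; rewrite lerDr.
pose n := Num.truncn (E u * m%:R - E v * m%:R - 1).
have z0 : 0 <= E u * m%:R - E v * m%:R - 1 by lra.
have n1 : n%:R <= E u * m%:R - E v * m%:R - 1 by rewrite truncn_le.
have n2 : E u * m%:R - E v * m%:R - 1 < n%:R + 1 by rewrite natr1 truncnS_gt.
suff nc : (n <= c)%N by move: nc; rewrite -(ler_nat R); lra.
have good k : (k0 <= k < k0 + n)%N -> (v < x (k%:R / m%:R)) && (x (k%:R / m%:R) <= u).
  move=> /andP[kk kn]; have k0' : 0 <= k%:R / m%:R :> R by rewrite divr_ge0.
  apply/andP; split.
    apply: gen_inverse_lt; rewrite ltr_pdivlMr//; apply: lt_le_trans k01 _.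
    by rewrite ler_nat.
  apply: lt_gen_inverse => //; rewrite ltr_pdivrMr//.
  have : k%:R + 1 <= (k0 + n)%:R :> R by rewrite natr1 ler_nat.
  by rewrite natrD; lra.
have kN : (k0 + n <= N)%N.
  rewrite leqNgt; apply/negP => Nk.
  have n0 : (0 < n)%N.
    have : 0 < n%:R :> R by lra.
    by rewrite ltr0n.
  have kE : (k0 + n = (k0 + n.-1).+1)%N by rewrite -addnS prednK.
  have /andP[_ hl] : (v < x ((k0 + n.-1)%:R / m%:R)) && (x ((k0 + n.-1)%:R / m%:R) <= u).
    by apply: good; rewrite leq_addr kE ltnSn.
  have : x (N%:R / m%:R) <= x ((k0 + n.-1)%:R / m%:R).
    apply: xmono; first by rewrite divr_ge0.
    by rewrite ler_pM2r ?invr_gt0// ler_nat -ltnS -kE.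
  by move=> hN; have := lt_le_trans uN (le_trans hN hl); rewrite ltxx.
apply: (@leq_trans (\sum_(k < N) ((k0 <= k) && (k < k0 + n) : nat))%N).
  by rewrite sum_window leq_min leqnn andbT leq_subRL ?(leq_trans _ kN)// leq_addr.
apply: leq_sum => k _; case: (boolP (_ && _)) => // hk.
by rewrite good.
Qed.

End generalized_inverse.

(** * Grid increments of the subordinator as a random walk *)

Section skeleton.
Context d (T : measurableType d) (R : realType) (Q : probability T R).
Variables (alpha : R) (W : T -> R -> R).
Hypothesis HW : stable_subordinator Q alpha W.
Variable m : nat.
Hypothesis m0 : (0 < m)%N.

Definition skel (i : nat) (w : T) : R := W w (i.+1%:R / m%:R) - W w (i%:R / m%:R).

Definition skel_sigma (i : nat) : set (set T) :=
  [set A | exists2 B : set R, measurable B & A = skel i @^-1` B].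

Let mR : 0 < m%:R :> R. Proof. by rewrite ltr0n. Qed.

Lemma skel_walk n w : walk skel n w = W w (n%:R / m%:R).
Proof.
have [_ [W0 _]] := HW; elim: n => [|n IH]; first by rewrite walk0 mul0r W0.
by rewrite walkS IH /skel addrC subrK.
Qed.

Lemma measurable_skel i : measurable_fun setT (skel i).
Proof. by have [mW _] := HW; apply: measurable_funB; exact: mW. Qed.

Lemma skel_ge0 i w : 0 <= skel i w.
Proof.
have [_ [_ [_ [Wm _]]]] := HW; rewrite subr_ge0; apply: Wm; first by rewrite divr_ge0.
by rewrite ler_pM2r ?invr_gt0// ler_nat.
Qed.

Lemma skel_sigma_algebra i : sigma_algebra setT (skel_sigma i).
Proof.
split.
- by exists set0; rewrite ?preimage_set0.
- move=> _ [B mB ->]; exists (~` B); first exact: measurableC.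
  by rewrite setTD preimage_setC.
- move=> F HF; have /choice[B HB] : forall n, exists B, measurable B /\ F n = skel i @^-1` B.
    by move=> n; have [B mB ->] := HF n; exists B.
  exists (\bigcup_n B n); first by apply: bigcupT_measurable => n; have [] := HB n.
  by rewrite preimage_bigcup; apply: eq_bigcupr => n _; have [] := HB n.
Qed.

Lemma skel_sigma_measurable i A : skel_sigma i A -> measurable A.
Proof.
by move=> [B mB ->]; rewrite -[X in measurable X]setTI; exact: (@measurable_skel i measurableT B mB).
Qed.

Lemma skel_adapted i : adapted (skel_sigma i) (skel i).
Proof. by apply: adaptedP => B mB; apply: sub_sigma_algebra; exists B. Qed.

(** Independence of consecutive increments is extended to an arbitrary finite index set by filling
    the missing indices with the full event. *)
Lemma skel_indep : indep_sigma Q skel_sigma.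
Proof.
have [_ [_ [_ [_ [Wind _]]]]] := HW.
move=> I A Iu HA.
pose n := (\max_(k <- I) k).+1.
have In k : k \in I -> (k < n)%N.
  by move=> kI; rewrite ltnS; exact: (@leq_bigmax_seq _ I xpredT id k kI isT).
have /choice[B HB] : forall k, exists B : set R, measurable B /\
    ((k \in I) -> A k = skel k @^-1` B) /\ ((k \notin I) -> B = setT).
  move=> k; have [kI|kI] := boolP (k \in I).
    by have [B mB AE] := HA k kI; exists B.
  by exists setT; split => //.
have := Wind n (fun i => i%:R / m%:R) (fun i => B i).
rewrite /= mul0r lexx => /(_ isT).
have tm (i j : 'I_n.+1) : (i <= j)%N -> i%:R / m%:R <= j%:R / m%:R :> R.
  by move=> ij; rewrite ler_pM2r ?invr_gt0// ler_nat.
move=> /(_ tm (fun i => (HB i).1)).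
rewrite (_ : [set w | _] = \big[setI/setT]_(k <- I) A k); last first.
  apply/seteqP; split => w /=.
    move=> H; rewrite -bigcap_seq => k /= kI; have [_ [AE _]] := HB k; rewrite AE//.
    by have := H (Ordinal (In k kI)); rewrite /= /bump add1n.
  rewrite -bigcap_seq => H i; have [iI|iI] := boolP (val i \in I).
    have := H _ iI; have [_ [AE _]] := HB i; rewrite AE//.
  by have [_ [_ BE]] := HB i; rewrite BE.
move=> ->.
rewrite (eq_bigr (fun i : 'I_n => Q (skel i @^-1` B i))); last first.
  by move=> i _; congr (Q _); rewrite /skel /= /bump add1n.
rewrite -(big_mkord xpredT (fun i => Q (skel i @^-1` B i))).
rewrite (bigID (fun i => i \in I))/= [X in (_ * X)%E]big1 ?mule1; last first.
  move=> i iI; have [_ [_ ->]] := HB i => //.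
  by rewrite preimage_setT; exact: probability_setT.
rewrite -big_filter; apply: etrans (_ : (\big[*%E/1%E]_(i <- I) Q (skel i @^-1` B i))%E = _).
  apply: perm_big; apply: uniq_perm => //; first by rewrite filter_uniq ?iota_uniq.
  by move=> k; rewrite mem_filter mem_index_iota; have [/In ->|] := boolP (k \in I).
by apply: eq_big_seq => k kI; have [_ [AE _]] := HB k; rewrite AE.
Qed.

Lemma skel_laplace i (s : R) : 0 <= s ->
  (\int[Q]_w (expR (- (s * skel i w)))%:E = (expR (- (m%:R^-1 * Gamma (1 - alpha) * s `^ alpha)))%:E)%E.
Proof.
have [_ [_ [_ [_ [_ WL]]]]] := HW; move=> s0.
have r0 : 0 <= i%:R / m%:R :> R by rewrite divr_ge0.
have rt : i%:R / m%:R <= i.+1%:R / m%:R :> R by rewrite ler_pM2r ?invr_gt0// ler_nat.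
have := WL (i%:R / m%:R) (i.+1%:R / m%:R) s r0 rt s0.
have -> : i.+1%:R / m%:R - i%:R / m%:R = m%:R^-1 :> R.
  by rewrite -mulrBl -natr1 addrAC subrr add0r mul1r.
move=> <-.
by apply: eq_integral => w _; rewrite /skel mulNr.
Qed.

End skeleton.

Lemma powR_inv {R : realType} (y r : R) : 0 < y -> y^-1 `^ r = (y `^ r)^-1.
Proof. by move=> y0; rewrite -powR_inv1 ?ltW// -powRrM mulN1r powRN. Qed.

(** A pathwise statement: strict increase at grid times makes the inverse equal to [j / m] at level
    [x (j / m)]. Away from [u] kernel and power coincide, and near [u] both integrals lie between
    [0] and [Bd], by the modulus [D] of the inverse. *)
Lemma J_ar_block {R : realType} (x : R -> R) (rho a b Bd L : R) (D : nat -> R) (i0 m B : nat) :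
  x 0 = 0 -> (forall s t, 0 <= s -> s <= t -> x s <= x t) -> (forall y, exists2 t, 0 <= t & y < x t) ->
  (0 < m)%N -> (forall (j : nat) t, j%:R / m%:R < t -> x (j%:R / m%:R) < x t) ->
  0 < a -> a < b -> b / 2 ^+ i0 <= a ->
  (forall (i : nat) u, b / 2 ^+ i <= u <= b -> gen_inverse x u - gen_inverse x (u - b / 2 ^+ i) <= D i) ->
  (forall n, \sum_(i0 <= i < n) 2 `^ `|rho| * (b / 2 ^+ i) `^ rho * D i <= Bd) ->
  (forall e, 0 < e -> exists2 i, (i0 <= i)%N & D i <= e) ->
  0 <= L -> (forall y z, `|kernel (b / 2 ^+ i0) b rho y - kernel (b / 2 ^+ i0) b rho z| <= L * `|y - z|) ->
  b < x (B%:R / m%:R) ->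
  forall u, a <= u <= b ->
  `|J_ar rho x u - block_path (kernel (b / 2 ^+ i0) b rho) m B (fun j => x (j%:R / m%:R)) u| <=
    Bd + m%:R^-1 * L * b.
Proof.
move=> x0 xmono xunb m0 xstrict a0 ab kapa HD HB HDe L0 HL bB u /andP[au ub].
have b0 : 0 < b by exact: lt_trans ab.
have u0 : 0 < u by exact: lt_le_trans au.
pose kap := b / 2 ^+ i0; rewrite -/kap in kapa HL *.
have bi i : 0 < b / 2 ^+ i by rewrite divr_gt0// exprn_gt0.
have bmono i j : (i <= j)%N -> b / 2 ^+ j <= b / 2 ^+ i.
  by move=> ij; rewrite ler_pM2l// lef_pV2 ?posrE ?exprn_gt0// ler_eXn2l// ltr1n.
have kap0 : 0 < kap by exact: bi.
have kapb : kap <= b by exact/(le_trans kapa)/ltW.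
have kapu : kap <= u by exact: le_trans au.
have mR : 0 < m%:R :> R by rewrite ltr0n.
have EcumP := gen_inverse_cumP xunb.
rewrite /J_ar /LSint; case: pselect => // H.
set f := mkcum H.
have fE y : f y = gen_inverse x y by [].
set mu := lebesgue_stieltjes_measure f.
have D0 i : 0 <= D i.
  apply: le_trans (HD i b _); last by rewrite lexx andbT -[leRHS]divr1 -(expr0 2) bmono.
  by rewrite subr_ge0; apply: gen_inverse_mono => //; rewrite lerBlDr lerDl ltW.
have E00 : gen_inverse x 0 = 0.
  rewrite -{1}x0; apply: gen_inverse_at => // t t0.
  by have := xstrict 0%N t; rewrite mul0r; exact.
(* The inverse vanishes at and below [0], so the closed end of the integration interval carries no
   mass; smallness of [D] likewise excludes an atom at [u]. *)
have mu0 : mu [set 0] = 0%E.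
  apply: stieltjes_null1 => e e0; exists (-1); first by rewrite ltrN10.
  by rewrite !fE E00 gen_inverse_neg// ?ltrN10// subrr ltW.
have incr i : (i0 <= i)%N -> f u - f (u - b / 2 ^+ i) <= D i.
  by move=> ii; apply: HD; rewrite ub andbT; apply: le_trans (bmono _ _ ii) kapu.
have muu : mu [set u] = 0%E.
  apply: stieltjes_null1 => e e0; have [i ii De] := HDe e e0.
  exists (u - b / 2 ^+ i); first by rewrite ltrBlDr ltrDl.
  exact: le_trans (incr i ii) De.
have nearJ := @stieltjes_near _ f b u rho Bd i0 D b0 incr HB muu.
have kle := kernel_le0 rho kap0 kapb.
have [G G0 HG] := kernel_bounded rho kap0 kapb.
have k0 y : 0 <= kernel kap b rho y by have /andP[] := HG y.
pose g j := x (j%:R / m%:R).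
have g0 : g 0%N = 0 by rewrite /g mul0r.
have jm (j : nat) : 0 <= j%:R / m%:R :> R by rewrite divr_ge0.
have gmono i j : (i <= j)%N -> g i <= g j.
  by move=> ij; apply: xmono; [exact: jm|rewrite ler_pM2r ?invr_gt0// ler_nat].
have fg j : f (g j) = j%:R / m%:R by apply: gen_inverse_at => //; exact: xstrict.
have [I IE Ibl] := @stieltjes_block _ f _ L b u m B g L0 HL kle k0 (ltW u0) ub m0 g0 gmono fg bB mu0.
have mk := lipschitz_shift_measurable u L0 HL.
have mp := powR_shift_measurable u rho.
have p0 y : 0 <= (u - y) `^ rho by exact: powR_ge0.
have k0' y : 0 <= kernel kap b rho (u - y) by [].
have uk0 : 0 <= u - kap by rewrite subr_ge0.
have uku : u - kap <= u by rewrite lerBlDr lerDl ltW.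
move: IE; rewrite (stieltjes_remove_left (ltW u0) mu0 mk k0') (stieltjes_remove_left (ltW u0) mu0 mp p0).
rewrite (stieltjes_split f uk0 uku mk k0') (stieltjes_split f uk0 uku mp p0).
have -> : (\int[lebesgue_stieltjes_measure f]_(t in `]0%R, (u - kap)%R]) (kernel kap b rho (u - t))%:E =
    \int[lebesgue_stieltjes_measure f]_(t in `]0%R, (u - kap)%R]) ((u - t) `^ rho)%:E)%E.
  apply: eq_integral => y; rewrite inE /= in_itv/= => /andP[y0 yu].
  by rewrite kernel_far// lerBrDr addrC -lerBrDr yu lerBlDr (le_trans ub)// lerDl ltW.
set far := (X in (X + _)%E = I%:E); set nk := (X in (far + X)%E = I%:E).
set nj := (X in fine (far + X)%E); rewrite -/kap -/nj in nearJ.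
have far0 : (0 <= far)%E by apply: integral_ge0 => y _; rewrite lee_fin.
have nj0 : (0 <= nj)%E by apply: integral_ge0 => y _; rewrite lee_fin.
have nk0 : (0 <= nk)%E by apply: integral_ge0 => y _; rewrite lee_fin.
have two1 : 1 <= 2 `^ `|rho| :> R by apply: powR_ge1 => //; rewrite ler1n.
have nkB : (nk <= Bd%:E)%E.
  apply: (@le_trans _ _ (\int[lebesgue_stieltjes_measure f]_(t in `](u - kap)%R, u]) (kap `^ rho)%:E)%E).
    apply: le_integral_dom => y /=; rewrite in_itv/= => /andP[y0 yu]; rewrite lee_fin kernel_near//; last first.
      by apply/andP; split; lra.
    by rewrite -mulrA ler_piMr ?powR_ge0// ler_pdivrMl// mulr1; lra.
  rewrite stieltjes_cst// lee_fin; apply: le_trans (HB i0.+1); rewrite big_nat1 -/kap.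
  apply: (@le_trans _ _ (kap `^ rho * D i0)).
    by apply: ler_wpM2l; [exact: powR_ge0|exact: incr].
  by rewrite ler_wpM2r// ler_peMl ?powR_ge0.
case: far far0 => [far| |]//; last by move=> _; case: nk nk0 nkB => [nk| |].
rewrite lee_fin => far0.
case: nk nk0 nkB => [nk| |]//; rewrite ?lee_fin => nk0 nkB.
case: nj nj0 nearJ => [nj| |]//; rewrite ?lee_fin => nj0 njB.
move=> [IE]; rewrite /=.
have nn : `|nj - nk| <= Bd by rewrite ler_norml; lra.
rewrite -(subrKA I); apply: le_trans (ler_normD _ _) _; apply: lerD Ibl.
by rewrite -IE (_ : far + nj - (far + nk) = nj - nk)//; ring.
Qed.

(** * Almost sure regularity of the subordinator and its inverse *)

Section stable.
Context d (T : measurableType d) (R : realType) (Q : probability T R).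
Variables (alpha : R) (W : T -> R -> R).
Hypothesis alpha0 : 0 < alpha.
Hypothesis alpha1 : alpha < 1.
Hypothesis HW : stable_subordinator Q alpha W.
Let Gam : R := Gamma (1 - alpha).

Let Gam0 : 0 < Gam. Proof. by exact: Gamma_gt0. Qed.

Lemma measurable_subordinator_le (r t y : R) : measurable [set w | W w t - W w r <= y].
Proof.
have [mW _] := HW.
have mB : measurable_fun setT (fun w => W w t - W w r) by apply: measurable_funB; exact: mW.
rewrite -[X in measurable X]setTI (_ : [set w | _] = (fun w => W w t - W w r) @^-1` `]-oo, y]%classic).
  exact: (mB measurableT _ (measurable_itv _)).
by apply/seteqP; split => w /=; rewrite in_itv.
Qed.

Lemma subordinator_lower_tail (r t y : R) : 0 <= r -> r <= t -> 0 < y ->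
  (Q [set w | (W w t - W w r <= y)%R] <= (expR 1 * expR (- ((t - r) * Gam * y^-1 `^ alpha)))%:E)%E.
Proof.
move=> r0 rt y0; have [mW [_ [_ [_ [_ WL]]]]] := HW.
have mA := measurable_subordinator_le r t y.
have y1 : 0 <= y^-1 by rewrite invr_ge0 ltW.
rewrite EFinM -(WL r t y^-1 r0 rt y1).
have -> : Q [set w | (W w t - W w r <= y)%R] = (\int[Q]_w (\1_[set w | (W w t - W w r <= y)%R] w)%:E)%E.
  by rewrite integral_indic// setIT.
rewrite -ge0_integralZl//; last first.
- apply/measurable_EFinP; apply: measurableT_comp; first exact: measurable_expR.
  by apply: measurable_funM => //; apply: measurable_funB; exact: mW.
apply: le_integral_all => w; rewrite -EFinM lee_fin indicE.
have [|_] := boolP (w \in _); last by rewrite mulr_ge0// expR_ge0.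
rewrite inE /= => h; rewrite -expRD -[leLHS]expR0 ler_expR.
by rewrite mulNr subr_ge0 mulrC ler_pdivrMr// mul1r.
Qed.

Lemma exp_large (c e : R) : 0 < c -> 0 < e -> exists n0 : nat, forall z, n0%:R <= z ->
  expR 1 * expR (- (c * z)) <= e.
Proof.
move=> c0 e0; exists (Num.truncn (c^-1 * (expR 1 / e))).+1 => z hz.
have h : expR 1 / e <= c * z.
  by rewrite -ler_pdivrMl//; apply: le_trans hz; exact/ltW/truncnS_gt.
have h2 : c * z <= expR (c * z) by apply: le_trans (expR_ge1Dx _); rewrite lerDr.
by rewrite expRN ler_pdivrMr ?expR_gt0// mulrC -ler_pdivrMr//; exact: le_trans h h2.
Qed.

Lemma subordinator_large (y e : R) : 0 < y -> 0 < e -> exists n0 : nat, forall t, n0%:R <= t ->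
  (Q [set w | (W w t <= y)%R] <= e%:E)%E.
Proof.
move=> y0 e0; have c0 : 0 < Gam * y^-1 `^ alpha by apply: mulr_gt0; [exact: Gam0|rewrite powR_gt0// invr_gt0].
have [n0 H] := exp_large c0 e0; exists n0 => t ht.
have t0 : 0 <= t by exact: le_trans ht.
have [_ [W0 _]] := HW; have := subordinator_lower_tail (lexx 0) t0 y0.
rewrite (_ : [set w | _] = [set w | W w t <= y]); last by apply/seteqP; split => w /=; rewrite W0 subr0.
by move=> h; apply: le_trans h _; rewrite lee_fin; apply: le_trans (H _ ht); rewrite subr0 -mulrA [t * _]mulrC.
Qed.

(** Let the level tend to [0] in the lower-tail bound, whose exponent then diverges. *)
Lemma subordinator_increase (r t : R) : 0 <= r -> r < t ->
  Q [set w | W w t - W w r <= 0] = 0%E.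
Proof.
move=> r0 rt; apply/eqP; rewrite eq_le measure_ge0 andbT; apply/lee_addgt0Pr => e e0; rewrite add0e.
have c0 : 0 < (t - r) * Gam by apply: mulr_gt0; [rewrite subr_gt0|exact: Gam0].
have [n0 H] := exp_large c0 e0.
pose z : R := n0.+1%:R `^ alpha^-1.
have z0 : 0 < z by rewrite powR_gt0.
have zi : 0 < z^-1 by rewrite invr_gt0.
have zE : z `^ alpha = n0.+1%:R by rewrite /z -powRrM mulVf ?gt_eqF// powRr1.
apply: le_trans (_ : Q [set w | (W w t - W w r <= z^-1)%R] <= _)%E.
  apply: le_measure; rewrite ?inE; [exact: measurable_subordinator_le|exact: measurable_subordinator_le|].
  by move=> w /= h; apply: le_trans h _; exact: ltW.
apply: le_trans (subordinator_lower_tail r0 (ltW rt) zi) _.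
by rewrite lee_fin invrK zE; apply: H; rewrite ler_nat.
Qed.

(** Strict increase is obtained after the countably many times [j / m] only, which is what the grid
    arguments require. *)
Lemma subordinator_regular : exists A, [/\ measurable A, Q A = 0%E &
  forall w, ~ A w -> (forall y, exists2 t, 0 <= t & y < W w t) /\
    forall (m j : nat) t, (0 < m)%N -> j%:R / m%:R < t -> W w (j%:R / m%:R) < W w t].
Proof.
have [mW [W0 [_ [Wmono _]]]] := HW.
pose A1 (y : nat) := \bigcap_n [set w | W w n%:R - W w 0 <= y.+1%:R].
pose A2 (m j n : nat) := [set w | W w (j%:R / m.+1%:R + n.+1%:R^-1) - W w (j%:R / m.+1%:R) <= 0].
have mA1 y : measurable (A1 y).
  by apply: bigcapT_measurable => n; exact: measurable_subordinator_le.
have mA2 m j n : measurable (A2 m j n) by exact: measurable_subordinator_le.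
have P1 y : Q (A1 y) = 0%E.
  apply/eqP; rewrite eq_le measure_ge0 andbT; apply/lee_addgt0Pr => e e0; rewrite add0e.
  have y0 : 0 < y.+1%:R :> R by [].
  have [n0 H] := subordinator_large y0 e0.
  apply: le_trans (H n0%:R (lexx _)); apply: le_measure; rewrite ?inE//.
    have := measurable_subordinator_le 0 n0%:R y.+1%:R.
    rewrite (_ : [set w | _] = [set w | W w n0%:R <= y.+1%:R])//.
    by apply/seteqP; split => w /=; rewrite W0 subr0.
  by move=> w /(_ n0 I) /=; rewrite W0 subr0.
have P2 m j n : Q (A2 m j n) = 0%E.
  by apply: subordinator_increase; rewrite ?divr_ge0// ltrDl invr_gt0.
exists (\bigcup_y A1 y `|` \bigcup_m \bigcup_j \bigcup_n A2 m j n); split.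
- apply: measurableU; first exact: bigcupT_measurable.
  by do 3 (apply: bigcupT_measurable => ?).
- apply: prob_setU0; [exact: bigcupT_measurable| |by apply: prob_bigcup0|].
    by do 3 (apply: bigcupT_measurable => ?).
  apply: prob_bigcup0 => m; first by do 2 (apply: bigcupT_measurable => ?).
  apply: prob_bigcup0 => j; first by apply: bigcupT_measurable => ?.
  exact: prob_bigcup0.
- move=> w nA; split => [y|m j t m0 jt].
    have : ~ A1 (Num.truncn y) w by move=> h; apply: nA; left; exists (Num.truncn y).
    move=> /existsNP[n] /not_implyP[_] /= /negP; rewrite W0 subr0 -ltNge => h.
    by exists n%:R => //; apply: le_lt_trans h; exact/ltW/truncnS_gt.
  have tj : 0 < t - j%:R / m%:R by rewrite subr_gt0.
  pose n := Num.truncn (t - j%:R / m%:R)^-1.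
  have hn : n.+1%:R^-1 <= t - j%:R / m%:R.
    by rewrite -[leRHS]invrK lef_pV2 ?posrE ?invr_gt0//; exact/ltW/truncnS_gt.
  have : ~ A2 m.-1 j n w by move=> h; apply: nA; right; exists m.-1 => //; exists j => //; exists n.
  rewrite /A2/= prednK// => /negP; rewrite -ltNge subr_gt0 => h; apply: lt_le_trans h _.
  apply: Wmono; first by rewrite addr_ge0 ?divr_ge0 ?invr_ge0.
  by rewrite -lerBrDl.
Qed.

(** An increment of the inverse is a normalised count of skeleton points in a window, so the renewal
    window estimate for the skeleton bounds it. A mesh [1 / m] resolves the scales [i < I];
    infinitely many good [I] then give all scales at once. *)
Lemma inverse_modulus (b e q : R) (n : nat) : 0 < b -> 0 < e -> (0 < n)%N -> 1 < q -> q ^+ n = 4 ->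
  exists2 M, 0 < M & exists A, [/\ measurable A, (Q A <= e%:E)%E &
    forall w, ~ A w -> forall (i : nat) u, b / 2 ^+ i <= u <= b ->
      gen_inverse (W w) u - gen_inverse (W w) (u - b / 2 ^+ i) <= M * q ^+ i * (b / 2 ^+ i) `^ alpha].
Proof.
move=> b0 e0 n0 q1 qn.
have [mW [W0 [_ [Wmono _]]]] := HW.
have e3 : 0 < e / 3 by rewrite divr_gt0.
have [K [K1 HK]] := exp_sum_small n0 (lt_trans ltr01 q1) qn e3.
have Kp : 0 < K by exact: lt_le_trans K1.
(* The window bound [6 K q^i / tl] contributes [3 K / Gam]; the [1] covers the two partial cells. *)
pose M := 3 * K / Gam + 1.
have M0 : 0 < M.
  rewrite ltr_wpDl//; apply: divr_ge0; last exact: (ltW Gam0).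
  by apply: mulr_ge0 => //; exact: ltW.
have [Z [mZ PZ HZ]] := subordinator_regular.
exists M => //.
have bi i : 0 < b / 2 ^+ i by rewrite divr_gt0// exprn_gt0.
have bmono i j : (i <= j)%N -> b / 2 ^+ j <= b / 2 ^+ i.
  by move=> ij; rewrite ler_pM2l// lef_pV2 ?posrE ?exprn_gt0// ler_eXn2l// ltr1n.
have Wle n1 : measurable [set w | W w n1 <= b].
  have := measurable_subordinator_le 0 n1 b.
  rewrite (_ : [set w | _] = [set w | W w n1 <= b])//.
  by apply/seteqP; split => w /=; rewrite W0 subr0.
suff [A HA] : {A : nat -> set T | forall I, [/\ measurable (A I), (Q (A I) <= (e / 3 + e / 3)%:E)%E &
    forall w, ~ A I w -> ~ Z w -> forall (i : nat) u, (i < I)%N -> b / 2 ^+ i <= u <= b ->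
      gen_inverse (W w) u - gen_inverse (W w) (u - b / 2 ^+ i) <= M * q ^+ i * (b / 2 ^+ i) `^ alpha]}.
  have [B [mB PB HB]] := @prob_liminf_le _ _ _ Q A (e / 3 + e / 3) (fun I => let: And3 h _ _ := HA I in h)
    (fun I => let: And3 _ h _ := HA I in h).
  exists (B `|` Z); split; first exact: measurableU.
    apply: le_trans (prob_setU_le mB mZ PB (_ : Q Z <= (e / 3)%:E)%E) _; first by rewrite PZ lee_fin ltW.
    by rewrite lee_fin; lra.
  move=> w nBZ i u iu.
  have nB : ~ B w by move=> h; apply: nBZ; left.
  have nZ : ~ Z w by move=> h; apply: nBZ; right.
  have [I iI nA] := HB w nB i.+1; have [_ _ H] := HA I; exact: H.
suff /choice[A HA] : forall I, exists A, [/\ measurable A, (Q A <= (e / 3 + e / 3)%:E)%E &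
    forall w, ~ A w -> ~ Z w -> forall (i : nat) u, (i < I)%N -> b / 2 ^+ i <= u <= b ->
      gen_inverse (W w) u - gen_inverse (W w) (u - b / 2 ^+ i) <= M * q ^+ i * (b / 2 ^+ i) `^ alpha].
  by exists A.
move=> I; pose y := b / 2 ^+ I.
have ya : 0 < y `^ alpha by rewrite powR_gt0// bi.
(* At every scale [i <= I] this gives [m (b / 2^i)^alpha >= 2 Gam + 2]: the minimum in [tl] is then
   attained by its second argument, and the boundary term [2] is absorbed. *)
pose m := (Num.truncn ((2 * Gam + 2) / y `^ alpha)).+1.
have m0 : (0 < m)%N by [].
have mR : 0 < m%:R :> R by rewrite ltr0n.
have my i : (i <= I)%N -> 2 * Gam + 2 <= m%:R * (b / 2 ^+ i) `^ alpha.
  move=> iI; apply: (@le_trans _ _ (m%:R * y `^ alpha)).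
    by rewrite -ler_pdivrMr//; exact/ltW/truncnS_gt.
  by rewrite ler_pM2l//; apply: ler_powRl; [exact: bi|exact: bmono|exact: (ltW alpha0)].
(* Twice the Laplace exponent of one skeleton step at [z^-1], matching the form [expR (- tl / 2)],
   truncated at [1] as the window estimate demands. *)
pose tl z : R := Num.min 1 (2 * Gam * z^-1 `^ alpha / m%:R).
have tl01 z : 0 < z -> 0 < tl z <= 1.
  move=> z0; rewrite /tl lt_min ltr01/= ge_min lexx/= andbT.
  apply: divr_gt0 => //; apply: mulr_gt0; last by rewrite powR_gt0// invr_gt0.
  by apply: mulr_gt0 => //; exact: Gam0.
have Hl z i : 0 < z -> (\int[Q]_w (expR (- (z^-1 * skel W m i w)))%:E <= (expR (- (tl z / 2)))%:E)%E.
  move=> z0; have z1 : 0 <= z^-1 by rewrite invr_ge0 (ltW z0).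
  rewrite (skel_laplace HW m0)// lee_fin ler_expR lerN2.
  rewrite ler_pdivrMr// /tl ge_min; apply/orP; right.
  by rewrite -/Gam [leLHS](_ : _ = m%:R^-1 * Gam * z^-1 `^ alpha * 2)//; ring.
have [n1 Hn1] := subordinator_large b0 e3.
pose N := (n1 * m)%N.
have [A1 [mA1 [PA1 HA1]]] := @renewal_good_event _ _ _ Q _ (skel_sigma_algebra W m)
  (fun i A => @skel_sigma_measurable _ _ _ _ _ _ HW m i A) (skel_indep HW m0) _ (fun i => @skel_adapted _ _ _ W m i) tl q (e / 3) K tl01 (skel_ge0 HW m0) Hl (ltW q1) K1 HK b N I b0.
exists (A1 `|` [set w | W w n1%:R <= b]); split; first exact: measurableU.
  by apply: prob_setU_le => //; exact: Hn1.
move=> w nA nZ i u iI /andP[bu ub].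
have [unb _] := HZ w nZ.
have nA1 : ~ A1 w by move=> h; apply: nA; left.
have Wb : b < W w n1%:R by rewrite ltNge; apply/negP => h; apply: nA; right.
have v0 : 0 <= u - b / 2 ^+ i by rewrite subr_ge0.
have NE : N%:R / m%:R = n1%:R :> R by rewrite natrM mulfK// gt_eqF.
have uN : u < W w (N%:R / m%:R) by rewrite NE; exact: le_lt_trans Wb.
have u0 : 0 <= u by apply: le_trans bu; exact/ltW/bi.
have vu : u - b / 2 ^+ i <= u by rewrite lerBlDr lerDl ltW// bi.
have Wm s t : 0 <= s -> s <= t -> W w s <= W w t by exact: Wmono.
apply: le_trans (gen_inverse_increment Wm unb m0 v0 vu uN) _.
have := HA1 w nA1 i u iI; rewrite u0 ub => /(_ isT) cnt.
set s := (\sum_(k < N) _)%N.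
have sw : (s <= window_count (skel W m) N u (b / 2 ^+ i) w)%N.
  apply: leq_sum => k _; rewrite (skel_walk HW).
  case: (boolP (_ && _)) => // /andP[h1 h2].
  by rewrite (le_lt_trans v0 h1) (ltW h1) h2.
have ti : tl (b / 2 ^+ i) = 2 * Gam * (b / 2 ^+ i)^-1 `^ alpha / m%:R.
  rewrite /tl min_r// ler_pdivrMr// mul1r powR_inv ?bi// ler_pdivrMr ?powR_gt0 ?bi//.
  by have := my i (ltnW iI); set z := _ * _ `^ _; lra.
rewrite ti in cnt.
set Y := (b / 2 ^+ i) `^ alpha in my *.
have Yi : 0 < Y by rewrite powR_gt0 ?bi.
have qi : 1 <= q ^+ i by rewrite exprn_ege1// ltW.
have c1 : (window_count (skel W m) N u (b / 2 ^+ i) w)%:R <= 3 * K / Gam * q ^+ i * Y * m%:R.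
  apply: le_trans cnt _; rewrite le_eqVlt; apply/orP; left; apply/eqP.
  have Gn : Gam != 0 by rewrite gt_eqF.
  have mn : m%:R != 0 :> R by rewrite gt_eqF.
  have Yn : Y != 0 by rewrite gt_eqF.
  have -> : (b / 2 ^+ i)^-1 `^ alpha = Y^-1 by rewrite powR_inv// bi.
  by field; rewrite Gn mn Yn.
have c2 : 2 <= m%:R * Y by have := my i (ltnW iI); rewrite -/Y; have := Gam0; set z := m%:R * _; lra.
rewrite ler_pdivrMr//.
have sw' : s%:R <= (window_count (skel W m) N u (b / 2 ^+ i) w)%:R :> R by rewrite ler_nat.
apply: le_trans (lerD (le_trans sw' c1) c2) _.
rewrite /M [leRHS](_ : _ = 3 * K / Gam * q ^+ i * Y * m%:R + q ^+ i * (m%:R * Y)); last by ring.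
by rewrite lerD2l ler_peMl// mulr_ge0 ?ltW.
Qed.

End stable.

Lemma block_path_lip {R : realType} (g : R -> R) (m B : nat) (s : nat -> R) (L x y : R) :
  (forall x y, `|g x - g y| <= L * `|x - y|) ->
  `|block_path g m B s x - block_path g m B s y| <= m%:R^-1 * B%:R * L * `|x - y|.
Proof.
move=> gL; rewrite /block_path -mulrBr -sumrB normrM ger0_norm ?invr_ge0// -!mulrA ler_wpM2l ?invr_ge0//.
apply: le_trans (ler_norm_sum _ _ _) _; apply: le_trans (_ : \sum_(j < B) L * `|x - y| <= _).
  apply: ler_sum => j _; apply: le_trans (gL _ _) _.
  by rewrite (_ : x - _ - (y - _) = x - y)//; ring.
by rewrite sumr_const card_ord mulr_natl.
Qed.

Lemma continuous_lip_approx {R : realType} (f : R -> R) (a b u : R) : a < u -> u < b ->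
  (forall e, 0 < e -> exists g K, [/\ 0 <= K, (forall x y, `|g x - g y| <= K * `|x - y|) &
     forall x, a <= x <= b -> `|f x - g x| <= e]) -> f @ u --> f u.
Proof.
move=> au ub H; apply/cvgrPdist_le => e e0.
have e3 : 0 < e / 3 by rewrite divr_gt0.
have [g [K [K0 gK fg]]] := H _ e3.
have K1 : 0 < e / 3 / (K + 1) by rewrite divr_gt0// ltr_wpDl.
have K2 : 0 < K + 1 by rewrite ltr_wpDl.
apply/nbhs_ballP; exists (Num.min (e / 3 / (K + 1)) (Num.min (u - a) (b - u))) => /=.
  by rewrite !lt_min K1 !subr_gt0 au ub.
move=> x; rewrite /ball/= !lt_min => /andP[/ltW xu /andP[xa xb']].
have ax : a <= x by move: xa; rewrite ltr_distl; lra.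
have xb : x <= b by move: xb'; rewrite ltr_distl; lra.
have h1 := fg u ltac:(by rewrite !ltW).
have h2 := fg x ltac:(by rewrite ax xb).
have h3 : `|g u - g x| <= e / 3.
  apply: le_trans (gK _ _) _; apply: le_trans (_ : (K + 1) * `|u - x| <= _).
    by rewrite ler_wpM2r// lerDl.
  by rewrite mulrC -ler_pdivlMr.
rewrite (_ : f u - f x = (f u - g u) + (g u - g x) - (f x - g x)); last by ring.
apply: le_trans (ler_normB _ _) _; apply: le_trans (lerD (ler_normD _ _) (lexx _)) _; lra.
Qed.

Lemma root_of_4_small {R : realType} (theta : R) : 0 < theta ->
  exists n (q : R), [/\ (0 < n)%N, 1 < q, q ^+ n = 4 & q < 2 `^ theta].
Proof.
move=> th0; pose n := (Num.truncn (2 / theta)).+1.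
have n0 : 0 < n%:R :> R by rewrite ltr0n.
have nth : 2 / n%:R < theta.
  by rewrite ltr_pdivrMr// mulrC -ltr_pdivrMr//; exact: truncnS_gt.
have [q q1 [qn qI]] := @root_of_4 R n isT.
exists n, q; split => //; have := qI 1%N; rewrite !expr1 => ->.
by rewrite /powR pnatr_eq0/= ltr_expR ltr_pM2r// ln_gt0// ltr1n.
Qed.

(** * Block approximation and regularity of the limit process *)

Section limit.
Context d (T : measurableType d) (R : realType) (Q : probability T R).
Variables (alpha rho : R) (W : T -> R -> R).
Hypothesis alpha0 : 0 < alpha.
Hypothesis alpha1 : alpha < 1.
Hypothesis rho_alpha : - alpha < rho.
Hypothesis HW : stable_subordinator Q alpha W.

Lemma limit_approx (a b e : R) : 0 < a -> a < b -> 0 < e -> exists C0 : nat, forall C, (C0 <= C)%N ->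
  exists i1, forall i0, (i1 <= i0)%N -> exists m0, forall m, (m0 <= m)%N -> (0 < m)%N ->
  exists A, [/\ measurable A, (Q A <= e%:E)%E &
    forall w, ~ A w -> forall u, a <= u <= b ->
    `|J_ar rho (W w) u - block_path (kernel (b / 2 ^+ i0) b rho) m (C * m)%N
        (fun j => W w (j%:R / m%:R)) u| <= e].
Proof.
move=> a0 ab e0; have b0 : 0 < b by exact: lt_trans ab.
have e2 : 0 < e / 2 by rewrite divr_gt0.
have e22 : e / 2 + e / 2 = e by lra.
have ra := rho_alpha; have ra0 : 0 < rho + alpha by lra.
(* [rho + alpha] is for summability of the shells, [alpha] for the modulus itself to vanish at small
   scales. *)
have th0 : 0 < Num.min alpha (rho + alpha) by rewrite lt_min alpha0.
have [mW [W0 [_ [Wmono _]]]] := HW.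
have [n [q [n0 q1 qn qth]]] := root_of_4_small th0.
have q0 : 0 < q by exact: lt_trans q1.
have twopos r : 0 < 2 `^ r :> R by rewrite powR_gt0.
have zr r : Num.min alpha (rho + alpha) <= r -> 0 <= q * 2 `^ (- r) < 1.
  move=> hr; rewrite mulr_ge0 ?(ltW q0) ?powR_ge0//= powRN ltr_pdivrMr// mul1r.
  apply: lt_le_trans qth _; apply: ler_powR => //; by rewrite ler1n.
have z1 := zr (rho + alpha) ltac:(by rewrite ge_min lexx orbT).
have z2 := zr alpha ltac:(by rewrite ge_min lexx).
have [M M0 [A [mA PA HA]]] := inverse_modulus alpha0 alpha1 HW b0 e2 n0 q1 qn.
have [Z [mZ PZ HZ]] := subordinator_regular alpha0 alpha1 HW.
have [C0 HC0] := subordinator_large alpha0 alpha1 HW b0 e2.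
exists C0 => C CC.
pose c1 := 2 `^ `|rho| * M * b `^ (rho + alpha).
pose zz := q * 2 `^ (- (rho + alpha)).
have [j1 Hj1] := @exprn_small _ zz (c1 / (1 - zz)) (e / 2) z1 e2.
have half01 : 0 <= (2^-1 : R) < 1 by lra.
have [j2 Hj2] := @exprn_small _ 2^-1 b a half01 a0.
exists (maxn j1 j2) => i0; rewrite geq_max => /andP[ji1 ji2].
have kap0 : 0 < b / 2 ^+ i0 by rewrite divr_gt0// exprn_gt0.
have kapa : b / 2 ^+ i0 <= a by have := Hj2 _ ji2; rewrite exprVn.
have kapb : b / 2 ^+ i0 <= b by apply: le_trans kapa _; exact: ltW.
have [L L0 HL] := kernel_lip rho kap0 kapb.
pose m0 := (Num.truncn (L * b / (e / 2))).+1.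
exists m0 => m mm mpos.
have mR : 0 < m%:R :> R by rewrite ltr0n.
have Lb : m%:R^-1 * L * b <= e / 2.
  rewrite -mulrA ler_pdivrMl// -ler_pdivrMr//; apply: le_trans (_ : m0%:R <= _); first exact/ltW/truncnS_gt.
  by rewrite ler_nat.
have mC : measurable [set w | W w C%:R <= b].
  have := measurable_subordinator_le HW 0 C%:R b.
  by rewrite (_ : [set w | _] = [set w | W w C%:R <= b])//; apply/seteqP; split => w /=; rewrite W0 subr0.
exists ((A `|` [set w | W w C%:R <= b]) `|` Z); split.
- by apply: measurableU => //; exact: measurableU.
- apply: le_trans (prob_setU_le (_ : measurable (A `|` _)) mZ (prob_setU_le mA mC PA (HC0 C%:R _)) (_ : Q Z <= 0%:E)%E) _.
  + exact: measurableU.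
  + by rewrite ler_nat.
  + by rewrite PZ.
  + by rewrite addr0 e22.
move=> w nA u aub.
have nA1 : ~ A w by move=> h; apply: nA; left; left.
have nC : b < W w C%:R by rewrite ltNge; apply/negP => h; apply: nA; left; right.
have nZ : ~ Z w by move=> h; apply: nA; right.
have [unb strict] := HZ w nZ.
have CE : (C * m)%:R / m%:R = C%:R :> R by rewrite natrM mulfK// gt_eqF.
rewrite -e22; apply: le_trans (_ : e / 2 + m%:R^-1 * L * b <= _); last by rewrite lerD2l.
have pw i r : (b / 2 ^+ i) `^ r = b `^ r * (2 `^ (- r)) ^+ i.
  by rewrite -exprVn powRM ?exprn_ge0 ?invr_ge0 ?ltW// pow_inv2_powR.
apply: (@J_ar_block _ _ rho a b (e / 2) L (fun i => M * q ^+ i * (b / 2 ^+ i) `^ alpha) i0 m (C * m)%N) => //.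
- by move=> s t; exact: Wmono.
- by move=> j t; exact: strict.
- exact: HA.
- move=> k; rewrite (eq_bigr (fun i => c1 * zz ^+ i)); last first.
    move=> i _; rewrite -mulrA [X in 2 `^ `|rho| * X](_ : _ = M * q ^+ i * (b / 2 ^+ i) `^ (rho + alpha)).
      by rewrite pw /c1 /zz exprMn; ring.
    by rewrite powRD ?gt_eqF ?implybT// ?divr_gt0// ?exprn_gt0//; ring.
  rewrite -mulr_sumr; apply: le_trans (Hj1 _ ji1).
  rewrite [leRHS]mulrAC -[leRHS]mulrA; apply: ler_wpM2l.
    by rewrite !mulr_ge0 ?powR_ge0// ltW.
  by apply: geometric_tail.
- move=> e' e'0; have [j H] := @exprn_small _ (q * 2 `^ (- alpha)) (M * b `^ alpha) e' z2 e'0.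
  exists (maxn i0 j); first exact: leq_maxl.
  by apply: le_trans (H _ (leq_maxr i0 j)); rewrite pw exprMn le_eqVlt; apply/orP; left; apply/eqP; ring.
- by rewrite CE.
Qed.

(** Almost surely the path is, on each [[1 / k.+2, k.+2]], a uniform limit of Lipschitz block paths,
    hence continuous on [(0, oo)]. For each [N], the failures at all precisions [1 / (N + n).+1]
    have a null intersection. *)
Lemma J_ar_cadlag : exists A, [/\ measurable A, Q A = 0%E &
  forall w, ~ A w -> cadlag_pos (J_ar rho (W w))].
Proof.
have H (k n : nat) : exists A : set T, [/\ measurable A, (Q A <= (n.+1%:R^-1)%:E)%E &
    forall w, ~ A w -> exists g K, [/\ 0 <= K, (forall x y : R, `|g x - g y| <= K * `|x - y|) &
      forall x : R, k.+2%:R^-1 <= x <= k.+2%:R -> `|J_ar rho (W w) x - g x| <= n.+1%:R^-1]].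
  have a0 : 0 < k.+2%:R^-1 :> R by rewrite invr_gt0.
  have ab : k.+2%:R^-1 < k.+2%:R :> R.
    by apply: (@lt_le_trans _ _ 1); rewrite ?invf_lt1// ?ltr1n// ler1n.
  have e0 : 0 < n.+1%:R^-1 :> R by rewrite invr_gt0.
  have [C0 HC] := limit_approx a0 ab e0; have [i1 Hi] := HC C0 (leqnn _).
  have [m0 Hm] := Hi i1 (leqnn _); have [A [mA PA HA]] := Hm m0.+1 (leqnSn _) isT.
  exists A; split => // w nA.
  have kap0 : 0 < k.+2%:R / 2 ^+ i1 :> R by rewrite divr_gt0// exprn_gt0.
  have kapb : k.+2%:R / 2 ^+ i1 <= k.+2%:R :> R.
    by rewrite ler_pdivrMr ?exprn_gt0// ler_peMr// exprn_ege1// ler1n.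
  have [L L0 HL] := kernel_lip rho kap0 kapb.
  eexists; exists (m0.+1%:R^-1 * (C0 * m0.+1)%:R * L); split; last exact: (HA w nA).
    by rewrite !mulr_ge0 ?invr_ge0.
  by move=> x y; exact: block_path_lip.
have /choice[A HA] : forall kn : nat * nat, exists A : set T, [/\ measurable A, (Q A <= (kn.2.+1%:R^-1)%:E)%E &
    forall w, ~ A w -> exists g K, [/\ 0 <= K, (forall x y : R, `|g x - g y| <= K * `|x - y|) &
      forall x : R, kn.1.+2%:R^-1 <= x <= kn.1.+2%:R -> `|J_ar rho (W w) x - g x| <= kn.2.+1%:R^-1]].
  by move=> [k n]; exact: H.
pose B k N := \bigcap_n A (k, (N + n)%N).
have mB k N : measurable (B k N) by apply: bigcapT_measurable => n; have [] := HA (k, (N + n)%N).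
have PB k N : Q (B k N) = 0%E.
  apply/eqP; rewrite eq_le measure_ge0 andbT; apply/lee_addgt0Pr => e e0; rewrite add0e.
  pose n := Num.truncn e^-1.
  have ne : (N + n).+1%:R^-1 <= e.
    rewrite -[leRHS]invrK lef_pV2 ?posrE ?invr_gt0//; apply: le_trans (_ : n.+1%:R <= _).
      exact/ltW/truncnS_gt.
    by rewrite ler_nat ltnS leq_addl.
  have [mA' PA' _] := HA (k, (N + n)%N).
  apply: le_trans (_ : Q (A (k, (N + n)%N)) <= _)%E; last by apply: le_trans PA' _; rewrite lee_fin.
  by apply: le_measure; rewrite ?inE// => w; exact.
exists (\bigcup_k \bigcup_N B k N); split.
- by do 2 (apply: bigcupT_measurable => ?).
- apply: prob_bigcup0 => k; first by apply: bigcupT_measurable => ?.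
  exact: prob_bigcup0.
move=> w nB.
suff cont (u : R) : 0 < u -> J_ar rho (W w) @ u --> J_ar rho (W w) u.
  split => u u0; last exists (J_ar rho (W w) u).
    by apply: cvg_at_right_filter; exact: cont.
  by apply: cvg_at_left_filter; exact: cont.
move=> u0.
pose k := (Num.truncn u + Num.truncn u^-1)%N.
have k1 : u < k.+2%:R.
  by apply: lt_le_trans (truncnS_gt _) _; rewrite ler_nat /k ltnS leqW// leq_addr.
have k2 : k.+2%:R^-1 < u.
  rewrite -[ltRHS]invrK ltf_pV2 ?posrE ?invr_gt0//; apply: lt_le_trans (truncnS_gt _) _.
  by rewrite ler_nat /k ltnS leqW// leq_addl.
apply: (continuous_lip_approx k2 k1) => e e0.
pose N := Num.truncn e^-1.
have : ~ B k N w by move=> h; apply: nB; exists k => //; exists N.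
move=> /existsNP[n] /not_implyP[_ nA].
have [_ _ /(_ _ nA)[g [K [K0 gK gJ]]]] := HA (k, (N + n)%N).
exists g, K; split => // x xb; apply: le_trans (gJ x xb) _ => /=.
rewrite -[leRHS]invrK lef_pV2 ?posrE ?invr_gt0//; apply: le_trans (_ : N.+1%:R <= _).
  exact/ltW/truncnS_gt.
by rewrite ler_nat ltnS leq_addr.
Qed.

End limit.

(** * Convergence of expectations *)

Lemma big_blocks (U : Type) (idx : U) (op : Monoid.law idx) (B q : nat) (f : nat -> nat -> U) :
  \big[op/idx]_(k < B * q) f (k %/ q)%N k = \big[op/idx]_(j < B) \big[op/idx]_(i < q) f j (j * q + i)%N.
Proof.
elim: B => [|B IH]; first by rewrite !big_ord0.
rewrite big_ord_recr/= -IH mulSnr big_split_ord/=; congr (op _ _).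
apply: eq_bigr => i _; have q0 : (0 < q)%N by exact: leq_ltn_trans (ltn_ord i).
by rewrite divnMDl// divn_small// addn0.
Qed.

Lemma ln_clamp_lip {R : realType} (b x y : R) :
  `|ln (Num.max x (expR (- b))) - ln (Num.max y (expR (- b)))| <= expR b * `|x - y|.
Proof.
wlog xy : x y / x <= y.
  move=> H; have [|/ltW h] := leP x y; first exact: H.
  by rewrite distrC (distrC x); exact: H.
set c := expR (- b); have c0 : 0 < c by exact: expR_gt0.
have m0 z : 0 < Num.max z c by rewrite lt_max c0 orbT.
have mc z : c <= Num.max z c by rewrite le_max lexx orbT.
have mxy : Num.max x c <= Num.max y c by rewrite ge_max !le_max xy lexx orbT.
rewrite distrC (distrC x) ger0_norm; last by rewrite subr_ge0 ler_ln ?posrE.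
rewrite ger0_norm ?subr_ge0// -ln_div ?posrE//.
have -> : Num.max y c / Num.max x c = 1 + (Num.max y c - Num.max x c) / Num.max x c.
  by field; rewrite gt_eqF.
have d0 : 0 <= (Num.max y c - Num.max x c) / Num.max x c by rewrite divr_ge0 ?subr_ge0// ltW.
apply: le_trans (le_ln1Dx _) _; first by apply: lt_le_trans d0; rewrite ltrN10.
rewrite ler_pdivrMr//; apply: (@le_trans _ _ (y - x)).
  have [h1|h1] := leP y c; have [h2|h2] := leP x c; lra.
rewrite mulrAC ler_peMl ?subr_ge0//; apply: (@le_trans _ _ (expR b * c)).
  by rewrite -expRD subrr expR0.
by rewrite ler_wpM2l ?expR_ge0.
Qed.

Lemma clamp_expR {R : realType} (b x : R) : - ln (Num.max (expR (- x)) (expR (- b))) = Num.min x b.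
Proof.
have [h|h] := leP x b.
  by rewrite max_l ?ler_expR ?lerN2// expRK opprK.
by rewrite max_r ?ler_expR ?lerN2 ?(ltW h)// expRK opprK.
Qed.

(** If one summand exceeds [b], both clamped sums equal [b]; otherwise clamping changes nothing. *)
Lemma min_sum_min {R : realType} (n : nat) (z : nat -> R) (b : R) : 0 <= b -> (forall i, 0 <= z i) ->
  Num.min b (\sum_(i < n) Num.min (z i) b) = Num.min b (\sum_(i < n) z i).
Proof.
move=> b0 z0.
have [h|h] := pselect (forall i : 'I_n, z i <= b).
  by congr (Num.min b _); apply: eq_bigr => i _; rewrite min_l.
have [i hib] : exists i : 'I_n, b < z i by apply: contrapT => /forallNP H; apply: h => i; rewrite leNgt; exact/negP.
rewrite !min_l//.
  by rewrite (bigD1 i)//=; apply: le_trans (ltW hib) _; rewrite lerDl sumr_ge0.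
rewrite (bigD1 i)//= min_r ?(ltW hib)// lerDl sumr_ge0// => j _.
by rewrite le_min z0 b0.
Qed.

(** * Functionals of the block increments *)

Section functional.
Context {R : realType}.
Variables (a b L : R) (F : (R -> R) -> R) (g : R -> R) (Lg : R) (m B : nat).
Hypothesis b0 : 0 < b.
Hypothesis L0 : 0 <= L.
Hypothesis HF : lip_on a b L F.
Hypothesis Lg0 : 0 <= Lg.
Hypothesis gL : forall x y, `|g x - g y| <= Lg * `|x - y|.
Hypothesis gz : forall x, x <= 0 -> g x = 0.

(** The functional in the variables [z i], the exponentials of minus the increments, which range
    over [[0, 1]]. Cutting [z i] below at [expR (- b)] makes the logarithm Lipschitz and is
    invisible, since increments beyond [b] leave the range where [g] is nonzero. *)
Definition path_functional (z : nat -> R) : R :=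
  F (block_path g m B (fun j => \sum_(i < j) - ln (Num.max (z i) (expR (- b))))).

Lemma path_functional_lip z z' :
  `|path_functional z - path_functional z'| <=
    (L * (m%:R^-1 * B%:R * Lg * expR b)) * \sum_(i < B) `|z i - z' i|.
Proof.
have S0 : 0 <= \sum_(i < B) `|z i - z' i| by rewrite sumr_ge0.
rewrite -mulrA; apply: HF; first by rewrite !mulr_ge0 ?invr_ge0 ?expR_ge0.
move=> u _; rewrite /block_path -mulrBr -sumrB normrM ger0_norm ?invr_ge0// -!mulrA ler_wpM2l ?invr_ge0//.
apply: le_trans (ler_norm_sum _ _ _) _.
apply: le_trans (_ : \sum_(j < B) Lg * (expR b * \sum_(i < B) `|z i - z' i|) <= _); last first.
  by rewrite sumr_const card_ord mulr_natl.
apply: ler_sum => j _; apply: le_trans (gL _ _) _; apply: ler_wpM2l => //.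
have -> (x y : R) : u - x - (u - y) = y - x by ring.
rewrite -sumrB.
apply: le_trans (ler_norm_sum _ _ _) _; rewrite mulr_sumr.
apply: le_trans (_ : \sum_(i < j.+1) expR b * `|z i - z' i| <= _).
  by apply: ler_sum => i _; rewrite opprK addrC; apply: le_trans (ln_clamp_lip _ _ _) _.
rewrite (big_ord_widen B (fun i => expR b * `|z i - z' i|) (ltn_ord j)) big_mkcond/=.
by apply: ler_sum => i _; case: ifP => // _; rewrite mulr_ge0// expR_ge0.
Qed.

Lemma path_functionalE (y : nat -> R) : (forall i, 0 <= y i) ->
  path_functional (fun i => expR (- y i)) = F (block_path g m B (fun j => \sum_(i < j) y i)).
Proof.
move=> y0; apply/eqP; rewrite -subr_eq0 -normr_eq0 eq_le normr_ge0 andbT.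
apply: (@le_trans _ _ (L * 0)); last by rewrite mulr0.
apply: HF => // u /andP[au ub].
have gmin x : g (u - Num.min b x) = g (u - x).
  by have [h|h] := leP b x => //; rewrite !gz// subr_le0 ?(le_trans ub h).
have key s s' : (forall j, Num.min b (s j) = Num.min b (s' j)) ->
    block_path g m B s u = block_path g m B s' u.
  by move=> ss; congr (_ * _); apply: eq_bigr => j _; rewrite -gmin ss gmin.
rewrite (key _ (fun j => \sum_(i < j) y i)) ?subrr ?normr0// => j.
under eq_bigr do rewrite clamp_expR.
exact: min_sum_min (ltW b0) y0.
Qed.

End functional.

Lemma Ex_polyfun d (T : measurableType d) (R : realType) (P : probability T R) (B : nat)
    (s : seq (R * (nat -> nat))) (Z : nat -> T -> R) (psi : nat -> R) :
  (forall i, measurable_fun setT (Z i)) -> (forall i w, 0 <= Z i w <= 1) ->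
  (forall n : nat -> nat, (\int[P]_w (\prod_(i < B) Z i w ^+ n i)%:E = (\prod_(i < B) psi (n i))%:E)%E) ->
  Ex P (fun w => \sum_(p <- s) monomial B p (fun i => Z i w)) =
  \sum_(p <- s) p.1 * \prod_(i < B) psi (p.2 i).
Proof.
move=> mZ Z01 HZ.
have mprod (n : nat -> nat) : measurable_fun setT (fun w => \prod_(i < B) Z i w ^+ n i).
  by apply: measurable_prod => i _; apply: measurable_funX; exact: mZ.
have bprod (n : nat -> nat) w : `|\prod_(i < B) Z i w ^+ n i| <= 1.
  rewrite normr_prod; apply: prodr_ile1 => i _; rewrite normr_ge0 normrX exprn_ile1//.
  by have /andP[h1 h2] := Z01 i w; rewrite ger0_norm.
have iprod n := bounded_integrable P (mprod n) (bprod n).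
have mmon p : measurable_fun setT (fun w => monomial B p (fun i => Z i w)).
  by apply: measurable_funM => //; exact: mprod.
have imon p : P.-integrable setT (EFin \o (fun w => monomial B p (fun i => Z i w))).
  apply: (@bounded_integrable _ _ _ P _ `|p.1|); first exact: mmon.
  by move=> w; rewrite normrM ler_piMr.
elim: s => [|p s IH].
  rewrite big_nil (_ : (fun w => _) = (fun=> 0)) ?Ex_cst//.
  by apply/funext => w; rewrite big_nil.
rewrite (_ : (fun w => _) = (fun w => monomial B p (fun i => Z i w) + \sum_(p' <- s) monomial B p' (fun i => Z i w))).
  rewrite ExD//.
    by rewrite IH big_cons (ExZ _ (iprod p.2)); congr (_ * _ + _); rewrite /Ex HZ.
  elim: s {IH} => [|p' s IH].
    rewrite (_ : (fun w => _) = (fun=> 0)); first exact: integrable_cstR.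
    by apply/funext => w; rewrite big_nil.
  rewrite (_ : EFin \o _ = (EFin \o (fun w => monomial B p' (fun i => Z i w))) \+
    (EFin \o (fun w => \sum_(p <- s) monomial B p (fun i => Z i w)))); first exact: integrableD.
  by apply/funext => w /=; rewrite big_cons.
by apply/funext => w; rewrite big_cons.
Qed.

(** A squeeze: [1 - x] lies between [expR (- x / (1 - x))] and [expR (- x)]. *)
Lemma exprn_laplace_cvg {R : realType} (x : R -> R) (q : R -> nat) (c : R) :
  (forall t, 0 <= x t) -> x t @[t --> +oo] --> (0 : R) -> (q t)%:R * x t @[t --> +oo] --> c ->
  (1 - x t) ^+ q t @[t --> +oo] --> expR (- c).
Proof.
move=> x0 xcvg qx.
have x1 : \forall t \near +oo, x t <= 2^-1.
  have h0 : 0 < 2^-1 :> R by rewrite invr_gt0.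
  move/cvgrPdist_le : (xcvg) => /(_ _ h0); apply: filterS => t.
  by rewrite sub0r normrN ger0_norm.
apply: (@squeeze_cvgr _ _ _ _ (fun t => expR (- ((q t)%:R * x t * (1 - x t)^-1)))
   (fun t => expR (- ((q t)%:R * x t)))).
- near=> t.
  have xt : x t <= 2^-1 by near: t.
  have x1' : 0 < 1 - x t by have := xt; lra.
  apply/andP; split.
    rewrite -mulrA -mulrN expRM_natl lerXn2r ?nnegrE ?expR_ge0 ?(ltW x1')//.
    rewrite expRN -[leRHS]invrK lef_pV2 ?posrE ?expR_gt0 ?invr_gt0//.
    apply: le_trans (expR_ge1Dx _); rewrite le_eqVlt; apply/orP; left; apply/eqP.
    by field; rewrite gt_eqF.
  rewrite -mulrN expRM_natl lerXn2r ?nnegrE ?expR_ge0 ?(ltW x1')//.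
  exact: expR_ge1Dx.
- apply: (@cvg_comp _ _ _ (fun t => - ((q t)%:R * x t * (1 - x t)^-1)) expR _ (nbhs (- c))); last exact: continuous_expR.
  apply: cvgN; have h1 : 1 - x t @[t --> +oo] --> (1 : R).
    by have := cvgB (cvg_cst (1 : R)) xcvg; rewrite subr0; apply.
  by have := cvgM qx (cvgV (oner_neq0 _) h1); rewrite invr1 mulr1; apply.
- by apply: (@cvg_comp _ _ _ (fun t => - ((q t)%:R * x t)) expR _ (nbhs (- c))); [exact: cvgN|exact: continuous_expR].
Unshelve. all: by end_near. Qed.

Lemma block_size_cvg {R : realType} (p : R -> R) (m : nat) : (forall y, 0 < p y <= 1) ->
  p t @[t --> +oo] --> (0 : R) -> (0 < m)%N ->
  (block_size p m t)%:R * p t @[t --> +oo] --> (m%:R^-1 : R).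
Proof.
move=> p01 pc m0.
apply: (@squeeze_cvgr _ _ _ _ (fun t => m%:R^-1 - p t) (fun=> m%:R^-1)); last exact: cvg_cst.
  by near=> t; have [h1 h2] := block_size_bounds p01 t m0; rewrite h1 h2.
by have := cvgB (cvg_cst (m%:R^-1 : R)) pc; rewrite subr0; apply.
Unshelve. all: by end_near. Qed.

Section laplace_power.
Context {R : realType}.
Variables (alpha Gam : R) (p phi : R -> R).
Hypothesis alpha0 : 0 < alpha.
Hypothesis p01 : forall y, 0 < p y <= 1.
Hypothesis rvp : regularly_varying p (- alpha).
Hypothesis p_cvg0 : p t @[t --> +oo] --> (0 : R).
Hypothesis phi0 : phi 0 = 1.
Hypothesis phi1 : forall s, 0 <= s -> phi s <= 1.
Hypothesis phi_asym : (1 - phi t^-1) / p t @[t --> +oo] --> Gam.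

Lemma laplace_power_cvg (m n : nat) : (0 < m)%N ->
  phi (n%:R / t) ^+ block_size p m t @[t --> +oo] --> expR (- (m%:R^-1 * Gam * n%:R `^ alpha)).
Proof.
move=> m0; case: n => [|n].
  rewrite powR0 ?gt_eqF// mulr0 oppr0 expR0; apply: cvg_near_cst.
  by near=> t; rewrite mul0r phi0 expr1n.
set N : R := n.+1%:R; have N0 : 0 < N by rewrite ltr0n.
have Ni : 0 < N^-1 by rewrite invr_gt0.
have scale : N^-1 * t @[t --> +oo] --> +oo by apply: gt0_cvgMry => //; exact: cvg_id.
have px y : p y != 0 by have /andP[h _] := p01 y; rewrite gt_eqF.
pose x (t : R) : R := Num.max 0 (1 - phi (N / t)).
have xE : \forall t \near +oo, x t = 1 - phi (N / t).
  near=> t; have t0 : 0 < t by near: t; exact: nbhs_pinfty_gt.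
  by rewrite /x max_r// subr_ge0 phi1// divr_ge0 ?(ltW N0) ?(ltW t0).
have c1 : (1 - phi (N / t)) / p (N^-1 * t) @[t --> +oo] --> Gam.
  have := cvg_comp _ _ scale phi_asym; apply: cvg_trans; apply: near_eq_cvg.
  by near=> t => /=; rewrite invfM invrK.
have c2 : p (N^-1 * t) @[t --> +oo] --> (0 : R) by exact: cvg_comp scale p_cvg0.
have c3 := regularly_varying_ratio rvp Ni.
have xcvg : x t @[t --> +oo] --> (0 : R).
  rewrite -(mulr0 Gam); apply: cvg_trans (cvgM c1 c2); apply: near_eq_cvg.
  by near=> t; rewrite (near xE)//= divfK.
have qx : (block_size p m t)%:R * x t @[t --> +oo] --> m%:R^-1 * Gam * N `^ alpha.
  have Na : N `^ alpha = N^-1 `^ (- alpha) by rewrite powR_inv// powRN invrK.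
  rewrite Na; apply: cvg_trans (cvgM (cvgM (block_size_cvg p01 p_cvg0 m0) c1) c3); apply: near_eq_cvg.
  by near=> t; rewrite (near xE)//=; field; rewrite !px.
have := exprn_laplace_cvg (fun t => (_ : 0 <= x t)) xcvg qx.
move=> /(_ ltac:(by move=> t; rewrite le_max lexx)); apply: cvg_trans; apply: near_eq_cvg.
by near=> t; rewrite (near xE)//= opprB addrC subrK.
Unshelve. all: by end_near. Qed.

End laplace_power.

Lemma cvg_monomial_sum {R : realType} {I : Type} (G : set_system I) {FG : Filter G} (B : nat)
    (s : seq (R * (nat -> nat))) (psi : I -> nat -> R) (psi' : nat -> R) :
  (forall n, psi t n @[t --> G] --> psi' n) ->
  \sum_(p <- s) p.1 * \prod_(i < B) psi t (p.2 i) @[t --> G] --> \sum_(p <- s) p.1 * \prod_(i < B) psi' (p.2 i).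
Proof.
move=> H.
have prod (n : nat -> nat) : \prod_(i < B) psi t (n i) @[t --> G] --> \prod_(i < B) psi' (n i).
  elim: B => [|B IH]; first by rewrite big_ord0; apply: cvg_near_cst; near=> t; rewrite big_ord0.
  rewrite big_ord_recr/=; apply: cvg_trans (cvgM IH (H (n B))); apply: near_eq_cvg.
  by near=> t; rewrite big_ord_recr.
elim: s => [|p s IH]; first by rewrite big_nil; apply: cvg_near_cst; near=> t; rewrite big_nil.
rewrite big_cons/=; apply: cvg_trans (cvgD (cvgM (cvg_cst p.1) (prod p.2)) IH); apply: near_eq_cvg.
by near=> t; rewrite big_cons.
Unshelve. all: by end_near. Qed.

Lemma walk_block {R : realType} d (T : measurableType d) (xi : nat -> T -> R) (j q : nat) (w : T) :
  walk xi (j.+1 * q)%N w - walk xi (j * q)%N w = \sum_(i < q) xi (j * q + i)%N w.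
Proof. by rewrite /walk mulSnr big_split_ord/= addrAC subrr add0r. Qed.

Lemma walk_blocks_sum {R : realType} d (T : measurableType d) (xi : nat -> T -> R) (j q : nat) (t : R) (w : T) :
  \sum_(i < j) (walk xi (i.+1 * q)%N w - walk xi (i * q)%N w) / t = walk xi (j * q)%N w / t.
Proof.
elim: j => [|j IH]; first by rewrite big_ord0 mul0n walk0 mul0r.
by rewrite big_ord_recr/= IH -mulrDl addrC subrK.
Qed.

Section assemble.
Context d (T : measurableType d) (R : realType) (P : probability T R).
Variable S : nat -> set (set T).
Hypothesis Ssig : forall k, sigma_algebra setT (S k).
Hypothesis Smeas : forall k A, S k A -> measurable A.
Hypothesis Sind : indep_sigma P S.
Variable xi : nat -> T -> R.
Hypothesis xiS : forall k, adapted (S k) (xi k).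
Hypothesis xi0 : forall k w, 0 <= xi k w.
Variables (p phi : R -> R) (alpha rho : R).
Hypothesis alpha0 : 0 < alpha.
Hypothesis alpha1 : alpha < 1.
Hypothesis rho_alpha : - alpha < rho.
Hypothesis p01 : forall y, 0 < p y <= 1.
Hypothesis rvp : regularly_varying p (- alpha).
Hypothesis p_cvg0 : p t @[t --> +oo] --> (0 : R).
Hypothesis phiE : forall k s, 0 <= s -> (\int[P]_w (expR (- (s * xi k w)))%:E = (phi s)%:E)%E.
Hypothesis phi_asym : (1 - phi t^-1) / p t @[t --> +oo] --> Gamma (1 - alpha).

(** Regroup the product step by step: a step in block [j] receives the exponent [n j / t], and
    independence of the steps factorises the integral. *)
Lemma block_laplace (B q : nat) (t : R) (n : nat -> nat) : 0 < t ->
  (\int[P]_w (\prod_(j < B) expR (- ((walk xi (j.+1 * q)%N w - walk xi (j * q)%N w) / t)) ^+ n j)%:E =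
   (\prod_(j < B) phi ((n j)%:R / t) ^+ q)%:E)%E.
Proof.
move=> t0.
pose V (k : nat) w := expR (- ((n (k %/ q)%N)%:R / t * xi k w)).
have intE w : \prod_(j < B) expR (- ((walk xi (j.+1 * q)%N w - walk xi (j * q)%N w) / t)) ^+ n j =
    \prod_(k < B * q) V k w.
  rewrite /V (big_blocks _ B q (fun j k => expR (- ((n j)%:R / t * xi k w)))); apply: eq_bigr => j _.
  rewrite -expR_sum sumrN -mulr_sumr -expRM_natl walk_block; congr expR.
  by rewrite mulrN; congr (- _); ring.
under eq_integral do rewrite intE.
rewrite (integral_prod_indep Ssig Smeas Sind).
- rewrite (eq_bigr (fun k : 'I_(B * q) => (phi ((n (k %/ q)%N)%:R / t))%:E)); last first.
    by move=> k _; rewrite phiE// divr_ge0// ltW.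
  rewrite (big_blocks _ B q (fun j _ => (phi ((n j)%:R / t))%:E)) -prodEFin.
  apply: eq_bigr => j _; rewrite -[in RHS](card_ord q) -prodr_const -prodEFin.
  by [].
- move=> k; apply: measurableT_comp; first exact: measurable_expR.
  by apply: measurable_funN; apply: measurable_funM => //; exact: (@xiS k).
- by move=> k w; exact: expR_ge0.
Qed.

Context d' (T' : measurableType d') (Q : probability T' R).
Variable W : T' -> R -> R.
Hypothesis HW : stable_subordinator Q alpha W.

Lemma skel_product (m B : nat) (n : nat -> nat) : (0 < m)%N ->
  (\int[Q]_w (\prod_(j < B) expR (- skel W m j w) ^+ n j)%:E =
   (\prod_(j < B) expR (- (m%:R^-1 * Gamma (1 - alpha) * (n j)%:R `^ alpha)))%:E)%E.
Proof.
move=> m0.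
have intE w : \prod_(j < B) expR (- skel W m j w) ^+ n j = \prod_(j < B) expR (- ((n j)%:R * skel W m j w)).
  by apply: eq_bigr => j _; rewrite -expRM_natl mulrN.
under eq_integral do rewrite intE.
rewrite (@integral_prod_indep _ _ _ Q _ (skel_sigma_algebra W m)
  (fun i A => @skel_sigma_measurable _ _ _ _ _ _ HW m i A) (skel_indep HW m0) B
  (fun j w => expR (- ((n j)%:R * skel W m j w)))).
- by rewrite -prodEFin; apply: eq_bigr => j _; rewrite (skel_laplace HW m0).
- move=> k; apply: measurableT_comp; first exact: measurable_expR.
  by apply: measurable_funN; apply: measurable_funM => //; exact: (@skel_adapted _ _ _ W m k).
- by move=> k w; exact: expR_ge0.
Qed.

Variable Y : R -> T -> R -> R.
Hypothesis HY : forall a b e : R, 0 < a -> a < b -> 0 < e -> exists C0 : nat, forall C, (C0 <= C)%N ->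
  exists i1, forall i0, (i1 <= i0)%N -> exists m0, forall m, (m0 <= m)%N -> (0 < m)%N ->
  \forall t \near +oo, exists A, [/\ measurable A, (P A <= e%:E)%E &
    forall w, ~ A w -> forall u, a <= u <= b ->
    `|Y t w u - block_path (kernel (b / 2 ^+ i0) b rho) m (C * m)%N
        (fun j => walk xi (j * block_size p m t)%N w / t) u| <= e].

(** On both sides the functional is replaced by the same polynomial in the exponentials of the block
    increments. Its expectation is the same combination of products of Laplace transforms, so
    convergence of these transforms is enough. *)
Lemma path_lip_approx : lip_approx P Y Q (fun w => J_ar rho (W w)).
Proof.
move=> a b L M e F a0 ab L0 lipF FM e0.
have b0 : 0 < b by exact: lt_trans ab.
have e20 : 0 < e / 2 by rewrite divr_gt0.
have L1 : 0 < L + 1 by rewrite ltr_wpDl.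
(* [e1] is the uniform error of the block paths, weighted by [L]; [e2] is the error of the
   polynomial, kept below [1] so that the bound [M + 1] survives. *)
pose e1 := Num.min e (e / 2 / (L + 1)); pose e2 := Num.min (e / 2) 1.
have e10 : 0 < e1 by rewrite lt_min e0 divr_gt0.
have e2p : 0 < e2 by rewrite lt_min e20 ltr01.
have e1e : e1 <= e by rewrite ge_min lexx.
have e2e : e2 <= e / 2 by rewrite ge_min lexx.
have e21 : e2 <= 1 by rewrite ge_min lexx orbT.
have Le1 : L * e1 <= e / 2.
  apply: (@le_trans _ _ ((L + 1) * e1)); first by rewrite ler_wpM2r ?(ltW e10)// lerDl.
  by rewrite mulrC -ler_pdivlMr// ge_min lexx orbT.
have eE : L * e1 + e2 <= e by rewrite [leRHS]splitr; exact: lerD.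
have [C1 HC1] := HY a0 ab e10.
have [C2 HC2] := limit_approx alpha0 alpha1 rho_alpha HW a0 ab e10.
pose C := maxn C1 C2.
have [i1 Hi1] := HC1 C (leq_maxl _ _); have [i2 Hi2] := HC2 C (leq_maxr _ _).
pose i0 := maxn i1 i2.
have [m1 Hm1] := Hi1 i0 (leq_maxl _ _); have [m2 Hm2] := Hi2 i0 (leq_maxr _ _).
pose m := (maxn m1 m2).+1; have m0 : (0 < m)%N by [].
have HP := Hm1 m (leqW (leq_maxl _ _)) m0.
have [A' [mA' PA' HA']] := Hm2 m (leqW (leq_maxr _ _)) m0.
move: HP HA'; set g := kernel _ _ _; set B := (C * m)%N => HP HA'.
have kap0 : 0 < b / 2 ^+ i0 by rewrite divr_gt0// exprn_gt0.
have kapb : b / 2 ^+ i0 <= b by rewrite ler_pdivrMr ?exprn_gt0// ler_peMr ?exprn_ege1 ?ler1n// ltW.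
have [Lg Lg0 gL] := kernel_lip rho kap0 kapb.
have gz := kernel_le0 rho kap0 kapb.
have K0 : 0 <= L * (m%:R^-1 * B%:R * Lg * expR b) by rewrite !mulr_ge0 ?invr_ge0 ?expR_ge0.
have [T0 [[s Ts] TH]] := lipschitz_polyfun_approx K0 e2p
  (fun z z' _ _ => @path_functional_lip _ a b L F g Lg m B lipF Lg0 gL z z').
have TF (y : nat -> R) : (forall i, 0 <= y i) ->
    `|F (block_path g m B (fun j => \sum_(i < j) y i)) - T0 (fun i => expR (- y i))| <= e2.
  move=> y0; rewrite distrC -(@path_functionalE _ a b L F g m B b0 lipF gz y y0); apply: TH => i _.
  by rewrite expR_ge0 -expR0 ler_expR oppr_le0 y0.
have TM (y : nat -> R) : (forall i, 0 <= y i) -> `|T0 (fun i => expR (- y i))| <= M + 1.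
  move=> y0; have := TF y y0; have := FM (block_path g m B (fun j => \sum_(i < j) y i)).
  set x1 := F _; set x2 := T0 _ => h1 h2; rewrite -(subrK x1 x2) addrC.
  apply: le_trans (ler_normD _ _) _; apply: lerD => //; rewrite distrC; exact: le_trans h2 e21.
have sk0 i w : 0 <= skel W m i w by exact: (skel_ge0 HW m0).
have mTZ d1 (U : measurableType d1) (Z : nat -> U -> R) : (forall i, measurable_fun setT (Z i)) ->
    measurable_fun setT (fun w => T0 (fun i => Z i w)).
  move=> mZ; under eq_fun do rewrite Ts.
  apply: measurable_sum => q; apply: measurable_funM => //.
  by apply: measurable_prod => i _; apply: measurable_funX; exact: mZ.
pose G' w := T0 (fun i => expR (- skel W m i w)).
exists G'; split.
- split.
    apply: mTZ => i; apply: measurableT_comp; first exact: measurable_expR.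
    by apply: measurable_funN; exact: (measurable_skel HW).
  exists A'; split => //; split; first by apply: le_trans PA' _; rewrite lee_fin.
  move=> w nA; apply: le_trans eE.
  have h := TF (fun i => skel W m i w) (fun i => sk0 i w).
  apply: le_trans (ler_distD (F (block_path g m B (fun j => \sum_(i < j) skel W m i w))) _ _) _.
  apply: lerD h; apply: lipF; first exact: ltW.
  move=> u aub; have := HA' w nA u aub; rewrite /block_path.
  by under [X in `|_ - _ * X| <= _ -> _]eq_bigr do rewrite -(skel_walk HW).
- by move=> w; apply: TM.
pose psi t (n : nat) := phi (n%:R / t) ^+ block_size p m t.
pose psi' (n : nat) := expR (- (m%:R^-1 * Gamma (1 - alpha) * n%:R `^ alpha)).
have phi0 : phi 0 = 1.
  have := phiE 0%N (lexx 0); under eq_integral do rewrite mul0r oppr0 expR0.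
  by rewrite integral_prob_cst => -[].
have phi1 x : 0 <= x -> phi x <= 1.
  move=> x0; rewrite -lee_fin -(phiE 0%N x0) -(@integral_prob_cst _ _ _ P 1).
  by apply: le_integral_all => w; rewrite lee_fin -expR0 ler_expR oppr_le0 mulr_ge0.
have Ecvg : \sum_(q <- s) q.1 * \prod_(i < B) psi t (q.2 i) @[t --> +oo] -->
    \sum_(q <- s) q.1 * \prod_(i < B) psi' (q.2 i).
  apply: cvg_monomial_sum => n.
  exact (@laplace_power_cvg _ _ _ _ _ alpha0 p01 rvp p_cvg0 phi0 phi1 phi_asym m n m0).
have ExG' : Ex Q G' = \sum_(q <- s) q.1 * \prod_(i < B) psi' (q.2 i).
  rewrite /G'; under [X in Ex _ X]eq_fun do rewrite Ts.
  apply: (@Ex_polyfun _ _ _ Q B s (fun i w => expR (- skel W m i w)) psi').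
  - move=> i; apply: measurableT_comp; first exact: measurable_expR.
    by apply: measurable_funN; exact: (measurable_skel HW).
  - by move=> i w; rewrite expR_ge0 -expR0 ler_expR oppr_le0 sk0.
  - by move=> n; exact: skel_product.
near=> t.
have t0 : 0 < t by near: t; exact: nbhs_pinfty_gt.
pose q := block_size p m t.
pose y i w := (walk xi (i.+1 * q)%N w - walk xi (i * q)%N w) / t.
have y0 i w : 0 <= y i w.
  by rewrite /y walk_block divr_ge0 ?(ltW t0)// sumr_ge0.
have my i : measurable_fun setT (fun w => expR (- y i w)).
  apply: measurableT_comp; first exact: measurable_expR.
  apply: measurable_funN; apply: measurable_funM => //.
  by apply: measurable_funB; exact: (@measurable_walk _ _ _ _ Smeas _ xiS).
exists (fun w => T0 (fun i => expR (- y i w))); split.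
- split; first exact: (mTZ _ _ (fun i w => expR (- y i w))).
  have [A [mA PA HA]] : exists A, [/\ measurable A, (P A <= e1%:E)%E &
    forall w, ~ A w -> forall u, a <= u <= b ->
    `|Y t w u - block_path g m B (fun j => walk xi (j * block_size p m t)%N w / t) u| <= e1].
    by near: t.
  exists A; split => //; split; first by apply: le_trans PA _; rewrite lee_fin.
  move=> w nA; apply: le_trans eE.
  have h := TF (fun i => y i w) (fun i => y0 i w).
  apply: le_trans (ler_distD (F (block_path g m B (fun j => \sum_(i < j) y i w))) _ _) _.
  apply: lerD h; apply: lipF; first exact: ltW.
  move=> u aub; have := HA w nA u aub; rewrite /block_path.
  by under [X in `|_ - _ * X| <= _ -> _]eq_bigr do rewrite -walk_blocks_sum.
- by move=> w; apply: TM.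
- have -> : Ex P (fun w => T0 (fun i => expR (- y i w))) = \sum_(q <- s) q.1 * \prod_(i < B) psi t (q.2 i).
    under [X in Ex _ X]eq_fun do rewrite Ts.
    apply: (@Ex_polyfun _ _ _ P B s (fun i w => expR (- y i w)) (psi t)) => //.
    + by move=> i w; rewrite expR_ge0 -expR0 ler_expR oppr_le0 y0.
    + by move=> n; exact: block_laplace.
  rewrite ExG' distrC; near: t.
  by move/cvgrPdist_le : Ecvg; apply.
Unshelve. all: by end_near. Qed.

End assemble.

(** * Independent copies of the pair *)

Section cadlag_paths.
Context {R : realType}.
Implicit Types f g : R -> R.

Lemma cadlag_pos_scale f (t : R) : 0 < t -> cadlag_pos f -> cadlag_pos (fun u => f (u * t)).
Proof.
move=> t0 [fr fl].
have tr (x : R) (r : R) z : `|x - z| < r / t -> `|x * t - z * t| < r.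
  by rewrite -mulrBl normrM (gtr0_norm t0) ltr_pdivlMr.
split=> x x0.
  apply/cvgrPdist_le => e e0; have /cvgrPdist_le/(_ e e0) := fr _ (mulr_gt0 x0 t0).
  rewrite !near_withinE => -[r /= r0 hr]; exists (r / t); first exact: divr_gt0.
  by move=> z /= /tr zr xz; apply: hr => //=; rewrite ltr_pM2r.
have [l fl'] := fl _ (mulr_gt0 x0 t0); exists l.
apply/cvgrPdist_le => e e0; have /cvgrPdist_le/(_ e e0) := fl'.
rewrite !near_withinE => -[r /= r0 hr]; exists (r / t); first exact: divr_gt0.
by move=> z /= /tr zr xz; apply: hr => //=; rewrite ltr_pM2r.
Qed.

Lemma cadlag_pos_shift0 f (y : R) : 0 <= y -> cadlag0 f -> cadlag_pos (shift0 f y).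
Proof.
move=> y0 [fr fl]; split => x x0.
  by apply: shift0_right_continuous => //; exact: ltW.
have [xy|yx] := leP x y.
  exists 0; apply: cvg_near_cst; near=> z; rewrite /shift0 (_ : y <= z = false)//; apply/negbTE.
  by rewrite -ltNge; apply: lt_le_trans xy; near: z; exact: nbhs_left_lt.
have xy0 : 0 < x - y by rewrite subr_gt0.
have [l fl'] := fl _ xy0; exists l.
have h : f (z - y) @[z --> x^'-] --> l.
  apply/cvgrPdist_le => e e0; have /cvgrPdist_le/(_ e e0) := fl'.
  rewrite !near_withinE => -[r /= r0 hr]; exists r => //= z /= zr sz; apply: hr => /=.
    by rewrite opprB addrA subrK.
  by rewrite ltrD2r.
apply: cvg_trans h; apply: near_eq_cvg; near=> z; rewrite /shift0 (_ : y <= z = true)//.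
by apply: ltW; near: z; exact: nbhs_left_gt.
Unshelve. all: by end_near. Qed.

Lemma cadlag_posM (c : R) f : cadlag_pos f -> cadlag_pos (fun u => c * f u).
Proof.
move=> [fr fl]; split => x x0; first by apply: cvgM; [exact: cvg_cst|exact: fr].
by have [l hl] := fl _ x0; exists (c * l); apply: cvgM => //; exact: cvg_cst.
Qed.

Lemma cadlag_pos_sum (n : nat) (g : nat -> R -> R) : (forall k, cadlag_pos (g k)) ->
  cadlag_pos (fun u => \sum_(k < n) g k u).
Proof.
move=> H; split => x x0; first exact: (@cvg_sum_ord R R _ _ n g (fun k => g k x) (fun k => (H k).1 x x0)).
have /choice[l hl] : forall k, exists l : R, g k z @[z --> x^'-] --> l.
  by move=> k; have [_ /(_ _ x0)] := H k.
by exists (\sum_(k < n) l k); exact: (@cvg_sum_ord R R _ _ n g l hl).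
Qed.

Lemma cadlag_pos_local f : (forall b : R, 0 < b -> exists2 g, cadlag_pos g & forall u, u < b -> f u = g u) ->
  cadlag_pos f.
Proof.
move=> H; split => x x0; have [g [gr gl] fg] := H (x + 1) ltac:(by rewrite addr_gt0).
  rewrite fg ?ltrDl//; apply: cvg_trans (gr x x0); apply: near_eq_cvg; near=> z.
  by rewrite fg//; near: z; apply: nbhs_right_lt; rewrite ltrDl.
have [l hl] := gl x x0; exists l; apply: cvg_trans hl; apply: near_eq_cvg; near=> z.
rewrite fg//; apply: (@lt_trans _ _ x); last by rewrite ltrDl.
by near: z; exact: nbhs_left_lt.
Unshelve. all: by end_near. Qed.

End cadlag_paths.

(** * From the moment hypotheses to power bounds *)

Section moments.
Context d (T : measurableType d) (R : realType) (P : probability T R).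
Variable V : T -> R -> R.
Hypothesis mV : forall s, measurable_fun setT (V ^~ s).

(** Pointwise, [|x|^j <= c^j + c^(j - 2l) x^(2l)], by separating [|x| <= c] from [|x| > c]; this
    yields moments of every order up to [2 l] from the even one, odd orders included. *)
Lemma moment_interpolation (s c D C : R) (l j : nat) : 0 < c -> 0 <= C -> 0 <= D -> (j <= 2 * l)%N ->
  (\int[P]_w ((V w s) ^+ (2 * l))%:E <= (C * (D * c ^+ 2) ^+ l)%:E)%E ->
  (\int[P]_w (`|V w s| ^+ j)%:E <= ((1 + C * D ^+ l) * c ^+ j)%:E)%E.
Proof.
move=> c0 C0 D0 jl H.
have cn : c != 0 by rewrite gt_eqF.
have even x : x ^+ (2 * l) = `|x| ^+ (2 * l) :> R.
  by rewrite !exprM -normrX ger0_norm// sqr_ge0.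
have ge x : 0 <= x ^+ (2 * l) :> R by rewrite even exprn_ge0.
have pw x : `|x| ^+ j <= c ^+ j + c ^+ j / c ^+ (2 * l) * x ^+ (2 * l) :> R.
  have [h|h] := leP `|x| c.
    apply: (@le_trans _ _ (c ^+ j)); first by rewrite lerXn2r ?nnegrE// ltW.
    by rewrite lerDl mulr_ge0// divr_ge0 ?exprn_ge0// ltW.
  apply: (@le_trans _ _ (c ^+ j / c ^+ (2 * l) * x ^+ (2 * l))); last by rewrite lerDr exprn_ge0// ltW.
  apply: (@le_trans _ _ (c ^+ j * (`|x| / c) ^+ j)); first by rewrite expr_div_n mulrC divfK ?expf_neq0.
  rewrite (even x) -mulrA [X in _ <= _ * X]mulrC -expr_div_n ler_wpM2l ?exprn_ge0 ?(ltW c0)//.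
  by rewrite ler_weXn2l// ler_pdivlMr// mul1r ltW.
have mX : measurable_fun setT (fun w => ((V w s) ^+ (2 * l))%:E).
  by apply/measurable_EFinP; apply: measurable_funX; exact: mV.
apply: le_trans (le_integral_all _ (fun w => (_ : _ <= (c ^+ j)%:E + (c ^+ j / c ^+ (2 * l))%:E * ((V w s) ^+ (2 * l))%:E)%E)) _.
  by move=> w; rewrite -EFinM -EFinD lee_fin; exact: pw.
have cc : 0 <= c ^+ j / c ^+ (2 * l) by rewrite divr_ge0 ?exprn_ge0// ltW.
rewrite ge0_integralD//; last 3 first.
- by move=> w _; rewrite lee_fin exprn_ge0// ltW.
- by move=> w _; rewrite -EFinM lee_fin mulr_ge0.
- by apply: emeasurable_funM => //; exact: measurable_cst.
rewrite integral_prob_cst ge0_integralZl//; last by move=> w _; rewrite lee_fin.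
apply: le_trans (leeD2l _ (lee_wpmul2l _ H)) _; first by rewrite lee_fin.
rewrite -EFinM -EFinD lee_fin le_eqVlt; apply/orP; left; apply/eqP.
rewrite exprMn -exprM mulrDl mul1r; congr (_ + _).
by field; rewrite expf_neq0.
Qed.

Lemma centered_max (s : R) : P.-integrable setT (fun w => (V w s)%:E) -> (\int[P]_w (V w s)%:E = 0)%E ->
  (\int[P]_w (Num.max (V w s) 0)%:E = \int[P]_w (Num.max (- V w s) 0)%:E)%E.
Proof.
move=> iV; rewrite integralE => H.
have ip := integrable_funepos measurableT iV; have im := integrable_funeneg measurableT iV.
have fp := integrable_fin_num measurableT ip; have fm := integrable_fin_num measurableT im.
have -> : (\int[P]_w (Num.max (V w s) 0)%:E = \int[P]_w ((fun w => (V w s)%:E) ^\+)%E w)%E.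
  by apply: eq_integral => w _; rewrite funeposE EFin_max.
have -> : (\int[P]_w (Num.max (- V w s) 0)%:E = \int[P]_w ((fun w => (V w s)%:E) ^\-)%E w)%E.
  by apply: eq_integral => w _; rewrite funenegE EFin_max.
by move: H; rewrite -(fineK fp) -(fineK fm) -EFinB => -[/eqP]; rewrite subr_eq0 => /eqP ->.
Qed.

Variables (delta beta : R) (v : R -> R).
Hypothesis delta0 : 0 < delta.
Hypothesis vE : forall s, v s = fine (\int[P]_w ((V w s) ^+ 2)%:E)%E.
Hypothesis rvv : regularly_varying v beta.
Hypothesis HV : forall l : nat, (0 < l)%N -> exists C a : R, [/\ 0 < C,
  (forall s, 0 <= s -> (\int[P]_w ((V w s) ^+ (2 * l))%:E <= (C * v s ^+ l)%:E)%E) &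
  forall t, 0 < t -> (\int[P]_w ereal_sup (osc_set l delta (V w) t) <= (C * t `^ a)%:E)%E].

(** Regular variation controls [v] from some [s0] on; on [[0, s0]] the oscillation hypothesis of
    order [2] bounds it through the local moments. *)
Lemma variance_bound (beta' : R) : beta < beta' -> exists2 D : R, 0 <= D & forall s, 0 <= s -> 0 <= v s <= D * (1 + s) `^ beta'.
Proof.
move=> bb; have bb0 : 0 < beta' - beta by rewrite subr_gt0.
have v0 s : 0 <= v s.
  by rewrite vE fine_ge0//; apply: integral_ge0 => w _; rewrite lee_fin sqr_ge0.
have [C [s0 [C0 s01 HC]]] := regularly_varying_potter_ub rvv bb0.
rewrite addrC subrK in HC.
have s00 : 0 < s0 by exact: lt_le_trans s01.
have [C2 [a [C20 _ H2]]] := @HV 2 isT.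
have [B HB] := local_moment delta0 C20 mV H2 s0.
have [D D0 [H1 H3]] := powr_shift_bounded beta' s00.
exists ((C + `|B|) * D) => [|s sge]; first by rewrite mulr_ge0 ?addr_ge0// ltW.
rewrite v0/=.
have q0 : 0 <= D * (1 + s) `^ beta' by rewrite mulr_ge0 ?powR_ge0// ltW.
rewrite -mulrA mulrDl; have [ss|ss] := leP s0 s.
  have /andP[_ h] := HC s ss; apply: le_trans h _; apply: le_trans (_ : C * (D * (1 + s) `^ beta') <= _).
    by rewrite ler_pM2l// H1.
  by rewrite lerDl mulr_ge0.
apply: (@le_trans _ _ `|B|); last first.
  apply: le_trans (_ : `|B| * (D * (1 + s) `^ beta') <= _); last by rewrite lerDr mulr_ge0// ltW.
  by rewrite ler_peMr// H3// sge ltW.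
have := HB s; rewrite sge (ltW ss) => /(_ isT) h.
rewrite vE; have h' : (\int[P]_w ((V w s) ^+ 2)%:E <= B%:E)%E.
  by apply: le_trans h; rewrite le_eqVlt; apply/orP; left; apply/eqP; apply: eq_integral => w _; rewrite real_normK// num_real.
have h0 : (0 <= \int[P]_w ((V w s) ^+ 2)%:E)%E by apply: integral_ge0 => w _; rewrite lee_fin sqr_ge0.
apply: le_trans (ler_norm B); case: (\int[P]_w _)%E h' h0 => [x| |]//.
Qed.

Lemma path_moments (beta' : R) (l : nat) : beta < beta' -> (0 < l)%N -> exists2 A : R, 0 <= A & forall s j,
  (2 <= j <= 2 * l)%N -> 0 <= s ->
  (\int[P]_w (`|V w s| ^+ j)%:E <= (A * (1 + s) `^ (j%:R * (beta' / 2)))%:E)%E.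
Proof.
move=> bb l0; have [D D0 HD] := variance_bound bb.
have [C [_ [C0 HC _]]] := HV l0.
exists (1 + C * D ^+ l) => [|s j /andP[_ jl] s0]; first by rewrite addr_ge0// mulr_ge0 ?exprn_ge0// ltW.
have s1 : 0 < 1 + s by rewrite ltr_pwDl.
pose c := (1 + s) `^ (beta' / 2).
have c0 : 0 < c by rewrite powR_gt0.
have cj k : c ^+ k = (1 + s) `^ (k%:R * (beta' / 2)).
  by rewrite -powR_mulrn ?(ltW c0)// -powRrM mulrC.
rewrite -cj; apply: moment_interpolation => //; first exact: ltW.
apply: le_trans (HC s s0) _; rewrite lee_fin ler_pM2l//.
have /andP[v0 v1] := HD s s0; rewrite lerXn2r ?nnegrE ?mulr_ge0 ?exprn_ge0 ?(ltW c0)//.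
by rewrite cj mulrCA divff ?mulr1.
Qed.

End moments.

Lemma walk_unbounded d (T : measurableType d) (R : realType) (P : probability T R) (S : nat -> set (set T))
    (xi : nat -> T -> R) (p : R -> R) :
  (forall k, sigma_algebra setT (S k)) -> (forall k A, S k A -> measurable A) -> indep_sigma P S ->
  (forall k, adapted (S k) (xi k)) -> (forall y, 0 < p y) ->
  (forall y i, 0 < y -> (\int[P]_w (expR (- (y^-1 * xi i w)))%:E <= (expR (- (p y / 2)))%:E)%E) ->
  exists A, [/\ measurable A, P A = 0%E & forall w, ~ A w -> forall y, exists n, y < walk xi n w].
Proof.
move=> Ssig Smeas Sind xiS p0 Hl.
have tl (y n : nat) := @walk_lower_tail _ _ _ P S Ssig Smeas Sind xi xiS n y.+1%:R _ (ltr0Sn R y)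
  (expR_ge0 _) (fun i => Hl y.+1%:R i (ltr0Sn R y)).
pose A (y : nat) := \bigcap_n [set w | walk xi n w <= y.+1%:R].
have mA y : measurable (A y) by apply: bigcapT_measurable => n; exact: (tl y n).1.
have PA y : P (A y) = 0%E.
  apply/eqP; rewrite eq_le measure_ge0 andbT; apply/lee_addgt0Pr => e e0; rewrite add0e.
  have c0 : 0 < p y.+1%:R / 2 by rewrite divr_gt0.
  have [n H] := exp_large c0 e0.
  apply: le_trans (_ : P [set w | (walk xi n w <= y.+1%:R)%R] <= _)%E.
    by apply: le_measure; rewrite ?inE//; [exact: (tl y n).1|move=> w /(_ n I)].
  apply: le_trans (tl y n).2 _; rewrite lee_fin -expRM_natr mulNr; exact: H.
exists (\bigcup_y A y); split; [exact: bigcupT_measurable|exact: prob_bigcup0|].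
move=> w nA y; have : ~ A (Num.truncn y) w by move=> h; apply: nA; exists (Num.truncn y).
move=> /existsNP[n] /not_implyP[_] /= /negP; rewrite -ltNge => h; exists n.
by apply: le_lt_trans h; exact/ltW/truncnS_gt.
Qed.

Section iid_pairs.
Context (R : realType) d (Om : measurableType d) (P : probability Om R).
Variables (X : nat -> Om -> R -> R) (xi : nat -> Om -> R).
Hypothesis mX : forall k t, measurable_fun [set: Om] (fun w => X k w t).
Hypothesis mxi : forall k, measurable_fun [set: Om] (xi k).

Lemma pair_sigma_algebra k : sigma_algebra setT (pair_sigma X xi k).
Proof. exact: smallest_sigma_algebra. Qed.

Lemma pair_sigma_measurable k A : pair_sigma X xi k A -> measurable A.
Proof.
apply: sigma_measurable => _ [[t [B [mB ->]]]|[B [mB ->]]].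
  by have := @mX k t measurableT B mB; rewrite setTI.
by have := @mxi k measurableT B mB; rewrite setTI.
Qed.

Lemma pair_sigma_path k (t c : R) : adapted (pair_sigma X xi k) (fun w => X k w t - c).
Proof.
apply: adaptedP => B mB; apply: sub_sigma_algebra; apply: sub_sigma_algebra; left.
exists t, ((fun x => x - c) @^-1` B); split => //.
have mf : measurable_fun setT (fun x : R => x - c) by apply: measurable_funB => //; exact: measurable_cst.
by rewrite -[Z in measurable Z]setTI; exact: (mf measurableT B mB).
Qed.

Lemma pair_sigma_step k : adapted (pair_sigma X xi k) (fun w => Num.max (xi k w) 0).
Proof.
apply: adaptedP => B mB; apply: sub_sigma_algebra; apply: sub_sigma_algebra; right.
exists ((fun x => Num.max x 0) @^-1` B); split => //.
have mf : measurable_fun setT (fun x : R => Num.max x 0) by apply: measurable_maxr => //; exact: measurable_cst.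
by rewrite -[Z in measurable Z]setTI; exact: (mf measurableT B mB).
Qed.

Hypothesis same : forall k, same_law_pair P X xi k.

(** Bounds known for the pair of index [0] are carried to every [k], for functionals measurable with
    respect to cylinders. *)
Lemma same_law_path k (h : R -> R) (F : @path_space R -> \bar R) :
  measurable_fun setT F -> (forall x, 0 <= F x)%E ->
  (\int[P]_w F (fun s => (X k w s - h s)%R) = \int[P]_w F (fun s => (X 0%N w s - h s)%R))%E.
Proof.
move=> mF F0.
have mV j t : measurable_fun setT (fun w => X j w t - h t).
  by apply: measurable_funB => //; exact: mX.
apply: (@law_transfer _ _ _ P (fun w s => X k w s - h s) (fun w s => X 0%N w s - h s)) => //.
move=> n ts Bs mBs.
have mB' i : measurable ((fun x => x - h (ts i)) @^-1` Bs i).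
  have mf : measurable_fun setT (fun x : R => x - h (ts i)) by apply: measurable_funB => //; exact: measurable_cst.
  by rewrite -[Z in measurable Z]setTI; exact: (mf measurableT _ (mBs i)).
have setE j : [set w | forall i, Bs i (X j w (ts i) - h (ts i))] =
    [set w | setT (xi j w) /\ forall i, ((fun x => x - h (ts i)) @^-1` Bs i) (X j w (ts i))].
  by apply/seteqP; split => w //= [].
by rewrite !setE; exact (@same k n ts _ setT mB' measurableT).
Qed.

Lemma same_law_step k (F : R -> R) : measurable_fun setT F -> (forall x, 0 <= F x) ->
  (\int[P]_w (F (xi k w))%:E = \int[P]_w (F (xi 0%N w))%:E)%E.
Proof.
move=> mF F0.
apply: (@law_transfer _ _ _ P (fun w _ => xi k w) (fun w _ => xi 0%N w) (fun f => (F (f 0))%:E)).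
- by move=> t; exact: mxi.
- by move=> t; exact: mxi.
- move=> n ts Bs mBs.
  have setE j : [set w | forall i, Bs i (xi j w)] =
      [set w | (\bigcap_(i in [set: 'I_n]) Bs i) (xi j w) /\
         forall i : 'I_0, (fun=> setT) i (X j w ((fun=> 0) i))].
    apply/seteqP; split => w /=; first by move=> H; split => // i _; exact: H.
    by move=> [H _] i; exact: H.
  have mcap : measurable (\bigcap_(i in [set: 'I_n]) Bs i).
    by apply: fin_bigcap_measurable => [|i _]; [exact: finite_finset|exact: mBs].
  rewrite !setE.
  exact (@same k 0%N (fun=> 0) (fun=> setT) (\bigcap_(i in [set: 'I_n]) Bs i) (fun=> measurableT) mcap).
- by apply/measurable_EFinP; apply: measurableT_comp => //; exact: measurable_eval.
- by move=> x; rewrite lee_fin.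
Qed.

End iid_pairs.

Theorem theorem1p1 (R : realType) (d : measure_display) (Om : measurableType d)
  (P : probability Om R)
  (* X k = X_{k+1}, xi k = xi_{k+1} : i.i.d. copies of the pair (X, xi) *)
  (X : nat -> Om -> R -> R) (xi : nat -> Om -> R)
  (alpha rho beta : R) :
  (forall k t, measurable_fun [set: Om] (fun w => X k w t)) ->
  (forall k, measurable_fun [set: Om] (xi k)) ->
  (forall k w, cadlag0 (X k w)) ->
  (forall k, P [set w | xi k w <= 0] = 0%E) ->
  indep_pairs P X xi ->
  (forall k, same_law_pair P X xi k) ->
  let h := fun t => fine (\int[P]_w (X 0%N w t)%:E)%E in
  let v := fun t => fine (\int[P]_w ((X 0%N w t - h t) ^+ 2)%:E)%E in
  let Xhat := fun w t => X 0%N w t - h t in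
  let tailxi := fun t => fine (P [set w | t < xi 0%N w]) in
  (forall t : R, 0 <= t -> forall l : nat,
      P.-integrable [set: Om] (fun w => (`|X 0%N w t| ^+ l)%:E)) ->
  cadlag0 h ->
  (* (A1) *)
  0 < alpha -> alpha < 1 ->
  (exists l_xi : R -> R, slowly_varying l_xi /\
     asym_equiv tailxi (fun t => t `^ (- alpha) * l_xi t)) ->
  (* (A2) *)
  - alpha < rho ->
  (exists l_h : R -> R, slowly_varying l_h /\
     asym_equiv h (fun t => t `^ rho * l_h t)) ->
  (* (A3) *)
  - alpha < beta -> beta < alpha + 2 * rho ->
  (exists l_v : R -> R, slowly_varying l_v /\
     asym_equiv v (fun t => t `^ beta * l_v t)) ->
  (* (A4) *)
  (exists delta : R, 0 < delta /\
     forall l : nat, (0 < l)%N ->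
     exists C : R, 0 < C /\ exists eps : R, 0 < eps /\
       (forall t : R, 0 <= t ->
          (\int[P]_w ((Xhat w t) ^+ (2 * l))%:E <= (C * v t ^+ l)%:E)%E) /\
       (forall t : R, 0 < t ->
          (\int[P]_w ereal_sup
              [set ((`|Xhat w t - (if y <= t then Xhat w (t - y) else 0)|
                      ^+ l)%R%:E) | y in `[0%R, delta[%classic]
           <= (C * t `^ (l%:R * (rho - eps)))%:E)%E)) ->
  (* conclusion: for any alpha-stable subordinator W *)
  forall (d' : measure_display) (Om' : measurableType d')
    (Q : probability Om' R) (W : Om' -> R -> R),
  stable_subordinator Q alpha W ->
  let S := fun (k : nat) w => \sum_(i < k) xi i w in
  let Y := fun (t : R) w (u : R) =>
    tailxi t / h t *
    limn (fun n => \sum_(k < n)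
            (if S k w <= u * t then X k w (u * t - S k w) else 0)) in
  weak_cvg_D P Y Q (fun w' u => J_ar rho (W w') u).
Proof.
move=> mX mxi cX xipos indep same h v Xhat tailxi intX ch alpha0 alpha1 [lxi [slxi eqxi]] rho_alpha.
move=> [lh [slh eqh]] beta_lo beta_lt [lv [slv eqv]] [delta [delta0 HA4]] d' Om' Q W HW S Y.
have rvp0 := asym_equiv_regularly_varying slxi eqxi.
have rvh := asym_equiv_regularly_varying slh eqh.
have rvv := asym_equiv_regularly_varying slv eqv.
(* An exponent strictly above [beta], to absorb the slowly varying factor of [v], still below the
   critical value. *)
have [beta' beta'lo beta'hi] : exists2 b', beta < b' & b' < alpha + 2 * rho.
  by exists ((beta + (alpha + 2 * rho)) / 2); rewrite ?midf_lt.
(* The order [l = 1] of the oscillation hypothesis supplies the gain [eps] for the mean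
   oscillation. *)
have [C1 [C10 [eps [eps0 [_ Hosc1]]]]] := HA4 1%N isT.
pose p := tail P (xi 0%N).
have rvp : regularly_varying p (- alpha) by exact: rvp0.
have p01 y : 0 < p y <= 1.
  by rewrite (tail_gt0 (mxi 0%N) rvp) (tail_le1 _ (mxi 0%N)).
have pdec y z : y <= z -> p z <= p y by exact: (tail_nonincreasing _ (mxi 0%N)).
have p_cvg0 : p t @[t --> +oo] --> (0 : R) by exact (tail_cvg0 alpha0 rvp).
pose Sg := pair_sigma X xi.
have Ssig k : sigma_algebra setT (Sg k) by exact: pair_sigma_algebra.
have Smeas k A : Sg k A -> measurable A by exact: pair_sigma_measurable.
have Sind : indep_sigma P Sg by exact: indep.
(* Steps are positive only almost surely; their positive parts give a walk that is monotone
   everywhere and equals the original one off the null set [N0]. *)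
pose xi' k w := Num.max (xi k w) 0.
have xiS k : adapted (Sg k) (xi' k) by exact: pair_sigma_step.
have xi0 k w : 0 <= xi' k w by rewrite le_max lexx orbT.
pose N0 := \bigcup_k [set w | xi k w <= 0].
have mneg k : measurable [set w | xi k w <= 0].
  rewrite -[Z in measurable Z]setTI (_ : [set w | _] = xi k @^-1` `]-oo, 0]%classic).
    exact: (mxi k measurableT _ (measurable_itv _)).
  by apply/seteqP; split => w /=; rewrite in_itv.
have mN0 : measurable N0 by exact: bigcupT_measurable.
have PN0 : P N0 = 0%E by exact: prob_bigcup0.
have xiN w k : ~ N0 w -> 0 < xi k w.
  by move=> nw; rewrite ltNge; apply/negP => hk; apply: nw; exists k.
have xi'E w k : ~ N0 w -> xi' k w = xi k w by move=> nw; rewrite /xi' max_l// ltW// xiN.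
have xiN0 w : ~ N0 w -> forall k, 0 < xi' k w by move=> nw k; rewrite xi'E// xiN.
pose phi := laplace P (xi 0%N).
have phiE k s : 0 <= s -> (\int[P]_w (expR (- (s * xi' k w)))%:E = (phi s)%:E)%E.
  move=> s0; rewrite -(integral_expE (mxi k) (xipos k) s0).
  rewrite (@same_law_step _ _ _ P X xi mxi same k (fun x => expR (- (s * x)))).
  - exact: (laplace_fin (mxi 0%N) (xipos 0%N)).
  - apply: measurableT_comp; first exact: measurable_expR.
    by apply: measurable_funN; apply: measurable_funM => //; exact: measurable_cst.
  - by move=> x; exact: expR_ge0.
have Hl y i : 0 < y -> (\int[P]_w (expR (- (y^-1 * xi' i w)))%:E <= (expR (- (p y / 2)))%:E)%E.
  move=> y0; rewrite phiE ?invr_ge0 ?(ltW y0)// lee_fin.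
  (* The linear bound [1 - p y / 2] is put in exponential form for the window estimates. *)
  apply: le_trans (laplace_tail_le (mxi 0%N) (xipos 0%N) y0) _; exact: expR_ge1Dx.
have phi_asym : (1 - phi t^-1) / p t @[t --> +oo] --> Gamma (1 - alpha).
  exact (laplace_asymptotics (mxi 0%N) (xipos 0%N) alpha0 alpha1 rvp).
pose V k w s := X k w s - h s.
have aV k s : adapted (Sg k) (V k ^~ s) by exact: pair_sigma_path.
have cV k w s : 0 <= s -> V k w y @[y --> s^'+] --> V k w s.
  by move=> s0; apply: cvgB; [exact: (cX k w).1|exact: ch.1].
have mV k s : measurable_fun setT (V k ^~ s).
  by apply: measurable_funB => //; exact: mX.
have law k F := @same_law_path _ _ _ P X xi mX same k h F.
have HV l : (0 < l)%N -> exists C a : R, [/\ 0 < C,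
    (forall s, 0 <= s -> (\int[P]_w ((V 0%N w s) ^+ (2 * l))%:E <= (C * v s ^+ l)%:E)%E) &
    forall t, 0 < t -> (\int[P]_w ereal_sup (osc_set l delta (V 0%N w) t) <= (C * t `^ a)%:E)%E].
  move=> l0; have [C [C0 [ep [ep0 [h1 h2]]]]] := HA4 l l0.
  by exists C, (l%:R * (rho - ep)).
have V_centered k s : 0 <= s ->
    (\int[P]_w (Num.max (V k w s) 0)%:E = \int[P]_w (Num.max (- V k w s) 0)%:E)%E.
  move=> s0.
  have mmax (g : R -> R) : measurable_fun setT g ->
      measurable_fun [set: @path_space R] (fun f : @path_space R => (Num.max (g (f s)) 0)%:E).
    move=> mg; apply/measurable_EFinP; apply: measurable_maxr => //.
    by apply: measurableT_comp => //; exact: measurable_eval.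
  have pmax (g : R -> R) (f : @path_space R) : (0 <= (Num.max (g (f s)) 0)%:E)%E.
    by rewrite lee_fin le_max lexx orbT.
  have mid : measurable_fun setT (fun x : R => x) by exact: measurable_id.
  have mopp : measurable_fun setT (fun x : R => - x) by exact: measurable_funN.
  rewrite (law k _ (mmax _ mid) (pmax _)) (law k _ (mmax _ mopp) (pmax _)).
  have iX : P.-integrable setT (fun w => (X 0%N w s)%:E).
    apply/integrableP; split; first exact/measurable_EFinP.
    have /integrableP[_] := intX s s0 1%N.
    by under eq_integral do rewrite expr1 /= normr_id.
  have ih : P.-integrable setT (fun w : Om => (h s)%:E) by exact: integrable_cstR.
  apply: (@centered_max _ _ _ P (V 0%N) s).
    rewrite (_ : (fun w => _) = ((fun w => (X 0%N w s)%:E) \- (fun=> (h s)%:E))%E); first exact: integrableB.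
    by apply/funext => w; rewrite /V EFinB.
  under eq_integral do rewrite EFinB.
  rewrite integralB//= integral_prob_cst /h fineK ?subee//; exact: integrable_fin_num.
have V_moment l : (0 < l)%N -> exists2 A : R, 0 <= A & forall k s j,
    (2 <= j <= 2 * l)%N -> 0 <= s ->
    (\int[P]_w (`|V k w s| ^+ j)%:E <= (A * (1 + s) `^ (j%:R * (beta' / 2)))%:E)%E.
  move=> l0; have [A A0 HA] := @path_moments _ _ _ P (V 0%N) (mV 0%N) delta beta v delta0
    (fun=> erefl) rvv HV beta' l beta'lo l0.
  exists A => // k s j jl s0.
  rewrite (law k (fun f => (`|f s| ^+ j)%:E)); first exact: HA.
    apply/measurable_EFinP; apply: measurable_funX; apply: measurableT_comp => //.
    exact: measurable_eval.
  by move=> f; rewrite lee_fin exprn_ge0.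
have mosc ys n s j : measurable_fun [set: @path_space R] (fun f : @path_space R => (osc ys n f s ^+ j)%:E).
  apply/measurable_EFinP; apply: measurable_funX.
  by apply: (@measurable_osc _ _ (@path_space R) ys n (fun f => f)) => x; exact: measurable_eval.
have posc ys n s j (f : @path_space R) : (0 <= (osc ys n f s ^+ j)%:E)%E.
  by rewrite lee_fin exprn_ge0// osc_ge0.
have osc_mean : exists2 A : R, 0 <= A & forall ys n k s,
    (forall i, 0 <= ys i < delta) -> 0 <= s ->
    (\int[P]_w (osc ys n (V k w) s)%:E <= (A * (1 + s) `^ (rho - eps))%:E)%E.
  have [A A0 HA] := @osc_moment _ _ _ P (V 0%N) delta C1 _ 1%N isT delta0 C10 (mV 0%N) Hosc1.
  exists A; first exact: ltW.
  move=> ys n k s Hy s0; have := law k _ (mosc ys n s 1%N) (posc ys n s 1%N).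
  by have := HA ys n s Hy s0; rewrite mul1r => h1 h2; rewrite h2.
have osc_moments l : (0 < l)%N -> exists2 A : R, 0 <= A & forall ys n k s j,
    (forall i, 0 <= ys i < delta) -> (2 <= j <= 2 * l)%N -> 0 <= s ->
    (\int[P]_w (osc ys n (V k w) s ^+ j)%:E <= (A * (1 + s) `^ (j%:R * rho))%:E)%E.
  move=> l0.
  (* The constants, and the gain [ep], depend on the order [j]: the gain is given away to reach the
     common exponent [j * rho], and the finitely many constants are summed. *)
  have /choice[A HA] : forall j, exists A : R, 0 <= A /\ ((0 < j)%N -> forall ys n k s,
      (forall i, 0 <= ys i < delta) -> 0 <= s ->
      (\int[P]_w (osc ys n (V k w) s ^+ j)%:E <= (A * (1 + s) `^ (j%:R * rho))%:E)%E).
    move=> [|j]; first by exists 0.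
    have [C [C0 [ep [ep0 [_ Hosc]]]]] := HA4 j.+1 isT.
    have [A A0 HA] := @osc_moment _ _ _ P (V 0%N) delta C _ j.+1 isT delta0 C0 (mV 0%N) Hosc.
    exists A; split; first exact: ltW.
    move=> _ ys n k s Hy s0; rewrite (law k _ (mosc ys n s j.+1) (posc ys n s j.+1)).
    apply: le_trans (HA ys n s Hy s0) _; rewrite lee_fin ler_pM2l//.
    apply: ler_powR; first by rewrite lerDl.
    by rewrite ler_pM2l ?ltr0n// gerBl ltW.
  exists (\sum_(j < (2 * l).+1) A j); first by apply: sumr_ge0 => j _; have [] := HA j.
  move=> ys n k s j Hy /andP[j2 jl] s0.
  have [_ H] := HA j; apply: le_trans (H (leq_trans _ j2) ys n k s Hy s0) _ => //.
  rewrite lee_fin ler_wpM2r ?powR_ge0//.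
  rewrite (bigD1 (Ordinal (_ : (j < (2 * l).+1)%N)))//= lerDl sumr_ge0// => i _.
  by have [] := HA i.
have rvH : regularly_varying (fun t => h t / p t) (rho + alpha).
  by have := regularly_varyingM rvh (regularly_varying_inv rvp); rewrite opprK.
have fl := @fluctuation_small _ _ _ P Sg Ssig Smeas Sind xi' xiS xi0 N0 mN0 PN0 xiN0 p alpha alpha0
  p01 pdec rvp Hl V rho beta' eps delta _ aV cV rho_alpha beta'hi eps0 delta0 rvH V_centered V_moment
  osc_mean osc_moments.
have mn := @mean_term _ _ _ P Sg Ssig Smeas Sind xi' xiS xi0 N0 mN0 PN0 xiN0 p alpha
  p01 pdec rvp Hl h rho rho_alpha rvh ch.
have pa := @process_approx _ _ _ P Sg Ssig Smeas Sind xi' xiS xi0 p alpha p01 rvp p_cvg0 Hl h rho V rvh fl mn.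
have walkE w : ~ N0 w -> forall k, S k w = walk xi' k w.
  by move=> nw k; apply: eq_bigr => i _; rewrite xi'E.
have YE w t u : ~ N0 w -> Y t w u =
    p t / h t * limn (fun n => \sum_(k < n) shift0 (X k w) (walk xi' k w) (u * t)).
  move=> nw; congr (_ * _); congr (limn _); apply/funext => n; apply: eq_bigr => k _.
  by rewrite /shift0 walkE.
apply: weak_cvg_criterion.
- have p0 y : 0 < p y by have /andP[] := p01 y.
  have [A [mA PA HA]] := @walk_unbounded _ _ _ P Sg xi' p Ssig Smeas Sind xiS p0 Hl.
  exists (N0 `|` A); split; [exact: measurableU|split; [exact: prob_setU0|]].
  move=> w t t0 nw.
  have nN : ~ N0 w by move=> h'; apply: nw; left.
  have nA : ~ A w by move=> h'; apply: nw; right.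
  (* Off a null set the walk exceeds [b * t], so below [b] the series is a finite sum of shifted
     cadlag paths. *)
  apply: cadlag_pos_local => b b0; have [n bn] := HA w nA (b * t).
  exists (fun u => p t / h t * \sum_(k < n.+1) shift0 (X k w) (walk xi' k w) (u * t)).
    apply: cadlag_posM; apply: (cadlag_pos_sum n.+1 (g := fun k u => shift0 (X k w) (walk xi' k w) (u * t))) => k.
    apply: (cadlag_pos_scale t0 (f := shift0 (X k w) (walk xi' k w))); apply: cadlag_pos_shift0 => //.
    exact: walk_ge0.
  move=> u ub; rewrite YE// (limn_shift0 xi0 (fun k => X k w) (w := w) (N := n))//.
  by apply: lt_trans bn; rewrite ltr_pM2r.
- have [A [mA PA HA]] := J_ar_cadlag alpha0 alpha1 rho_alpha HW.
  by exists A.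
apply: (@path_lip_approx _ _ _ P Sg Ssig Smeas Sind xi' xiS xi0 p phi alpha rho alpha0 alpha1 rho_alpha
  p01 rvp p_cvg0 phiE phi_asym _ _ Q W HW Y) => a b e a0 ab e0.
have [C0 HC] := pa a b e a0 ab e0; exists C0 => C /HC[i1 Hi]; exists i1 => i0 /Hi[m0 Hm].
exists m0 => m /Hm H mpos; apply: filterS (H mpos) => t [A [mA PA HA]].
exists (A `|` N0); split; first exact: measurableU.
  have := prob_setU_le mA mN0 PA (_ : P N0 <= 0%:E)%E; rewrite addr0; apply; by rewrite PN0.
move=> w nw u aub.
have nN : ~ N0 w by move=> h'; apply: nw; right.
have nA : ~ A w by move=> h'; apply: nw; left.
rewrite YE//; have := HA w nA u aub.
suff -> : (fun n => \sum_(k < n) shift0 (fun s => V k w s + h s) (walk xi' k w) (u * t)) =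
   (fun n => \sum_(k < n) shift0 (X k w) (walk xi' k w) (u * t)) by [].
by apply/funext => n; apply: eq_bigr => k _; rewrite /shift0 /V subrK.
Qed.
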